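(* Assume that $X$ is $\mathbb F$-quasi-left continuous, that $\mathbb P[\tau=\sigma<+\infty]=0$ for every $\mathbb F$-stopping time $\sigma$, and that every $\mathbb F$-martingale is a $\mathbb G$-martingale. Let $(U,\mathcal U)$ be a measurable space and let $\bar r,\bar l:\Omega\times[0,T]\times\mathbb R^d\times U\to\mathbb R$ be $\mathcal P(\mathbb F)\otimes\mathcal B(\mathbb R^d)\otimes\mathcal U$-measurable functions for which there are constants $M_{\bar r}>1$, $M_{\bar l}>0$ such that, $\mathbb P$-a.s., $0\le\bar r_t(x_1,u)\le M_{\bar r}$ and $|\bar l_t(x_1,u)|\le M_{\bar l}$ for all $t\in[0,T]$, $x_1\in\mathbb R^d$, $u\in U$. Assume $$\mathbb E[e^{(3+M_{\bar r}^4)C_T}]<+\infty.$$ Set $\bar L:=\operatorname{ess\,sup}_\omega(\sup\{|\bar r_t(x_1,u)-1|: t\in[0,T],x_1\in\mathbb R^d,u\in U\})$. Let $\bar g:\Omega\times\mathbb R^d\to\mathbb R$ be $\mathcal G_{T\wedge\tau}\otimes\mathcal B(\mathbb R^d)$-measurable and suppose there is $\beta>\bar L^2$ with $\mathbb E[e^{\beta C_T}]<+\infty$ and $\mathbb E[|\bar g(X_{T\wedge\tau})|^2e^{\beta C_T}]<+\infty$. Define $$f(\omega,t,y_1,\theta(\cdot)):=\inf_{u\in U}\Big\{\bar l_t(\omega,y_1,u)1_{[0,T\wedge\tau(\omega)]}(t)+\int_{\mathbb R^d}\theta(x_1,0)\,(\bar r_t(\omega,x_1,u)-1)\,\phi^{\mathbb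 F,X}_t(\omega,dx_1)\Big\}$$ for $\omega\in\Omega$, $t\in[0,T]$, $y_1\in\mathbb R^d$, $\theta\in\mathcal L^1(\mathbb R^{d+1},\mathcal B(\mathbb R^{d+1}),\phi_t(\omega,dx_1,dx_2))$, and assume that for every $\Theta\in L^{1,0}(\mu^Z,\mathbb G)$ there exists a $\mathbb G$-predictable process $\underline u^\Theta:\Omega\times[0,T]\to U$ such that, for $d_1(\omega,t)\,dC_t(\omega)\,\mathbb P(d\omega)$-almost all $(\omega,t)$, $$f(\omega,t,X_{t-}(\omega),\Theta_t(\omega,\cdot))=\bar l_t(\omega,X_{t-}(\omega),\underline u^\Theta(\omega,t))1_{[0,T\wedge\tau(\omega)]}(t)+\int_{\mathbb R^d}\Theta_t(\omega,x_1,0)\,(\bar r_t(\omega,x_1,\underline u^\Theta(\omega,t))-1)\,\phi^{\mathbb F,X}_t(\omega,dx_1).\qquad(\ast)$$ Let $(Y,\Theta(\cdot))\in L^{2,\beta}_{\mathrm{Prog}}(\Omega\times[0,T],\mathbb G)\times L^{2,\beta}(\mu^Z,\mathbb G)$ denote the unique solution to the BSDE: $\mathbb P$-a.s., for all $t\in[0,T]$, $$Y_t+\int_t^T\int_{\mathbb R^{d+1}}\Theta_s(x_1,x_2)\,(\mu^Z-\nu^Z)(ds,dx_1,dx_2)=\bar g(X_{T\wedge\tau})+\int_t^Tf(s,X_s,\Theta_s(\cdot))\,dC^{\mathbb F,X}_s,$$ with corresponding admissible control $\underline u^\Theta\in\mathcal C$ satisfying $(\ast)$. Set $$\underline{\hat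 u}^\Theta:=\underline u^\Theta\,1_{[0,T\wedge\tau]}\in\hat{\mathcal C}.$$ Then $\underline{\hat u}^\Theta$ is an optimal control process for the problem of minimizing, over $\hat u\in\hat{\mathcal C}$, the cost $$\bar J(\hat u)=\mathbb E_{\hat u}\Big[\int_0^{T\wedge\tau}\bar l_t(X_t,\hat u_t)\,dC^{\mathbb F,X}_t+\bar g(X_{T\wedge\tau})\Big],$$ and its value is represented by the initial value $Y_0$ of the solution $(Y,\Theta(\cdot))$ of the BSDE $Y_t+\int_t^T\int_{\mathbb R^{d+1}}\Theta_s(x_1,x_2)\,(\mu^Z-\nu^Z)(ds,dx_1,dx_2)=\bar g(X_{T\wedge\tau})+\int_t^Tf(s,X_s,\Theta_s(\cdot))\,dC^{\mathbb F,X}_s$, $t\in[0,T]$, namely $$Y_0=\bar J(\underline{\hat u}^\Theta)=\inf_{\hat u\in\hat{\mathcal C}}\bar J(\hat u)=\inf_{u\in\mathcal C}\bar J(u),$$ where for $u\in\mathcal C$, $\bar J(u):=\mathbb E_u\big[\int_0^T\bar l_t(X_t,u_t)1_{[0,T\wedge\tau]}(t)\,dC^{\mathbb F,X}_t+\bar g(X_{T\wedge\tau})\big]$.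
   Context: Setting: $(\Omega,\mathcal F,\mathbb P)$ is a probability space, $T>0$ is fixed, $X$ is an $\mathbb R^d$-valued step process and $\mathbb F=(\mathcal F_t)_{t\ge0}$, $\mathcal F_t=\mathcal F^X_t$, is the smallest right-continuous filtration to which $X$ is adapted. (Step process: a semimartingale $X=\sum_{n\ge1}\xi_n1_{[\tau_n,+\infty)}$ with stopping times $\tau_n\uparrow+\infty$, $\tau_n<\tau_{n+1}$ on $\{\tau_n<\infty\}$, and $\mathcal F_{\tau_n}$-measurable $\xi_n$, $\xi_n\ne0$ iff $\tau_n<\infty$.) $\tau:\Omega\to(0,+\infty]$ is a random time, $H=1_{[\tau,+\infty)}$, $\mathbb G=(\mathcal G_t)$ is the smallest right-continuous filtration containing $\mathbb F$ and making $\tau$ a stopping time, and $Z=(X,H)$. Quasi-left continuity of $X$ w.r.t. $\mathbb F$: $\Delta X_\sigma=0$ a.s. for every finite-valued $\mathbb F$-predictable stopping time $\sigma$. $\mathcal P(\cdot)$ denotes the predictable $\sigma$-algebra. $\mu^X,\mu^Z$ are the jump measures of $X,Z$ ($\mu^Y(dt,dy)=\sum_{s>0}1_{\{\Delta Y_s\ne0\}}\delta_{(s,\Delta Y_s)}(dt,dy)$); $\nu^{\mathbb F,X}$ is the $\mathbb F$-compensator of $\mu^X$, $\nu^Z$ the $\mathbb G$-compensator of $\mu^Z$, $\Lambda^{\mathbb G}$ the $\mathbb G$-dual predictable projection of $H$. Write $\nu^{\mathbb F,X}(dt,dx_1)=\phi^{\mathbb F,X}_t(dx_1)\,dC^{\mathbb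 F,X}_t$ with $\phi^{\mathbb F,X}$ a transition probability from $(\Omega\times[0,T],\mathcal P(\mathbb F))$ to $(\mathbb R^d,\mathcal B(\mathbb R^d))$ and $C^{\mathbb F,X}$ an increasing process. Under the stated assumptions on $X$ and $\tau$, $C^{\mathbb F,X}$ and $\Lambda^{\mathbb G}$ are continuous, the $\mathbb G$-compensator of $\mu^X$ equals $\nu^{\mathbb F,X}$, and $\nu^Z(dt,dx_1,dx_2)=\delta_0(dx_2)\phi^{\mathbb F,X}_t(dx_1)\,dC^{\mathbb F,X}_t+\delta_0(dx_1)\delta_1(dx_2)\,d\Lambda^{\mathbb G}_t$. Set $C:=C^{\mathbb F,X}+\Lambda^{\mathbb G}$ and write $\nu^Z(dt,dx_1,dx_2)=\phi_t(dx_1,dx_2)\,dC_t$ with $\phi$ a transition probability from $(\Omega\times[0,T],\mathcal P(\mathbb G))$ to $(\mathbb R^{d+1},\mathcal B(\mathbb R^{d+1}))$. Set $d_1(\omega,t):=\int_{\mathbb R^{d+1}}1_{\{x_2=0\}}\phi_t(\omega,dx_1,dx_2)$, so $d_1\,dC=dC^{\mathbb F,X}$. Spaces: $L^{2,\beta}_{\mathrm{Prog}}(\Omega\times[0,T],\mathbb G)$ is the set of real $\mathbb G$-progressively measurable $Y$ with $\mathbb E[\int_0^Te^{\beta C_t}|Y_t|^2dC_t]<\infty$; $L^{2,\beta}(\mu^Z,\mathbb G)$ is the set of $\mathcal P(\mathbb G)\otimes\mathcal B(\mathbb R^{d+1})$-measurable $\Theta$ with $\mathbb E[\int_0^T\int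 e^{\beta C_t}|\Theta_t(x_1,x_2)|^2\phi_t(dx_1,dx_2)dC_t]<\infty$; $L^{1,0}(\mu^Z,\mathbb G)$ is the set of $\mathcal P(\mathbb G)\otimes\mathcal B(\mathbb R^{d+1})$-measurable $\Theta$ with $\mathbb E[\int_0^T\int|\Theta_t(x_1,x_2)|\phi_t(dx_1,dx_2)dC_t]<\infty$. Controls: $\mathcal C$ is the set of all $U$-valued $\mathbb G$-predictable processes on $[0,T]$; $U$ has a distinguished element denoted $0$, $1_Bu$ denotes the process equal to $u$ on $B$ and to $0$ off $B$, and $\hat{\mathcal C}:=\{u\in\mathcal C:\ 1_{(T\wedge\tau,T]}u=0\}$. Put $R_t(x_1,x_2,u):=\bar r_t(x_1,u)1_{\{x_2=0\}}+1_{\{x_2\neq0\}}$. For $u\in\mathcal C$, $L^u$ is the Doléans-Dade exponential solving $$L^u_t=1+\int_0^t\int_{\mathbb R^{d+1}}L^u_{s-}\,(R_s(x_1,x_2,u_s)-1)\,(\mu^Z-\nu^Z)(ds,dx_1,dx_2),\quad t\in[0,T].$$ Under $\mathbb E[e^{(3+M_{\bar r}^4)C_T}]<\infty$ it is a nonnegative square integrable $\mathbb G$-martingale with $\mathbb E[L^u_T]=1$, so $\mathbb P_u(d\omega):=L^u_T(\omega)\,\mathbb P(d\omega)$ is a probability measure; $\mathbb E_u$ denotes expectation under $\mathbb P_u$.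
   Formalization: The jump times τ_n of the step process X are taken strictly positive, so X_0 = 0; with a random jump at time 0 the initial value Y_0 would be random and could not equal the number J̄. *)

(* Defs.v *)
From HB Require Import structures.
From mathcomp Require Import all_boot all_order all_algebra.
From mathcomp Require Import all_classical all_reals all_analysis.
From mathcomp Require Import measurable_realfun ess_sup_inf.

Set Implicit Arguments.
Unset Strict Implicit.
Unset Printing Implicit Defensive.

Import Order.TTheory GRing.Theory Num.Theory.
Import numFieldNormedType.Exports.

Local Open Scope classical_set_scope.
Local Open Scope ring_scope.

Definition rV_display : measure_display. Proof. exact. Qed.

HB.instance Definition _ (R : realType) (d : nat) :=
  @isMeasurable.Build rV_display 'rV[R]_d
    <<s @open 'rV[R]_d >>
    (@sigma_algebra0 _ setT _) (@sigma_algebraC _ _)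
    (@sigma_algebra_bigcup _ setT _).

Section paths.
Context {R : realType}.

Definition left_lim {V : normedModType R} (x : R -> V) (t : R) : V :=
  lim (x @ t^'-).

Definition jump {V : normedModType R} (x : R -> V) (t : R) : V :=
  if 0 < t then x t - left_lim x t else 0.

Definition jump_times {V : normedModType R} (x : R -> V) : set R :=
  [set s | 0 < s /\ jump x s != 0].

Definition cadlag_on (T : R) (x : R -> R) :=
  (forall t, 0 <= t < T -> x @ t^'+ --> x t) /\
  (forall t, 0 < t <= T -> cvg (x @ t^'-)).

End paths.

Section point_measure.
Context {R : realType} {dV : measure_display} {V : measurableType dV}.
Variables (D : set R) (y : R -> V).
Local Open Scope ereal_scope.

Definition point_measure (A : set (R * V)) : \bar R :=
  \esum_(s in D) \d_(s, y s) A.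

Let point_measure0 : point_measure set0 = 0.
Proof. by apply: esum1 => s _; rewrite measure0. Qed.

Let point_measure_ge0 A : 0 <= point_measure A.
Proof. by apply: esum_ge0 => s _; exact: measure_ge0. Qed.

Let point_measure_sigma_additive : semi_sigma_additive point_measure.
Proof.
move=> F mF tF mUF.
suff -> : point_measure (\bigcup_n F n) = \sum_(0 <= n <oo) point_measure (F n).
  by apply: is_cvg_ereal_nneg_natsum_cond => n _ _; exact: point_measure_ge0.
rewrite /point_measure nneseries_esumT; last first.
  by move=> n; exact: point_measure_ge0.
have -> : \esum_(s in D) \d_(s, y s) (\bigcup_n F n) =
    \esum_(s in D) \esum_(n in [set: nat]) \d_(s, y s) (F n) :> \bar R.
  apply: eq_esum => s _; rewrite measure_semi_bigcup//.
  by rewrite nneseries_esumT// => n; exact: measure_ge0.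
have esumC (I J : choiceType) (a : I -> J -> \bar R) (K : set I) (L : set J) :
    (forall i j, 0 <= a i j) ->
    \esum_(i in K) \esum_(j in L) a i j <= \esum_(j in L) \esum_(i in K) a i j.
  move=> a0; rewrite esum_esum// esum_esum//.
  rewrite [leLHS](reindex_esum (L `*`` (fun=> K)) _
    (fun k => (k.2, k.1)))//; last first.
    split => //=.
    - by move=> [j i] /= [].
    - by move=> [j i] [j' i'] _ _ [-> ->].
    - by move=> [i j] [/= Ki Lj]; exists (j, i).
by apply/eqP; rewrite eq_le !esumC.
Qed.

HB.instance Definition _ := isMeasure.Build _ _ _ point_measure
  point_measure0 point_measure_ge0 point_measure_sigma_additive.

End point_measure.

Section cumulative_paths.
Context {R : realType}.

Definition indic_after (s : \bar R) (t : R) : R := (s <= t%:E)%E%:R.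

Let indic_after_nd s : nondecreasing (indic_after s).
Proof.
move=> x y xy; rewrite /indic_after ler_nat.
by case: (leP s x%:E) => // sx; rewrite (le_trans sx)// lee_fin.
Qed.

Let indic_after_rc s x : indic_after s @ x^'+ --> indic_after s x.
Proof.
have [sx|xs] := leP s x%:E; rewrite /indic_after.
  rewrite sx; apply: cvg_near_cst; near=> y.
  rewrite (le_trans sx)// lee_fin; apply/ltW.
  by near: y; exact: nbhs_right_gt.
rewrite leNgt xs/=; apply: cvg_near_cst.
case: s xs => [r|_|]//; last first.
  by near=> y; rewrite leye_eq.
rewrite lte_fin => xr; near=> y.
rewrite lee_fin leNgt; suff -> : y < r by [].
by near: y; exact: nbhs_right_lt.
Unshelve. all: by end_near. Qed.

HB.instance Definition _ (s : \bar R) := isCumulative.Build R _ R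
  (indic_after s) (@indic_after_nd s) (@indic_after_rc s).

Definition cumulativeD (f g : cumulative R R) : R -> R := f \+ g.

Let cumulativeD_nd (f g : cumulative R R) : nondecreasing (cumulativeD f g).
Proof. by move=> x y xy; rewrite lerD// cumulative_is_nondecreasing. Qed.

Let cumulativeD_rc (f g : cumulative R R) x :
  cumulativeD f g @ x^'+ --> cumulativeD f g x.
Proof. by apply: cvgD; exact: cumulative_is_right_continuous. Qed.

HB.instance Definition _ (f g : cumulative R R) := isCumulative.Build R _ R
  (cumulativeD f g) (@cumulativeD_nd f g) (@cumulativeD_rc f g).

End cumulative_paths.

Notation stieltjes := lebesgue_stieltjes_measure.

Section filtrations.
Context {R : realType} {dO : measure_display} {Omega : measurableType dO}.

(* Time runs over `[0, +oo[: the value of a filtration, or of a process, at a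
   negative time never matters. *)
Definition is_filtration (Fl : R -> set (set Omega)) :=
  [/\ forall t, 0 <= t -> sigma_algebra setT (Fl t),
      forall t, 0 <= t -> Fl t `<=` measurable &
      forall s t, 0 <= s -> s <= t -> Fl s `<=` Fl t].

Definition right_continuous_filtration (Fl : R -> set (set Omega)) :=
  forall t, 0 <= t -> \bigcap_(s in `]t, +oo[) Fl s `<=` Fl t.

Definition smallest_filtration (C : (R -> set (set Omega)) -> Prop) (t : R) :
    set (set Omega) :=
  [set A | forall Fl, is_filtration Fl -> right_continuous_filtration Fl ->
     C Fl -> Fl t A].

Definition adapted_on (I : set R) (Fl : R -> set (set Omega))
    {dE} {E : measurableType dE} (X : Omega -> R -> E) :=
  forall t, I t ->
    measurable_fun [set: g_sigma_algebraType (Fl t)]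
      (fun w : g_sigma_algebraType (Fl t) => X w t).

Definition stopping_time (Fl : R -> set (set Omega)) (s : Omega -> \bar R) :=
  (forall w, 0 <= s w)%E /\
  forall t, 0 <= t -> Fl t [set w | s w <= t%:E]%E.

Definition stopped_sigma_algebra (Fl : R -> set (set Omega))
    (s : Omega -> \bar R) : set (set Omega) :=
  [set A | measurable A /\
     forall t, 0 <= t -> Fl t (A `&` [set w | s w <= t%:E]%E)].

Definition natural_filtration {dE} {E : measurableType dE}
    (X : Omega -> R -> E) : R -> set (set Omega) :=
  smallest_filtration (fun Fl => adapted_on `[0, +oo[ Fl X).

Definition progressive_enlargement (Fl : R -> set (set Omega))
    (tau : Omega -> \bar R) : R -> set (set Omega) :=
  smallest_filtration (fun Gl =>
    (forall t, 0 <= t -> Fl t `<=` Gl t) /\ stopping_time Gl tau).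

Definition predictable_rectangles (Fl : R -> set (set Omega)) :
    set (set (Omega * R)) :=
  [set D | (exists2 A, Fl 0 A & D = A `*` [set 0]) \/
           (exists A s t, [/\ 0 <= s, s <= t, Fl s A & D = A `*` `]s, t]])].

(* Omega x R with the predictable sigma-algebra. Its trace on Omega x [0, T] is
   the predictable sigma-algebra over [0, T], which is why predictability on an
   interval I is measurability on Omega x I below. *)
Definition predictable_space (Fl : R -> set (set Omega)) :=
  g_sigma_algebraType (predictable_rectangles Fl).

Definition predictable_on (I : set R) (Fl : R -> set (set Omega))
    {dE} {E : measurableType dE} (Y : Omega -> R -> E) :=
  measurable_fun [set p : predictable_space Fl | I p.2]
    (fun p => Y p.1 p.2).

Definition predictable_field_on (I : set R) (Fl : R -> set (set Omega))
    {dV} {V : measurableType dV} {dE} {E : measurableType dE}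
    (W : Omega -> R -> V -> E) :=
  measurable_fun [set q : predictable_space Fl * V | I q.1.2]
    (fun q => W q.1.1 q.1.2 q.2).

Definition progressive_on (T : R) (Fl : R -> set (set Omega))
    (Y : Omega -> R -> R) :=
  forall t, 0 <= t <= T ->
    measurable_fun [set p : g_sigma_algebraType (Fl t) * R | 0 <= p.2 <= t]
      (fun p => Y p.1 p.2).

Definition predictable_time (Fl : R -> set (set Omega)) (s : Omega -> \bar R) :=
  stopping_time Fl s /\
  measurable [set p : predictable_space Fl | 0 <= p.2 /\ (s p.1 <= p.2%:E)%E].

(* Positivity of the s n says that X 0 = 0. The semimartingale property is
   automatic: X is adapted and its paths are piecewise constant. *)
Definition step_process {d : nat} (Fl : R -> set (set Omega))
    (X : Omega -> R -> 'rV[R]_d) :=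
  exists (s : nat -> Omega -> \bar R) (xi : nat -> Omega -> 'rV[R]_d),
    (forall n, stopping_time Fl (s n) /\ forall w, 0 < s n w)%E /\
    (forall n w, s n w <= s n.+1 w /\ (s n w < +oo -> s n w < s n.+1 w))%E /\
    (forall w, s n w @[n --> \oo] --> +oo%E) /\
    (forall n, measurable_fun
       [set: g_sigma_algebraType (stopped_sigma_algebra Fl (s n))]
       (fun w : g_sigma_algebraType (stopped_sigma_algebra Fl (s n)) =>
          xi n w)) /\
    (forall n w, xi n w != 0 <-> (s n w < +oo)%E) /\
    (forall w t, 0 <= t ->
       \sum_(n < N) indic_after (s n w) t *: xi n w @[N --> \oo] --> X w t).

End filtrations.

Section compensators.
Context {R : realType} {dO : measure_display} {Omega : measurableType dO}.
Variable P : probability Omega R.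
Local Open Scope ereal_scope.

Definition martingale (Fl : R -> set (set Omega)) (M : Omega -> R -> R) :=
  [/\ adapted_on `[0%R, +oo[ Fl M,
      forall t, (0 <= t)%R -> P.-integrable setT (fun w => (M w t)%:E) &
      forall s t A, (0 <= s)%R -> (s <= t)%R -> Fl s A ->
        \int[P]_(w in A) (M w t)%:E = \int[P]_(w in A) (M w s)%:E].

Definition immersed (Fl Gl : R -> set (set Omega)) :=
  forall M, martingale Fl M -> martingale Gl M.

Definition quasi_left_continuous {V : normedModType R}
    (Fl : R -> set (set Omega)) (X : Omega -> R -> V) :=
  forall s, predictable_time Fl s -> (forall w, s w < +oo) ->
    {ae P, forall w, jump (X w) (fine (s w)) = 0%R}.

Definition avoids_stopping_times (Fl : R -> set (set Omega))
    (tau : Omega -> \bar R) :=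
  forall s, stopping_time Fl s -> P [set w | tau w = s w /\ s w < +oo] = 0.

Definition increasing_process (Fl : R -> set (set Omega))
    (A : Omega -> cumulative R R) :=
  adapted_on `[0%R, +oo[ Fl (fun w t => A w t) /\
  forall w t, (t <= 0)%R -> A w t = 0%R.

(* The horizon is [0, T]: the paths of A and B after T are irrelevant. *)
Definition is_dual_predictable_projection (T : R) (Fl : R -> set (set Omega))
    (A B : Omega -> cumulative R R) :=
  [/\ predictable_on `[0%R, T] Fl (fun w t => B w t),
      forall w t, (t <= 0)%R -> B w t = 0%R &
      forall W : Omega -> R -> \bar R, predictable_on `[0%R, T] Fl W ->
        (forall w t, 0 <= W w t) ->
        \int[P]_w \int[stieltjes (B w)]_(t in `]0%R, T]) W w t =
        \int[P]_w \int[stieltjes (A w)]_(t in `]0%R, T]) W w t].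

Section random_measures.
Context {dV : measure_display} {V : measurableType dV}.
Implicit Types mu nu : Omega -> {measure set (R * V) -> \bar R}.

Definition predictable_random_measure (Fl : R -> set (set Omega)) nu :=
  forall W : Omega -> R -> V -> \bar R,
    predictable_field_on `[0%R, +oo[ Fl W -> (forall w t x, 0 <= W w t x) ->
    predictable_on `[0%R, +oo[ Fl
      (fun w t => \int[nu w]_(q in `]0%R, t] `*` setT) W w q.1 q.2).

Definition is_compensator (Fl : R -> set (set Omega)) mu nu :=
  predictable_random_measure Fl nu /\
  forall W : Omega -> R -> V -> \bar R,
    predictable_field_on `[0%R, +oo[ Fl W -> (forall w t x, 0 <= W w t x) ->
    \int[P]_w \int[nu w]_(q in `]0%R, +oo[ `*` setT) W w q.1 q.2 =
    \int[P]_w \int[mu w]_(q in `]0%R, +oo[ `*` setT) W w q.1 q.2.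

(* nu(dt, dx) = phi_t(dx) dA_t on [0, T], almost surely. *)
Definition disintegrates (T : R) (Fl : R -> set (set Omega)) nu
    (phi : R.-pker (predictable_space Fl) ~> V)
    (A : Omega -> cumulative R R) :=
  {ae P, forall w, forall D : set (R * V), measurable D ->
    nu w (D `&` (`]0%R, T] `*` setT)) =
    \int[stieltjes (A w)]_(t in `]0%R, T]) phi (w, t) (xsection D t)}.

End random_measures.

End compensators.

Section spaces.
Context {R : realType} {dO : measure_display} {Omega : measurableType dO}.
Variables (P : probability Omega R) (T : R) (Gl : R -> set (set Omega)).
Variable C : Omega -> cumulative R R.
Local Open Scope ereal_scope.

Definition L2Prog (beta : R) (Y : Omega -> R -> R) :=
  progressive_on T Gl Y /\
  \int[P]_w \int[stieltjes (C w)]_(t in `]0%R, T])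
    (expR (beta * C w t) * `|Y w t| ^+ 2)%:E < +oo.

Context {dV : measure_display} {V : measurableType dV}.
Variable phi : R.-pker (predictable_space Gl) ~> V.

Definition L2mu (beta : R) (Theta : Omega -> R -> V -> R) :=
  predictable_field_on `[0%R, T] Gl Theta /\
  \int[P]_w \int[stieltjes (C w)]_(t in `]0%R, T]) \int[phi (w, t)]_x
    (expR (beta * C w t) * `|Theta w t x| ^+ 2)%:E < +oo.

Definition L1mu (Theta : Omega -> R -> V -> R) :=
  predictable_field_on `[0%R, T] Gl Theta /\
  \int[P]_w \int[stieltjes (C w)]_(t in `]0%R, T]) \int[phi (w, t)]_x
    `|Theta w t x|%:E < +oo.

End spaces.

(* Integral of W over A x V against mu - nu. In all uses mu and nu almost surely
   have finite mass over A x V, so this is the pathwise integral. *)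
Definition compensated_integral {R : realType} {dV : measure_display}
    {V : measurableType dV} (mu nu : {measure set (R * V) -> \bar R})
    (A : set R) (W : R -> V -> R) : R :=
  \int[mu]_(q in A `*` setT) W q.1 q.2 - \int[nu]_(q in A `*` setT) W q.1 q.2.

Section control.
Context {R : realType} {dO : measure_display} {Omega : measurableType dO}.
Variables (P : probability Omega R) (T : R) (Gl : R -> set (set Omega)).
Variable tau : Omega -> \bar R.
Context {d : nat}.
Variable X : Omega -> R -> 'rV[R]_d.
Context {dU : measure_display} {U : measurableType dU}.
Variable u0 : U.
Implicit Types (u : Omega -> R -> U) (r l : Omega -> R -> 'rV[R]_d -> U -> R).

Definition min_time (w : Omega) : R := fine (Order.min T%:E (tau w)).

Definition control u := predictable_on `[0, T] Gl u.

Definition stopped_control u :=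
  control u /\ forall w t, min_time w < t <= T -> u w t = u0.

Definition stop_control u : Omega -> R -> U :=
  fun w t => if 0 <= t <= min_time w then u w t else u0.

Definition jump_factor r (w : Omega) (t : R) (x : 'rV[R]_d * R) (v : U) : R :=
  r w t x.1 v * (x.2 == 0)%:R + (x.2 != 0)%:R.

Definition is_stochastic_exponential r
    (mu nu : Omega -> {measure set (R * ('rV[R]_d * R)) -> \bar R}) u
    (L : Omega -> R -> R) :=
  adapted_on `[0, T] Gl L /\
  {ae P, forall w, cadlag_on T (L w) /\ forall t, 0 <= t <= T ->
    L w t = 1 + compensated_integral (mu w) (nu w) `]0, t]
      (fun s x => left_lim (L w) s * (jump_factor r w s x (u w s) - 1))}.

Section generator.
Context {Fl : R -> set (set Omega)}.
Variable phiF : R.-pker (predictable_space Fl) ~> 'rV[R]_d.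

Definition hamiltonian r l (w : Omega) (t : R) (y : 'rV[R]_d)
    (theta : 'rV[R]_d * R -> R) (v : U) : R :=
  l w t y v * \1_(`[0, min_time w]) t +
  \int[phiF (w, t)]_x (theta (x, 0) * (r w t x v - 1)).

(* Meant for theta integrable for phi_t. The set is then bounded below wherever
   r and l are bounded; elsewhere inf is the total real infimum. *)
Definition generator r l (w : Omega) (t : R) (y : 'rV[R]_d)
    (theta : 'rV[R]_d * R -> R) : R :=
  inf [set hamiltonian r l w t y theta v | v in [set: U]].

(* Equality of the generator and the Hamiltonian at u, almost everywhere for
   d1 dC dP, where d1 is the mass that phi gives to {x.2 = 0}. *)
Definition attains_generator r l (C : Omega -> cumulative R R)
    (phi : R.-pker (predictable_space Gl) ~> ('rV[R]_d * R)%type)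
    (Theta : Omega -> R -> 'rV[R]_d * R -> R) u :=
  exists N : set (Omega * R), [/\ measurable N,
    (\int[P]_w \int[stieltjes (C w)]_(t in `]0%R, T])
       ((\int[phi (w, t)]_x (\1_[set z | z.2 = 0%R] x)%:E) *
        (\1_N (w, t))%:E) = 0)%E &
    forall w t, 0 <= t <= T -> ~ N (w, t) ->
      generator r l w t (left_lim (X w) t) (Theta w t) =
      hamiltonian r l w t (left_lim (X w) t) (Theta w t) (u w t)].

Definition solves_bsde r l (mu nu : Omega ->
    {measure set (R * ('rV[R]_d * R)) -> \bar R})
    (CF : Omega -> cumulative R R) (g : Omega -> 'rV[R]_d -> R)
    (Y : Omega -> R -> R) (Theta : Omega -> R -> 'rV[R]_d * R -> R) :=
  {ae P, forall w, forall t, 0 <= t <= T ->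
    Y w t + compensated_integral (mu w) (nu w) `]t, T] (Theta w) =
    g w (X w (min_time w)) +
    \int[stieltjes (CF w)]_(s in `]t, T])
      generator r l w s (X w s) (Theta w s)}.

End generator.

(* Q stands for the measure P_u. *)
Definition cost l (CF : Omega -> cumulative R R) (g : Omega -> 'rV[R]_d -> R)
    (Q : {measure set Omega -> \bar R}) u : \bar R :=
  (\int[Q]_w (\int[stieltjes (CF w)]_(t in `]0, T])
                 (l w t (X w t) (u w t) * \1_(`[0, min_time w]) t) +
               g w (X w (min_time w)))%R%:E)%E.

Definition stopped_cost l (CF : Omega -> cumulative R R)
    (g : Omega -> 'rV[R]_d -> R) (Q : {measure set Omega -> \bar R}) u :
    \bar R :=
  (\int[Q]_w (\int[stieltjes (CF w)]_(t in `]0, min_time w])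
                 l w t (X w t) (u w t) +
               g w (X w (min_time w)))%R%:E)%E.

End control.

(* Main.v *)
Require Import Defs.
From HB Require Import structures.
From mathcomp Require Import all_boot all_order all_algebra.
From mathcomp Require Import all_classical all_reals all_analysis.
From mathcomp Require Import measurable_realfun ess_sup_inf.
From mathcomp Require Import ring lra.

(** Let [CF] be the clock of [X], [L] the density of a control [u] and
    [h t u] its Hamiltonian, that is, the running cost plus the integral of
    [Theta (r - 1)] against the kernel of [X]; the generator is the infimum of
    [h t u] over [u]. At time 0 the backward equation reads
      terminal cost = Y 0 + compensated integral of [Theta]
                      - integral of the generator against [CF].
    Under the measure with density [L] the jumps of [X] have intensity [r] times
    the original one and the jump of [H] keeps its intensity, so that the
    compensated integral of [Theta] has the same mean as the integral of
    [Theta (r - 1)] against the compensator of [X]. Adding the running cost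
    gives
      J u = Y 0 + mean under [u] of the integral of (h t u - generator),
    where the integrand is nonnegative, and zero for a minimizer. This is
    [verification_identity], whence [cost_ge] and [cost_attained].

    The change of measure ([density_projection], [density_jump_projection],
    [drift_centred]) is obtained from the linear equation for [L]. Since [Theta]
    is only square integrable, enough moments of [L] are needed. Along one path,
    [L ^+ 4] multiplied by a decreasing exponential of the clock satisfies an
    explicit change of variables formula with finitely many jumps and a
    continuous compensator; its drift is negative at the rate [2 + M ^+ 4], and
    the exponential moment pays for the weight ([linear_fourth_moment],
    [density_moments]).

    That the drift involves only the compensator of [X] in the small filtration
    rests on three facts. Avoidance of stopping times keeps the jump of [H]
    apart from those of [X] ([no_common_jump]). By immersion the compensators of
    the jumps of [X] in the two filtrations have the same predictable means
    ([pair_state_mean]). By quasi-left continuity the masses they accumulate are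
    continuous; their difference is a continuous martingale of finite variation,
    hence zero, and so [CF] is the clock of the pair on these jumps
    ([pair_clock]).

    Stopping a control at [tau] does not change its cost: the densities of the
    two controls solve the same linear equation up to that time, where the
    fourth moment estimate for their difference, which starts from 0, forces
    them to agree ([densities_agree], [cost_stopped]). Finally [Y 0] is constant
    because the events at time 0 do not separate points
    ([initial_event_trivial]). *)

Set Implicit Arguments.
Unset Strict Implicit.
Unset Printing Implicit Defensive.

Import Order.TTheory GRing.Theory Num.Theory.
Import numFieldNormedType.Exports.

Local Open Scope classical_set_scope.
Local Open Scope ring_scope.

Local Notation mfun := measurable_fun (only parsing).
Local Notation mfunTS := measurable_funTS (only parsing).
Local Notation mcomp := measurableT_comp (only parsing).
Local Notation mEFinP := measurable_EFinP (only parsing).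
Local Notation jump_measure R V := {measure set (R * V) -> \bar R} (only parsing).
Local Notation mtype := measurableType (only parsing).
Local Notation pspace := predictable_space (only parsing).

(** * Integrals without measurability *)

Section integral_without_measurability.
Local Open Scope ereal_scope.
Context d (T : mtype d) (R : realType).
Variable mu : {measure set T -> \bar R}.
Import HBNNSimple.
Implicit Types (f g : T -> \bar R) (D N : set T).

Lemma ge0_le_negligible D N f g : measurable N -> mu N = 0 ->
 (forall x, D x -> 0 <= f x) -> (forall x, D x -> 0 <= g x) ->
 (forall x, D x -> ~ N x -> f x <= g x) ->
 \int[mu]_(x in D) f x <= \int[mu]_(x in D) g x.
move=> mN N0 f0 g0 fg;rewrite (ge0_integralE _ f0) (ge0_integralE _ g0).
apply: ge_ereal_sup => _ [h /= hf <-].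
have [k kE] : exists k : {nnsfun T >-> R},
forall x, k x = (h x * \1_(~` N) x)%R.
by exists (proj_nnsfun h (measurableC mN)).
have -> : sintegral mu h = sintegral mu k.
rewrite -!integralT_nnsfun;apply: ge0_ae_eq_integral => //=.
- exact/mEFinP.
- exact/mEFinP.
- by move=> x _;rewrite lee_fin.
- by move=> x _;rewrite lee_fin.
exists N;split => // x /=;apply: contra_notP => Nx _.
by rewrite kE indicE mem_set ?mulr1.
apply: ereal_sup_ubound;exists k => //= x.
rewrite kE indicE;have [Nx|Nx] := pselect (N x).
rewrite memNset/= ?mulr0;last by move=> /=;apply.
by rewrite patchE;case: ifPn => // /set_mem/g0.
rewrite mem_set// mulr1;apply: (le_trans (hf x)).
by rewrite !patchE;case: ifPn => // /set_mem xD;exact: fg.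
Qed.

Lemma eq_negligible D N f g : measurable N -> mu N = 0 ->
 (forall x, D x -> ~ N x -> f x = g x) ->
 \int[mu]_(x in D) f x = \int[mu]_(x in D) g x.
move=> mN N0 fg;rewrite integralE [RHS]integralE.
by congr (_ - _);apply/eqP;rewrite eq_le;apply/andP;split;
apply: ge0_le_negligible mN N0 _ _ _ => // x Dx Nx;
rewrite ?funeposE ?funenegE fg.
Qed.

Lemma ge0_ae_le_nm f g :
 (forall x, 0 <= f x) -> (forall x, 0 <= g x) ->
 {ae mu, forall x, f x <= g x} -> \int[mu]_x f x <= \int[mu]_x g x.
move=> f0 g0 [N [mN N0 fgN]].
apply: (ge0_le_negligible mN N0) => // x _ Nx.
by apply: contrapT => h;apply/Nx/fgN.
Qed.

Lemma ae_eq_nm f g :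
 {ae mu, forall x, f x = g x} -> \int[mu]_x f x = \int[mu]_x g x.
move=> [N [mN N0 fgN]].
apply: (eq_negligible mN N0) => // x _ Nx.
by apply: contrapT => h;apply/Nx/fgN.
Qed.

Lemma ge0_integrable D f : mfun D f -> (forall x, 0 <= f x) ->
 \int[mu]_(x in D) f x < +oo -> mu.-integrable D f.
move=> mf f0 fin;apply/integrableP;split => //.
by under eq_integral do rewrite gee0_abs//.
Qed.

End integral_without_measurability.

(** * Filtrations and stopping times *)

Section filtrations_theory.
Context {R : realType} {dO : measure_display} {Omega : mtype dO}.
Implicit Types (Fl Gl : R -> set (set Omega)) (s : Omega -> \bar R).

Lemma smallest_filtration_sub (Cl : (R -> set (set Omega)) -> Prop) Fl t :
 is_filtration Fl -> right_continuous_filtration Fl -> Cl Fl ->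
 smallest_filtration Cl t `<=` Fl t.
Proof. by move=> fF rF cF A;exact. Qed.

Lemma smallest_filtration_filtration (Cl : (R -> set (set Omega)) -> Prop) :
 (exists Fl, [/\ is_filtration Fl, right_continuous_filtration Fl & Cl Fl]) ->
 is_filtration (smallest_filtration Cl) /\
 right_continuous_filtration (smallest_filtration Cl).
move=> [Fl [fF rF cF]];split.
split.
- move=> t t0;split.
+ by move=> Gl [sG _ _] _ _;have [] := sG t t0.
+ by move=> A FA Gl fG rG cG;have [sG _ _] := fG;have [_ + _] := sG t t0;
apply;exact: FA.
+ by move=> A FA Gl fG rG cG;have [sG _ _] := fG;have [_ _] := sG t t0;
apply => n;exact: FA.
- by move=> t t0 A /(_ Fl fF rF cF);have [_ + _] := fF;exact.
- move=> a b a0 ab A FA Gl fG rG cG;have [_ _ h] := fG.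
by apply: (h a b) => //;exact: FA.
move=> t t0 A h Gl fG rG cG;apply: (rG) => // x tx.
exact: (h x tx).
Qed.

Lemma filtrationE Fl t : is_filtration Fl -> 0 <= t ->
 (@measurable _ (g_sigma_algebraType (Fl t))) = Fl t.
Proof. by move=> [sF _ _] t0;rewrite /measurable/= sigma_algebra_id//;exact: sF. Qed.

Section one_filtration.
Variable Fl : R -> set (set Omega).
Hypothesis fF : is_filtration Fl.

Lemma filtrationM t A : 0 <= t -> Fl t A -> measurable A.
Proof. by move=> t0;have [_ + _] := fF;apply. Qed.

Lemma filtrationS a b A : 0 <= a -> a <= b -> Fl a A -> Fl b A.
Proof. by move=> a0 ab;have [_ _ +] := fF;apply. Qed.

Lemma filtration0 t : 0 <= t -> Fl t set0.
Proof. by move=> t0;have [sF _ _] := fF;have [] := sF t t0. Qed.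

Lemma filtrationC t A : 0 <= t -> Fl t A -> Fl t (~` A).
move=> t0 FA;have [sF _ _] := fF;have [_ + _] := sF t t0.
by move=> /(_ A FA);rewrite setTD.
Qed.

Lemma filtrationT t : 0 <= t -> Fl t setT.
Proof. by move=> t0;rewrite -setC0;apply: filtrationC => //;exact: filtration0. Qed.

Lemma filtrationI t A B : 0 <= t -> Fl t A -> Fl t B -> Fl t (A `&` B).
move=> t0;rewrite -(filtrationE fF t0);exact: measurableI.
Qed.

Lemma filtrationD t A B : 0 <= t -> Fl t A -> Fl t B -> Fl t (A `\` B).
move=> t0;rewrite -(filtrationE fF t0);exact: measurableD.
Qed.

Lemma adapted_onP (I : set R) dE (E : mtype dE) (X : Omega -> R -> E) :
 (forall t, I t -> 0 <= t) ->
 adapted_on I Fl X <->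
 forall t B, I t -> measurable B -> Fl t [set w | B (X w t)].
move=> I0;split=> [aX t B It mB|aX t It _ B mB].
have := aX t It measurableT B mB.
by rewrite setTI (filtrationE fF (I0 _ It)).
by rewrite setTI (filtrationE fF (I0 _ It));exact: aX.
Qed.

Local Notation PS := (pspace Fl).

Lemma predictable_rectangleW A a b : 0 <= a -> Fl a A ->
 measurable (A `*` `]a, b] : set PS).
move=> a0 FA;have [ab|ba] := leP a b.
by apply: sub_gen_smallest;right;exists A, a, b.
suff -> : (A `*` `]a, b]) = set0 :> set (Omega * R) by exact: measurable0.
by apply/seteqP;split => // -[w t]/= [_];rewrite in_itv/=;lra.
Qed.

Lemma predictable_rectangle0 A : Fl 0 A -> measurable (A `*` [set 0] : set PS).
Proof. by move=> FA;apply: sub_gen_smallest;left;exists A. Qed.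

Lemma predictable_after A a : 0 <= a -> Fl a A ->
 measurable ([set p | A p.1 /\ a < p.2] : set PS).
move=> a0 FA.
rewrite (_ : [set _ | _] = \bigcup_n (A `*` `]a, n%:R])).
by apply: bigcupT_measurable => n;exact: predictable_rectangleW.
apply/seteqP;split=> [[w t]/= [Aw at_]|[w t] [n _]/= [Aw]];last first.
by rewrite in_itv/= => /andP[].
exists (Num.truncn t).+1 => //=;split => //;rewrite in_itv/= at_/=.
exact/ltW/truncnS_gt.
Qed.

Lemma predictable_gt a : 0 <= a -> measurable ([set p | a < p.2] : set PS).
move=> a0;rewrite (_ : [set _ | _] = [set p | setT p.1 /\ a < p.2]).
by apply: predictable_after => //;exact: filtrationT.
by apply/seteqP;split => p //= [].
Qed.

Lemma predictable_ge0 : measurable ([set p | 0 <= p.2] : set PS).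
rewrite (_ : [set _ | _] = (setT `*` [set 0]) `|` [set p | 0 < p.2]).
apply: measurableU;first by apply: predictable_rectangle0;exact: filtrationT.
exact: predictable_gt.
apply/seteqP;split=> [[w t]/=|[w t]/= [[_ ->]//|/ltW//]].
by rewrite le_eqVlt => /orP[/eqP<-|];[left|right].
Qed.

Lemma predictable_le T : measurable ([set p | 0 <= p.2 <= T] : set PS).
have [T0|T0] := ltP T 0.
rewrite (_ : [set _ | _] = set0);first exact: measurable0.
by apply/seteqP;split => // p /=;lra.
rewrite (_ : [set _ | _] = [set p | 0 <= p.2] `\` [set p | T < p.2]).
by apply: measurableD;[exact: predictable_ge0|exact: predictable_gt].
apply/seteqP;split=> [p/= /andP[p0 pT]|p/= [p0 /negP]].
by split => //;apply/negP;rewrite -leNgt.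
by rewrite -leNgt p0.
Qed.

Lemma measurable_predictable_time :
 mfun ([set p | 0 <= p.2] : set PS) (fun p => p.2).
apply: measurability (RGenOInfty.measurableE R) _.
move=> _ [_ [a ->] <-].
have [a0|a0] := ltP a 0.
rewrite (_ : _ `&` _ = [set p | 0 <= p.2]);first exact: predictable_ge0.
apply/seteqP;split => [p/= []//|p/= p0];split => //.
by rewrite /= in_itv/= andbT (lt_le_trans a0).
rewrite (_ : _ `&` _ = [set p | a < p.2]);first exact: predictable_gt.
apply/seteqP;split => [p/= []|p/= p0];rewrite ?in_itv/= ?andbT//.
by split => //;rewrite (le_trans a0) ?ltW.
Qed.

Lemma measurable_to_predictable d (T : mtype d) (D : set T)
 (f : T -> Omega * R) :
 (forall A, Fl 0 A -> measurable (D `&` [set x | A (f x).1 /\ (f x).2 = 0])) ->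
 (forall A a b, 0 <= a -> a <= b -> Fl a A ->
 measurable (D `&` [set x | A (f x).1 /\ a < (f x).2 <= b])) ->
 mfun D (f : T -> PS).
move=> f0 fab;apply: (@measurability _ _ T PS D f (predictable_rectangles Fl)) => //.
move=> _ [_ [[A FA ->]|[A [a [b [a0 ab FA ->]]]]] <-];first exact: f0.
exact: fab.
Qed.

Lemma measurable_predictable_slice w :
 mfun [set: R] (fun t => (w, t) : PS).
apply: measurable_to_predictable => [A FA|A a b a0 ab FA];rewrite setTI.
have [Aw|nAw] := pselect (A w).
rewrite (_ : [set _ | _] = [set 0]);first exact: measurable_set1.
by apply/seteqP;split => [t []|t ->].
rewrite (_ : [set _ | _] = set0);first exact: measurable0.
by apply/seteqP;split => [t []|t].
have [Aw|nAw] := pselect (A w).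
rewrite (_ : [set _ | _] = `]a, b]%classic);first exact: measurable_itv.
by apply/seteqP;split => [t []|t];rewrite /= in_itv.
rewrite (_ : [set _ | _] = set0);first exact: measurable0.
by apply/seteqP;split => [t []|t].
Qed.

Lemma measurable_predictable_id :
 mfun [set: Omega * R] (fun p => p : PS).
apply: measurable_to_predictable => [A FA|A a b a0 ab FA];rewrite setTI.
rewrite (_ : [set _ | _] = A `*` [set 0])//.
apply: measurableX;last exact: measurable_set1.
exact: filtrationM FA.
rewrite (_ : [set _ | _] = A `*` `]a, b]%classic).
apply: measurableX;last exact: measurable_itv.
exact: filtrationM FA.
by apply/seteqP;split => [[w t]|[w t]]/= [];rewrite in_itv.
Qed.

Lemma measurable_predictable_section t : 0 <= t ->
 mfun [set: g_sigma_algebraType (Fl t)] (fun w => (w, t) : PS).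
move=> t0.
apply: measurable_to_predictable => [A FA|A a b a0 ab FA];rewrite setTI
(filtrationE fF t0)/=.
have [->|t1] := eqVneq t 0.
by rewrite (_ : [set _ | _] = A)//;apply/seteqP;split => [w []|w].
rewrite (_ : [set _ | _] = set0);first exact: filtration0.
by apply/seteqP;split => // w [_/= /eqP];rewrite (negbTE t1).
have [tab|tab] := boolP (a < t <= b).
rewrite (_ : [set _ | _] = A).
by apply: (filtrationS a0 _ FA);lra.
by apply/seteqP;split => [w []|w].
rewrite (_ : [set _ | _] = set0);first exact: filtration0.
by apply/seteqP;split => // w [_].
Qed.

Lemma predictable_adapted (I : set R) dE (E : mtype dE)
 (Y : Omega -> R -> E) : (forall t, I t -> 0 <= t) ->
 measurable ([set p | I p.2] : set PS) ->
 predictable_on I Fl Y -> adapted_on I Fl Y.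
move=> I0 mI pY t It _ B mB;rewrite setTI.
have := measurable_predictable_section (I0 _ It) measurableT (pY mI B mB).
congr measurable;apply/seteqP;split=> [w/= [_ []]//|w/= Bw].
by split.
Qed.

Section stopping.
Variable s : Omega -> \bar R.
Hypothesis ss : stopping_time Fl s.

Lemma stopping_time_le t : 0 <= t -> Fl t [set w | s w <= t%:E]%E.
Proof. by case: ss => _;apply. Qed.

Lemma stopped_sigma_algebra_sigma :
 sigma_algebra setT (stopped_sigma_algebra Fl s).
have [s0 sF] := ss;split.
- by split => // t t0;rewrite set0I;exact: filtration0.
- move=> A [mA FA];rewrite setTD;split;first exact: measurableC.
move=> t t0;rewrite (_ : _ `&` _ = [set w | s w <= t%:E]%E `\`
(A `&` [set w | s w <= t%:E]%E)).
by apply: filtrationD => //;[exact: sF|exact: FA].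
apply/seteqP;split => [w/= [Aw sw]|w/= [sw Asw]].
by split => // -[].
by split => // Aw;apply: Asw.
- move=> A hA;split;first by apply: bigcupT_measurable => n;have [] := hA n.
move=> t t0;rewrite setI_bigcupl -(filtrationE fF t0).
apply: bigcupT_measurable => n;rewrite (filtrationE fF t0).
by have [_] := hA n;exact.
Qed.

Lemma stopped_measurableE :
 (@measurable _ (g_sigma_algebraType (stopped_sigma_algebra Fl s))) =
 stopped_sigma_algebra Fl s.
by rewrite /measurable/= sigma_algebra_id//;exact: stopped_sigma_algebra_sigma.
Qed.

Lemma stopped_sigma_algebraT : stopped_sigma_algebra Fl s setT.
by rewrite -stopped_measurableE;exact: measurableT.
Qed.

(** The graph of a stopping time is excluded: between two reals there is a
  rational at which the past of [s] is already decided. *)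
Lemma predictable_after_stopping A : stopped_sigma_algebra Fl s A ->
 measurable ([set p | A p.1 /\ s p.1 < p.2%:E]%E : set PS).
move=> [mA FA].
rewrite (_ : [set _ | _] = \bigcup_(q : rat)
(if 0 <= (ratr q : R) then
[set p | (A `&` [set w | s w <= (ratr q)%:E]%E) p.1 /\ ratr q < p.2]
else set0)).
apply: bigcupT_measurable_rat => q;case: ifPn => [q0|_];last exact: measurable0.
by apply: predictable_after => //;exact: FA.
apply/seteqP;split=> [[w t]/= [Aw swt]|[w t]/= [q _]];last first.
by case: ifPn => //= q0 [[Aw sw] qt];split => //;rewrite (le_lt_trans sw)// lte_fin.
have [s0 _] := ss;move: (s0 w) swt.
case sE : (s w) => [r| |]//;rewrite lee_fin lte_fin => r0 rt.
have [q] := rat_in_itvoo rt;rewrite in_itv/= => /andP[rq qt].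
exists q => //;have q0 : 0 <= (ratr q : R) by rewrite (le_trans r0) ?ltW.
by rewrite q0/=;split => //;split => //;rewrite sE lee_fin ltW.
Qed.

Lemma predictable_stopping_lt :
 measurable ([set p | s p.1 < p.2%:E]%E : set PS).
rewrite (_ : [set _ | _] = [set p | setT p.1 /\ s p.1 < p.2%:E]%E).
by apply: predictable_after_stopping;exact: stopped_sigma_algebraT.
by apply/seteqP;split => p //= [].
Qed.

Lemma predictable_stopping_ge :
 measurable ([set p | 0 <= p.2 /\ (p.2%:E <= s p.1)%E] : set PS).
rewrite (_ : [set _ | _] = [set p | 0 <= p.2] `\` [set p | s p.1 < p.2%:E]%E).
by apply: measurableD;[exact: predictable_ge0|exact: predictable_stopping_lt].
apply/seteqP;split=> [p/= [p0 ps]|p/= [p0 /negP]];rewrite -?leNgt//.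
by split => //;rewrite ltNge ps.
Qed.

Lemma measurable_predictable_stopping t : 0 <= t ->
 mfun ([set w | s w <= t%:E]%E : set (g_sigma_algebraType (Fl t)))
 (fun w => (w, fine (s w)) : PS).
move=> t0;have [s0 sF] := ss.
have sfin w : (s w <= t%:E)%E -> s w = (fine (s w))%:E.
by move: (s0 w);case: (s w).
apply: measurable_to_predictable => [A FA|A a b a0 ab FA];
rewrite (filtrationE fF t0)/=.
rewrite (_ : _ `&` _ = A `&` [set w | s w <= 0]%E).
apply: filtrationI => //;first exact: filtrationS FA.
by apply: (@filtrationS 0) => //;exact: sF.
apply/seteqP;split=> [w [/= sw [/= Aw s0E]]|w [/= Aw sw]].
by split => //=;rewrite (sfin _ sw) s0E.
have sE : s w = 0%E by apply/eqP;rewrite eq_le sw s0.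
by rewrite sE;split => //=;rewrite lee_fin.
have [ta|at_] := leP t a.
rewrite (_ : _ `&` _ = set0);first exact: filtration0.
apply/seteqP;split=> // w [/= sw [/= Aw]] /andP[+ _].
by move: (sw);rewrite (sfin _ sw) lee_fin/=;lra.
rewrite (_ : _ `&` _ = (A `&` [set w | s w <= (Num.min t b)%:E]%E) `\`
[set w | s w <= a%:E]%E).
apply: filtrationD => //;first apply: filtrationI => //.
- by apply: filtrationS FA => //;exact: ltW.
- apply: (@filtrationS (Num.min t b)) => //.
+ by rewrite le_min t0 (le_trans a0).
+ by rewrite ge_min lexx.
+ by apply: sF;rewrite le_min t0 (le_trans a0).
- by apply: (@filtrationS a) => //;[exact: ltW|exact: sF].
apply/seteqP;split=> [w [/= sw [/= Aw]]|w [/= [Aw sw] asw]].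
move=> /andP[aw wb].
move: (sw);rewrite (sfin _ sw)/= !lee_fin => sw';rewrite le_min sw' wb;split => //.
by apply/negP;rewrite -ltNge.
have sw' : (s w <= t%:E)%E.
by rewrite (le_trans sw)// lee_fin ge_min lexx.
split => //;split => //=.
move: sw asw;rewrite (sfin _ sw')/= !lee_fin le_min => /andP[_ ->] /negP.
by rewrite -ltNge => ->.
Qed.

End stopping.

Lemma stopping_time_cst t : 0 <= t -> stopping_time Fl (fun=> t%:E).
move=> t0;split=> [w|u u0];first by rewrite lee_fin.
have [tu|ut] := leP t u.
rewrite (_ : [set _ | _] = setT);first exact: filtrationT.
by apply/seteqP;split => //= w _;rewrite lee_fin.
rewrite (_ : [set _ | _] = set0);first exact: filtration0.
by apply/seteqP;split => //= w;rewrite lee_fin leNgt ut.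
Qed.

Lemma stopping_time_min s1 s2 : stopping_time Fl s1 -> stopping_time Fl s2 ->
 stopping_time Fl (fun w => Order.min (s1 w) (s2 w)).
move=> [s10 s1F] [s20 s2F];split=> [w|t t0];first by rewrite le_min s10 s20.
rewrite (_ : [set _ | _] = [set w | s1 w <= t%:E]%E `|` [set w | s2 w <= t%:E]%E).
rewrite -(filtrationE fF t0);apply: measurableU;
rewrite (filtrationE fF t0).
exact: s1F.
exact: s2F.
by apply/seteqP;split=> w/=;rewrite ge_min => /orP.
Qed.

Definition dyadic (n : nat) (t : R) : R :=
 ((Num.ceil (t * 2 ^+ n))%:~R - 1) / 2 ^+ n.

Lemma dyadic_before_lt n t : dyadic n t < t.
rewrite /dyadic ltr_pdivrMr ?exprn_gt0// ltrBlDr.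
by have := ceil_itv (t * 2 ^+ n);lra.
Qed.

Lemma dyadic_before_ge n t : t - (2 ^+ n)^-1 <= dyadic n t.
rewrite /dyadic ler_pdivlMr ?exprn_gt0// mulrBl mulVf ?gt_eqF ?exprn_gt0//.
by have := ceil_itv (t * 2 ^+ n);lra.
Qed.

Lemma dyadic_before_ge0 n t : 0 < t -> 0 <= dyadic n t.
move=> t0;rewrite divr_ge0 ?exprn_ge0// subr_ge0.
rewrite -[1]/(1%:~R) ler_int.
by rewrite -gtz0_ge1 ceil_gt0 mulr_gt0 ?exprn_gt0.
Qed.

Lemma cvg_dyadic_before t : dyadic n t @[n --> \oo] --> t.
apply: (@squeeze_cvgr _ _ _ _ (fun n => t - (2 ^+ n)^-1) (cst t)).
- by near=> n;rewrite dyadic_before_ge/= ltW// dyadic_before_lt.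
- rewrite -[X in _ --> X]subr0;apply: cvgB;first exact: cvg_cst.
by under eq_fun do rewrite -exprVn;apply: cvg_expr;rewrite ger0_norm;lra.
- exact: cvg_cst.
Unshelve. all: by end_near. Qed.

Lemma measurable_dyadic_before T dE (E : mtype dE)
 (x : Omega -> R -> E) n : adapted_on `[0, T] Fl x ->
 mfun ([set p | 0 < p.2 <= T] : set PS)
 (fun p => x p.1 (dyadic n p.2)).
move=> ax mD B mB.
rewrite (_ : _ `&` _ = [set p | 0 < p.2 <= T] `&` \bigcup_k
(if k%:R / 2 ^+ n <= T then
[set w | B (x w (k%:R / 2 ^+ n))] `*` `]k%:R / 2 ^+ n, k.+1%:R / 2 ^+ n]
else set0)).
apply: measurableI => //;apply: bigcupT_measurable => k.
have k0 : 0 <= k%:R / 2 ^+ n :> R by rewrite divr_ge0 ?exprn_ge0.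
case: ifPn => [kT|_];last exact: measurable0.
apply: predictable_rectangleW => //.
move/adapted_onP : ax;apply => //=.
by move=> t;rewrite in_itv/= => /andP[].
by rewrite in_itv/= k0.
have n0 : 0 < 2 ^+ n :> R by rewrite exprn_gt0.
apply/seteqP;split=> -[w t]/= [/andP[t0 tT]].
move=> Bw;split;first by rewrite t0.
have := dyadic_before_ge0 n t0;have := dyadic_before_lt n t.
have := ceil_itv (t * 2 ^+ n);move: Bw;rewrite /dyadic.
have : (0 < Num.ceil (t * 2 ^+ n))%R by rewrite ceil_gt0 mulr_gt0.
case: (Num.ceil _) => // -[//|k] _.
have kE : (Posz k.+1)%:~R - 1 = k%:R :> R
by rewrite -[(Posz k.+1)%:~R]/(k.+1%:R : R) -natr1 addrK.
rewrite intrB kE => Bw kt kt2 k0.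
exists k => //;rewrite ifT;last by rewrite (le_trans (ltW kt2)).
split => //=;rewrite in_itv/= kt2 ler_pdivlMr// -natr1;lra.
move=> [k _];case: ifPn => //= kT [Bw];rewrite in_itv/=.
rewrite ltr_pdivrMr// ler_pdivlMr// => kt;split;first by rewrite t0.
suff -> : dyadic n t = k%:R / 2 ^+ n by [].
have kE : (Posz k.+1)%:~R - 1 = k%:R :> R
by rewrite -[(Posz k.+1)%:~R]/(k.+1%:R : R) -natr1 addrK.
rewrite /dyadic (@ceil_def _ _ k.+1)//.
by rewrite kE.
by rewrite intrB kE -[(Posz k.+1)%:~R]/(k.+1%:R : R).
Qed.

End one_filtration.

Lemma mpred_sub Fl Gl :
 (forall t, 0 <= t -> Fl t `<=` Gl t) ->
 mfun [set: pspace Gl] (fun p => p : pspace Fl).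
move=> FG.
apply: measurable_to_predictable => [A FA|A a b a0 ab FA];rewrite setTI.
by apply: sub_gen_smallest;left;exists A;[exact: FG|apply/seteqP;split].
by apply: sub_gen_smallest;right;exists A, a, b;split => //;exact: FG.
Qed.

Lemma stopping_time_sub Fl Gl s : (forall t, 0 <= t -> Fl t `<=` Gl t) ->
 stopping_time Fl s -> stopping_time Gl s.
Proof. by move=> FG [s0 sF];split => // t t0;apply: FG => //;exact: sF. Qed.

End filtrations_theory.

(** * Predictable processes and fields *)

Section measurable_misc.
Context d (T : mtype d).

Lemma measurable_fun_pair_on d1 d2 (T1 : mtype d1)
 (T2 : mtype d2) (D : set T) (f : T -> T1) (g : T -> T2) :
 mfun D f -> mfun D g ->
 mfun D (fun x => (f x, g x)).
move=> mf mg mD;apply: (measurability _ (measurable_prod_measurableType T1 T2) _ mD).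
move=> _ [_ [A mA [B mB <-]] <-].
rewrite (_ : _ `&` _ = (D `&` f @^-1` A) `&` (D `&` g @^-1` B)).
by apply: measurableI;[exact: mf|exact: mg].
by apply/seteqP;split=> [x [? []]|x [[? ?] [? ?]]].
Qed.

Lemma measurable_fun_cond d2 (T2 : mtype d2) (D : set T) (f : T -> T2)
 (a : T2) : measurable D -> mfun D f ->
 mfun setT (fun x => if `[< D x >] then f x else a).
move=> mD mf;apply: measurable_fun_if => //.
- apply: (@measurable_fun_bool _ _ _ _ true);rewrite setTI.
rewrite (_ : _ @^-1` _ = D)//;apply/seteqP;split => x /=;first by move/asboolP.
by move=> /asboolP ->.
- rewrite (_ : _ `&` _ = D)//;apply/seteqP;split => x /=.
by move=> [_ /asboolP].
by move=> /asboolP ->.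
Qed.

End measurable_misc.

Definition pprocess {R : realType} {dO} {Omega : mtype dO}
 (Fl : R -> set (set Omega)) {dE} {E : mtype dE} (Y : Omega -> R -> E) :=
 mfun [set: pspace Fl] (fun p => Y p.1 p.2).

Definition pfield {R : realType} {dO} {Omega : mtype dO}
 (Fl : R -> set (set Omega)) {dV} {V : mtype dV} {dE}
 {E : mtype dE} (W : Omega -> R -> V -> E) :=
 mfun [set: pspace Fl * V] (fun q => W q.1.1 q.1.2 q.2).

Section predictable_fields.
Context {R : realType} {dO : measure_display} {Omega : mtype dO}.
Variable Fl : R -> set (set Omega).
Hypothesis fF : is_filtration Fl.
Context {dV : measure_display} {V : mtype dV}.
Local Notation PS := (pspace Fl).

Lemma field_process {dE} {E : mtype dE} (Y : Omega -> R -> E) :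
 pprocess Fl Y -> pfield Fl (fun w t (x : V) => Y w t).
Proof. by move=> mY;exact: (mcomp mY measurable_fst). Qed.

Lemma predictable_field_on_total (I : set R) {dE} {E : mtype dE}
 (W : Omega -> R -> V -> E) :
 pfield Fl W -> predictable_field_on I Fl W.
Proof. by move=> mY;exact: mfunTS. Qed.

Lemma predictable_process_cut (I : set R) {dE} {E : mtype dE}
 (Y : Omega -> R -> E) (a : E) : measurable ([set p | I p.2] : set PS) ->
 predictable_on I Fl Y ->
 pprocess Fl (fun w t => if `[< I t >] then Y w t else a).
Proof. by move=> mI mY;exact: (measurable_fun_cond a mI mY). Qed.

Lemma field_cut (I : set R) {dE} {E : mtype dE}
 (W : Omega -> R -> V -> E) (a : E) : measurable ([set p | I p.2] : set PS) ->
 predictable_field_on I Fl W ->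
 pfield Fl (fun w t x => if `[< I t >] then W w t x else a).
move=> mI mW;apply: (measurable_fun_cond a _ mW).
rewrite -[X in measurable X]setTI.
exact: (@measurable_fst _ _ PS V measurableT _ mI).
Qed.

Lemma measurable_field_slice w :
 mfun [set: R * V] (fun q => ((w, q.1) : PS, q.2)).
apply: measurable_fun_pair;last exact: measurable_snd.
exact: (mcomp (@measurable_predictable_slice _ _ _ Fl w) measurable_fst).
Qed.

Lemma field_path {dE} {E : mtype dE}
 (W : Omega -> R -> V -> E) w : pfield Fl W ->
 mfun [set: R * V] (fun q => W w q.1 q.2).
Proof. by move=> mW;exact: (mcomp mW (measurable_field_slice w)). Qed.

Lemma process_path {dE} {E : mtype dE}
 (Y : Omega -> R -> E) w : pprocess Fl Y ->
 mfun [set: R] (Y w).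
Proof. by move=> mY;exact: (mcomp mY (@measurable_predictable_slice _ _ _ Fl w)). Qed.

Lemma process_measurable {dE} {E : mtype dE}
 (Y : Omega -> R -> E) t : 0 <= t -> pprocess Fl Y ->
 forall B, measurable B -> Fl t [set w | B (Y w t)].
move=> t0 mY B mB;rewrite -(filtrationE fF t0).
have := measurable_predictable_section fF t0 measurableT (mY measurableT _ mB).
by rewrite !setTI.
Qed.

Lemma process_time_measurable {dE} {E : mtype dE}
 (Y : Omega -> R -> E) t : 0 <= t -> pprocess Fl Y ->
 mfun setT (Y ^~ t).
move=> t0 mY _ B mB;rewrite setTI.
by apply: (filtrationM fF t0);exact: process_measurable mY _ mB.
Qed.

(** A random variable that is known at a stopping time [s] gives a process that
  is predictable strictly after [s]. *)
Lemma process_after (s : Omega -> \bar R) (z : Omega -> R) :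
 stopping_time Fl s ->
 (forall B, measurable B -> stopped_sigma_algebra Fl s (z @^-1` B)) ->
 pprocess Fl (fun w t => if (s w < t%:E)%E then z w else 0).
move=> ss mz;pose D : set PS := [set p | s p.1 < p.2%:E]%E.
have mD : measurable D by exact: predictable_stopping_lt.
suff mDz : mfun D (fun p => z p.1).
have := measurable_fun_cond (0:R) mD mDz;congr mfun.
by apply/funext => p;rewrite /D/= asboolb.
move=> _ B mB;have := predictable_after_stopping ss (mz B mB).
by congr measurable;apply/seteqP;split => p [].
Qed.

Lemma process_interval (T : R) :
 pprocess Fl (fun w t => ((0 < t <= T)%R)%:R : R).
pose D : set PS := [set p | 0 <= p.2 <= T] `&` [set p | 0 < p.2].
have mD : measurable D.
by apply: measurableI;[exact: predictable_le|exact: predictable_gt].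
have := measurable_fun_cond (0:R) mD (@measurable_cst _ _ PS R D 1).
congr mfun;apply/funext => p.
have -> : `[< D p >] = (0 < p.2 <= T).
by apply/asboolP/idP;rewrite /D/=;lra.
by case: ifP.
Qed.

(** Left limits are read along the dyadic times just before [t]; the upper
  limit makes sense on the exceptional paths that have no left limit. *)
Definition left_version T (x : Omega -> R -> R) (w : Omega) (t : R) : R :=
 if 0 < t <= T then
 fine (limn_esup (fun n => (x w (dyadic n t))%:E)) else 0.

Lemma left_versionE T (x : Omega -> R -> R) w t : 0 < t <= T ->
 cvg (x w @ t^'-) -> left_version T x w t = left_lim (x w) t.
move=> tT cx;rewrite /left_version tT.
have cv : (x w (dyadic n t))%:E @[n --> \oo] --> (left_lim (x w) t)%:E.
apply: cvg_EFin;first by near=> n.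
move: cx => /cvg_at_leftP;apply;split.
by move=> n;exact: dyadic_before_lt.
exact: cvg_dyadic_before.
rewrite is_cvg_limn_esupE;last by apply/cvg_ex;exists (left_lim (x w) t)%:E.
by rewrite (cvg_lim _ cv).
Unshelve. all: by end_near. Qed.

Lemma predictable_left_version T (x : Omega -> R -> R) : adapted_on `[0, T] Fl x ->
 pprocess Fl (left_version T x).
move=> ax;pose D : set PS := [set p | 0 < p.2 <= T].
have mD : measurable D.
rewrite (_ : D = [set p | 0 <= p.2 <= T] `&` [set p | 0 < p.2]).
by apply: measurableI;[exact: predictable_le|exact: predictable_gt].
by apply/seteqP;split => p;rewrite /D/=;lra.
have mDx : mfun D (fun p =>
fine (limn_esup (fun n => (x p.1 (dyadic n p.2))%:E))).
apply: (@mcomp _ _ _ _ _ _ fine) => //.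
apply: measurable_fun_limn_esup => n;apply/mEFinP.
exact: measurable_dyadic_before.
have := measurable_fun_cond (0:R) mD mDx;congr mfun;apply/funext => p.
by rewrite /left_version /D/= asboolb.
Qed.

(** For paths that are locally constant on the left no topology on the state
  space is needed. *)
Lemma predictable_left_const {dE} {E : mtype dE} (x y : Omega -> R -> E) T :
 adapted_on `[0, T] Fl x ->
 (forall w t, 0 < t -> \forall r \near t^'-, x w r = y w t) ->
 forall a, pprocess Fl (fun w t => if 0 < t <= T then y w t else a).
move=> ax xy a;pose D : set PS := [set p | 0 < p.2 <= T].
have mD : measurable D.
rewrite (_ : D = [set p | 0 <= p.2 <= T] `&` [set p | 0 < p.2]).
by apply: measurableI;[exact: predictable_le|exact: predictable_gt].
by apply/seteqP;split => p;rewrite /D/=;lra.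
have mDy : mfun D (fun p => y p.1 p.2).
move=> _ B mB.
rewrite (_ : _ `&` _ = \bigcup_n \bigcap_(k in [set k | (n <= k)%N])
(D `&` (fun p => x p.1 (dyadic k p.2)) @^-1` B)).
apply: bigcupT_measurable => n;apply: bigcap_measurable;first by exists n => /=.
by move=> k _;apply: measurable_dyadic_before.
have ev w t : 0 < t ->
exists n, forall k, (n <= k)%N -> x w (dyadic k t) = y w t.
move=> t0;apply: contrapT => /forallNP h.
have : (fun r => (`[< x w r = y w t >])%:R : R) @ t^'- --> (1 : R).
by apply: cvg_near_cst;near=> r;rewrite asboolT//;near: r;exact: xy.
move=> /cvg_at_leftP /(_ (fun k => dyadic k t)) hc.
have /hc {}hc : (forall n, dyadic n t < t) /\
dyadic n t @[n --> \oo] --> t.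
by split;[move=> n;exact: dyadic_before_lt|exact: cvg_dyadic_before].
have /cvgrPdist_lt/(_ 1 ltr01)[n _ hn] := hc.
have := h n;apply => k nk;have := hn k nk.
case: (asboolP (_ = _)) => // _;rewrite subr0 normr1 ltxx//.
apply/seteqP;split => -[w t] /=.
move=> [Dt By];have [n hn] := ev w t (andP Dt).1;exists n => // k /= nk.
by split => //;rewrite /preimage/= hn.
move=> [n _ h];have [Dt _] := h n (leqnn n);split => //.
have [m hm] := ev w t (andP Dt).1.
by have [_] := h (maxn n m) (leq_maxl _ _);rewrite /preimage/= hm// leq_maxr.
have := measurable_fun_cond a mD mDy;congr mfun;apply/funext => p.
by rewrite /D/= asboolb.
Unshelve. all: by end_near. Qed.

End predictable_fields.

(** * Step paths and their jump measures *)

Section atoms.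
Context {R : realType} {dV : measure_display} {V : mtype dV}.
Local Open Scope ereal_scope.

Definition atom (s : \bar R) (y : V) : jump_measure R V :=
 match s with
 | r%:E => [the (jump_measure R V) of \d_((r, y) : R * V)]
 | _ => [the (jump_measure R V) of mzero]
 end.

Definition points (s : nat -> \bar R) (y : nat -> V) :
 (jump_measure R V) :=
 mseries (fun n => atom (s n) (y n)) 0.

Definition at_atom (s : \bar R) (y : V) (f : R * V -> \bar R) : \bar R :=
 if s is r%:E then f (r, y) else 0.

Lemma integral_atom s y f : mfun setT f ->
 \int[atom s y]_q f q = at_atom s y f.
move=> mf;case: s => [r| |] /=.
- by rewrite integral_dirac// diracT mul1e.
- by rewrite integral_measure_zero.
- by rewrite integral_measure_zero.
Qed.

Lemma ge0_integral_points s y f : mfun setT f -> (forall q, 0 <= f q) ->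
 \int[points s y]_q f q = \sum_(0 <= n <oo) at_atom (s n) (y n) f.
move=> mf f0;rewrite ge0_integral_measure_series//.
by apply: eq_eseriesr => n _;rewrite integral_atom.
Qed.

Lemma point_measureE (D : set R) (y : R -> V) (s : nat -> \bar R) :
 (forall n, s n <> -oo) ->
 (forall r, D r <-> exists n, s n = r%:E) ->
 (forall n m, s n < +oo -> s n = s m -> n = m) ->
 forall A, measurable A ->
 point_measure D y A = points s (fun n => y (fine (s n))) A.
move=> sN Ds sI A mA;rewrite /point_measure.
have -> : D = [set fine (s n) | n in [set n | s n < +oo]].
apply/seteqP;split=> [r /Ds[n sn]|r [n /= sn <-]].
by exists n => /=;rewrite sn// ltry.
by apply/Ds;exists n;move: (sN n) sn;case: (s n).
rewrite esum_image;last first.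
move=> n m;rewrite !inE/= => sn sm nm;apply: sI => //.
by move: (sN n) (sN m) sn sm nm;case: (s n);case: (s m) => //= a b _ _ _ _ ->.
rewrite esum_mkcond -nneseries_esumT;last by move=> n;case: ifP.
rewrite /points/= /mseries;apply: eq_eseriesr => n _.
case: ifPn => [|/negP].
by rewrite inE/= => sn;move: (sN n) sn;rewrite /atom;case: (s n).
by rewrite inE/=;move: (sN n);case: (s n) => [r _|//|//] [];exact: ltry.
Qed.

End atoms.

Section left_constant_paths.
Context {R : realType} {M : normedModType R}.
Implicit Types x : R -> M.

Lemma left_lim_near_cst x t c : (\forall r \near t^'-, x r = c) -> left_lim x t = c.
Proof. by move=> h;apply: cvg_lim => //;exact: cvg_near_cst. Qed.

End left_constant_paths.

Section step_paths.
Context {R : realType} {M : normedModType R}.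
Variables (s : nat -> \bar R) (xi : nat -> M) (x : R -> M).
Hypotheses (s_gt0 : forall n, (0 < s n)%E)
 (s_step : forall n, (s n <= s n.+1)%E /\ (s n < +oo -> s n < s n.+1)%E)
 (s_cvg : s n @[n --> \oo] --> +oo%E)
 (xi_neq0 : forall n, xi n != 0 <-> (s n < +oo)%E)
 (xE : forall t, 0 <= t ->
 \sum_(n < N) indic_after (s n) t *: xi n @[N --> \oo] --> x t).

Lemma step_time_le n m : (n <= m)%N -> (s n <= s m)%E.
elim: m => [|m IH];first by rewrite leqn0 => /eqP ->.
rewrite leq_eqVlt => /orP[/eqP->//|];rewrite ltnS => /IH h.
by apply: (le_trans h);have [] := s_step m.
Qed.

Lemma step_time_lt n m : (n < m)%N -> (s n < +oo)%E -> (s n < s m)%E.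
move=> nm sn;have [_ /(_ sn) h] := s_step n.
by apply: (lt_le_trans h);exact: step_time_le.
Qed.

Lemma step_time_inj n m : (s n < +oo)%E -> s n = s m -> n = m.
move=> sn nm;have [nm'|mn|//] := ltngtP n m.
by have := step_time_lt nm' sn;rewrite nm ltxx.
by have := step_time_lt mn;rewrite -nm ltxx => /(_ sn).
Qed.

Lemma step_time_exceeds (t : R) : exists n, (t%:E < s n)%E.
have /cvgeyPge/(_ (t + 1))[n _ hn] := s_cvg.
exists n;apply: lt_le_trans (hn n _) => //=.
by rewrite lte_fin ltrDl.
Qed.

Lemma step_pathE t k : 0 <= t -> (forall i, (i < k)%N -> s i <= t%:E)%E ->
 (t%:E < s k)%E -> x t = \sum_(i < k) xi i.
move=> t0 sk tk;apply: (cvg_unique _ (xE t0)) => //.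
apply: cvg_near_cst;exists k => // N /= kN.
rewrite -(subnKC kN) big_split_ord/= [X in _ + X]big1 ?addr0;last first.
move=> i _;rewrite /indic_after (_ : (_ <= _)%E = false) ?scale0r//.
by apply/negbTE;rewrite -ltNge (lt_le_trans tk)// step_time_le// leq_addr.
by apply: eq_bigr => i _;rewrite /indic_after sk ?scale1r.
Qed.

Lemma step_index t : 0 < t ->
 exists k, (forall i, (i < k)%N -> s i < t%:E)%E /\ (t%:E <= s k)%E.
move=> t0;have : exists n, (t%:E <= s n)%E.
by have [n /ltW ?] := step_time_exceeds t;exists n.
move=> /ex_minnP[k tk kmin];exists k;split => // i ik.
by rewrite ltNge;apply/negP => /kmin;rewrite leqNgt ik.
Qed.

Lemma step_path_left t k : 0 < t -> (forall i, (i < k)%N -> s i < t%:E)%E ->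
 (t%:E <= s k)%E -> \forall r \near t^'-, x r = \sum_(i < k) xi i.
move=> t0 sk tk.
pose m : R := \big[Num.max/0]_(i < k) fine (s i).
have sm i : (i < k)%N -> (s i <= m%:E)%E.
move=> ik;have := sk i ik;have := s_gt0 i.
case sE : (s i) => [r| |]//;rewrite lee_fin => _ _.
have := le_bigmax (0 : R) (fun j : 'I_k => fine (s j)) (Ordinal ik).
by rewrite /= sE.
have mt : m < t.
apply/bigmax_ltP;split => // i _;have := sk i (ltn_ord i);have := s_gt0 i.
by case: (s i).
have m0 : 0 <= m.
by rewrite /m bigmax_ge_id.
near=> r.
have mr : m < r by near: r;exact: nbhs_left_gt.
have rt : r < t by near: r;exact: nbhs_left_lt.
apply: step_pathE.
- by rewrite (le_trans m0) ?ltW.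
- by move=> i ik;rewrite (le_trans (sm i ik))// lee_fin ltW.
- by rewrite (lt_le_trans _ tk)// lte_fin.
Unshelve. all: by end_near. Qed.

Lemma step_path_left_lim t : 0 < t -> \forall r \near t^'-, x r = left_lim x t.
move=> t0;have [k [sk tk]] := step_index t0.
have h := step_path_left t0 sk tk.
by rewrite (left_lim_near_cst h).
Qed.

Lemma step_path_jump n t : s n = t%:E -> jump x t = xi n.
move=> snt;have t0 : 0 < t by have := s_gt0 n;rewrite snt lte_fin.
rewrite /jump t0 (left_lim_near_cst (@step_path_left t n t0 _ _));last 2 first.
- move=> i ilt;rewrite -snt;apply: step_time_lt => //.
by rewrite (le_lt_trans (step_time_le (ltnW ilt)))// snt ltry.
- by rewrite snt.
rewrite (@step_pathE t n.+1) ?ltW//;last 2 first.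
- by move=> i;rewrite ltnS -snt;exact: step_time_le.
- by rewrite -snt;apply: step_time_lt => //;rewrite snt ltry.
by rewrite big_ord_recr/= [X in X - _]addrC addrK.
Qed.

Lemma step_path_no_jump t : 0 < t -> (forall n, s n <> t%:E) -> jump x t = 0.
move=> t0 nt;have [k [sk tk]] := step_index t0.
rewrite /jump t0 (left_lim_near_cst (step_path_left t0 sk tk)).
rewrite (@step_pathE t k) ?subrr// ?ltW//.
by move=> i ik;rewrite ltW// sk.
by rewrite lt_neqAle tk andbT;apply/eqP => h;exact: (nt k).
Qed.

Lemma step_path_jump_times t : jump_times x t <-> exists n, s n = t%:E.
split=> [[t0 jt]|[n snt]].
apply: contrapT => /forallNP nt;move: jt.
by rewrite (step_path_no_jump t0)// eqxx.
split;first by have := s_gt0 n;rewrite snt lte_fin.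
by rewrite (step_path_jump snt);apply/xi_neq0;rewrite snt ltry.
Qed.

End step_paths.

Section indicator_path.
Context {R : realType}.
Variable s : \bar R.

Lemma indic_after_left (t : R) :
 \forall r \near t^'-, indic_after s r = (s < t%:E)%E%:R.
have [st|ts] := ltP s t%:E;rewrite /indic_after.
case: s st => [a| |]//.
by rewrite lte_fin => at_;near=> r;rewrite lee_fin (_ : _ <= _ = true)//;
near: r;exact: nbhs_left_ge.
by move=> _;near=> r;rewrite leNye.
near=> r.
suff -> : (s <= r%:E)%E = false by [].
apply/negbTE;rewrite -ltNge (lt_le_trans _ ts)// lte_fin.
by near: r;exact: nbhs_left_lt.
Unshelve. all: by end_near. Qed.

Lemma indic_after_jump (t : R) : 0 < t ->
 jump (indic_after s : R -> R) t = (s == t%:E)%:R.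
move=> t0;rewrite /jump t0 (left_lim_near_cst (indic_after_left t)) /indic_after.
by case: ltgtP => _;rewrite ?subrr ?subr0.
Qed.

End indicator_path.

Lemma left_lim_pair {R : realType} {M N : normedModType R} (x : R -> M)
 (y : R -> N) t a b : (\forall r \near t^'-, x r = a) ->
 (\forall r \near t^'-, y r = b) -> left_lim (fun r => (x r, y r)) t = (a, b).
move=> xa yb;apply: left_lim_near_cst;near=> r.
by congr pair;near: r.
Unshelve. all: by end_near. Qed.

Section stopped_values.
Context {R : realType} {dO : measure_display} {Omega : mtype dO}.
Variable Fl : R -> set (set Omega).
Hypothesis fF : is_filtration Fl.
Context {dV : measure_display} {V : mtype dV}.
Variables (s : Omega -> \bar R) (z : Omega -> V).
Hypotheses (ss : stopping_time Fl s)
 (mz : forall B t, measurable B -> 0 <= t ->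
 Fl t (z @^-1` B `&` [set w | s w <= t%:E]%E)).
Context {dE : measure_display} {E : mtype dE}.
Variables (W : Omega -> R -> V -> E) (a : E).
Hypothesis mW : pfield Fl W.

Lemma stopped_value_measurable B : measurable B ->
 stopped_sigma_algebra Fl s
 [set w | B (if (s w < +oo)%E then W w (fine (s w)) (z w) else a)].
move=> mB;pose y w := if (s w < +oo)%E then W w (fine (s w)) (z w) else a.
rewrite -/(y @^-1` B).
have FB t : 0 <= t -> Fl t (y @^-1` B `&` [set w | s w <= t%:E]%E).
move=> t0;rewrite -(filtrationE fF t0).
pose D : set (g_sigma_algebraType (Fl t)) := [set w | s w <= t%:E]%E.
have mD : measurable D.
by rewrite (filtrationE fF t0);exact: stopping_time_le.
have h1 := measurable_predictable_stopping fF ss t0.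
have h2 : mfun D z.
by move=> _ C mC;rewrite (filtrationE fF t0) setIC;exact: mz.
have h3 := measurable_fun_pair_on h1 h2.
have h4 : mfun D (fun w => W w (fine (s w)) (z w)).
exact: (mcomp mW h3).
have := h4 mD B mB;congr measurable;apply/seteqP;split=> w [].
move=> /= Dw Bw;split => //;rewrite /y/= (le_lt_trans Dw) ?ltry//.
by move=> /=;rewrite /y => + Dw;rewrite (le_lt_trans Dw) ?ltry.
have ms t : 0 <= t -> measurable [set w | s w <= t%:E]%E.
by move=> t0;apply: (filtrationM fF t0);exact: stopping_time_le.
split=> [|t t0];last exact: FB.
have dec : y @^-1` B = (\bigcup_n (y @^-1` B `&` [set w | s w <= n%:R%:E]%E)) `|`
(if `[< B a >] then ~` \bigcup_n [set w | s w <= n%:R%:E]%E else set0).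
have fin w : (s w < +oo)%E -> exists n : nat, (s w <= n%:R%:E)%E.
have := ss.1 w;case: (s w) => [r r0 _| |]//.
exists (Num.truncn r).+1;rewrite lee_fin;exact/ltW/truncnS_gt.
apply/seteqP;split=> w.
move=> Bw;have [sw|sw] := ltP (s w) +oo%E.
by left;have [n hn] := fin _ sw;exists n.
right;case: asboolP => [Ba|nBa].
move=> [n _ /=];rewrite leNgt => /negP;apply.
by rewrite (lt_le_trans _ sw)// ltry.
by move: Bw;rewrite /y/= ltNge sw.
move=> [[n _ []//]|];case: asboolP => // Ba h.
rewrite /y/=;case: ifP => // sw;exfalso;apply: h.
by have [n hn] := fin _ sw;exists n.
rewrite dec;apply: measurableU.
apply: bigcupT_measurable => n.
exact: (filtrationM fF (ler0n _ _) (FB _ _)).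
case: ifP => _;last exact: measurable0.
by apply: measurableC;apply: bigcupT_measurable => n;exact: ms.
Qed.

End stopped_values.

(** * Change of variables along a path *)

Section real_induction.
Context {R : realType}.
Implicit Types (a b t u r : R) (P : R -> Prop).

Lemma near_right_ex P t : (\forall r \near t^'+, P r) ->
 exists2 e, 0 < e & forall r, t < r < t + e -> P r.
move=> [e /= e0 he];exists e => // r /andP[tr re];apply: he => //=.
by rewrite ltr0_norm ?subr_lt0//;lra.
Qed.

Lemma near_left_ex P t : (\forall r \near t^'-, P r) ->
 exists2 e, 0 < e & forall r, t - e < r < t -> P r.
move=> [e /= e0 he];exists e => // r /andP[tr re];apply: he => //=.
by rewrite gtr0_norm ?subr_gt0//;lra.
Qed.

Lemma real_induction P a b : P a ->
 (forall t, a < t <= b -> (forall u, a <= u < t -> P u) -> P t) ->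
 (forall t, a <= t < b -> (forall u, a <= u <= t -> P u) ->
 \forall r \near t^'+, P r) ->
 forall t, a <= t <= b -> P t.
move=> Pa Pl Pr t0 /andP[at0 t0b].
pose A := [set t | a <= t <= b /\ forall u, a <= u <= t -> P u].
have Aa : A a.
split;first by rewrite lexx (le_trans at0).
by move=> u /andP[au ua];rewrite (_ : u = a)//;apply/eqP;rewrite eq_le au ua.
have hA : has_sup A.
by split;[exists a|exists b => u [/andP[]]].
pose c := sup A.
have ac : a <= c by exact: ub_le_sup hA.2 _ Aa.
have cb : c <= b by apply: ge_sup => //;[exists a|move=> u [/andP[]]].
have below u : a <= u < c -> P u.
move=> /andP[au uc];have [v [_ hv] uv] := sup_gt (ex_intro _ a Aa) uc.
by apply: hv;rewrite au ltW.
have Pc : P c.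
move: ac;rewrite le_eqVlt => /orP[/eqP <-//|ac'].
by apply: Pl => //;rewrite ac' cb.
have belowc u : a <= u <= c -> P u.
move=> /andP[au];rewrite le_eqVlt => /orP[/eqP -> //|uc].
by apply: below;rewrite au uc.
have cEb : c = b.
apply/eqP;rewrite eq_le cb leNgt;apply/negP => cb'.
have acb : a <= c < b by rewrite ac.
have [e e0 he] := near_right_ex (Pr c acb belowc).
pose v := c + Num.min (e / 2) (b - c).
have m0 : 0 < Num.min (e / 2) (b - c) by rewrite lt_min;lra.
have me : Num.min (e / 2) (b - c) < e by rewrite gt_min;lra.
have mb : Num.min (e / 2) (b - c) <= b - c by rewrite ge_min lexx orbT.
have : v <= c.
apply: (ub_le_sup hA.2);split;first by rewrite /v;lra.
move=> u /andP[au uv];have [uc|cu] := leP u c;first by apply: belowc;rewrite au.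
by apply: he;rewrite cu/=;move: uv;rewrite /v;lra.
by rewrite /v;lra.
by apply: belowc;rewrite at0 cEb.
Qed.

(** A function whose increments are negligible, to the right of each point,
  before those of a nondecreasing function, and which has no jump from the
  left, is constant; [F] may have jumps and flat pieces. *)
Lemma constant_wrt_nondecreasing (F h : R -> R) a b : a <= b ->
 (forall s t, a <= s -> s <= t -> t <= b -> F s <= F t) ->
 (forall t, a < t <= b -> h s @[s --> t^'-] --> h t) ->
 (forall e t, 0 < e -> a <= t < b ->
 \forall r \near t^'+, r <= b -> `|h r - h t| <= e * (F r - F t)) ->
 h b = h a.
move=> ab Fnd hl hr;apply/eqP;rewrite -subr_eq0 -normr_le0.
apply/ler_addgt0Pl => e e0;rewrite addr0.
pose e' := e / (F b - F a + 1).
have Fab : 0 <= F b - F a by rewrite subr_ge0 Fnd.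
have e'0 : 0 < e' by rewrite divr_gt0// ltr_wpDl.
suff : b <= b -> `|h b - h a| <= e' * (F b - F a).
move=> /(_ (lexx b)) /le_trans;apply.
rewrite /e' mulrAC ler_pdivrMr ?ltr_wpDl//.
by rewrite ler_wpM2l ?(ltW e0)// lerDl.
apply: (@real_induction (fun t => t <= b -> `|h t - h a| <= e' * (F t - F a)) a b).
- by rewrite !subrr normr0 mulr0.
- move=> t /andP[at_ tb] IH _.
apply: (@cvgr_to_le _ (t^'-) _ _ (fun s => `|h s - h a|)).
by apply: cvg_norm;apply: cvgB;[apply: hl;rewrite at_|exact: cvg_cst].
near=> s.
have as_ : a < s by near: s;exact: nbhs_left_gt.
have st : s < t by near: s;exact: nbhs_left_lt.
apply: (le_trans (IH s _ _));rewrite ?(ltW as_)//.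
by rewrite ltW// (lt_le_trans st).
by rewrite ler_wpM2l ?(ltW e'0)// lerB// Fnd// ltW.
- move=> t /andP[at_ tb] IH.
have atb : a <= t < b by rewrite at_.
near=> r;move=> rb.
have tr : t < r by near: r;exact: nbhs_right_gt.
have hrt : `|h r - h t| <= e' * (F r - F t).
by move: rb;near: r;exact: hr.
have := IH t;rewrite at_ lexx => /(_ isT (ltW tb)) => iht.
rewrite -(subrKA (h t)) (le_trans (ler_normD _ _))//.
have -> : F r - F a = (F r - F t) + (F t - F a) by ring.
by rewrite mulrDr lerD.
- by rewrite ab lexx.
Unshelve. all: by end_near. Qed.

Lemma cadlag_bounded (S : R) (l : R -> R) : 0 <= S -> cadlag_on S l ->
 exists B, forall t, 0 <= t <= S -> `|l t| <= B.
move=> S0 [lr ll].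
suff : exists B, forall u, 0 <= u <= S -> `|l u| <= B by [].
apply: (@real_induction (fun t => exists B, forall u, 0 <= u <= t -> `|l u| <= B) 0 S).
- exists `|l 0| => u /andP[u0 u0'];rewrite (_ : u = 0)//.
by apply/eqP;rewrite eq_le u0 u0'.
- move=> t /andP[t0 tS] IH.
have tS' : 0 < t <= S by rewrite t0.
have /cvgrPdist_lt/(_ 1 ltr01)/near_left_ex[e e0 he] := ll t tS'.
pose v := Num.max 0 (t - e / 2).
have v0 : 0 <= v by rewrite le_max lexx.
have ve : t - e / 2 <= v by rewrite le_max lexx orbT.
have vt : v < t by rewrite gt_max t0/=;lra.
have [|B hB] := IH v;first by rewrite v0 vt.
exists (Num.max B (Num.max (`|lim (l @ t^'-)| + 1) `|l t|)) => u /andP[u0 ut].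
rewrite !le_max;have [uv|vu] := leP u v;first by rewrite hB ?u0 ?uv.
move: ut;rewrite le_eqVlt => /orP[/eqP ->|ut];first by rewrite lexx !orbT.
apply/orP;right;apply/orP;left.
have : `|lim (l @ t^'-) - l u| < 1 by apply: he;rewrite ut andbT;lra.
by have := ler_distD (l u) 0 (lim (l @ t^'-));rewrite !sub0r !normrN distrC
=> *;have := lerB_dist (l u) (lim (l @ t^'-));rewrite distrC;lra.
- move=> t /andP[t0 tS] IH.
have tS' : 0 <= t < S by rewrite t0.
have [|B hB] := IH t;first by rewrite t0 lexx.
have /cvgrPdist_lt/(_ 1 ltr01)/near_right_ex[e e0 he] := lr t tS'.
near=> r;exists (Num.max B (`|l t| + 1)) => u /andP[u0 ur].
rewrite le_max;have [ut|tu] := leP u t;first by rewrite hB// u0.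
have : `|l t - l u| < 1.
apply: he;rewrite tu/= (le_lt_trans ur)//.
by near: r;apply: nbhs_right_lt;lra.
by move=> h;apply/orP;right;have := lerB_dist (l u) (l t);rewrite distrC;lra.
- by rewrite S0 lexx.
Unshelve. all: by end_near. Qed.

Lemma cadlag_left_lim (S : R) (l : R -> R) t : cadlag_on S l -> 0 < t <= S ->
 l @ t^'- --> left_lim l t.
Proof. by move=> [_ ll] /ll. Qed.

Lemma cadlag_left_lim_bounded (S : R) (l : R -> R) (B : R) : cadlag_on S l ->
 (forall t, 0 <= t <= S -> `|l t| <= B) ->
 forall t, 0 < t <= S -> `|left_lim l t| <= B.
move=> cl hB t tS.
apply: (@cvgr_to_le _ (t^'-) _ _ (fun s => `|l s|)).
by apply: cvg_norm;apply: (cadlag_left_lim cl).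
near=> s;apply: hB;apply/andP;split.
by rewrite ltW//;near: s;apply: nbhs_left_gt;lra.
have st : s < t by near: s;exact: nbhs_left_lt.
by rewrite ltW// (lt_le_trans st)//;have /andP[] := tS.
Unshelve. all: by end_near. Qed.

End real_induction.

Section polynomial_weights.
Context {R : realType}.
Implicit Types x e eps : R.

Lemma expR_second_order x : 0 <= x -> `|expR (- x) - 1 + x| <= x ^+ 2.
move=> x0;have h1 : 1 - x <= expR (- x) by have := expR_ge1Dx (- x).
have h2 : 1 + x <= expR x := expR_ge1Dx x.
have h3 : expR (- x) * expR x = 1 by rewrite -expRD addrC subrr expR0.
have h4 := expR_gt0 (- x).
rewrite ger0_norm;last lra.
suff : expR (- x) <= 1 - x + x ^+ 2 by lra.
have : expR (- x) * (1 + x) <= 1.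
by rewrite -[leRHS]h3 ler_wpM2l// ltW.
have : 1 <= (1 - x + x ^+ 2) * (1 + x).
have : 0 <= x ^+ 3 by rewrite exprn_ge0.
by nra.
by move=> *;rewrite -(@ler_pM2r _ (1 + x));lra.
Qed.

Lemma cvg_expRN (K a : R) (F : R -> R) (Fil : set_system R) {FF : Filter Fil} :
 F r @[r --> Fil] --> a -> expR (- (K * F r)) @[r --> Fil] --> expR (- (K * a)).
move=> h.
have h2 : - (K * F r) @[r --> Fil] --> - (K * a).
by apply: cvgN;apply: cvgM => //;exact: cvg_cst.
exact: (cvg_comp _ _ h2 (@continuous_expR R _)).
Qed.

Lemma fourth_power_remainder x e eps : 0 < eps ->
 exists2 eta, 0 < eta & forall p y e1 e2, `|p - x| < eta -> `|y - x| < eta ->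
 `|e1 - e| < eta -> `|e2 - e| < eta ->
 `|4 * p ^+ 4 * e1 - e2 * (y ^+ 3 + y ^+ 2 * x + y * x ^+ 2 + x ^+ 3) * p| < eps /\
 `|p ^+ 4 * e1 - x ^+ 4 * e| < eps.
move=> eps0.
pose f1 (z : (R * R) * (R * R)) := 4 * z.1.1 ^+ 4 * z.2.1 -
z.2.2 * (z.1.2 ^+ 3 + z.1.2 ^+ 2 * x + z.1.2 * x ^+ 2 + x ^+ 3) * z.1.1.
pose f2 (z : (R * R) * (R * R)) := z.1.1 ^+ 4 * z.2.1 - x ^+ 4 * e.
pose z0 : (R * R) * (R * R) := ((x, x), (e, e)).
have c11 : (fun z : (R * R) * (R * R) => z.1.1) @ z0 --> x.
by apply: (cvg_comp _ _ (@cvg_fst _ _ _ _ _));exact: cvg_fst.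
have c12 : (fun z : (R * R) * (R * R) => z.1.2) @ z0 --> x.
by apply: (cvg_comp _ _ (@cvg_fst _ _ _ _ _));exact: cvg_snd.
have c21 : (fun z : (R * R) * (R * R) => z.2.1) @ z0 --> e.
by apply: (cvg_comp _ _ (@cvg_snd _ _ _ _ _));exact: cvg_fst.
have c22 : (fun z : (R * R) * (R * R) => z.2.2) @ z0 --> e.
by apply: (cvg_comp _ _ (@cvg_snd _ _ _ _ _));exact: cvg_snd.
have cX (g : (R * R) * (R * R) -> R) (a : R) n : g @ z0 --> a ->
(fun z => g z ^+ n) @ z0 --> a ^+ n.
move=> ga;elim: n => [|n IH];first exact: cvg_cst.
by rewrite exprS;under eq_fun do rewrite exprS;exact: cvgM.
have cf1 : f1 @ z0 --> 4 * x ^+ 4 * e -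
e * (x ^+ 3 + x ^+ 2 * x + x * x ^+ 2 + x ^+ 3) * x.
apply: cvgB.
by apply: cvgM => //;apply: cvgM;[exact: cvg_cst|exact: cX].
apply: cvgM => //;apply: cvgM => //.
apply: cvgD;last exact: cvg_cst.
apply: cvgD;last by apply: cvgM => //;exact: cvg_cst.
by apply: cvgD;[exact: cX|apply: cvgM;[exact: cX|exact: cvg_cst]].
have cf2 : f2 @ z0 --> x ^+ 4 * e - x ^+ 4 * e.
by apply: cvgB;[apply: cvgM => //;exact: cX|exact: cvg_cst].
move: cf1 => /cvgrPdist_lt/(_ eps eps0) n1.
move: cf2 => /cvgrPdist_lt/(_ eps eps0) n2.
have : \forall z \near z0,
`|4 * x ^+ 4 * e - e * (x ^+ 3 + x ^+ 2 * x + x * x ^+ 2 + x ^+ 3) * x - f1 z|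
< eps /\ `|x ^+ 4 * e - x ^+ 4 * e - f2 z| < eps.
by near=> z;split;near: z.
move=> /nbhs_ballP[eta /= eta0 h].
exists eta => // p y e1 e2 px yx e1e e2e.
have [] := h ((p, y), (e1, e2)).
by split;split;rewrite /ball/= distrC.
rewrite /f1 /f2 subrr sub0r normrN.
have -> : 4 * x ^+ 4 * e -
e * (x ^+ 3 + x ^+ 2 * x + x * x ^+ 2 + x ^+ 3) * x = 0 by ring.
by rewrite sub0r normrN.
Unshelve. all: by end_near. Qed.

End polynomial_weights.

Section exponential_path.
Context {R : realType} {dV : measure_display} {V : mtype dV}.
Implicit Types (g : R * V -> R) (s t r B : R).
Variables (n0 : jump_measure R V) (F : R -> R) (S K M c : R).
Hypotheses (S_ge0 : 0 <= S)
 (K_ge0 : 0 <= K)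
 (n0F : forall s t, 0 <= s -> s <= t -> t <= S ->
 n0 (`]s, t] `*` setT) = (F t - F s)%:E)
 (F0 : F 0 = 0)
 (mF : mfun setT F)
 (F_left : forall t, 0 < t <= S -> F r @[r --> t^'-] --> F t)
 (F_right : forall t, 0 <= t < S -> F r @[r --> t^'+] --> F t).
Variables (sg : nat -> \bar R) (y : nat -> V) (N : nat).
Hypotheses (sg_gt0 : forall n, (0 < sg n)%E)
 (sg_inj : forall n m, (sg n < +oo)%E -> sg n = sg m -> n = m).
Variable rho : R * V -> R.
Hypotheses (mrho : mfun setT rho)
 (rhoM : forall q, 0 < q.1 <= S -> 0 <= rho q <= M).
Variables (l p : R -> R).
Hypotheses (l_cadlag : cadlag_on S l)
 (mp : mfun setT p)
 (pE : forall t, 0 < t <= S -> p t = left_lim l t).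

Local Notation I g s t := (\int[n0]_(q in `]s, t] `*` setT) g q).
Local Notation jumps g t :=
 (\sum_(n < N) (sg n <= t%:E)%E%:R * g (fine (sg n), y n)).

Hypothesis lE : forall t, 0 <= t <= S ->
 l t = c + jumps (fun q => p q.1 * (rho q - 1)) t -
 I (fun q => p q.1 * (rho q - 1)) 0 t.
Let F_nd s t : 0 <= s -> s <= t -> t <= S -> F s <= F t.
move=> s0 st tS;rewrite -subr_ge0 -lee_fin -n0F//.
Qed.
Let F_ge0 t : 0 <= t <= S -> 0 <= F t.
Proof. by move=> /andP[t0 tS];rewrite -F0;exact: F_nd. Qed.
Let mX (s t : R) : measurable (`]s, t] `*` setT : set (R * V)).
Proof. exact: measurableX. Qed.
Let ig g s t B : mfun setT g -> 0 <= s -> s <= t -> t <= S ->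
 (forall q, s < q.1 <= t -> `|g q| <= B) ->
 n0.-integrable (`]s, t] `*` setT) (EFin \o g).
move=> mg s0 st tS gB;apply: measurable_bounded_integrable => //.
- by rewrite n0F// ltry.
- exact: mfunTS.
- exists B;split;first exact: num_real.
by move=> b Bb q [/= qst _];rewrite (le_trans _ (ltW Bb))// gB// -in_itv.
Qed.
Let I_bound g s t B : mfun setT g -> 0 <= s -> s <= t -> t <= S ->
 (forall q, s < q.1 <= t -> `|g q| <= B) -> `|I g s t| <= B * (F t - F s).
move=> mg s0 st tS gB;have i := ig mg s0 st tS gB.
apply: (le_trans (le_normr_Rintegral _ i)) => //.
rewrite (_ : B * _ = I (fun=> B) s t);last by rewrite Rintegral_cst// n0F.
apply: le_Rintegral => //.
- exact: (integrable_norm i).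
- apply: measurable_bounded_integrable => //;first by rewrite n0F// ltry.
by exists `|B|;split => [|b Bb q _];[exact: num_real|exact: ltW].
- by move=> q [/= qst _];apply: gB;move: qst;rewrite in_itv.
Qed.
Let I_split g t r B : mfun setT g -> 0 <= t -> t <= r -> r <= S ->
 (forall q, 0 < q.1 <= r -> `|g q| <= B) -> I g 0 r = I g 0 t + I g t r.
move=> mg t0 tr rS gB.
rewrite -Rintegral_setU//.
- congr (Rintegral _ _ _);apply/seteqP;split => [[u x]|[u x]]/=.
by rewrite !in_itv/= => -[/andP[u0 ur] _];case: (leP u t) => ut;
[left|right];split;rewrite // ?u0 ?ur.
by rewrite !in_itv/= => -[[/andP[u0 ut] _]|[/andP[u0 ut] _]];split => //;lra.
- apply: (@integrableS _ _ _ _ (`]0, r] `*` setT)) => //.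
+ exact: measurableU.
+ by move=> [u x]/=;rewrite !in_itv/= => -[[/andP[u0 ut] _]|[/andP[u0 ut] _]];
split => //;lra.
+ exact: (ig mg (lexx 0) (le_trans t0 tr) rS gB).
- apply/disj_setPS => -[u x] [[/= + _] [/= + _]];rewrite !in_itv/=;lra.
Qed.

Lemma exponential_path_bounded :
 exists2 B, 0 <= B & forall t, 0 < t <= S -> `|p t| <= B.
have [B hB] := cadlag_bounded S_ge0 l_cadlag.
exists B;first by rewrite (le_trans (normr_ge0 (l 0)))// hB// lexx.
by move=> t tS;rewrite pE//;exact: (cadlag_left_lim_bounded l_cadlag hB).
Qed.

Local Notation E t := (expR (- (K * F t))).
Let Gn (q : R * V) := p q.1 ^+ 4 * E q.1 * (rho q ^+ 4 - 1).
Let Gc (q : R * V) := p q.1 ^+ 4 * E q.1 * (4 * (rho q - 1) + K).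
Let g1 (q : R * V) := p q.1 * (rho q - 1).
Let m1 (f : R -> R) : mfun setT f ->
 mfun setT (fun q : R * V => f q.1).
Proof. by move=> mf;exact: (mcomp mf measurable_fst). Qed.
Let mE : mfun setT (fun t => E t).
apply: (@mcomp _ _ _ _ _ _ (@expR R));first exact: measurable_expR.
by apply: mcomp => //;exact: measurable_funM.
Qed.
Let mGc : mfun setT Gc.
apply: measurable_funM.
apply: measurable_funM;last exact: (m1 mE).
by apply: measurable_funX;exact: (m1 mp).
by apply: measurable_funD => //;apply: measurable_funM => //;exact: measurable_funB.
Qed.
Let mg1 : mfun setT g1.
Proof. by apply: measurable_funM;[exact: (m1 mp)|exact: measurable_funB]. Qed.
Let E_le1 t : 0 <= t <= S -> 0 <= E t <= 1.
by move=> tS;rewrite expR_ge0/= -expR0 ler_expR oppr_le0 mulr_ge0// F_ge0.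
Qed.
Let jumps_left g t : 0 < t ->
 \forall s \near t^'-, jumps g s =
 \sum_(n < N) (sg n < t%:E)%E%:R * g (fine (sg n), y n).
move=> t0.
have : \forall s \near t^'-, forall n : 'I_N,
(sg n <= s%:E)%E = (sg n < t%:E)%E.
apply: filter_forall => n;have [st|ts] := ltP (sg n) t%:E.
move: (sg_gt0 n) st;case: (sg n) => [a| |]//= _.
rewrite lte_fin => at_;near=> s;rewrite lee_fin.
by near: s;exact: nbhs_left_ge.
near=> s;apply/negbTE;rewrite -ltNge (lt_le_trans _ ts)// lte_fin.
by near: s;exact: nbhs_left_lt.
apply: filterS => s h;by apply: eq_bigr => n _;rewrite h.
Unshelve. all: by end_near. Qed.
Let jumps_right t :
 \forall s \near t^'+, forall g, jumps g s = jumps g t.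
have : \forall s \near t^'+, forall n : 'I_N,
(sg n <= s%:E)%E = (sg n <= t%:E)%E.
apply: filter_forall => n;have [st|ts] := leP (sg n) t%:E.
have h : \forall s \near t^'+, t < s by exact: nbhs_right_gt.
apply: filterS h => s ts;apply: (le_trans st).
by rewrite lee_fin ltW.
move: ts;case: (sg n) => [a| |]//=.
+ rewrite lte_fin => ta;near=> s;apply/negbTE;rewrite -ltNge lte_fin.
by near: s;exact: nbhs_right_lt.
+ by move=> _;near=> s.
by apply: filterS => s h g;apply: eq_bigr => n _;rewrite h.
Unshelve. all: by end_near. Qed.
Let I_left g t B : mfun setT g -> 0 < t <= S ->
 (forall q, 0 < q.1 <= S -> `|g q| <= B) ->
 I g 0 s @[s --> t^'-] --> I g 0 t.
move=> mg /andP[t0 tS] gB.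
have cv : I g 0 t - B * (F t - F s) @[s --> t^'-] --> I g 0 t.
rewrite -[X in _ --> X]subr0 -[X in _ --> _ - X](mulr0 B) -(subrr (F t)).
apply: cvgB;first exact: cvg_cst.
apply: cvgM;first exact: cvg_cst.
by apply: cvgB;[exact: cvg_cst|apply: F_left;rewrite t0].
have cv' : I g 0 t + B * (F t - F s) @[s --> t^'-] --> I g 0 t.
rewrite -[X in _ --> X]addr0 -[X in _ --> _ + X](mulr0 B) -(subrr (F t)).
apply: cvgD;first exact: cvg_cst.
apply: cvgM;first exact: cvg_cst.
by apply: cvgB;[exact: cvg_cst|apply: F_left;rewrite t0].
apply: (squeeze_cvgr _ cv cv');near=> s.
have s0 : 0 <= s by rewrite ltW//;near: s;exact: nbhs_left_gt.
have st : s <= t by rewrite ltW//;near: s;exact: nbhs_left_lt.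
have gBt q : 0 < q.1 <= t -> `|g q| <= B by move=> qt;apply: gB;lra.
have gBs q : s < q.1 <= t -> `|g q| <= B by move=> qt;apply: gB;lra.
have := I_bound mg s0 st tS gBs.
by rewrite (I_split mg s0 st tS gBt) ler_norml => /andP[];lra.
Unshelve. all: by end_near. Qed.

(** Change of variables for [l ^+ 4 * exp (- K F)]. Between two jumps [l] moves
  only through [F], so the second order terms are negligible with respect to
  [F]; at a jump the fourth power is multiplied by [rho ^+ 4]. *)
Lemma exponential_path_fourth :
 l S ^+ 4 * E S = c ^+ 4 + jumps Gn S - I Gc 0 S.
have [B B0 hB] := exponential_path_bounded.
have [SE|/eqP Sne] := eqVneq S 0.
have j0 g : jumps g S = 0.
by apply: big1 => n _;rewrite SE leNgt sg_gt0 mul0r.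
have S0I g : I g 0 S = 0.
rewrite SE (_ : _ `*` _ = set0) ?Rintegral_set0//.
by apply/seteqP;split => // -[u x] [/=];rewrite in_itv/=;lra.
rewrite (j0 Gn) (S0I Gc) lE ?S_ge0 ?lexx// (j0 g1) (S0I g1) addr0 subr0.
by rewrite SE F0 mulr0 oppr0 expR0;ring.
have Spos : 0 < S by rewrite lt_neqAle S_ge0 andbT;apply/eqP => /esym.
have M0 : 0 <= M.
have : 0 < (S, point : V).1 <= S by rewrite /= Spos lexx.
by move=> /rhoM;lra.
have rho1 q : 0 < q.1 <= S -> `|rho q - 1| <= M + 1.
by move=> /rhoM;rewrite ler_norml;lra.
have g1B q : 0 < q.1 <= S -> `|g1 q| <= B * (M + 1).
by move=> qS;rewrite normrM ler_pM// ?hB ?rho1.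
have GcB q : 0 < q.1 <= S -> `|Gc q| <= B ^+ 4 * 1 * (4 * (M + 1) + K).
move=> qS.
have pB : `|p q.1 ^+ 4| <= B ^+ 4 by rewrite normrX lerXn2r ?nnegrE ?hB.
have EB : `|E q.1| <= 1.
have /E_le1/andP[_] : 0 <= q.1 <= S by lra.
by rewrite ger0_norm ?expR_ge0.
have rB : `|4 * (rho q - 1) + K| <= 4 * (M + 1) + K.
by rewrite (le_trans (ler_normD _ _))// (ger0_norm K_ge0) lerD2r normrM
ger0_norm// ler_wpM2l// rho1.
by rewrite /Gc normrM ler_pM// normrM ler_pM.
pose h t := l t ^+ 4 * E t - jumps Gn t + I Gc 0 t.
suff : h S = h 0.
have j0 g : jumps g 0 = 0.
by apply: big1 => n _;rewrite leNgt sg_gt0 mul0r.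
have I0 g : I g 0 0 = 0.
rewrite (_ : _ `*` _ = set0) ?Rintegral_set0//.
by apply/seteqP;split => // -[u x] [/=];rewrite in_itv/=;lra.
rewrite /h (j0 Gn) (I0 Gc).
have -> : l 0 = c.
by rewrite lE ?lexx// (j0 g1) (I0 g1);ring.
by rewrite F0 mulr0 oppr0 expR0 mulr1;lra.
apply: (@constant_wrt_nondecreasing _ F h 0 S) => //.
- move=> t tS;have /andP[t0 tS'] := tS.
have tS0 : 0 <= t <= S by rewrite ltW.
have lt : l s @[s --> t^'-] --> p t.
by rewrite pE//;exact: (cadlag_left_lim l_cadlag).
pose J g := \sum_(n < N) (sg n == t%:E)%E%:R * g (fine (sg n), y n).
have jumpsE g : jumps g t =
\sum_(n < N) (sg n < t%:E)%E%:R * g (fine (sg n), y n) + J g.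
rewrite -big_split/=;apply: eq_bigr => n _;rewrite -mulrDl;congr (_ * _).
by case: ltgtP => _;rewrite ?addr0 ?add0r.
have cJ g : jumps g s @[s --> t^'-] -->
\sum_(n < N) (sg n < t%:E)%E%:R * g (fine (sg n), y n).
by apply: cvg_near_cst;exact: jumps_left.
have jl : l t = p t + J g1.
have : l s @[s --> t^'-] --> c + \sum_(n < N) (sg n < t%:E)%E%:R *
g1 (fine (sg n), y n) - I g1 0 t.
have hl : c + jumps g1 s - I g1 0 s @[s --> t^'-] -->
c + \sum_(n < N) (sg n < t%:E)%E%:R * g1 (fine (sg n), y n) - I g1 0 t.
apply: cvgB;last exact: (I_left mg1 tS g1B).
by apply: cvgD;[exact: cvg_cst|exact: (cJ g1)].
apply: cvg_trans hl.
apply: near_eq_cvg;near=> s;rewrite lE//;apply/andP;split.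
by rewrite ltW//;near: s;exact: nbhs_left_gt.
by rewrite (le_trans _ tS')// ltW//;near: s;exact: nbhs_left_lt.
move=> /(cvg_unique _ lt) -> //.
have -> : l t = c + jumps g1 t - I g1 0 t by exact: lE.
by rewrite (jumpsE g1);ring.
have -> : h t = p t ^+ 4 * E t -
\sum_(n < N) (sg n < t%:E)%E%:R * Gn (fine (sg n), y n) + I Gc 0 t.
rewrite /h (jumpsE Gn) opprD addrA;congr (_ + _).
suff -> : l t ^+ 4 * E t = p t ^+ 4 * E t + J Gn by ring.
rewrite jl /J.
have [[n sn]|/forallNP nt] := pselect (exists n : 'I_N, sg n = t%:E).
have uq (g : R * V -> R) : \sum_(n0 < N) (sg n0 == t%:E)%E%:R * g (fine (sg n0), y n0) =
g (t, y n).
rewrite (bigD1 n)//= sn eqxx mul1r big1 ?addr0// => m mn.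
rewrite (_ : (_ == _) = false) ?mul0r//;apply/negbTE;apply: contra mn.
move=> /eqP smt;apply/eqP/val_inj => /=;apply: sg_inj.
by rewrite smt ltry.
by rewrite sn.
by rewrite !uq /g1 /Gn/=;ring.
have uq (g : R * V -> R) : \sum_(n0 < N) (sg n0 == t%:E)%E%:R * g (fine (sg n0), y n0) = 0.
by apply: big1 => n _;rewrite (_ : (_ == _) = false) ?mul0r//;apply/eqP.
by rewrite !uq;ring.
apply: cvgD;last exact: (I_left mGc tS GcB).
apply: cvgB;last exact: cJ.
apply: cvgM.
rewrite !exprS expr0;under eq_fun do rewrite !exprS expr0.
by do !apply: cvgM => //;exact: cvg_cst.
by apply: cvg_expRN;exact: F_left.
- move=> e t e0 /andP[t0 tS].
have tS0 : 0 <= t <= S by rewrite t0 ltW.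
have tS1 : 0 <= t < S by rewrite t0.
set x := l t.
pose e' := e / (M + 1 + K + x ^+ 4 * K ^+ 2 + 1).
have x4 : 0 <= x ^+ 4 * K ^+ 2.
by rewrite mulr_ge0// ?sqr_ge0// (exprM _ 2 2) sqr_ge0.
have D0 : 0 < M + 1 + K + x ^+ 4 * K ^+ 2 + 1 by rewrite ltr_wpDl// !addr_ge0.
have e'0 : 0 < e' by rewrite divr_gt0.
have e'E : e' * (M + 1 + K + x ^+ 4 * K ^+ 2 + 1) = e.
by rewrite /e' divfK// gt_eqF.
have [eta eta0 heta] := fourth_power_remainder x (E t) e'0.
have lr : l s @[s --> t^'+] --> x by have [lr _] := l_cadlag;exact: lr.
have Er : E s @[s --> t^'+] --> E t.
by apply: cvg_expRN;exact: F_right.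
have eta2 : 0 < eta / 2 by rewrite divr_gt0.
have half : eta / 2 < eta by rewrite ltr_pdivrMr// mulr_natr mulr2n ltrDl.
have /cvgrPdist_lt/(_ _ eta2)/near_right_ex[d1 d10 hd1] := lr.
have /cvgrPdist_lt/(_ _ eta2)/near_right_ex[d2 d20 hd2] := Er.
have /cvgrPdist_lt/(_ _ e'0)/near_right_ex[d3 d30 hd3] := F_right tS1.
near=> r;move=> rS.
have tr : t < r by near: r;exact: nbhs_right_gt.
have rd1 : r < t + d1 by near: r;apply: nbhs_right_lt;rewrite ltrDl.
have rd2 : r < t + d2 by near: r;apply: nbhs_right_lt;rewrite ltrDl.
have rd3 : r < t + d3 by near: r;apply: nbhs_right_lt;rewrite ltrDl.
have jr : forall g, jumps g r = jumps g t by near: r;exact: jumps_right.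
have r0 : 0 <= r by rewrite (le_trans t0)// ltW.
have trw := ltW tr.
have bt (g : R * V -> R) C : (forall q, 0 < q.1 <= S -> `|g q| <= C) ->
(forall q, 0 < q.1 <= r -> `|g q| <= C).
by move=> gC q qr;apply: gC;lra.
have bt' (g : R * V -> R) C : (forall q, 0 < q.1 <= S -> `|g q| <= C) ->
(forall q, t < q.1 <= r -> `|g q| <= C).
by move=> gC q qr;apply: gC;lra.
pose dF := F r - F t.
have dF0 : 0 <= dF by rewrite subr_ge0 F_nd.
have dFe : dF <= e'.
rewrite -(ger0_norm dF0) /dF distrC ltW//;apply: hd3;rewrite tr//=.
have lrE : l r = x - I g1 t r.
have r0S : 0 <= r <= S by rewrite r0.
have -> : l r = c + jumps g1 r - I g1 0 r by exact: lE.
have -> : x = c + jumps g1 t - I g1 0 t by exact: lE.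
by rewrite (jr g1) (I_split mg1 t0 trw rS (bt _ _ g1B));ring.
pose c1 := l r ^+ 3 + l r ^+ 2 * x + l r * x ^+ 2 + x ^+ 3.
pose Phi (q : R * V) := Gc q - E r * c1 * g1 q - x ^+ 4 * E t * K.
have ir := ig mGc t0 trw rS (bt' _ _ GcB).
have i1 := ig mg1 t0 trw rS (bt' _ _ g1B).
have i1' : n0.-integrable (`]t, r] `*` setT) (EFin \o (fun q => E r * c1 * g1 q)).
by apply: (ig (B := `|E r * c1| * (B * (M + 1)))) => //;
[exact: measurable_funM|move=> q qtr;rewrite normrM ler_wpM2l// (bt' _ _ g1B)].
have ik : n0.-integrable (`]t, r] `*` setT) (EFin \o (fun q => x ^+ 4 * E t * K)).
by apply: (ig (B := `|x ^+ 4 * E t * K|)).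
have PhiE : I Phi t r = I Gc t r - E r * c1 * I g1 t r - x ^+ 4 * E t * K * dF.
rewrite /Phi RintegralB//;last exact: (integrableB (mX t r) ir i1').
rewrite RintegralB// RintegralZl// Rintegral_cst// n0F//.
have mPhi : mfun setT Phi.
by do 2 apply: measurable_funB => //;exact: measurable_funM.
have PhiB q : t < q.1 <= r -> `|Phi q| <= e' * (M + 1 + K).
move=> /andP[tq qr].
have qS : 0 < q.1 <= S by rewrite (le_lt_trans t0 tq) (le_trans qr rS).
have [] := heta (p q.1) (l r) (E q.1) (E r).
- rewrite pE//.
suff : `|left_lim l q.1 - x| <= eta / 2 by move/le_lt_trans;apply;exact: half.
apply: (@cvgr_to_le _ (q.1^'-) _ _ (fun s => `|l s - x|)).
apply: cvg_norm;apply: cvgB;last exact: cvg_cst.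
exact: (cadlag_left_lim l_cadlag).
near=> s.
have ts : t < s by near: s;exact: nbhs_left_gt.
have sq : s < q.1 by near: s;exact: nbhs_left_lt.
rewrite /= ltW// distrC;apply: hd1;rewrite ts/=.
by rewrite (lt_trans sq)// (le_lt_trans qr).
- by rewrite distrC (lt_trans _ half)//;apply: hd1;rewrite tr.
- rewrite distrC (lt_trans _ half)//;apply: hd2;rewrite tq/=.
exact: le_lt_trans rd2.
- by rewrite distrC (lt_trans _ half)//;apply: hd2;rewrite tr.
move=> b1 b2.
have -> : Phi q = (4 * p q.1 ^+ 4 * E q.1 - E r * c1 * p q.1) * (rho q - 1) +
K * (p q.1 ^+ 4 * E q.1 - x ^+ 4 * E t) by rewrite /Phi /Gc /g1;ring.
rewrite (le_trans (ler_normD _ _))// [leRHS]mulrDr lerD//.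
by rewrite normrM ler_pM// ?rho1// ltW.
by rewrite normrM (ger0_norm K_ge0) mulrC ler_wpM2r// ltW.
have IPhi := I_bound mPhi t0 trw rS PhiB.
have Edec : E r = E t * expR (- (K * dF)).
by rewrite -expRD;congr expR;rewrite /dF;ring.
have KdF : 0 <= K * dF by rewrite mulr_ge0.
have e2 := expR_second_order KdF.
have hE : h r - h t = I Phi t r + x ^+ 4 * (E t * (expR (- (K * dF)) - 1 + K * dF)).
rewrite PhiE /h (jr Gn) (I_split mGc t0 trw rS (bt _ _ GcB)) -/x.
have -> : l r ^+ 4 * E r = x ^+ 4 * E r - E r * c1 * I g1 t r.
have : l r - x = - I g1 t r by rewrite lrE;ring.
move=> lx;have -> : l r ^+ 4 = x ^+ 4 + c1 * (l r - x) by rewrite /c1;ring.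
by rewrite lx;ring.
by rewrite Edec;ring.
rewrite hE -e'E (le_trans (ler_normD _ _))//.
have : `|x ^+ 4 * (E t * (expR (- (K * dF)) - 1 + K * dF))| <=
e' * (x ^+ 4 * K ^+ 2) * dF.
have x40 : 0 <= x ^+ 4 by rewrite (exprM _ 2 2) sqr_ge0.
rewrite normrM (ger0_norm x40) [`|E t * _|]normrM (ger0_norm (expR_ge0 _)).
have -> : e' * (x ^+ 4 * K ^+ 2) * dF = x ^+ 4 * (1 * (K ^+ 2 * dF * e')) by ring.
rewrite ler_wpM2l// ler_pM ?expR_ge0//;first by case/andP: (E_le1 tS0).
rewrite (le_trans e2)// (_ : (K * dF) ^+ 2 = K ^+ 2 * dF * dF);last by ring.
by rewrite ler_wpM2l// mulr_ge0 ?sqr_ge0.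
move: IPhi;rewrite -/dF => IPhi h2.
apply: (le_trans (lerD IPhi h2)).
rewrite -subr_ge0 (_ : _ - _ = e' * dF);last by ring.
by rewrite mulr_ge0// ltW.
Unshelve. all: by end_near. Qed.

End exponential_path.

(** * Compensated jump measures *)

Section integral_points.
Context {R : realType} {dV : measure_display} {V : mtype dV}.
Variables (s : nat -> \bar R) (y : nat -> V) (N : nat).
Hypotheses (s_gt0 : forall n, (0 < s n)%E)
 (sN : forall n, (N <= n)%N -> s n = +oo%E).
Local Notation mu := (points s y).
Implicit Types f : R * V -> R.
Let finite_series (u : nat -> \bar R) : (forall n, (N <= n)%N -> u n = 0%E) ->
 (forall n, (0 <= u n)%E) ->
 (\sum_(0 <= n <oo) u n = \sum_(n < N) u n)%E.
move=> uN u0;rewrite (nneseries_split 0 N)// add0n eseries0 ?adde0 ?big_mkord//.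
by move=> i Ni _;exact: uN.
Qed.

Lemma ge0_integral_finite_points f : mfun setT f -> (forall q, 0 <= f q) ->
 (\int[mu]_q (f q)%:E)%E = (\sum_(n < N) (s n < +oo)%E%:R * f (fine (s n), y n))%:E.
move=> mf f0;rewrite ge0_integral_points//;last exact/mEFinP.
rewrite finite_series.
- rewrite -sumEFin;apply: eq_bigr => n _;rewrite /at_atom.
move: (s_gt0 n);case: (s n) => [r| |]//= _;first by rewrite ltry mul1r.
by rewrite mul0r.
- by move=> n /sN ->.
- by move=> n;rewrite /at_atom;case: (s n) => // r;rewrite lee_fin.
Qed.

Lemma integrable_finite_points f : mfun setT f ->
 mu.-integrable setT (EFin \o f).
move=> mf;apply/integrableP;split;first exact/mEFinP.
rewrite (_ : (fun x => _) = (fun q => (`|f q|)%:E))//.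
rewrite (@ge0_integral_finite_points (fun q => `|f q|)) ?ltry//.
exact: (mcomp (@normr_measurable _ _)).
Qed.

Lemma Rintegral_finite_points f : mfun setT f ->
 \int[mu]_q f q = \sum_(n < N) (s n < +oo)%E%:R * f (fine (s n), y n).
move=> mf.
have mp : mfun setT (fun q => Num.max (f q) 0) by exact: measurable_maxr.
have mn : mfun setT (fun q => Num.max (- f q) 0).
by apply: measurable_maxr => //;exact: mcomp.
rewrite (_ : (fun q => f q) = (fun q => Num.max (f q) 0 - Num.max (- f q) 0));last first.
by apply/funext => q;rewrite /Num.max;case: ifPn;case: ifPn;lra.
rewrite RintegralB//;[|exact: integrable_finite_points..].
have fi (g : R * V -> R) : mfun setT g -> (forall q, 0 <= g q) ->
\int[mu]_q g q = \sum_(n < N) (s n < +oo)%E%:R * g (fine (s n), y n).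
by move=> mg g0;rewrite /Rintegral ge0_integral_finite_points.
rewrite fi//;last by move=> q;rewrite le_max lexx orbT.
rewrite fi//;last by move=> q;rewrite le_max lexx orbT.
rewrite -sumrB;apply: eq_bigr => n _;rewrite -mulrBr;congr (_ * _).
by rewrite /Num.max;case: ifPn;case: ifPn;lra.
Qed.

End integral_points.

(** Jump times [sg n] in [0, T] with marks [ze n], and a predictable random
  measure [nu] that compensates them. On [V0] the compensator has no atom in
  time, that is, jumps with marks in [V0] are totally inaccessible. *)
Record compensated_points {R : realType} {dO} {Omega : mtype dO}
 (P : probability Omega R) (Gl : R -> set (set Omega)) (T : R)
 {dV} {V : mtype dV} (V0 : set V)
 (sg : nat -> Omega -> \bar R) (ze : nat -> Omega -> V)
 (nu : Omega -> jump_measure R V) := CompensatedPoints {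
 cp_filtration : is_filtration Gl ;
 cp_T : 0 < T ;
 cp_stop : forall n, stopping_time Gl (sg n) ;
 cp_gt0 : forall n w, (0 < sg n w)%E ;
 cp_le : forall n w, (sg n w < +oo)%E -> (sg n w <= T%:E)%E ;
 cp_finite : forall w, exists N, forall n, (N <= n)%N -> sg n w = +oo%E ;
 cp_mark : forall n B t, measurable B -> 0 <= t ->
 Gl t (ze n @^-1` B `&` [set w | sg n w <= t%:E]%E) ;
 cp_inj : {ae P, forall w, forall n m, (sg n w < +oo)%E -> sg n w = sg m w -> n = m} ;
 cp_off : forall w, nu w (~` (`]0, T] `*` setT)) = 0%E ;
 cp_predictable : forall W : Omega -> R -> V -> \bar R,
 pfield Gl W -> (forall w t x, 0 <= W w t x)%E ->
 pprocess Gl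
 (fun w t => \int[nu w]_(q in `]0%R, t] `*` setT) W w q.1 q.2)%E ;
 cp_comp : forall W : Omega -> R -> V -> \bar R,
 pfield Gl W -> (forall w t x, 0 <= W w t x)%E ->
 (\int[P]_w \int[points (sg^~ w) (ze^~ w)]_q W w q.1 q.2 =
 \int[P]_w \int[nu w]_q W w q.1 q.2)%E ;
 cp_bounded : {ae P, forall w, (nu w setT < +oo)%E} ;
 cp_V0 : measurable V0 ;
 cp_atomless : {ae P, forall w, forall t, nu w ([set t] `*` V0) = 0%E }
}.

Section compensated.
Context {R : realType} {dO} {Omega : mtype dO} (P : probability Omega R)
 (Gl : R -> set (set Omega)) (T : R) {dV} {V : mtype dV} (V0 : set V)
 (sg : nat -> Omega -> \bar R) (ze : nat -> Omega -> V)
 (nu : Omega -> jump_measure R V).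
Hypothesis cp : compensated_points P Gl T V0 sg ze nu.
Let fG := cp_filtration cp.
Local Notation mu w := (points (sg^~ w) (ze^~ w)).
Let T_ge0 : 0 <= T. Proof. exact/ltW/(cp_T cp). Qed.

Lemma ge0_integral_compensator_cut (f : R * V -> \bar R) w :
 mfun setT f -> (forall q, 0 <= f q)%E ->
 (\int[nu w]_q f q = \int[nu w]_(q in `]0%R, T] `*` setT) f q)%E.
move=> mf f0;have mX : measurable (`]0, T] `*` setT : set (R * V)).
exact: measurableX.
have h := @ge0_negligible_integral _ _ _ (nu w) setT (~` (`]0, T] `*` setT)) f
(measurableC mX) measurableT mf (fun q _ => f0 q) (cp_off cp w).
by rewrite h setDE setTI setCK.
Qed.

Lemma nu_measurable (W : Omega -> R -> V -> \bar R) :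
 pfield Gl W -> (forall w t x, 0 <= W w t x)%E ->
 mfun setT (fun w => \int[nu w]_q W w q.1 q.2)%E.
move=> mW W0;rewrite (_ : (fun w => _) =
(fun w => \int[nu w]_(q in `]0%R, T] `*` setT) W w q.1 q.2)%E).
exact: (process_time_measurable fG T_ge0 (cp_predictable cp mW W0)).
apply/funext => w;rewrite ge0_integral_compensator_cut//.
exact: (field_path _ mW).
Qed.

Lemma at_atom_stopped (W : Omega -> R -> V -> \bar R) n w :
 at_atom (sg n w) (ze n w) (fun q => W w q.1 q.2) =
 if (sg n w < +oo)%E then W w (fine (sg n w)) (ze n w) else 0%E.
by rewrite /at_atom;move: (cp_gt0 cp n w);case: (sg n w) => [r| |]//=;rewrite ltry.
Qed.

Lemma mu_measurable (W : Omega -> R -> V -> \bar R) :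
 pfield Gl W -> (forall w t x, 0 <= W w t x)%E ->
 mfun setT (fun w => \int[mu w]_q W w q.1 q.2)%E.
move=> mW W0;rewrite (_ : (fun w => _) = (fun w => \sum_(0 <= n <oo)
if (sg n w < +oo)%E then W w (fine (sg n w)) (ze n w) else 0)%E);last first.
apply/funext => w;rewrite ge0_integral_points//.
by apply: eq_eseriesr => n _;rewrite at_atom_stopped.
exact: (field_path _ mW).
apply: ge0_emeasurable_sum => [n w _ _|n _];first by case: ifP.
move=> _ B mB;rewrite setTI.
by have [] := stopped_value_measurable fG (cp_stop cp n) (cp_mark cp n) 0%E mW mB.
Qed.
Let measurable_pos (H : Omega -> R -> V -> R) : pfield Gl H ->
 pfield Gl (fun w t x => maxe (H w t x)%:E 0).
Proof. by move=> mH;apply: measurable_maxe => //;exact/mEFinP. Qed.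
Let measurable_neg (H : Omega -> R -> V -> R) : pfield Gl H ->
 pfield Gl (fun w t x => maxe (- (H w t x)%:E)%E 0).
move=> mH;apply: measurable_maxe => //;apply: mcomp => //.
exact/mEFinP.
Qed.
Let max0 (x : \bar R) : (0 <= maxe x 0)%E. Proof. by rewrite le_max lexx orbT. Qed.

Lemma measurable_Rintegral_points (H : Omega -> R -> V -> R) :
 pfield Gl H -> mfun setT (fun w => \int[mu w]_q H w q.1 q.2).
move=> mH;apply: (@mcomp _ _ _ _ _ _ fine) => //.
rewrite (_ : (fun w => _) = (fun w => \int[mu w]_q maxe (H w q.1 q.2)%:E 0 -
\int[mu w]_q maxe (- (H w q.1 q.2)%:E) 0)%E);last first.
by apply/funext => w;rewrite integralE;congr (_ - _)%E;apply: eq_integral => q _;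
rewrite ?funeposE ?funenegE.
apply: emeasurable_funB.
by apply: (@mu_measurable (fun w t x => maxe (H w t x)%:E 0)) => //;
exact: measurable_pos.
by apply: (@mu_measurable (fun w t x => maxe (- (H w t x)%:E)%E 0)) => //;
exact: measurable_neg.
Qed.

Lemma measurable_Rintegral_compensator (H : Omega -> R -> V -> R) :
 pfield Gl H -> mfun setT (fun w => \int[nu w]_q H w q.1 q.2).
move=> mH;apply: (@mcomp _ _ _ _ _ _ fine) => //.
rewrite (_ : (fun w => _) = (fun w => \int[nu w]_q maxe (H w q.1 q.2)%:E 0 -
\int[nu w]_q maxe (- (H w q.1 q.2)%:E) 0)%E);last first.
by apply/funext => w;rewrite integralE;congr (_ - _)%E;apply: eq_integral => q _;
rewrite ?funeposE ?funenegE.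
apply: emeasurable_funB.
by apply: (@nu_measurable (fun w t x => maxe (H w t x)%:E 0)) => //;
exact: measurable_pos.
by apply: (@nu_measurable (fun w t x => maxe (- (H w t x)%:E)%E 0)) => //;
exact: measurable_neg.
Qed.

Lemma compensator_integrable_ae (H : Omega -> R -> V -> R) :
 pfield Gl H ->
 (\int[P]_w \int[nu w]_q `|H w q.1 q.2|%:E < +oo)%E ->
 {ae P, forall w, (nu w).-integrable setT (fun q => (H w q.1 q.2)%:E)}.
move=> mH Hfin.
have mHa : pfield Gl (fun w t x => `|H w t x|%:E).
by apply/mEFinP;exact: (mcomp (@normr_measurable _ _)).
have i : P.-integrable setT (fun w => \int[nu w]_q `|H w q.1 q.2|%:E)%E.
apply/integrableP;split;first exact: (nu_measurable mHa).
by rewrite (eq_integral (fun w => \int[nu w]_q `|H w q.1 q.2|%:E)%E)// => w _;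
rewrite gee0_abs// integral_ge0.
have := integrable_ae measurableT i.
apply: filterS => w /(_ Logic.I) wf;apply/integrableP;split.
by apply/mEFinP;exact: (field_path _ mH).
by rewrite (_ : (fun x => _) = (fun q => `|H w q.1 q.2|%:E))// ltey_eq wf.
Qed.

Lemma compensated_integral_centred (H : Omega -> R -> V -> R) :
 pfield Gl H ->
 (\int[P]_w \int[nu w]_q `|H w q.1 q.2|%:E < +oo)%E ->
 P.-integrable setT (fun w => (\int[mu w]_q H w q.1 q.2 - \int[nu w]_q H w q.1 q.2)%:E) /\
 (\int[P]_w (\int[mu w]_q H w q.1 q.2 - \int[nu w]_q H w q.1 q.2)%R%:E = 0)%E.
move=> mH Hfin.
have mHa : pfield Gl (fun w t x => `|H w t x|%:E).
by apply/mEFinP;exact: (mcomp (@normr_measurable _ _)).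
have bd (n : Omega -> jump_measure R V) :
mfun setT (fun w => \int[n w]_q H w q.1 q.2) ->
mfun setT (fun w => \int[n w]_q `|H w q.1 q.2|%:E)%E ->
(\int[P]_w \int[n w]_q `|H w q.1 q.2|%:E < +oo)%E ->
{ae P, forall w, (n w).-integrable setT (fun q => (H w q.1 q.2)%:E)} ->
P.-integrable setT (fun w => (\int[n w]_q H w q.1 q.2)%:E).
move=> m1 m2 fin ae;apply/integrableP;split;first exact/mEFinP.
apply: (le_lt_trans _ fin);apply: ge0_ae_le_nm => //.
by move=> w;exact: integral_ge0.
apply: filterS ae => w iw.
rewrite /Rintegral fineK;last exact: integrable_fin_num.
exact: le_abse_integral (measurable_int _ iw).
have Ha0 w t x : (0 <= `|H w t x|%:E)%E by rewrite lee_fin.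
have muE : (\int[P]_w \int[mu w]_q `|H w q.1 q.2|%:E < +oo)%E.
by rewrite (cp_comp cp mHa).
have mu_int : {ae P, forall w, (mu w).-integrable setT (fun q => (H w q.1 q.2)%:E)}.
apply: aeW => w;have [N hN] := cp_finite cp w.
apply: (@integrable_finite_points _ _ _ _ _ N) => //;first by move=> n;exact: (cp_gt0 cp n w).
exact: (field_path _ mH).
have nu_int := compensator_integrable_ae mH Hfin.
have i1 := bd _ (measurable_Rintegral_points mH) (mu_measurable mHa Ha0) muE mu_int.
have i2 := bd _ (measurable_Rintegral_compensator mH)
(nu_measurable mHa Ha0) Hfin nu_int.
split;first exact: (integrableB measurableT i1 i2).
rewrite (_ : (fun w => _) = (fun w => (\int[mu w]_q H w q.1 q.2)%:E -
(\int[nu w]_q H w q.1 q.2)%:E)%E)// integralB_EFin//.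
pose Hp w t x := maxe (H w t x)%:E 0;pose Hn w t x := maxe (- (H w t x)%:E)%E 0.
have Hle (n : Omega -> jump_measure R V) (K : Omega -> R -> V -> \bar R) :
(forall w t x, 0 <= K w t x <= `|H w t x|%:E)%E ->
(\int[P]_w \int[n w]_q `|H w q.1 q.2|%:E < +oo)%E ->
(\int[P]_w \int[n w]_q K w q.1 q.2 < +oo)%E.
move=> KH;apply: le_lt_trans;apply: ge0_ae_le_nm => //.
- by move=> w;apply: integral_ge0 => q _;case/andP: (KH w q.1 q.2).
- by move=> w;apply: integral_ge0.
- apply: aeW => w;apply: ge0_ae_le_nm => //.
+ by move=> q;case/andP: (KH w q.1 q.2).
+ by apply: aeW => q;case/andP: (KH w q.1 q.2).
have Hpb w t x : (0 <= Hp w t x <= `|H w t x|%:E)%E.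
by rewrite max0 /Hp ge_max lee_fin ler_norm lee_fin normr_ge0.
have Hnb w t x : (0 <= Hn w t x <= `|H w t x|%:E)%E.
by rewrite max0 /Hn ge_max lee_fin -normrN ler_norm lee_fin normr_ge0.
have Hpm := measurable_pos mH;have Hnm := measurable_neg mH.
have key (n : Omega -> jump_measure R V) :
(forall W, pfield Gl W -> (forall w t x, 0 <= W w t x)%E ->
mfun setT (fun w => \int[n w]_q W w q.1 q.2)%E) ->
{ae P, forall w, (n w).-integrable setT (fun q => (H w q.1 q.2)%:E)} ->
(\int[P]_w \int[n w]_q `|H w q.1 q.2|%:E < +oo)%E ->
(\int[P]_w (\int[n w]_q H w q.1 q.2)%R%:E =
\int[P]_w \int[n w]_q Hp w q.1 q.2 - \int[P]_w \int[n w]_q Hn w q.1 q.2)%E.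
move=> mn ae fin.
have ip : P.-integrable setT (fun w => \int[n w]_q Hp w q.1 q.2)%E.
apply: ge0_integrable;[by apply: (mn Hp) => // w t x;case/andP: (Hpb w t x)| |].
by move=> w;apply: integral_ge0 => q _;case/andP: (Hpb w q.1 q.2).
exact: (Hle n Hp Hpb fin).
have inn : P.-integrable setT (fun w => \int[n w]_q Hn w q.1 q.2)%E.
apply: ge0_integrable;[by apply: (mn Hn) => // w t x;case/andP: (Hnb w t x)| |].
by move=> w;apply: integral_ge0 => q _;case/andP: (Hnb w q.1 q.2).
exact: (Hle n Hn Hnb fin).
apply: etrans _ (integralB measurableT ip inn);apply: ae_eq_nm;apply: filterS ae => w iw.
rewrite /Rintegral fineK;last exact: integrable_fin_num.
by rewrite integralE;congr (_ - _)%E;apply: eq_integral => q _;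
rewrite ?funeposE ?funenegE.
rewrite (key _ mu_measurable mu_int muE).
rewrite (key _ nu_measurable nu_int Hfin).
have pE : (\int[P]_w \int[mu w]_q Hp w q.1 q.2 = \int[P]_w \int[nu w]_q Hp w q.1 q.2)%E.
by apply: (cp_comp cp Hpm) => w t x;case/andP: (Hpb w t x).
have nE : (\int[P]_w \int[mu w]_q Hn w q.1 q.2 = \int[P]_w \int[nu w]_q Hn w q.1 q.2)%E.
by apply: (cp_comp cp Hnm) => w t x;case/andP: (Hnb w t x).
have pfin : (\int[P]_w \int[nu w]_q Hp w q.1 q.2)%E \is a fin_num.
rewrite ge0_fin_numE;first exact: (Hle nu Hp Hpb Hfin).
by apply: integral_ge0 => w _;apply: integral_ge0 => q _;case/andP: (Hpb w q.1 q.2).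
have nfin : (\int[P]_w \int[nu w]_q Hn w q.1 q.2)%E \is a fin_num.
rewrite ge0_fin_numE;first exact: (Hle nu Hn Hnb Hfin).
by apply: integral_ge0 => w _;apply: integral_ge0 => q _;case/andP: (Hnb w q.1 q.2).
have cancel (a b c d : \bar R) : a = c -> b = d -> c \is a fin_num ->
d \is a fin_num -> (a - b - (c - d) = 0)%E.
by move=> -> -> cf df;rewrite subee// fin_numB cf df.
exact: cancel pE nE pfin nfin.
Qed.

End compensated.

(** * Linear equations and their fourth moments *)

Section restricted_measure.
Context d (T : mtype d) (R : realType).
Variables (m : {measure set T -> \bar R}) (D : set T) (mD : measurable D).

Lemma ge0_integral_mrestr E f : measurable E -> mfun E f ->
 (forall x, E x -> 0 <= f x)%E ->
 (\int[mrestr m mD]_(x in E) f x = \int[m]_(x in E `&` D) f x)%E.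
move=> mE mf f0.
have h := @ge0_negligible_integral _ _ _ (mrestr m mD) E (~` D) f
(measurableC mD) mE mf f0.
rewrite h;last by rewrite /= /mrestr setICl measure0.
rewrite setDE setCK;apply: eq_measure_integral => A mA AED.
by rewrite /= /mrestr setIidl//;move=> x /AED[].
Qed.

Lemma Rintegral_mrestr E (f : T -> R) : measurable E -> mfun E f ->
 \int[mrestr m mD]_(x in E) f x = \int[m]_(x in E `&` D) f x.
move=> mE mf;rewrite /Rintegral integralE [in RHS]integralE;congr (fine (_ - _)%E).
- apply: ge0_integral_mrestr => //.
by apply: measurable_funepos;exact/mEFinP.
- apply: ge0_integral_mrestr => //.
by apply: measurable_funeneg;exact/mEFinP.
Qed.

End restricted_measure.

Section time_continuity.
Context {R : realType} {dV} {V : mtype dV}.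
Variable m : jump_measure R V.
Hypothesis m_fin : (m setT < +oo)%E.
Variable A : set V.
Hypothesis mA : measurable A.
Let mX (a b : R) : measurable (`]a, b] `*` A : set (R * V)).
Proof. exact: measurableX. Qed.
Let m_lt B : measurable B -> (m B < +oo)%E.
Proof. by move=> mB;apply: le_lt_trans m_fin;apply: le_measure;rewrite ?inE. Qed.
Let inv0 : (n.+1%:R : R)^-1 @[n --> \oo] --> 0.
Proof. exact: (@cvg_harmonic R). Qed.

Lemma time_interval_left t e : m ([set t] `*` A) = 0%E -> 0 < e ->
 \forall r \near t^'-, (m (`]r, t] `*` A) < e%:E)%E.
move=> mt0 e0.
pose G n : set (R * V) := `](t - n.+1%:R^-1)%R, t] `*` A.
have mG n : measurable (G n) by exact: mX.
have cG : m (G n) @[n --> \oo] --> m (\bigcap_n G n).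
apply: nonincreasing_cvg_mu => //.
- exact: m_lt (mG 0%N).
- exact: bigcapT_measurable.
- move=> n k nk;apply/subsetPset => -[u x] [/= + Ax];rewrite !in_itv/= => /andP[tu ut].
split => //=;rewrite in_itv/= ut andbT (le_lt_trans _ tu)// lerD2l lerN2.
by rewrite lef_pV2 ?posrE// ler_nat ltnS.
have G0 : \bigcap_n G n = [set t] `*` A.
apply/seteqP;split=> [[u x] h|[u x] [/= -> Ax] n _];last first.
by split => //=;rewrite in_itv/= lexx andbT ltrBlDr ltrDl.
have [/= + Ax] := h 0%N Logic.I;rewrite in_itv/= => /andP[_ ut];split => //=.
apply/eqP;rewrite eq_le ut/= leNgt;apply/negP => ut'.
have tu0 : 0 < t - u by rewrite subr_gt0.
have /cvgrPdist_lt/(_ _ tu0)[n _ hn] := inv0.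
have [/= + _] := h n Logic.I;rewrite in_itv/= => /andP[+ _].
have := hn n (leqnn n);rewrite /= sub0r normrN ger0_norm//.
by move: (n.+1%:R^-1) => v vt tv;clear mt0;lra.
move: cG;rewrite G0 mt0 => /fine_cvgP[_ /cvgrPdist_lt/(_ e e0)[n _ hn]].
have := hn n (leqnn n);rewrite /= sub0r normrN => hG.
near=> r.
have rG : t - n.+1%:R^-1 < r.
by near: r;apply: nbhs_left_gt;rewrite ltrBlDr ltrDl.
apply: (@le_lt_trans _ _ (m (G n))).
apply: le_measure;rewrite ?inE// => -[u x] [/= + Ax];rewrite in_itv/= => /andP[ru ut].
by split => //=;rewrite in_itv/= ut andbT (lt_trans rG).
have : m (G n) \is a fin_num by rewrite ge0_fin_numE// m_lt.
move=> /fineK <-;rewrite lte_fin;apply: le_lt_trans hG;exact: ler_norm.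
Unshelve. all: by end_near. Qed.

Lemma time_interval_right t e : 0 < e ->
 \forall r \near t^'+, (m (`]t, r] `*` A) < e%:E)%E.
move=> e0.
pose G n : set (R * V) := `]t, (t + n.+1%:R^-1)%R] `*` A.
have mG n : measurable (G n) by exact: mX.
have cG : m (G n) @[n --> \oo] --> m (\bigcap_n G n).
apply: nonincreasing_cvg_mu => //.
- exact: m_lt (mG 0%N).
- exact: bigcapT_measurable.
- move=> n k nk;apply/subsetPset => -[u x] [/= + Ax];rewrite !in_itv/= => /andP[tu ut].
split => //=;rewrite in_itv/= tu/= (le_trans ut)// lerD2l.
by rewrite lef_pV2 ?posrE// ler_nat ltnS.
have G0 : \bigcap_n G n = set0.
apply/seteqP;split=> // -[u x] h.
have [/= + Ax] := h 0%N Logic.I;rewrite in_itv/= => /andP[tu _].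
have tu0 : 0 < u - t by rewrite subr_gt0.
have /cvgrPdist_lt/(_ _ tu0)[n _ hn] := inv0.
have [/= + _] := h n Logic.I;rewrite in_itv/= => /andP[_ +].
have := hn n (leqnn n);rewrite /= sub0r normrN ger0_norm//.
by move: (n.+1%:R^-1) => v vt tv;lra.
move: cG;rewrite G0 measure0 => /fine_cvgP[_ /cvgrPdist_lt/(_ e e0)[n _ hn]].
have := hn n (leqnn n);rewrite /= sub0r normrN => hG.
near=> r.
have rG : r < t + n.+1%:R^-1.
by near: r;apply: nbhs_right_lt;rewrite ltrDl.
apply: (@le_lt_trans _ _ (m (G n))).
apply: le_measure;rewrite ?inE// => -[u x] [/= + Ax];rewrite in_itv/= => /andP[ru ut].
by split => //=;rewrite in_itv/= ru/= (le_trans ut)// ltW.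
have : m (G n) \is a fin_num by rewrite ge0_fin_numE// m_lt.
move=> /fineK <-;rewrite lte_fin;apply: le_lt_trans hG;exact: ler_norm.
Unshelve. all: by end_near. Qed.

Definition time_mass (t : R) : R := fine (m (`]0%R, t] `*` A)).

Lemma time_massB s t : 0 <= s -> s <= t ->
 m (`]s, t] `*` A) = (time_mass t - time_mass s)%:E.
move=> s0 st;have fin (B : set (R * V)) : measurable B -> m B \is a fin_num.
by move=> mB;rewrite ge0_fin_numE// m_lt.
have -> : m (`]s, t] `*` A) = (m (`]0%R, t] `*` A) - m (`]0%R, s] `*` A))%E.
have tE : `]0, t] `*` A = (`]0, s] `*` A) `|` (`]s, t] `*` A) :> set (R * V).
apply/seteqP;split=> [[u x] [/=]|[u x]].
rewrite !in_itv/= => /andP[u0 ut] Ax.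
by case: (leP u s) => us;[left|right];split => //=;rewrite ?in_itv/= ?u0 ?ut ?us.
by move=> [[/= + Ax]|[/= + Ax]];rewrite !in_itv/= => /andP[u0 ut];split => //=;
rewrite ?in_itv/=;lra.
rewrite tE measureU//;last first.
apply/seteqP;split => // -[u x] [[/= + _] [/= + _]];rewrite !in_itv/=;lra.
by rewrite addeAC subee ?add0e// fin.
by rewrite EFinB /time_mass !fineK ?fin.
Qed.

Lemma time_mass_nd s t : s <= t -> time_mass s <= time_mass t.
move=> st;rewrite fine_le ?ge0_fin_numE// ?m_lt//.
apply: le_measure;rewrite ?inE// => -[u x] [/= + Ax];rewrite in_itv/= => /andP[u0 us].
by split => //=;rewrite in_itv/= u0 (le_trans us).
Qed.

Lemma time_mass0 : time_mass 0 = 0.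
rewrite /time_mass (_ : _ `*` _ = set0) ?measure0//.
by apply/seteqP;split => // -[u x] [/=];rewrite in_itv/=;lra.
Qed.

Lemma time_mass_left t : 0 < t -> m ([set t] `*` A) = 0%E ->
 time_mass r @[r --> t^'-] --> time_mass t.
move=> t0 mt0;apply/cvgrPdist_lt => e e0;near=> r.
have r0 : 0 <= r by rewrite ltW//;near: r;exact: nbhs_left_gt.
have rt : r <= t by rewrite ltW//;near: r;exact: nbhs_left_lt.
rewrite ger0_norm ?subr_ge0 ?time_mass_nd// -lte_fin -time_massB//.
by near: r;exact: time_interval_left.
Unshelve. all: by end_near. Qed.

Lemma time_mass_right t : 0 <= t -> time_mass r @[r --> t^'+] --> time_mass t.
move=> t0;apply/cvgrPdist_lt => e e0;near=> r.
have tr : t <= r by rewrite ltW//;near: r;exact: nbhs_right_gt.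
rewrite distrC ger0_norm ?subr_ge0 ?time_mass_nd// -lte_fin -time_massB//.
by near: r;exact: time_interval_right.
Unshelve. all: by end_near. Qed.

End time_continuity.

(** For [0 <= a <= M] and [K = 2 + M ^+ 4] one has
  [a ^+ 4 - 1 - 4 * (a - 1) <= K - (M - 1)]: this is where the exponent of the
  moment assumption on the compensator comes from, and the slack [M - 1] is
  what controls the fourth moments of the left limits. *)
Lemma fourth_power_slack {R : realType} (M a : R) : 1 < M -> 0 <= a <= M ->
 a ^+ 4 - 1 + (M - 1) <= 4 * (a - 1) + (2 + M ^+ 4).
move=> M_gt1 /andP[a0 aM];have M0 : 0 <= M by rewrite (le_trans a0).
have M3 : M <= M ^+ 3 by rewrite -[leLHS]expr1 ler_weXn2l// ltW.
have a3 : a ^+ 3 <= M ^+ 3 by rewrite lerXn2r ?nnegrE.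
have -> : a ^+ 4 = a * a ^+ 3 by ring.
have -> : M ^+ 4 = M * M ^+ 3 by ring.
have h2 : a * a ^+ 3 <= a * M ^+ 3 by rewrite ler_wpM2l.
have h3 : (M - a) * 1 <= (M - a) * M ^+ 3.
by rewrite ler_wpM2l ?subr_ge0// (le_trans (ltW M_gt1)).
rewrite mulr1 mulrBl in h3.
move: h2 h3;move: (a * a ^+ 3) (a * M ^+ 3) (M * M ^+ 3) => u v z h2 h3.
lra.
Qed.

Section linear_path.
Context {R : realType} {dV} {V : mtype dV}.

Definition solves_linear (mu m : jump_measure R V) (p : R -> R)
 (rho : R -> V -> R) (c S : R) (l : R -> R) :=
 [/\ cadlag_on S l, forall t, 0 < t <= S -> p t = left_lim l t &
 forall t, 0 <= t <= S ->
 l t = c + compensated_integral mu m `]0, t] (fun s x => p s * (rho s x - 1))].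

Lemma solves_linearW mu m p rho c S S' l : S' <= S ->
 solves_linear mu m p rho c S l -> solves_linear mu m p rho c S' l.
move=> SS [[lr ll] pl le];split.
- split=> t /andP[t0 tS];first by apply: lr;rewrite t0 (lt_le_trans tS).
by apply: ll;rewrite t0 (le_trans tS).
- by move=> t /andP[t0 tS];apply: pl;rewrite t0 (le_trans tS).
- by move=> t /andP[t0 tS];apply: le;rewrite t0 (le_trans tS).
Qed.

Variables (s : nat -> \bar R) (y : nat -> V) (N : nat).
Hypotheses (s_gt0 : forall n, (0 < s n)%E)
 (sN : forall n, (N <= n)%N -> s n = +oo%E).

Lemma Rintegral_points_interval (g : R * V -> R) (t : R) : mfun setT g ->
 \int[points s y]_(q in `]0, t] `*` setT) g q =
 \sum_(n < N) (s n <= t%:E)%E%:R * g (fine (s n), y n).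
move=> mg;have mX : measurable (`]0, t] `*` setT : set (R * V)).
exact: measurableX.
rewrite Rintegral_mkcond (Rintegral_finite_points _ s_gt0 sN);last first.
by apply/(measurable_restrict _ mX) => //;exact: mfunTS.
apply: eq_bigr => n _;rewrite patchE.
move: (s_gt0 n);case: (s n) => [r| |]//=;last by rewrite !mul0r.
rewrite lte_fin ltry mul1r lee_fin => r0.
case: ifPn => [|/negP h];first by rewrite inE/= in_itv/= => -[/andP[_ ->] _];rewrite mul1r.
rewrite (_ : (r <= t) = false) ?mul0r//;apply/negP => rt;apply: h.
by rewrite inE/= in_itv/= r0 rt.
Qed.

Hypothesis s_inj : forall n k, (s n < +oo)%E -> s n = s k -> n = k.
Variables (m : jump_measure R V) (V0 : set V).
Hypotheses (m_fin : (m setT < +oo)%E)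
 (mV0 : measurable V0)
 (atomless : forall t, m ([set t] `*` V0) = 0%E).
Variables (S M c : R) (rho : R -> V -> R) (l p : R -> R).
Hypotheses (S_ge0 : 0 <= S)
 (M_gt1 : 1 < M)
 (mrho : mfun setT (fun q : R * V => rho q.1 q.2))
 (rhoM : forall t x, 0 < t <= S -> 0 <= rho t x <= M)
 (rho_off : forall t x, ~ V0 x -> rho t x = 1)
 (mp : mfun setT p).
Local Notation mu := (points s y).
Hypothesis lin : solves_linear mu m p rho c S l.
Let mTV0 : measurable (setT `*` V0 : set (R * V)).
Proof. exact: measurableX. Qed.
Let mX (t : R) : measurable (`]0, t] `*` setT : set (R * V)).
Proof. exact: measurableX. Qed.

Lemma Rintegral_on_marks (g : R * V -> R) (t : R) : mfun setT g ->
 (forall u x, ~ V0 x -> g (u, x) = 0) ->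
 \int[mrestr m mTV0]_(q in `]0, t] `*` setT) g q =
 \int[m]_(q in `]0, t] `*` setT) g q.
move=> mg g0;rewrite Rintegral_mrestr//;last exact: mfunTS.
rewrite Rintegral_mkcondr;apply: eq_Rintegral => -[u x] _.
rewrite patchE;case: ifPn => // /negP h;rewrite g0// => Vx;apply: h.
by rewrite inE.
Qed.

Local Notation K := (2 + M ^+ 4).
Local Notation F := (time_mass m V0).
Local Notation E t := (expR (- (K * F t))).
Let K_ge0 : 0 <= K.
Proof. by rewrite addr_ge0// (exprM _ 2 2) sqr_ge0. Qed.
Let mF : mfun setT F.
Proof. by apply: nondecreasing_measurable => // a b;exact: time_mass_nd. Qed.
Let n0F a b : 0 <= a -> a <= b -> b <= S ->
 mrestr m mTV0 (`]a, b] `*` setT) = (F b - F a)%:E.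
move=> a0 ab _;rewrite -(time_massB m_fin mV0)//= /mrestr;congr (m _).
by rewrite -setXI setIT setTI.
Qed.

Lemma linear_path_fourth :
 l S ^+ 4 * E S +
 (M - 1) * \int[m]_(q in `]0, S] `*` V0) (p q.1 ^+ 4 * E q.1) <=
 c ^+ 4 + compensated_integral mu m `]0, S]
 (fun t x => p t ^+ 4 * E t * (rho t x ^+ 4 - 1)).
have [cl pl le] := lin.
pose g1 (q : R * V) := p q.1 * (rho q.1 q.2 - 1).
pose gn (q : R * V) := p q.1 ^+ 4 * E q.1 * (rho q.1 q.2 ^+ 4 - 1).
pose gc (q : R * V) := p q.1 ^+ 4 * E q.1 * (4 * (rho q.1 q.2 - 1) + K).
pose g4 (q : R * V) := p q.1 ^+ 4 * E q.1.
have m1 (f : R -> R) : mfun setT f ->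
mfun setT (fun q : R * V => f q.1).
by move=> mf;exact: (mcomp mf measurable_fst).
have mg1 : mfun setT g1.
by apply: measurable_funM;[exact: (m1 p)|exact: measurable_funB].
have mE : mfun setT (fun t => E t).
apply: (@mcomp _ _ _ _ _ _ (@expR R));first exact: measurable_expR.
by apply: mcomp => //;exact: measurable_funM.
have mg4 : mfun setT g4.
apply: measurable_funM;last exact: (m1 _ mE).
by apply: measurable_funX;exact: (m1 _ mp).
have mgn : mfun setT gn.
by apply: measurable_funM => //;apply: measurable_funB => //;exact: measurable_funX.
have mgc : mfun setT gc.
apply: measurable_funM => //;apply: measurable_funD => //.
by apply: measurable_funM => //;exact: measurable_funB.
have Fl t : 0 < t <= S -> F r @[r --> t^'-] --> F t.
by move=> /andP[t0 _];exact: time_mass_left.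
have Fr t : 0 <= t < S -> F r @[r --> t^'+] --> F t.
by move=> /andP[t0 _];exact: time_mass_right.
have rM q : 0 < q.1 <= S -> 0 <= rho q.1 q.2 <= M by exact: rhoM.
have lE t : 0 <= t <= S -> l t = c +
\sum_(n < N) (s n <= t%:E)%E%:R * g1 (fine (s n), y n) -
\int[mrestr m mTV0]_(q in `]0, t] `*` setT) g1 q.
move=> tS;rewrite le// /compensated_integral addrA;congr (_ + _ - _).
exact: (Rintegral_points_interval _ mg1).
rewrite Rintegral_on_marks// => u x Vx;by rewrite /g1/= rho_off// subrr mulr0.
have := @exponential_path_fourth R dV V (mrestr m mTV0) F S K M c S_ge0 K_ge0 n0F
(time_mass0 m V0) mF Fl Fr s y N s_gt0 s_inj (fun q => rho q.1 q.2) mrho rM l p cl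
mp pl lE.
have [B B0 hB] := exponential_path_bounded S_ge0 cl pl.
have E01 t : 0 <= E t <= 1.
rewrite expR_ge0/= -[leRHS]expR0 ler_expR oppr_le0 mulr_ge0//.
by rewrite fine_ge0.
have bint (g : R * V -> R) C : mfun setT g ->
(forall q, 0 < q.1 <= S -> `|g q| <= C) ->
(mrestr m mTV0).-integrable (`]0, S] `*` setT) (EFin \o g).
move=> mg gC;apply: measurable_bounded_integrable => //.
- by have /= -> := n0F (lexx 0) S_ge0 (lexx S);rewrite ltry.
- exact: mfunTS.
- exists C;split;first exact: num_real.
move=> b Cb q [/= qst _];rewrite (le_trans _ (ltW Cb))// gC//.
have g4B q : 0 < q.1 <= S -> `|g4 q| <= B ^+ 4.
move=> qS;rewrite /g4 normrM -[leRHS]mulr1 ler_pM//.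
by rewrite normrX lerXn2r ?nnegrE ?hB.
by have /andP[E0 E1] := E01 q.1;rewrite ger0_norm.
have i4 := bint _ _ mg4 g4B.
have in_ : (mrestr m mTV0).-integrable (`]0, S] `*` setT) (EFin \o gn).
apply: (bint _ (B ^+ 4 * (M ^+ 4 + 1))) => // q qS.
rewrite /gn normrM ler_pM// ?g4B//.
rewrite (le_trans (ler_normB _ _))// normr1 lerD2r normrX.
by have /andP[r0 rM'] := rM q qS;rewrite ger0_norm// lerXn2r// nnegrE (le_trans r0).
have ic : (mrestr m mTV0).-integrable (`]0, S] `*` setT) (EFin \o gc).
apply: (bint _ (B ^+ 4 * (4 * (M + 1) + K))) => // q qS.
rewrite /gc normrM ler_pM// ?g4B//.
rewrite (le_trans (ler_normD _ _))// (ger0_norm K_ge0) lerD2r normrM ger0_norm//.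
rewrite ler_wpM2l// (le_trans (ler_normB _ _))// normr1 lerD2r.
by have /andP[r0 rM'] := rM q qS;rewrite ger0_norm.
move=> ->;rewrite /compensated_integral addrA.
rewrite (Rintegral_points_interval _ mgn).
have -> : \int[m]_(q in `]0, S] `*` V0) (p q.1 ^+ 4 * E q.1) =
\int[mrestr m mTV0]_(q in `]0, S] `*` setT) g4 q.
rewrite Rintegral_mrestr//;last exact: mfunTS.
by rewrite -setXI setIT setTI.
have <- : \int[mrestr m mTV0]_(q in `]0, S] `*` setT) gn q =
\int[m]_(q in `]0, S] `*` setT) (p q.1 ^+ 4 * E q.1 * (rho q.1 q.2 ^+ 4 - 1)).
rewrite Rintegral_on_marks// => u x Vx.
by rewrite /gn/= rho_off// expr1n subrr mulr0.
have : \int[mrestr m mTV0]_(q in `]0, S] `*` setT) gn q +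
(M - 1) * \int[mrestr m mTV0]_(q in `]0, S] `*` setT) g4 q <=
\int[mrestr m mTV0]_(q in `]0, S] `*` setT) gc q.
have i4' := integrableZl (mX S) (M - 1) i4.
rewrite -RintegralZl// -RintegralD//.
apply: le_Rintegral => //;first exact: (integrableD (mX S) in_ i4').
move=> q [/= qS _];rewrite in_itv/= in qS.
have -> : gn q + (M - 1) * g4 q = g4 q * (rho q.1 q.2 ^+ 4 - 1 + (M - 1)).
by rewrite /gn /g4;ring.
rewrite /gc -/(g4 q) ler_wpM2l//.
by rewrite /g4 mulr_ge0 ?expR_ge0// (exprM _ 2 2) sqr_ge0.
exact/fourth_power_slack/rM.
set A := \sum_(_ < _) _;set Ic := (\int[_]_(_ in _) gc _).
set In := (\int[_]_(_ in _) gn _);set I4 := (\int[_]_(_ in _) g4 _).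
by move=> h;rewrite -!addrA !lerD2l [leLHS]addrC lerBlDr [leRHS]addrC lerBrDl.
Qed.

End linear_path.

Section linear_moments.
Context {R : realType} {dO} {Omega : mtype dO} (P : probability Omega R)
 (Gl : R -> set (set Omega)) (T : R) {dV} {V : mtype dV} (V0 : set V)
 (sg : nat -> Omega -> \bar R) (ze : nat -> Omega -> V)
 (nu : Omega -> jump_measure R V).
Hypothesis cp : compensated_points P Gl T V0 sg ze nu.
Let fG := cp_filtration cp.
Local Notation mu w := (points (sg^~ w) (ze^~ w)).
Local Notation PS := (pspace Gl).
Variables (M c : R) (rho : Omega -> R -> V -> R) (S : Omega -> R)
 (pm l : Omega -> R -> R).
Hypotheses (M_gt1 : 1 < M)
 (mrho : pfield Gl rho)
 (rho_off : forall w t x, ~ V0 x -> rho w t x = 1)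
 (rhoM : {ae P, forall w, forall t x, 0 < t <= T -> 0 <= rho w t x <= M})
 (S_le : forall w, 0 <= S w <= T)
 (mS : pprocess Gl (fun w t => (0 < t <= S w)%R%:R : R))
 (mpm : pprocess Gl pm)
 (al : adapted_on `[0, T] Gl l)
 (lin : {ae P, forall w,
 solves_linear (mu w) (nu w) (pm w) (rho w) c (S w) (l w)})
 (fin_V0 : (\int[P]_w nu w (setT `*` V0) < +oo)%E).

Local Notation F w := (time_mass (nu w) V0).
Local Notation K := (2 + M ^+ 4).
Local Notation E w t := (expR (- (K * F w t))).

Lemma predictable_time_mass : pprocess Gl (fun w t => F w t).
apply: (@mcomp _ _ _ _ _ _ fine) => //.
have mW : pfield Gl (fun w (t : R) x => (\1_V0 x)%:E : \bar R).
apply/mEFinP;apply: (@mcomp _ _ _ _ _ _ (\1_V0 : V -> R)).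
exact: measurable_indic (cp_V0 cp).
exact: measurable_snd.
have W0 (w : Omega) (t : R) (x : V) : (0 <= (\1_V0 x : R)%:E)%E by rewrite lee_fin.
have := cp_predictable cp mW W0.
rewrite /pprocess;congr mfun;apply/funext => -[w t]/=.
have mX : measurable (`]0, t] `*` setT : set (R * V)).
exact: measurableX.
have mTV : measurable (setT `*` V0 : set (R * V)).
exact: measurableX (cp_V0 cp).
rewrite (eq_integral (fun q => (\1_(setT `*` V0) q)%:E));last first.
move=> [u x] _ /=;congr (_%:E);rewrite !indicE;congr (_%:R).
by rewrite in_setX in_setT.
by rewrite integral_indic// -setXI setTI setIT.
Qed.

(** The part of the path that runs while the solution has stayed below [k].
  Only rational times are tested, to keep the set predictable. *)
Let cut (k : nat) (w : Omega) (t : R) : Prop :=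
 forall q : rat, 0 < ratr q :> R -> ratr q < t -> `|l w (ratr q)| <= k%:R.
Let pcut k : measurable [set p : PS | 0 < p.2 <= S p.1 /\ cut k p.1 p.2].
have mD : measurable [set p : PS | 0 < p.2 <= S p.1].
rewrite (_ : [set p | _] = (fun p : PS => ((0 < p.2 <= S p.1)%R)%:R : R) @^-1` [set 1]).
by rewrite -[X in measurable X]setTI;exact: (mS measurableT).
apply/seteqP;split => p /=;first by move=> ->.
by case: (0 < p.2 <= S p.1) => // /esym/eqP;rewrite oner_eq0.
rewrite (_ : [set p | _] = [set p : PS | 0 < p.2 <= S p.1] `\`
\bigcup_(q in [set: rat]) ([set p : PS | 0 < p.2 <= S p.1] `&`
[set p : PS | 0 < (ratr q : R) /\ (ratr q < p.2 /\ ~ (`|l p.1 (ratr q)| <= k%:R))]));last first.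
apply/seteqP;split => p /=.
by move=> [pS h];split => // -[q _ [_ [q0 [qp]]]];apply;exact: h.
move=> [pS h];split => // q q0 qp;apply: contrapT => lk.
by apply: h;exists q.
apply: measurableD => //;apply: bigcupT_measurable_rat => q.
have [q0|q0] := ltP 0 (ratr q : R);last first.
rewrite (_ : _ `&` _ = set0)//;by apply/seteqP;split=> // p [_ []].
have [qT|Tq] := leP (ratr q) T;last first.
rewrite (_ : _ `&` _ = set0)//;apply/seteqP;split => // p [/= pS [_ [qp _]]].
by move: pS qp Tq (S_le p.1);move: (ratr q) => x;lra.
apply: measurableI => //.
rewrite (_ : [set _ | _] = [set p : PS | ratr q < p.2 /\ ~ (`|l p.1 (ratr q)| <= k%:R)]);
last by apply/seteqP;split => p /=;[case|].
rewrite (_ : [set _ | _] = [set p : PS | [set w | ~ (`|l w (ratr q)| <= k%:R)] p.1 /\ ratr q < p.2]);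
last by apply/seteqP;split => p /= [].
apply: (predictable_after (ltW q0)).
have := al;rewrite /adapted_on => /(_ (ratr q)).
rewrite /= in_itv/= qT (ltW q0) => /(_ isT).
move=> /(_ measurableT (~` [set x | `|x| <= k%:R])) h.
rewrite -(filtrationE fG (ltW q0)) -[X in measurable X]setTI;apply: h.
apply: measurableC;rewrite -[X in measurable X]setTI.
exact: (measurable_fun_le measurableT (@normr_measurable _ _) (measurable_cst _)).
Qed.
Let H k w t x : R := if `[< 0 < t <= S w /\ cut k w t >] then
 pm w t ^+ 4 * E w t * (rho w t x ^+ 4 - 1) else 0.
Let mH k : pfield Gl (H k).
apply: (@measurable_fun_cond _ _ _ _ [set q : PS * V | 0 < q.1.2 <= S q.1.1 /\ cut k q.1.1 q.1.2]).
rewrite -[X in measurable X]setTI.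
exact: (@measurable_fst _ _ PS V measurableT _ (pcut k)).
apply: mfunTS;apply: measurable_funM;last first.
by apply: measurable_funB => //;exact: measurable_funX mrho.
apply: measurable_funM.
by apply: measurable_funX;exact: field_process mpm.
apply: (@mcomp _ _ _ _ _ _ (@expR R));first exact: measurable_expR.
apply: measurable_funN;apply: measurable_funM => //.
exact: field_process predictable_time_mass.
Qed.
Let E01 w t : 0 <= E w t <= 1.
rewrite expR_ge0/= -[leRHS]expR0 ler_expR oppr_le0 mulr_ge0//.
by rewrite addr_ge0// (exprM _ 2 2) sqr_ge0.
by rewrite fine_ge0.
Qed.
Let cut_pm k w t : 0 < t <= S w -> cut k w t -> cvg (l w @ t^'-) ->
 `|left_lim (l w) t| <= k%:R.
move=> tS ct cl;rewrite leNgt;apply/negP => kp.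
have : \forall r \near t^'-, k%:R < `|l w r|.
have cn : `|l w r| @[r --> t^'-] --> `|left_lim (l w) t| by exact: cvg_norm.
exact: cvgr_gt cn _ kp.
have t0 : 0 < t by case/andP: tS.
move=> /near_left_ex[a at_ ha].
have [q] := @rat_in_itvoo R (Num.max 0 (t - a)) t
(ltac:(by rewrite gt_max t0 ltrBlDr ltrDl)).
rewrite in_itv/= gt_max => /andP[/andP[q0 aq] qt].
have := ha (ratr q) (ltac:(by apply/andP;split)).
by rewrite ltNge ct.
Qed.
Let cut_interval k w : exists2 s', 0 <= s' <= S w &
 forall t, (0 < t <= S w /\ cut k w t) <-> 0 < t <= s'.
have /andP[S0 ST] := S_le w.
pose A := [set t | t = 0 \/ (0 < t <= S w /\ cut k w t)].
have A0 : A 0 by left.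
have ubA : ubound A (S w) by move=> t [->|[/andP[]]].
have hA : has_sup A by split;[exists 0|exists (S w)].
exists (sup A).
by rewrite (ub_le_sup hA.2 A0)/= ge_sup//;exists 0.
move=> t;split=> [[/andP[t0 tS] ct]|/andP[t0 ts]].
by rewrite t0/= (ub_le_sup hA.2)//;right;rewrite t0 tS.
have tS : t <= S w by rewrite (le_trans ts)// ge_sup//;exists 0.
split;first by rewrite t0.
move=> q q0 qt;have [a Aa qa] := sup_gt (ex_intro _ 0 A0) (lt_le_trans qt ts).
case: Aa qa => [->|[_ ca] qa];last exact: ca.
by move=> q0';have := lt_trans q0 q0';rewrite ltxx.
Qed.

(** Localized fourth moment estimate: Fatou's lemma removes the cut. *)
Lemma linear_fourth_moment : exists Z : Omega -> \bar R,
 [/\ mfun setT Z, (forall w, 0 <= Z w)%E,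
 (\int[P]_w Z w <= (c ^+ 4)%:E)%E &
 {ae P, forall w, ((l w (S w) ^+ 4 * E w (S w))%:E + (M - 1)%:E *
 \int[nu w]_(q in `]0%R, S w] `*` V0) (pm w q.1 ^+ 4 * E w q.1)%:E
 <= Z w)%E}].
pose Zr k w := c ^+ 4 + (\int[mu w]_q H k w q.1 q.2 - \int[nu w]_q H k w q.1 q.2).
have mTV : measurable (setT `*` V0 : set (R * V)) by exact: measurableX (cp_V0 cp).
have HB k : {ae P, forall w, forall t x,
`|H k w t x| <= k%:R ^+ 4 * (M ^+ 4 + 1) * \1_V0 x}.
apply: filterS2 rhoM lin => w rw [[_ cl] pl _] t x;rewrite /H.
have M0 : 0 <= M by rewrite (le_trans _ (ltW M_gt1)).
have C0 : 0 <= k%:R ^+ 4 * (M ^+ 4 + 1) * \1_V0 x :> R.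
by rewrite !mulr_ge0 ?exprn_ge0// addr_ge0// exprn_ge0.
case: ifPn => [/asboolP[tS ct]|_];last by rewrite normr0.
have [Vx|Vx] := pselect (V0 x);last by rewrite rho_off// expr1n subrr mulr0 normr0.
rewrite indicE mem_set// mulr1 normrM ler_pM//.
have /andP[E0 E1] := E01 w t.
rewrite normrM -[leRHS]mulr1 ler_pM// ?(ger0_norm E0)//.
rewrite normrX lerXn2r ?nnegrE// pl// cut_pm//;exact: cl.
have tT : 0 < t <= T by move: tS (S_le w);lra.
have /andP[r0 rM'] := rw t x tT.
rewrite (le_trans (ler_normB _ _))// normr1 lerD2r normrX ger0_norm//.
by rewrite lerXn2r// nnegrE.
have mmass : mfun setT (fun w => nu w (setT `*` V0)).
have mW : pfield Gl (fun w (t : R) x => (\1_V0 x)%:E : \bar R).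
apply/mEFinP;apply: (@mcomp _ _ _ _ _ _ (\1_V0 : V -> R)).
exact: measurable_indic (cp_V0 cp).
exact: measurable_snd.
have W0 (w : Omega) (t : R) (x : V) : (0 <= (\1_V0 x : R)%:E)%E by rewrite lee_fin.
have := nu_measurable cp mW W0.
congr mfun;apply/funext => w.
rewrite (eq_integral (fun q => (\1_(setT `*` V0) q)%:E)).
by rewrite integral_indic// setIT.
by move=> [u x] _ /=;rewrite !indicE in_setX in_setT.
have Hfin k : (\int[P]_w \int[nu w]_q `|H k w q.1 q.2|%:E < +oo)%E.
pose C := k%:R ^+ 4 * (M ^+ 4 + 1) : R.
have C0 : 0 <= C.
by rewrite /C !mulr_ge0 ?exprn_ge0// addr_ge0// exprn_ge0// (le_trans _ (ltW M_gt1)).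
apply: (@le_lt_trans _ _ (\int[P]_w (C%:E * nu w (setT `*` V0))))%E.
apply: ge0_ae_le_nm => //.
- by move=> w;exact: integral_ge0.
- by move=> w;rewrite mule_ge0// lee_fin.
apply: filterS (HB k) => w hw.
have <- : (\int[nu w]_q (C%:E * (\1_(setT `*` V0) q)%:E) = C%:E * nu w (setT `*` V0))%E.
rewrite ge0_integralZl_EFin//;first by rewrite integral_indic// setIT.
by apply/mEFinP;exact: measurable_indic.
apply: ge0_ae_le_nm => //.
by move=> q;rewrite mule_ge0// lee_fin.
apply: aeW => -[u x] /=;rewrite -EFinM lee_fin (le_trans (hw u x))//.
by rewrite !indicE in_setX in_setT.
rewrite ge0_integralZl_EFin//.
by rewrite lte_mul_pinfty.
pose Zk k w := maxe (Zr k w)%:E 0.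
have mZr k : mfun setT (Zr k).
have h1 := measurable_Rintegral_points cp (mH k).
have h2 := measurable_Rintegral_compensator cp (mH k).
by apply: measurable_funD => //;exact: measurable_funB h1 h2.
have mZk k : mfun setT (Zk k).
by apply: measurable_maxe => //;exact/mEFinP.
have Zk0 k w : (0 <= Zk k w)%E by rewrite le_max lexx orbT.
have main : {ae P, forall w, (nu w setT < +oo)%E /\
forall k s', 0 <= s' <= S w ->
(forall t, (0 < t <= S w /\ cut k w t) <-> 0 < t <= s') ->
l w s' ^+ 4 * E w s' + (M - 1) *
\int[nu w]_(q in `]0, s'] `*` V0) (pm w q.1 ^+ 4 * E w q.1) <= Zr k w}.
apply: filterS3 (filterI rhoM lin) (cp_inj cp) (filterI (cp_bounded cp) (cp_atomless cp)).
move=> w [rw lw] inj [fin atl];split => // k s' /andP[s0 sS] cutE.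
have [N hN] := cp_finite cp w.
have sT : s' <= T by move: sS (S_le w);lra.
have := @linear_path_fourth R dV V (sg^~ w) (ze^~ w) N (cp_gt0 cp ^~ w) hN
(fun n k => inj n k) (nu w) V0 fin (cp_V0 cp) atl s' M c (rho w) (l w) (pm w) s0 M_gt1
(field_path w mrho)
(fun t x ts => rw t x (ltac:(by move: ts sT;lra))) (rho_off w)
(process_path w mpm) (solves_linearW sS lw).
have HE (n : jump_measure R V) :
\int[n]_(q in `]0, s'] `*` setT)
(pm w q.1 ^+ 4 * E w q.1 * (rho w q.1 q.2 ^+ 4 - 1)) =
\int[n]_q H k w q.1 q.2.
rewrite Rintegral_mkcond;apply: eq_Rintegral => -[t x] _.
rewrite patchE /H;case: ifPn => [|/negP h].
rewrite inE/= in_itv/= => -[+ _] => /cutE/asboolP.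
by rewrite asbool_and;case: ifPn.
case: ifPn => // /asboolP/cutE h';exfalso;apply: h.
by rewrite inE/= in_itv/= h'.
by rewrite /compensated_integral !HE.
exists (fun w => limn_einf (Zk ^~ w));split.
- rewrite (_ : (fun w => _) = (fun w => - limn_esup (fun k => - Zk k w))%E)//.
apply: mcomp => //.
apply: (@measurable_fun_limn_esup _ _ _ _ (fun k w => - Zk k w)%E) => k.
exact: mcomp.
- move=> w;rewrite limn_einf_lim;apply: lime_ge;first exact: is_cvg_einfs.
by near=> n;apply: le_ereal_inf_tmp => _ [k /= nk <-].
- apply: le_trans (fatou P measurableT mZk (fun k w _ => Zk0 k w)) _.
rewrite (_ : (fun k => _) = fun=> (c ^+ 4)%:E).
by rewrite (cvg_limn_einf_sup (cvg_cst _)).1.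
apply/funext => k.
have [iH EH] := compensated_integral_centred cp (mH k) (Hfin k).
transitivity (\int[P]_w ((c ^+ 4)%:E + (\int[mu w]_q H k w q.1 q.2 - \int[nu w]_q H k w q.1 q.2)%:E))%E.
apply: ae_eq_nm;apply: filterS main => w [_ /(_ k)].
have [s' s'S cE] := cut_interval k w => /(_ s' s'S cE) h.
rewrite /Zk max_l// lee_fin;apply: le_trans h;rewrite addr_ge0//.
by rewrite mulr_ge0 ?expR_ge0// (exprM _ 2 2) sqr_ge0.
rewrite mulr_ge0 ?subr_ge0 ?(ltW M_gt1)// Rintegral_ge0// => q _.
by rewrite mulr_ge0 ?expR_ge0// (exprM _ 2 2) sqr_ge0.
rewrite integralD//;last exact: finite_measure_integrable_cst.
by rewrite EH adde0 integral_cst// [X in (_ * X)%E]probability_setT mule1.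
- apply: filterS2 main lin => w [fin hw] [cl pl _].
have /andP[S0 ST] := S_le w.
have [B hB] := cadlag_bounded S0 cl.
have [k0 Bk] : exists k : nat, B <= k%:R.
by exists (Num.Def.archi_bound B);rewrite ltW// unstable.ltr_bound.
have pB := cadlag_left_lim_bounded cl hB.
have mX : measurable (`]0, S w] `*` V0 : set (R * V)).
exact: measurableX _ (cp_V0 cp).
have -> : (\int[nu w]_(q in `]0%R, S w] `*` V0) (pm w q.1 ^+ 4 * E w q.1)%:E =
(\int[nu w]_(q in `]0%R, S w] `*` V0) (pm w q.1 ^+ 4 * E w q.1))%R%:E)%E.
rewrite /Rintegral fineK//;apply: integrable_fin_num => //.
apply: measurable_bounded_integrable => //.
- by apply: le_lt_trans fin;apply: le_measure;rewrite ?inE.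
- apply: mfunTS;apply: measurable_funM.
apply: measurable_funX;apply: (mcomp _ measurable_fst).
exact: process_path mpm.
apply: (mcomp (f := fun t => E w t) _ measurable_fst).
apply: (@mcomp _ _ _ _ _ _ (@expR R));first exact: measurable_expR.
apply: measurable_funN;apply: measurable_funM => //.
exact: process_path predictable_time_mass.
- exists (B ^+ 4);split;first exact: num_real.
move=> b Bb [t x] /= [+ _];rewrite in_itv/= => tS.
rewrite (le_trans _ (ltW Bb))// normrM -[leRHS]mulr1.
have /andP[E0 E1] := E01 w t.
rewrite ler_pM// ?(ger0_norm E0)// normrX.
have pb := pB t tS;rewrite pl// lerXn2r// nnegrE//.
exact: le_trans pb.
rewrite -EFinM -EFinD limn_einf_lim;apply: lime_ge;first exact: is_cvg_einfs.
near=> n;apply: le_ereal_inf_tmp => _ [k /= nk <-].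
rewrite /Zk le_max lee_fin;apply/orP;left;apply: hw;first by rewrite S0 lexx.
move=> t;split=> [[]//|tS];split => // q q0 qt.
have qS : (0 : R) <= ratr q <= S w.
by rewrite ltW//= (le_trans (ltW qt))//;case/andP: tS.
apply: le_trans (hB _ qS) _;apply: le_trans Bk _;rewrite ler_nat (leq_trans _ nk)//.
by near: n;exact: nbhs_infty_ge.
Unshelve. all: by end_near. Qed.

End linear_moments.

Lemma sq_le_fourth {R : realType} (a e : R) :
 a ^+ 2 <= a ^+ 4 * expR (- e) + expR e.
pose x := a ^+ 2 * expR (- e / 2);pose y := expR (e / 2).
have e1 : expR (- e / 2) * y = 1 by rewrite -expRD -mulrDl addNr mul0r expR0.
have -> : a ^+ 4 * expR (- e) = x ^+ 2.
by rewrite exprMn -exprM -expRM_natr;congr (_ * expR _);field.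
have -> : expR e = y ^+ 2 by rewrite -expRM_natr;congr expR;field.
have -> : a ^+ 2 = x * y by rewrite -mulrA e1 mulr1.
by move: x y {e1} => x y;have := sqr_ge0 (x - y);have := sqr_ge0 x;
have := sqr_ge0 y;nra.
Qed.

Lemma fourth_expR_ge0 {R : realType} (a e : R) : 0 <= a ^+ 4 * expR e.
Proof. by rewrite mulr_ge0 ?expR_ge0// (exprM _ 2 2) sqr_ge0. Qed.

(** * Density processes *)

(** The density process [L] of a change of measure that multiplies the
  compensator by [rho] on the atomless part [V0]; [pm] is a predictable
  version of its left limits. *)
Record density_process {R : realType} {dO} {Omega : mtype dO}
 (P : probability Omega R) (Gl : R -> set (set Omega)) (T : R)
 {dV} {V : mtype dV} (V0 : set V)
 (sg : nat -> Omega -> \bar R) (ze : nat -> Omega -> V)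
 (nu : Omega -> jump_measure R V)
 (M : R) (rho : Omega -> R -> V -> R) (pm L : Omega -> R -> R) := DensityProcess {
 dp_points : compensated_points P Gl T V0 sg ze nu ;
 dp_gt1 : 1 < M ;
 dp_factor : pfield Gl rho ;
 dp_off : forall w t x, ~ V0 x -> rho w t x = 1 ;
 dp_factor_le : {ae P, forall w, forall t x, 0 < t <= T -> 0 <= rho w t x <= M} ;
 dp_left : pprocess Gl pm ;
 dp_adapted : adapted_on `[0, T] Gl L ;
 dp_linear : {ae P, forall w,
 solves_linear (points (sg^~ w) (ze^~ w)) (nu w) (pm w) (rho w) 1 T (L w)} ;
 dp_moment : (\int[P]_w (expR ((3 + M ^+ 4) * fine (nu w setT)))%:E < +oo)%E ;
 dp_ge0 : {ae P, forall w, 0 <= L w T}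
}.

Section density.
Context {R : realType} {dO} {Omega : mtype dO} {P : probability Omega R}
 {Gl : R -> set (set Omega)} {T : R} {dV} {V : mtype dV} {V0 : set V}
 {sg : nat -> Omega -> \bar R} {ze : nat -> Omega -> V}
 {nu : Omega -> jump_measure R V}
 {M : R} {rho : Omega -> R -> V -> R} {pm L : Omega -> R -> R}.
Hypothesis dp : density_process P Gl T V0 sg ze nu M rho pm L.
Let cp := dp_points dp.
Let fG := cp_filtration cp.
Let T_gt0 : 0 < T := cp_T cp.
Let M_gt1 : 1 < M := dp_gt1 dp.
Let mpm := dp_left dp.
Let mom := dp_moment dp.
Let aL := dp_adapted dp.
Local Notation mu w := (points (sg^~ w) (ze^~ w)).
Local Notation PS := (pspace Gl).
Local Notation Ct w := (fine (nu w setT)).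
Local Notation F w := (time_mass (nu w) V0).
Local Notation K := (2 + M ^+ 4).
Local Notation E w t := (expR (- (K * F w t))).

Lemma measurable_total_mass : mfun setT (fun w => nu w setT).
have := @nu_measurable _ _ _ _ _ _ _ _ _ _ _ _ cp (fun _ _ _ => 1%E)
(measurable_cst _) (fun _ _ _ => lee01).
by congr mfun;apply/funext => w;rewrite integral_cst// mul1e.
Qed.
Let M4 : 0 <= M ^+ 4. Proof. by rewrite (exprM _ 2 2) sqr_ge0. Qed.

Lemma terminal_measurable : mfun setT (L ^~ T).
have h := aL (ltac:(by rewrite /= in_itv/= lexx ltW) : `[0, T]%classic T).
move=> _ B mB;rewrite setTI;apply: (filtrationM fG (ltW T_gt0)).
rewrite -(filtrationE fG (ltW T_gt0)) -[X in measurable X]setTI.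
exact: h.
Qed.

Lemma mean_total_mass : (\int[P]_w nu w setT < +oo)%E.
apply: le_lt_trans (dp_moment dp);apply: ge0_ae_le_nm => //.
apply: filterS (cp_bounded cp) => w fin.
rewrite -[leLHS]fineK ?ge0_fin_numE// lee_fin.
have C0 : 0 <= Ct w by rewrite fine_ge0.
have h : 0 <= (2 + M ^+ 4) * Ct w by rewrite mulr_ge0// addr_ge0.
have -> : (3 + M ^+ 4) * Ct w = (2 + M ^+ 4) * Ct w + Ct w by ring.
by apply: le_trans (expR_ge1Dx _);rewrite addrA lerDr addr_ge0.
Qed.

Lemma mean_mark_mass : (\int[P]_w nu w (setT `*` V0) < +oo)%E.
apply: le_lt_trans mean_total_mass;apply: ge0_ae_le_nm => //.
apply: aeW => w;apply: le_measure => //;rewrite inE//.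
by apply: measurableX => //;exact: cp_V0 cp.
Qed.
(** One integrable random variable dominates all moments that are needed. *)
Lemma density_moments : exists D : Omega -> \bar R,
 [/\ mfun setT D, (forall w, 0 <= D w)%E, (\int[P]_w D w < +oo)%E &
 {ae P, forall w, [/\ ((L w T ^+ 2)%:E <= D w)%E,
 (\int[nu w]_(q in setT `*` V0) (pm w q.1 ^+ 2)%:E <= D w)%E &
 (((1 + Ct w) ^+ 3)%:E <= D w)%E]}].
have mC : mfun setT (fun w => Ct w).
by apply: (@mcomp _ _ _ _ _ _ fine) => //;exact: measurable_total_mass.
have mexp : mfun setT (fun w => (expR ((3 + M ^+ 4) * Ct w))%:E).
apply/mEFinP;apply: (@mcomp _ _ _ _ _ _ (@expR R)).
exact: measurable_expR.
exact: measurable_funM.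
have mTV : measurable (setT `*` V0 : set (R * V)) by exact: measurableX (cp_V0 cp).
have [Z [mZ Z0 EZ ZP]] := @linear_fourth_moment R dO Omega P Gl T dV V V0 sg ze nu cp M 1 rho
(fun=> T) pm L M_gt1 (dp_factor dp) (dp_off dp) (dp_factor_le dp)
(fun w => (ltac:(by rewrite lexx ltW) : 0 <= T <= T))
(process_interval fG T) mpm aL (dp_linear dp) mean_mark_mass.
exists (fun w => Z w + ((M - 1)^-1%:E * Z w + (expR ((3 + M ^+ 4) * Ct w))%:E))%E.
have M10 : 0 < M - 1 by rewrite subr_gt0.
have iM : 0 <= (M - 1)^-1 by rewrite invr_ge0 ltW.
have h0 w : (0 <= (M - 1)^-1%:E * Z w)%E by rewrite mule_ge0.
have h1 w : (0 <= (expR ((3 + M ^+ 4) * Ct w))%:E)%E by rewrite lee_fin expR_ge0.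
have m0 : mfun setT (fun w => (M - 1)^-1%:E * Z w)%E.
exact: measurable_funeM.
split.
- by apply: emeasurable_funD => //;exact: emeasurable_funD.
- by move=> w;rewrite !adde_ge0.
- rewrite ge0_integralD//=;[|by move=> w _;rewrite adde_ge0|exact: emeasurable_funD].
rewrite ge0_integralD//= ge0_integralZl_EFin//.
have Zf : (\int[P]_w Z w < +oo)%E by rewrite (le_lt_trans EZ)// ltry.
by apply: lte_add_pinfty => //;apply: lte_add_pinfty => //;exact: lte_mul_pinfty.
- apply: filterS2 ZP (cp_bounded cp) => w Zw fin.
have mass B : measurable B -> (nu w B <= nu w setT)%E.
by move=> mB;apply: le_measure;rewrite ?inE.
have FC t : F w t <= Ct w.
have mI : measurable (`]0, t] `*` V0 : set (R * V)).
exact: measurableX _ (cp_V0 cp).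
apply: fine_le;last exact: mass.
by rewrite ge0_fin_numE//;exact: le_lt_trans (mass _ mI) fin.
by rewrite ge0_fin_numE.
have F0 t : 0 <= F w t by rewrite fine_ge0.
have C0 : 0 <= Ct w by rewrite fine_ge0.
have K0 : 0 <= K by rewrite addr_ge0.
have amgm := @sq_le_fourth R.
have Ebig : expR (K * F w T) <= expR ((3 + M ^+ 4) * Ct w).
rewrite ler_expR ler_pM// lerD2r;lra.
have ZL : ((L w T ^+ 4 * E w T)%:E <= Z w)%E.
apply: le_trans Zw;rewrite leeDl// mule_ge0//;first by rewrite lee_fin ltW.
by apply: integral_ge0 => q _;rewrite lee_fin fourth_expR_ge0.
have Zp : (\int[nu w]_(q in `]0%R, T] `*` V0) (pm w q.1 ^+ 4 * E w q.1)%:E <=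
(M - 1)^-1%:E * Z w)%E.
rewrite lee_pdivlMl//;apply: le_trans Zw;rewrite leeDr//.
by rewrite lee_fin fourth_expR_ge0.
split.
+ rewrite (@le_trans _ _ ((L w T ^+ 4 * E w T)%:E + (expR (K * F w T))%:E)%E)//.
by rewrite -EFinD lee_fin amgm.
by rewrite leeD//;apply: (@le_trans _ _ (expR ((3 + M ^+ 4) * Ct w))%:E) => //;rewrite leeDr.
+ have mX : measurable (`]0, T] `*` V0 : set (R * V)).
exact: measurableX _ (cp_V0 cp).
have mp : mfun setT (fun q : R * V => pm w q.1).
exact: (mcomp (process_path w mpm) measurable_fst).
have mE : mfun setT (fun q : R * V => E w q.1).
apply: (mcomp (f := fun t => E w t) _ measurable_fst).
apply: (@mcomp _ _ _ _ _ _ (@expR R));first exact: measurable_expR.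
apply: measurable_funN;apply: measurable_funM => //.
exact: process_path (predictable_time_mass cp).
have -> : (\int[nu w]_(q in setT `*` V0) (pm w q.1 ^+ 2)%:E =
\int[nu w]_(q in `]0%R, T] `*` V0) (pm w q.1 ^+ 2)%:E)%E.
have := @ge0_negligible_integral _ _ _ (nu w) (setT `*` V0) (~` (`]0, T] `*` setT))
(fun q => (pm w q.1 ^+ 2)%:E) _ mTV _ _ (cp_off cp w).
move=> ->.
* by rewrite setDE setCK -setXI setTI setIT.
* by apply: measurableC;apply: measurableX => //;exact: measurable_itv.
* by apply: mfunTS;apply/mEFinP;exact: measurable_funX.
* by move=> q _;rewrite lee_fin sqr_ge0.
apply: (@le_trans _ _ (\int[nu w]_(q in `]0%R, T] `*` V0)
((pm w q.1 ^+ 4 * E w q.1)%:E + (expR (K * F w T))%:E))%E).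
apply: ge0_le_integral => //.
* by move=> q _;rewrite lee_fin sqr_ge0.
* by apply: mfunTS;apply/mEFinP;exact: measurable_funX.
* apply: mfunTS;apply: emeasurable_funD => //;apply/mEFinP.
by apply: measurable_funM => //;exact: measurable_funX.
* move=> [t x] /= [+ _];rewrite in_itv/= => /andP[t0 tT].
rewrite -EFinD lee_fin (le_trans (amgm _ (K * F w t)))// lerD2l ler_expR ler_wpM2l//.
by apply: time_mass_nd => //;exact: cp_V0 cp.
rewrite ge0_integralD//;last first.
- apply: mfunTS;apply/mEFinP.
by apply: measurable_funM => //;exact: measurable_funX.
- by move=> q _;rewrite lee_fin fourth_expR_ge0.
apply: (@le_trans _ _ ((M - 1)^-1%:E * Z w + (expR ((3 + M ^+ 4) * Ct w))%:E)%E);last first.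
by rewrite leeDr.
rewrite leeD// integral_cst//.
have -> : nu w (`]0%R, T] `*` V0) = (F w T)%:E.
by rewrite fineK// ge0_fin_numE// (le_lt_trans (mass _ mX)).
rewrite -EFinM lee_fin (@le_trans _ _ (expR (K * F w T) * expR (F w T)))//.
rewrite ler_wpM2l ?expR_ge0// (le_trans _ (expR_ge1Dx _))//;lra.
rewrite -expRD ler_expR -[X in _ + X]mul1r -mulrDl ler_pM//;lra.
+ apply: (@le_trans _ _ (expR ((3 + M ^+ 4) * Ct w))%:E);last first.
by rewrite (le_trans (leeDr _ (h0 w)))// leeDr.
rewrite lee_fin (@le_trans _ _ (expR (Ct w) ^+ 3))//.
by rewrite lerXn2r ?nnegrE ?expR_ge0 ?addr_ge0// expR_ge1Dx.
by rewrite -expRM_natr ler_expR mulrC ler_wpM2r// lerDl.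
Qed.

Local Notation LT w := (Num.max (L w T) 0).

Let square_split (a c e : R) : 0 <= c ->
 a ^+ 2 * c <= a ^+ 4 * expR (- e) + expR e * expR c.
move=> c0;have e0 : 0 < expR e by exact: expR_gt0.
have h : a ^+ 2 * c <= a ^+ 4 * expR (- e) + expR e * (c / 2) ^+ 2.
have := sqr_ge0 (a ^+ 2 - expR e * (c / 2));rewrite expRN.
rewrite -[a ^+ 4]/(a ^+ (2 * 2)) exprM.
move: (a ^+ 2) (expR e) e0 => x y y0 sq.
have : 0 <= (x - y * (c / 2)) ^+ 2 / y by rewrite divr_ge0// ltW.
have -> : (x - y * (c / 2)) ^+ 2 / y = x ^+ 2 / y - x * c + y * (c / 2) ^+ 2.
by field;rewrite gt_eqF.
by lra.
apply: le_trans h _;rewrite lerD2l ler_wpM2l ?expR_ge0//.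
have -> : expR c = expR (c / 2) ^+ 2 by rewrite -expRM_natl;congr expR;lra.
by rewrite lerXn2r ?nnegrE ?expR_ge0// ?divr_ge0//;have := expR_ge1Dx (c / 2);lra.
Qed.

Lemma mean_density_square_mass : (\int[P]_w (((LT w) ^+ 2)%:E * nu w setT) < +oo)%E.
have [Z [mZ Z0 EZ ZP]] := @linear_fourth_moment R dO Omega P Gl T dV V V0 sg ze nu cp M 1 rho
(fun=> T) pm L (dp_gt1 dp) (dp_factor dp) (dp_off dp) (dp_factor_le dp)
(fun w => (ltac:(by rewrite lexx ltW) : 0 <= T <= T))
(process_interval fG T) (dp_left dp) (dp_adapted dp) (dp_linear dp) mean_mark_mass.
have mexp : mfun setT (fun w => (expR ((3 + M ^+ 4) * Ct w))%:E).
apply/mEFinP;apply: (@mcomp _ _ _ _ _ _ (@expR R)).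
exact: measurable_expR.
apply: measurable_funM => //;apply: (@mcomp _ _ _ _ _ _ fine) => //.
exact: measurable_total_mass.
apply: (@le_lt_trans _ _ (\int[P]_w (Z w + (expR ((3 + M ^+ 4) * Ct w))%:E))%E);last first.
rewrite ge0_integralD//.
by apply: lte_add_pinfty;[exact: le_lt_trans EZ (ltry _)|exact: dp_moment dp].
apply: ge0_ae_le_nm.
- by move=> w;apply: mule_ge0 => //;rewrite lee_fin sqr_ge0.
- by move=> w;apply: adde_ge0 => //;rewrite lee_fin expR_ge0.
apply: filterS2 ZP (filterI (cp_bounded cp) (dp_ge0 dp)) => w Zw [fin L0].
have C0 : 0 <= Ct w by rewrite fine_ge0.
have mass B : measurable B -> (nu w B <= nu w setT)%E.
by move=> mB;apply: le_measure;rewrite ?inE.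
have FC : F w T <= Ct w.
have mI : measurable (`]0, T] `*` V0 : set (R * V)).
exact: measurableX _ (cp_V0 cp).
apply: fine_le;last exact: mass.
by rewrite ge0_fin_numE//;exact: le_lt_trans (mass _ mI) fin.
by rewrite ge0_fin_numE.
have M10 : 0 <= M - 1 by rewrite subr_ge0 ltW// (dp_gt1 dp).
have ZL : ((L w T ^+ 4 * expR (- (K * F w T)))%:E <= Z w)%E.
apply: le_trans Zw;rewrite leeDl//;apply: mule_ge0;first by rewrite lee_fin.
by apply: integral_ge0 => q _;rewrite lee_fin fourth_expR_ge0.
rewrite -[nu w setT]fineK ?ge0_fin_numE// -EFinM (max_l L0).
apply: (@le_trans _ _ ((L w T ^+ 4 * expR (- (K * F w T)))%:E +
(expR ((3 + M ^+ 4) * Ct w))%:E)%E);last by rewrite leeD2r.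
have K0 : 0 <= K by rewrite addr_ge0.
have -> : (3 + M ^+ 4) * Ct w = K * Ct w + Ct w by ring.
have h : K * F w T <= K * Ct w by rewrite ler_wpM2l.
rewrite -EFinD lee_fin expRD;apply: le_trans (_ : _ <= L w T ^+ 4 * expR (- (K * F w T)) +
expR (K * F w T) * expR (Ct w)) _;last by rewrite lerD2l ler_wpM2r ?expR_ge0// ler_expR.
exact: square_split.
Qed.

End density.

(** * Jumps and compensators under a change of measure *)

Section bounded_integrals.
Context d1 (X : mtype d1) (R : realType).

Lemma bounded_integrable (m : {measure set X -> \bar R}) (D : set X) (f : X -> R) B :
 (m setT < +oo)%E -> measurable D -> mfun D f ->
 (forall x, D x -> `|f x| <= B) -> m.-integrable D (EFin \o f).
move=> fin mD mf fB;apply: measurable_bounded_integrable => //.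
by apply: le_lt_trans fin;apply: le_measure;rewrite ?inE.
exists B;split;first exact: num_real.
by move=> b Bb x Dx;exact: le_trans (fB x Dx) (ltW Bb).
Qed.

Lemma Rintegral_bounded (m : {measure set X -> \bar R}) (D : set X) (f : X -> R) B :
 (m setT < +oo)%E -> measurable D -> mfun D f -> 0 <= B ->
 (forall x, D x -> `|f x| <= B) -> `|\int[m]_(x in D) f x| <= B * fine (m D).
move=> fin mD mf B0 fB;have i := bounded_integrable fin mD mf fB.
have mDf : (m D < +oo)%E by apply: le_lt_trans fin;apply: le_measure;rewrite ?inE.
apply: le_trans (le_normr_Rintegral mD i) _.
rewrite -(Rintegral_cst m mD);apply: le_Rintegral => //.
- exact: (integrable_norm i).
- by apply: (bounded_integrable (B := B)) => // x _;rewrite ger0_norm.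
Qed.

End bounded_integrals.

Section bounded_fubini.
Context d1 d2 (X : mtype d1) (Y : mtype d2) (R : realType).
Variables (m : {measure set X -> \bar R}) (n : {measure set Y -> \bar R}).
Hypotheses (m_fin : (m setT < +oo)%E)
 (n_fin : (n setT < +oo)%E).
Variables (a : X -> R) (b : Y -> R) (A B : R).
Hypotheses (ma : mfun setT a)
 (mb : mfun setT b)
 (aA : forall x, `|a x| <= A)
 (bB : forall y, `|b y| <= B).
Variable D : set (X * Y).
Hypothesis mD : measurable D.
Let Rmfrestr (E : set X) (f : X -> R) :
 \int[mfrestr measurableT m_fin]_(x in E) f x = \int[m]_(x in E) f x.
congr fine;apply: eq_measure_integral => C _ _.
exact: (congr1 m (setIT C)).
Qed.
Let Rnfrestr (E : set Y) (f : Y -> R) :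
 \int[mfrestr measurableT n_fin]_(x in E) f x = \int[n]_(x in E) f x.
congr fine;apply: eq_measure_integral => C _ _.
exact: (congr1 n (setIT C)).
Qed.

Lemma bounded_fubini (f : X * Y -> R) C : mfun setT f ->
 (forall z, `|f z| <= C) ->
 [/\ mfun setT (fun x => \int[n]_y f (x, y)),
 mfun setT (fun y => \int[m]_x f (x, y)) &
 \int[m]_x \int[n]_y f (x, y) = \int[n]_y \int[m]_x f (x, y)].
move=> mf fC;pose m' : {finite_measure set X -> \bar R} := mfrestr measurableT m_fin.
pose n' : {finite_measure set Y -> \bar R} := mfrestr measurableT n_fin.
have mT : (m' setT < +oo)%E by rewrite [m' setT](congr1 m (setIT setT)).
have nT : (n' setT < +oo)%E by rewrite [n' setT](congr1 n (setIT setT)).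
have i : (m' \x n')%E.-integrable setT (EFin \o f).
apply: measurable_bounded_integrable => //;last first.
exists C;split;first exact: num_real.
by move=> e Ce z _;exact: le_trans (fC z) (ltW Ce).
rewrite -setXTT [X in (X < _)%E](product_measure1E m' n')// lte_mul_pinfty//.
by rewrite ge0_fin_numE.
have inn x : (\int[n']_y (f (x, y))%:E = (\int[n]_y f (x, y))%:E)%E.
rewrite -Rnfrestr /Rintegral fineK//;apply: integrable_fin_num => //.
apply: measurable_bounded_integrable => //.
- exact: (mcomp mf (pair1_measurable x)).
- exists C;split;first exact: num_real.
by move=> e Ce z _;exact: le_trans (fC _) (ltW Ce).
have inm y : (\int[m']_x (f (x, y))%:E = (\int[m]_x f (x, y))%:E)%E.
rewrite -Rmfrestr /Rintegral fineK//;apply: integrable_fin_num => //.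
apply: measurable_bounded_integrable => //.
- exact: (mcomp mf (pair2_measurable y)).
- exists C;split;first exact: num_real.
by move=> e Ce z _;exact: le_trans (fC _) (ltW Ce).
split.
- apply/mEFinP;have /measurable_int := integrable_fubini_F i.
by congr mfun;apply/funext => x;rewrite /fubini_F/= inn.
- apply/mEFinP;have := measurable_fubini_G i.
by congr mfun;apply/funext => y;rewrite /fubini_G/= inm.
- rewrite -Rmfrestr -Rnfrestr;congr fine;have := Fubini i => /= h.
rewrite -[LHS](eq_integral _ _ (fun x _ => inn x)) h.
by apply: eq_integral => y _;rewrite inm.
Qed.

Lemma Rintegral_swap :
 \int[m]_x (a x * \int[n]_(y in xsection D x) b y) =
 \int[n]_y (b y * \int[m]_(x in ysection D y) a x).
pose f z := a z.1 * (b z.2 * \1_D z).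
have mf : mfun setT f.
apply: measurable_funM;first exact: (mcomp ma measurable_fst).
apply: measurable_funM;first exact: (mcomp mb measurable_snd).
exact: measurable_indic.
have fC z : `|f z| <= A * (B * 1).
rewrite /f !normrM ler_pM ?ler_pM ?mulr_ge0//.
by rewrite indicE;case: (_ \in _);rewrite ?normr1 ?normr0.
have [_ _ h] := bounded_fubini mf fC.
transitivity (\int[m]_x \int[n]_y f (x, y)).
apply: eq_Rintegral => x _.
rewrite Rintegral_mkcond -RintegralZl//;last first.
apply: (bounded_integrable (B := B)) => //.
apply/(measurable_restrict _ (measurable_xsection x mD)) => //.
exact: mfunTS.
by move=> y _;rewrite patchE;case: ifP => _;rewrite // normr0 (le_trans _ (bB y)).
apply: eq_Rintegral => y _;rewrite /f/= patchE;congr (_ * _).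
rewrite indicE -mem_xsection;case: ifP => _;by rewrite ?mulr1 ?mulr0.
rewrite h;apply: eq_Rintegral => y _.
rewrite [in RHS]Rintegral_mkcond -RintegralZl//;last first.
apply: (bounded_integrable (B := A)) => //.
apply/(measurable_restrict _ (measurable_ysection y mD)) => //.
exact: mfunTS.
by move=> x _;rewrite patchE;case: ifP => _;rewrite // normr0 (le_trans _ (aA x)).
apply: eq_Rintegral => x _;rewrite /f/= patchE mulrCA;congr (_ * _).
by rewrite indicE -mem_ysection;case: ifP => _;rewrite ?mulr1 ?mulr0.
Qed.

End bounded_fubini.

Section by_parts.
Context {R : realType} {dV} {V : mtype dV}.
Implicit Types (m n : jump_measure R V) (a b : R * V -> R).

Lemma measurable_before (t : R) : measurable [set q : R * V | q.1 < t].
rewrite (_ : [set _ | _] = `]-oo, t[%classic `*` setT).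
exact: measurableX.
by apply/seteqP;split => [q|q []];rewrite /= in_itv/=.
Qed.

Lemma measurable_upto (t : R) : measurable [set q : R * V | q.1 <= t].
rewrite (_ : [set _ | _] = `]-oo, t]%classic `*` setT).
exact: measurableX.
by apply/seteqP;split => [q|q []];rewrite /= in_itv/=.
Qed.
Let mlt : measurable [set z : (R * V) * (R * V) | z.1.1 < z.2.1].
rewrite (_ : [set _ | _] = (fun z : (R * V) * (R * V) => z.2.1 - z.1.1) @^-1` `]0, +oo[%classic).
have h : mfun setT (fun z : (R * V) * (R * V) => z.2.1 - z.1.1).
apply: measurable_funB.
exact: (mcomp measurable_fst measurable_snd).
exact: (mcomp measurable_fst measurable_fst).
by rewrite -[X in measurable X]setTI;exact: (h measurableT _ (measurable_itv _)).
by apply/seteqP;split => z;rewrite /= in_itv/= andbT subr_gt0.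
Qed.

Lemma measurable_Rintegral_section n b B (D : set (R * (R * V))) :
 (n setT < +oo)%E -> mfun setT b -> (forall q, `|b q| <= B) ->
 measurable D -> mfun setT (fun t : R => \int[n]_(q in xsection D t) b q).
move=> nf mb bB mD.
have dirac_fin : (\d_(0%R : R) [set: R] < +oo :> \bar R)%E by rewrite diracT ltry.
have mf : mfun setT (fun z : R * (R * V) => b z.2 * \1_D z).
by apply: measurable_funM;[exact: (mcomp mb measurable_snd)|exact: measurable_indic].
have [|h _ _] := bounded_fubini (C := B) dirac_fin nf mf.
move=> z;rewrite normrM indicE;case: (_ \in _).
by rewrite normr1 mulr1.
by rewrite normr0 mulr0 (le_trans _ (bB z.2)).
move: h;congr mfun;apply/funext => t.
rewrite [RHS]Rintegral_mkcond;apply: eq_Rintegral => q _.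
by rewrite patchE indicE/= mem_xsection;case: ifP;rewrite (mulr1, mulr0).
Qed.
Let mdiff : mfun setT (fun z : R * (R * V) => z.1 - z.2.1).
Proof. by apply: measurable_funB => //;exact: (mcomp measurable_fst measurable_snd). Qed.

Lemma measurable_Rintegral_upto n b B : (n setT < +oo)%E -> mfun setT b ->
 (forall q, `|b q| <= B) ->
 mfun setT (fun t : R => \int[n]_(q in [set q | q.1 <= t]) b q).
move=> nf mb bB;pose D := [set z : R * (R * V) | z.2.1 <= z.1].
have mD : measurable D.
rewrite (_ : D = (fun z : R * (R * V) => z.1 - z.2.1) @^-1` `[0, +oo[%classic).
by rewrite -[X in measurable X]setTI;exact: (mdiff measurableT (measurable_itv _)).
by apply/seteqP;split => z;rewrite /D/= in_itv/= andbT subr_ge0.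
have := measurable_Rintegral_section nf mb bB mD.
congr mfun;apply/funext => t;congr Rintegral.
by apply/seteqP;split => q;rewrite /xsection/= inE.
Qed.

Lemma measurable_Rintegral_before n b B : (n setT < +oo)%E -> mfun setT b ->
 (forall q, `|b q| <= B) ->
 mfun setT (fun t : R => \int[n]_(q in [set q | q.1 < t]) b q).
move=> nf mb bB;pose D := [set z : R * (R * V) | z.2.1 < z.1].
have mD : measurable D.
rewrite (_ : D = (fun z : R * (R * V) => z.1 - z.2.1) @^-1` `]0, +oo[%classic).
by rewrite -[X in measurable X]setTI;exact: (mdiff measurableT (measurable_itv _)).
by apply/seteqP;split => z;rewrite /D/= in_itv/= andbT subr_gt0.
have := measurable_Rintegral_section nf mb bB mD.
congr mfun;apply/funext => t;congr Rintegral.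
by apply/seteqP;split => q;rewrite /xsection/= inE.
Qed.

(** Integration by parts: Fubini's theorem on the two halves of the product. *)
Lemma Rintegral_by_parts m n a b A B : (m setT < +oo)%E -> (n setT < +oo)%E ->
 mfun setT a -> mfun setT b ->
 (forall q, `|a q| <= A) -> (forall q, `|b q| <= B) ->
 (\int[m]_q a q) * (\int[n]_p b p) =
 \int[n]_p (b p * \int[m]_(q in [set q | q.1 < p.1]) a q) +
 \int[m]_q (a q * \int[n]_(p in [set p | p.1 <= q.1]) b p).
move=> mf nf ma mb aA bB.
have A0 : 0 <= A := le_trans (normr_ge0 _) (aA point).
have B0 : 0 <= B := le_trans (normr_ge0 _) (bB point).
have sw := Rintegral_swap mf nf ma mb aA bB mlt.
have E2 p : [set q : R * V | q.1 < p.1] = ysection [set z : (R * V) * (R * V) | z.1.1 < z.2.1] p.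
by apply/seteqP;split => q;rewrite /ysection/= inE.
rewrite [X in _ = X + _](_ : _ = \int[n]_y (b y *
\int[m]_(x in ysection [set z : (R * V) * (R * V) | z.1.1 < z.2.1] y) a x));last first.
by apply: eq_Rintegral => p _;rewrite E2.
rewrite -sw.
have int_ m' D (f : R * V -> R) C : (m' setT < +oo)%E -> measurable D -> mfun setT f ->
(forall q, `|f q| <= C) -> m'.-integrable D (EFin \o f).
move=> h mD mf' fC;apply: (@bounded_integrable _ _ _ m' D f C) => //.
exact: mfunTS.
have bd m' D (f : R * V -> R) C : (m' setT < +oo)%E -> measurable D -> mfun setT f ->
(forall q, `|f q| <= C) -> `|\int[m']_(q in D) f q| <= C * fine (m' setT).
move=> h mD mf' fC.
have C0 : 0 <= C := le_trans (normr_ge0 _) (fC point).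
apply: le_trans (Rintegral_bounded h mD (mfunTS mf') C0 (fun q _ => fC q)) _.
rewrite ler_wpM2l// fine_le ?ge0_fin_numE//;last by apply: le_measure;rewrite ?inE.
by apply: le_lt_trans h;apply: le_measure;rewrite ?inE.
have mle := measurable_Rintegral_upto nf mb bB.
have msec (q : R * V) : measurable (xsection [set z : (R * V) * (R * V) | z.1.1 < z.2.1] q).
exact: measurable_xsection.
have split q : \int[n]_p b p = \int[n]_(p in [set p | p.1 <= q.1]) b p +
\int[n]_(p in xsection [set z : (R * V) * (R * V) | z.1.1 < z.2.1] q) b p.
rewrite -Rintegral_setU//.
- congr Rintegral;apply/seteqP;split => // p _.
by rewrite /xsection/= inE/=;case: (leP p.1 q.1) => h;[left|right].
- exact: measurable_upto.
- by apply: (int_ n _ b B) => //;apply: measurableU => //;exact: measurable_upto.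
- apply/disj_setPS => p [];rewrite /xsection/= inE/=.
by rewrite leNgt => /negP h /h.
have mx : mfun setT (fun q => a q *
\int[n]_(p in xsection [set z : (R * V) * (R * V) | z.1.1 < z.2.1] q) b p).
apply: measurable_funM => //.
rewrite (_ : (fun q => _) = (fun q => \int[n]_p b p -
\int[n]_(p in [set p | p.1 <= q.1]) b p));last first.
by apply/funext => q;rewrite [in RHS](split q) addrC addKr.
apply: measurable_funB => //.
exact: (mcomp mle measurable_fst).
rewrite -RintegralD//.
- rewrite mulrC -RintegralZl//;last exact: (int_ m _ a A).
by apply: eq_Rintegral => q _;rewrite -mulrDr addrC -split mulrC.
- apply: (int_ m _ _ (A * (B * fine (n setT)))) => // q.
by rewrite normrM ler_pM// bd.
- apply: (int_ m _ _ (A * (B * fine (n setT)))) => //.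
by apply: measurable_funM => //;exact: (mcomp mle measurable_fst).
move=> q;rewrite normrM ler_pM// bd//;exact: measurable_upto.
Qed.

Lemma Rintegral_upto_left m a A t : (m setT < +oo)%E -> mfun setT a ->
 (forall q, `|a q| <= A) ->
 \int[m]_(q in [set q | q.1 <= s]) a q @[s --> t^'-] -->
 \int[m]_(q in [set q | q.1 < t]) a q.
move=> mf ma aA;apply/cvg_at_leftP => u [ut cu].
have i D : measurable D -> m.-integrable D (EFin \o a).
move=> mD;apply: (bounded_integrable (B := A)) => //;exact: mfunTS.
have fE D : measurable D -> (\int[m]_q (a \_ D q)%:E = (\int[m]_(q in D) a q)%:E)%E.
move=> mD;rewrite /Rintegral fineK ?integrable_fin_num//;last exact: i.
rewrite [RHS]integral_mkcond;apply: eq_integral => q _.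
by rewrite !patchE;case: ifP.
have mr D : measurable D -> mfun setT (fun q => (a \_ D q)%:E).
move=> mD;apply/mEFinP;apply/(measurable_restrict _ mD) => //.
exact: mfunTS.
have A0 : 0 <= A := le_trans (normr_ge0 _) (aA point).
suff h : (\int[m]_(q in [set q | q.1 <= u k]) a q)%:E @[k --> \oo] -->
(\int[m]_(q in [set q | q.1 < t]) a q)%:E by move/fine_cvgP : h => [].
rewrite (_ : (fun k => _) = (fun k => \int[m]_q (a \_ [set q | q.1 <= u k] q)%:E)%E);last first.
by apply/funext => k;rewrite fE//;exact: measurable_upto.
rewrite -fE;last exact: measurable_before.
apply: (@dominated_cvg _ _ _ m setT measurableT _ _ (cst A%:E)) => //.
- by move=> k;apply: mr;exact: measurable_upto.
- move=> q _;apply: cvg_EFin;first by near=> k.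
apply: cvg_near_cst;rewrite /comp/= !patchE.
have [qt|tq] := ltP q.1 t.
rewrite mem_set//;near=> k;rewrite patchE mem_set//=;apply: ltW.
by near: k;exact: cvgr_gt cu _ qt.
rewrite memNset;last by rewrite /= ltNge tq.
near=> k;rewrite patchE memNset//= => qu.
by have := lt_le_trans (ut k) (le_trans tq qu);rewrite ltxx.
- apply: (@bounded_integrable _ _ _ m setT (cst A) A) => // q _.
by rewrite ger0_norm.
- move=> k q _;rewrite lee_fin patchE;case: ifP => _ //.
by rewrite normr0.
Unshelve. all: by end_near. Qed.

End by_parts.

Section linear_path_values.
Context {R : realType} {dV} {V : mtype dV}.
Variables (s : nat -> \bar R) (y : nat -> V) (N : nat).
Hypotheses (s_gt0 : forall n, (0 < s n)%E)
 (sN : forall n, (N <= n)%N -> s n = +oo%E)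
 (s_inj : forall n k, (s n < +oo)%E -> s n = s k -> n = k).
Variables (m : jump_measure R V) (V0 : set V) (T : R).
Hypotheses (m_fin : (m setT < +oo)%E)
 (mV0 : measurable V0)
 (m_off : m (~` (`]0, T] `*` setT)) = 0%E)
 (atomless : forall t, m ([set t] `*` V0) = 0%E).
Variables (M c : R) (rho : R -> V -> R) (l p : R -> R).
Hypotheses (T_ge0 : 0 <= T)
 (mrho : mfun setT (fun q : R * V => rho q.1 q.2))
 (rhoM : forall t x, 0 < t <= T -> 0 <= rho t x <= M)
 (rho_off : forall t x, ~ V0 x -> rho t x = 1)
 (mp : mfun setT p).
Local Notation mu := (points s y).
Hypothesis lin : solves_linear mu m p rho c T l.

Definition integrand (q : R * V) : R :=
 if 0 < q.1 <= T then p q.1 * (rho q.1 q.2 - 1) else 0.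
Local Notation a := integrand.
Let mT : measurable (`]0, T] `*` setT : set (R * V)).
Proof. exact: measurableX. Qed.

Lemma measurable_integrand : mfun setT a.
have m1 : mfun setT (fun q : R * V => p q.1 * (rho q.1 q.2 - 1)).
by apply: measurable_funM;[exact: (mcomp mp measurable_fst)|exact: measurable_funB].
have := measurable_fun_cond (0 : R) mT (mfunTS m1).
congr mfun;apply/funext => q;rewrite /integrand.
have -> : `[< (`]0, T] `*` setT) q >] = (0 < q.1 <= T).
by apply/asboolP/idP => [[/=]|h];[rewrite in_itv|split => //=;rewrite in_itv].
by [].
Qed.

Lemma integrand_bounded : exists A, forall q, `|a q| <= A.
have [cl pl _] := lin;have [B hB] := cadlag_bounded T_ge0 cl.
have pB := cadlag_left_lim_bounded cl hB.
have B0 : 0 <= B by apply: le_trans (hB 0 _);rewrite ?lexx.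
exists (B * (`|M| + 1)) => q;rewrite /integrand;case: ifPn => [qT|_].
rewrite normrM ler_pM//;first by rewrite pl// pB.
have /andP[r0 rM] := rhoM q.2 qT.
rewrite (le_trans (ler_normB _ _))// normr1 lerD2r ger0_norm// (le_trans rM)// ler_norm//.
by rewrite normr0 mulr_ge0// addr_ge0.
Qed.

Lemma points_measure_fin : (mu setT < +oo)%E.
have := @ge0_integral_finite_points _ _ _ s y N s_gt0 sN (cst 1) (measurable_cst _)
(fun=> ler01).
by rewrite (eq_integral (cst 1%E))// integral_cst// mul1e => ->;rewrite ltry.
Qed.
Let integrable_a (n : jump_measure R V) D : (n setT < +oo)%E -> measurable D ->
 n.-integrable D (EFin \o a).
move=> nf mD;have [A aA] := integrand_bounded.
apply: (bounded_integrable (B := A)) => //.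
by apply: mfunTS;exact: measurable_integrand.
Qed.
Let interval_a (n : jump_measure R V) t : t <= T ->
 \int[n]_(q in `]0, t] `*` setT) (p q.1 * (rho q.1 q.2 - 1)) =
 \int[n]_(q in [set q | q.1 <= t]) a q.
move=> tT;rewrite [LHS]Rintegral_mkcond [RHS]Rintegral_mkcond.
apply: eq_Rintegral => q _;rewrite !patchE /integrand.
case: ifPn => [/set_mem[/=]|h].
rewrite in_itv/= => /andP[q0 qt] _;rewrite mem_set//= q0/=.
by rewrite (le_trans qt tT).
case: ifPn => // /set_mem/= qt;case: ifPn => // /andP[q0 _].
by move/negP: h;case;apply/mem_set;split => //=;rewrite in_itv/= q0.
Qed.

Lemma linear_path_value t : 0 <= t <= T -> l t = c +
 \int[mu]_(q in [set q | q.1 <= t]) a q - \int[m]_(q in [set q | q.1 <= t]) a q.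
move=> tT;have [_ _ le] := lin;rewrite le// /compensated_integral addrA.
by case/andP: tT => _ tT;rewrite !interval_a.
Qed.

Lemma linear_path_left t : 0 < t <= T -> p t = c +
 \int[mu]_(q in [set q | q.1 < t]) a q - \int[m]_(q in [set q | q.1 < t]) a q.
move=> tT;have /andP[t0 tT'] := tT.
have [cl pl _] := lin;have [A aA] := integrand_bounded.
have ma := measurable_integrand.
rewrite pl//;apply: cvg_lim => //.
apply: (@cvg_trans _ ((c + \int[mu]_(q in [set q | q.1 <= r]) a q -
\int[m]_(q in [set q | q.1 <= r]) a q) @[r --> t^'-])).
apply: near_eq_cvg;near=> r;rewrite linear_path_value//.
apply/andP;split;first by near: r;exact: nbhs_left_ge.
by apply: (@le_trans _ _ t).
apply: cvgB;last exact: Rintegral_upto_left aA.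
by apply: cvgD;[exact: cvg_cst|exact: (Rintegral_upto_left points_measure_fin ma aA)].
Unshelve. all: by end_near. Qed.

Lemma linear_path_terminal : l T = c + \int[mu]_q a q - \int[m]_q a q.
rewrite linear_path_value ?T_ge0 ?lexx//;congr (_ + _ - _);
rewrite Rintegral_mkcond;apply: eq_Rintegral => q _;rewrite patchE;
case: ifPn => // /negP h;rewrite /integrand;case: ifPn => // /andP[_ qT];
by exfalso;apply: h;rewrite inE.
Qed.

Lemma linear_path_jump n : (s n < +oo)%E -> fine (s n) <= T ->
 l (fine (s n)) = p (fine (s n)) * rho (fine (s n)) (y n).
move=> sn;set t := fine (s n) => tT.
have snE : s n = t%:E by rewrite fineK// gt0_fin_numE.
have t0 : 0 < t by rewrite -lte_fin -snE.
have uE (k : jump_measure R V) : (k setT < +oo)%E ->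
\int[k]_(q in [set q | q.1 <= t]) a q = \int[k]_(q in [set q | q.1 < t]) a q +
\int[k]_(q in [set t] `*` setT) a q.
move=> kf;have E : [set q : R * V | q.1 <= t] = [set q | q.1 < t] `|` ([set t] `*` setT).
apply/seteqP;split => q /=.
by rewrite le_eqVlt => /orP[/eqP|];[right|left].
by move=> [/ltW//|[-> _]].
rewrite E;apply: Rintegral_setU => //.
- exact: measurable_before.
- exact: measurableX.
- by apply: integrable_a => //;rewrite -E;exact: measurable_upto.
- by apply/disj_setPS => q [/= qt [qt' _]];move: qt;rewrite qt' ltxx.
rewrite linear_path_value ?(ltW t0)// !uE//;last exact: points_measure_fin.
have -> : \int[m]_(q in [set t] `*` setT) a q = 0.
rewrite Rintegral_mkcond (_ : \int[m]_x _ = \int[m]_(q in [set t] `*` V0) a q).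
have [A aA] := integrand_bounded.
have mt : measurable ([set t] `*` V0 : set (R * V)) by exact: measurableX.
apply/eqP;rewrite -normr_le0.
have A0 : 0 <= A := le_trans (normr_ge0 _) (aA point).
have := Rintegral_bounded m_fin mt (mfunTS measurable_integrand) A0
(fun q _ => aA q).
by rewrite atomless/= mulr0.
rewrite [RHS]Rintegral_mkcond;apply: eq_Rintegral => -[u x] _;rewrite !patchE.
rewrite !in_setX in_setT andbT;case: ifPn => // _;case: ifPn => //= /negP h.
rewrite /integrand/= rho_off ?subrr ?mulr0;first by case: ifP.
by move=> Vx;apply: h;rewrite inE.
have -> : \int[mu]_(q in [set t] `*` setT) a q = p t * (rho t (y n) - 1).
rewrite Rintegral_mkcond (Rintegral_finite_points _ s_gt0 sN);last first.
have mt : measurable ([set t] `*` setT : set (R * V)) by exact: measurableX.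
apply/(measurable_restrict _ mt) => //;apply: mfunTS.
exact: measurable_integrand.
have nN : (n < N)%N by rewrite ltnNge;apply/negP => /sN h;rewrite h in sn.
rewrite (bigD1 (Ordinal nN))//= sn mul1r patchE mem_set//= -/t /integrand/= t0 tT/=.
rewrite big1 ?addr0// => k kn;rewrite patchE;case: (boolP (_ \in _));rewrite ?mulr0//.
rewrite inE/= => -[skt _];case: (boolP (s k < +oo)%E);rewrite ?mul0r// => sk.
exfalso;move/eqP: kn;apply;apply/val_inj/esym => /=;apply: s_inj => //.
by rewrite snE -skt fineK// gt0_fin_numE.
have := linear_path_left (t := t);rewrite t0 => /(_ tT).
set I1 := \int[mu]_(_ in _) _;set I2 := \int[m]_(_ in _) _ => pE.
by move: pE;move: (p t) (rho t (y n)) I1 I2 => x r0 i j ->;ring.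
Qed.

Lemma linear_path_by_parts (b : R * V -> R) B : mfun setT b ->
 (forall q, `|b q| <= B) ->
 l T * \int[m]_q b q - \int[m]_q (p q.1 * b q) =
 \int[mu]_q (a q * \int[m]_(r in [set r | r.1 <= q.1]) b r) -
 \int[m]_q (a q * \int[m]_(r in [set r | r.1 <= q.1]) b r).
move=> mb bB;have [A aA] := integrand_bounded.
have ma := measurable_integrand;have muf := points_measure_fin.
have h1 := Rintegral_by_parts muf m_fin ma mb aA bB.
have h2 := Rintegral_by_parts m_fin m_fin ma mb aA bB.
have A0 : 0 <= A := le_trans (normr_ge0 _) (aA point).
have B0 : 0 <= B := le_trans (normr_ge0 _) (bB point).
have mB (k : jump_measure R V) : (k setT < +oo)%E -> mfun setT
(fun q : R * V => b q * \int[k]_(r in [set r | r.1 < q.1]) a r).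
move=> kf;apply: measurable_funM => //.
exact: (mcomp (measurable_Rintegral_before kf ma aA) measurable_fst).
have iB (k : jump_measure R V) : (k setT < +oo)%E -> m.-integrable setT
(EFin \o (fun q : R * V => b q * \int[k]_(r in [set r | r.1 < q.1]) a r)).
move=> kf;apply: (bounded_integrable (B := B * (A * fine (k setT)))) => //;first exact: mB.
move=> q _;rewrite normrM ler_pM//.
apply: le_trans (Rintegral_bounded kf (measurable_before q.1) (mfunTS ma) A0
(fun q _ => aA q)) _.
rewrite ler_wpM2l// fine_le ?ge0_fin_numE//.
- by apply: le_lt_trans kf;apply: le_measure;rewrite ?inE//;exact: measurable_before.
- by apply: le_measure;rewrite ?inE//;exact: measurable_before.
have ib : m.-integrable setT (EFin \o b) by apply: (bounded_integrable (B := B)).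
have -> : \int[m]_q (p q.1 * b q) = c * \int[m]_q b q +
\int[m]_q (b q * \int[mu]_(r in [set r | r.1 < q.1]) a r) -
\int[m]_q (b q * \int[m]_(r in [set r | r.1 < q.1]) a r).
have icb : m.-integrable setT (EFin \o (fun q => c * b q)).
by have := integrableZl measurableT c ib.
rewrite -RintegralZl// -RintegralD//;last exact: iB.
rewrite -RintegralB//;[|by have := integrableD measurableT icb (iB _ muf)|exact: iB].
have off : m.-negligible (~` (`]0, T] `*` setT)).
by exists (~` (`]0, T] `*` setT));split => //;exact: measurableC.
congr fine;apply: ae_eq_nm;exists (~` (`]0, T] `*` setT));split => //.
exact: measurableC.
apply: subsetC => q [/=];rewrite in_itv/= => qT _.
by rewrite (linear_path_left qT);congr (_%:E);ring.
rewrite linear_path_terminal.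
move: h1 h2.
set x1 := \int[mu]_q a q;set x2 := \int[m]_q a q;set x3 := \int[m]_q b q.
set x4 := \int[m]_q (b q * _);set x5 := \int[mu]_q _.
set x6 := \int[m]_q (b q * _);set x7 := \int[m]_q _ => h1 h2.
by rewrite !mulrDl mulNr h1 h2;ring.
Qed.

End linear_path_values.

Lemma normM_le_sq {R : realType} (p r B M c : R) : 0 <= B -> 0 <= M -> `|r| <= M ->
 0 <= c -> `|p * r| * (B * c) <= B * M * (p ^+ 2 + c ^+ 2).
move=> B0 M0 rM c0;rewrite normrM.
have -> : `|p| * `|r| * (B * c) = `|r| * (B * (`|p| * c)) by ring.
have -> : B * M * (p ^+ 2 + c ^+ 2) = M * (B * (p ^+ 2 + c ^+ 2)) by ring.
rewrite ler_pM ?mulr_ge0// ler_wpM2l// -(real_normK (num_real p)).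
move: (`|p|) (normr_ge0 p) => z z0;have := sqr_ge0 (z - c).
by have := sqr_ge0 z;have := sqr_ge0 c;nra.
Qed.

Section change_of_measure.
Context {R : realType} {dO} {Omega : mtype dO} {P : probability Omega R}
 {Gl : R -> set (set Omega)} {T : R} {dV} {V : mtype dV} {V0 : set V}
 {sg : nat -> Omega -> \bar R} {ze : nat -> Omega -> V}
 {nu : Omega -> jump_measure R V}
 {M : R} {rho : Omega -> R -> V -> R} {pm L : Omega -> R -> R}.
Hypothesis dp : density_process P Gl T V0 sg ze nu M rho pm L.
Let cp := dp_points dp.
Let fG := cp_filtration cp.
Let T_gt0 : 0 < T := cp_T cp.
Local Notation mu w := (points (sg^~ w) (ze^~ w)).
Local Notation PS := (pspace Gl).
Local Notation Ct w := (fine (nu w setT)).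
Local Notation a w := (integrand T (rho w) (pm w)).
Implicit Types W H : Omega -> R -> V -> R.
Let field_integrand : pfield Gl (fun w t x => a w (t, x)).
have mI : measurable [set q : PS * V | 0 < q.1.2 <= T].
rewrite (_ : [set _ | _] = (fun q : PS * V => ((0 < q.1.2 <= T)%R)%:R : R) @^-1` [set 1]).
rewrite -[X in measurable X]setTI.
exact: (field_process (V := V) (process_interval fG T) measurableT).
apply/seteqP;split => q /=;first by move=> ->.
by case: (0 < q.1.2 <= T) => // /esym/eqP;rewrite oner_eq0.
have m1 : pfield Gl (fun w t x => pm w t * (rho w t x - 1)).
apply: measurable_funM;first exact: field_process (dp_left dp).
by apply: measurable_funB => //;exact: dp_factor dp.
have := measurable_fun_cond (0 : R) mI (mfunTS m1).
congr mfun;apply/funext => q;rewrite /integrand/=.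
by case: (boolP (0 < q.1.2 <= T)) => h;[rewrite asboolT|rewrite asboolF//;exact/negP].
Qed.
Let path_ae : {ae P, forall w, [/\ (nu w setT < +oo)%E,
 (forall n k, (sg n w < +oo)%E -> sg n w = sg k w -> n = k),
 (forall t, nu w ([set t] `*` V0) = 0%E),
 (forall t x, 0 < t <= T -> 0 <= rho w t x <= M) &
 solves_linear (mu w) (nu w) (pm w) (rho w) 1 T (L w)]}.
apply: filterS3 (filterI (cp_bounded cp) (cp_inj cp))
(filterI (cp_atomless cp) (dp_factor_le dp)) (dp_linear dp).
by move=> w [? ?] [? ?] ?.
Qed.
Let mrw w : mfun setT (fun q : R * V => rho w q.1 q.2).
Proof. exact: field_path w (dp_factor dp). Qed.
Let mpw w : mfun setT (pm w).
Proof. exact: process_path w (dp_left dp). Qed.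

(** All fields that are compensated below are dominated by
  [a w q * B * (1 + Ct w)], which the moment estimate makes integrable. *)
Lemma dominated_field_integrable H B : 0 <= B -> pfield Gl H ->
 {ae P, forall w, forall t x, `|H w t x| <= `|a w (t, x)| * (B * (1 + Ct w))} ->
 (\int[P]_w \int[nu w]_q `|H w q.1 q.2|%:E < +oo)%E.
move=> B0 mH HB;have [D [mD D0 Dfin hD]] := density_moments dp.
have M0 : 0 <= M by rewrite (le_trans _ (ltW (dp_gt1 dp))).
apply: (@le_lt_trans _ _ (\int[P]_w ((B * M * 2)%:E * D w))%E);last first.
rewrite ge0_integralZl_EFin//;last by rewrite !mulr_ge0.
by rewrite lte_mul_pinfty// ?lee_fin ?mulr_ge0.
have BM0 : 0 <= B * M by rewrite mulr_ge0.
apply: ge0_ae_le_nm => //.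
- by move=> w;exact: integral_ge0.
- by move=> w;rewrite mule_ge0// lee_fin !mulr_ge0.
apply: filterS3 HB hD path_ae => w hw [_ pD CD] [fin _ _ rw _].
have C0 : 0 <= Ct w by rewrite fine_ge0.
have mTV : measurable (setT `*` V0 : set (R * V)) by exact: measurableX (cp_V0 cp).
have mpq : mfun setT (fun q : R * V => pm w q.1).
exact: (mcomp (mpw w) measurable_fst).
pose f (q : R * V) : R := (B * M) * ((pm w q.1 ^+ 2 + (1 + Ct w) ^+ 2) * \1_(setT `*` V0) q).
have f0 q : 0 <= f q.
by rewrite /f !mulr_ge0// addr_ge0 ?sqr_ge0.
have mf1 : mfun setT (fun q : R * V => (pm w q.1 ^+ 2 + (1 + Ct w) ^+ 2)).
by apply: measurable_funD => //;exact: measurable_funX.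
apply: (@le_trans _ _ (\int[nu w]_q (f q)%:E)%E).
apply: ge0_ae_le_nm => //;apply: aeW => -[t x];rewrite lee_fin.
apply: le_trans (hw t x) _;rewrite /f /integrand/=.
have r0 : 0 <= (B * M) * ((pm w t ^+ 2 + (1 + Ct w) ^+ 2) * \1_(setT `*` V0) (t, x)).
exact: (f0 (t, x)).
case: ifPn => [tT|_];last by rewrite normr0 mul0r.
have [Vx|Vx] := pselect (V0 x);last by rewrite (dp_off dp)// subrr mulr0 normr0 mul0r.
rewrite indicE mem_set// mulr1.
have /andP[ra rb] := rw t x tT;have M1 := dp_gt1 dp.
have rM : `|rho w t x - 1| <= M by rewrite ler_norml;lra.
by apply: normM_le_sq => //;rewrite addr_ge0.
have BMp : (0 <= (B * M)%:E)%E by rewrite lee_fin.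
rewrite /f;under eq_integral do rewrite EFinM.
rewrite ge0_integralZl_EFin//;last 2 first.
- by move=> q _;rewrite lee_fin mulr_ge0// addr_ge0 ?sqr_ge0.
- by apply/mEFinP;apply: measurable_funM => //;exact: measurable_indic.
rewrite [X in (_ <= X * _)%E]EFinM -[leRHS]muleA lee_wpmul2l//.
rewrite (_ : (\int[nu w]_q _ = \int[nu w]_(q in setT `*` V0)
((pm w q.1 ^+ 2)%:E + ((1 + Ct w) ^+ 2)%:E))%E);last first.
rewrite [RHS]integral_mkcond;apply: eq_integral => q _;rewrite patchE indicE.
by case: ifP => _;rewrite (mulr1, mulr0).
rewrite ge0_integralD//;last 2 first.
- by move=> q _;rewrite lee_fin sqr_ge0.
- by apply: mfunTS;apply/mEFinP;exact: measurable_funX.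
rewrite [(2%:E * _)%E](_ : _ = D w + D w)%E;last first.
by rewrite mule_natl mule2n.
rewrite leeD// integral_cst//;apply: le_trans CD.
have -> : (1 + Ct w) ^+ 3 = (1 + Ct w) ^+ 2 * (1 + Ct w) by rewrite -exprSr.
rewrite [leRHS]EFinM;apply: lee_wpmul2l;first by rewrite lee_fin sqr_ge0.
apply: (@le_trans _ _ (nu w setT));first by apply: le_measure;rewrite ?inE.
rewrite -[leLHS]fineK ?ge0_fin_numE// lee_fin;lra.
Qed.

(** Optional stopping between [sig] and [T]: the difference of the two values is
  the compensated integral over the times after [sig]. *)
Lemma density_optional_stopping (sig : Omega -> \bar R) (z : Omega -> R) B :
 stopping_time Gl sig ->
 (forall A, measurable A -> stopped_sigma_algebra Gl sig (z @^-1` A)) ->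
 (forall w, `|z w| <= B) ->
 exists Q : Omega -> R, [/\ P.-integrable setT (EFin \o Q),
 (\int[P]_w (Q w)%:E = 0)%E &
 {ae P, forall w, Q w =
 if (sig w <= T%:E)%E then z w * (L w T - L w (fine (sig w))) else 0}].
move=> ss mz zB;pose H w t x := (if (sig w < t%:E)%E then z w else 0) * a w (t, x).
have mH : pfield Gl H.
apply: measurable_funM;last exact: field_integrand.
exact: field_process (process_after fG ss mz).
have [w0|w0] := pselect (exists w0 : Omega, True);last first.
exists (fun=> 0);split.
- exact: finite_measure_integrable_cst.
- by rewrite integral0.
- by apply: aeW => w;exfalso;apply: w0;exists w.
have B0 : 0 <= B by case: w0 => w _;exact: le_trans (zB w).
have Hfin := dominated_field_integrable B0 mH.
have [|iQ EQ] := compensated_integral_centred cp mH.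
apply: Hfin;apply: aeW => w t x;rewrite /H normrM mulrC ler_wpM2l//.
rewrite mulrDr mulr1 ler_wpDr// ?mulr_ge0// ?fine_ge0//.
by case: ifP => _;rewrite ?normr0.
exists (fun w => \int[mu w]_q H w q.1 q.2 - \int[nu w]_q H w q.1 q.2);split => //.
apply: filterS path_ae => w [fin inj atl rw lw].
have [N hN] := cp_finite cp w.
have T0 : 0 <= T := ltW T_gt0.
have [A aA] := integrand_bounded T0 rw lw.
have ma := measurable_integrand T (mrw w) (mpw w).
have muf : (mu w setT < +oo)%E := points_measure_fin _ (cp_gt0 cp ^~ w) hN.
case: ifPn => [sT|Ts];last first.
have H0 q : H w q.1 q.2 = 0.
rewrite /H /integrand/=;case: ifPn => sq;last by rewrite mul0r.
case: ifPn => [/andP[_ qT]|];rewrite ?mulr0//.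
move: Ts;rewrite -ltNge => /lt_trans/(_ sq).
by rewrite lte_fin ltNge qT.
have z0 (k : jump_measure R V) : \int[k]_q H w q.1 q.2 = 0.
rewrite (_ : \int[k]_q _ = \int[k]_q (0 : R));last by apply: eq_Rintegral.
by rewrite Rintegral_cst// mul0r.
by rewrite !z0 subrr.
have [s sE] : exists s, sig w = s%:E.
by move: sT (ss.1 w);case: (sig w) => // s _ _;exists s.
have s0 : 0 <= s by rewrite -lee_fin -sE;exact: ss.1.
have sT' : s <= T by rewrite -lee_fin -sE.
rewrite sE/= (linear_path_terminal T0 lw).
rewrite (linear_path_value lw) ?s0//.
have part (k : jump_measure R V) : (k setT < +oo)%E ->
\int[k]_q H w q.1 q.2 =
z w * (\int[k]_q a w q - \int[k]_(q in [set q | q.1 <= s]) a w q).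
move=> kf;have ik D : measurable D -> k.-integrable D (EFin \o a w).
by move=> mD;apply: (bounded_integrable (B := A)) => //;exact: mfunTS.
have mc : measurable (~` [set q : R * V | q.1 <= s]).
by apply: measurableC;exact: measurable_upto.
have -> : \int[k]_q a w q = \int[k]_(q in [set q | q.1 <= s]) a w q +
\int[k]_(q in ~` [set q | q.1 <= s]) a w q.
rewrite -Rintegral_setU ?setUv//;first exact: measurable_upto.
- exact: ik.
- by apply/disj_setPS => q [].
rewrite addrC addKr -RintegralZl//;last exact: ik.
rewrite [RHS]Rintegral_mkcond;apply: eq_Rintegral => -[t x] _.
rewrite patchE /H sE lte_fin/=;case: (ltP s t) => st.
by rewrite mem_set//=;apply/negP;rewrite -ltNge.
by rewrite memNset ?mul0r//=;apply.
rewrite !part//.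
set x1 := \int[_]_q a w q;set x2 := \int[_]_(_ in _) _;set x3 := \int[_]_q a w q.
set x4 := \int[_]_(_ in _) _;ring.
Qed.

Lemma density_terminal_integrable : P.-integrable setT (fun w => (L w T)%:E).
have [D [mD D0 Dfin hD]] := density_moments dp.
apply/integrableP;split.
by apply/mEFinP;exact: terminal_measurable dp.
apply: (@le_lt_trans _ _ (\int[P]_w (1 + D w))%E);last first.
rewrite ge0_integralD// lte_add_pinfty// integral_cst// mul1e.
by rewrite [X in (X < _)%E]probability_setT ltry.
apply: ge0_ae_le_nm => //;first by move=> w;rewrite adde_ge0.
apply: filterS hD => w [LD _ _].
apply: (@le_trans _ _ (1 + (L w T ^+ 2)%:E)%E);last by rewrite leeD2l.
rewrite -EFinD lee_fin -(real_normK (num_real (L w T))).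
by move: (`|L w T|) => x;have := sqr_ge0 (x - 1);have := sqr_ge0 x;nra.
Qed.

Lemma density_path_ge0 : {ae P, forall w, forall t, 0 <= t <= T -> 0 <= L w t}.
have rat_ae (q : rat) : {ae P, forall w, 0 <= (ratr q : R) <= T -> 0 <= L w (ratr q)}.
have [qT|qT] := boolP (0 <= (ratr q : R) <= T);last by apply: aeW => w.
have /andP[q0 qT'] := qT.
pose z w : R := (L w (ratr q) < 0)%R%:R.
have [|||Q [iQ EQ QE]] := @density_optional_stopping (fun=> (ratr q)%:E) z 1.
- exact: stopping_time_cst fG _ q0.
- move=> A mA;have SG : Gl (ratr q) [set w | L w (ratr q) < 0].
have /adapted_onP := dp_adapted dp.
move=> /(_ fG) h.
have mI : measurable (`]-oo, 0[%classic : set R) by exact: measurable_itv.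
have := h (fun t => ltac:(by rewrite /= in_itv/= => /andP[])) (ratr q) _
(ltac:(by rewrite /= in_itv/= q0)) mI.
congr (Gl _);apply/seteqP;split => w;by rewrite /= in_itv/=.
have zG : Gl (ratr q) (z @^-1` A).
rewrite -(filtrationE fG q0) -[X in measurable X]setTI.
have SG' : measurable ([set w | L w (ratr q) < 0] : set (g_sigma_algebraType (Gl (ratr q)))).
by rewrite (filtrationE fG q0).
have := @measurable_indic _ _ R setT _ SG' measurableT _ mA.
congr (measurable (_ `&` _));apply/seteqP;split => w /=;rewrite /z indicE;
by case: (ltP (L w (ratr q)) 0) => h;[rewrite mem_set|rewrite memNset// /= ltNge h].
split;first exact: (filtrationM fG q0 zG).
move=> t t0;case: (leP (ratr q) t) => qt.
rewrite (_ : [set w | _] = setT) ?setIT;last by apply/seteqP;split => // w _;rewrite /= lee_fin.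
by case: fG => _ _;apply;last exact: zG.
rewrite (_ : [set w | _] = set0) ?setI0;last first.
by apply/seteqP;split => // w;rewrite /= lee_fin leNgt qt.
exact: filtration0.
- by move=> w;rewrite /z;case: (_ < _);rewrite ?normr1 ?normr0.
have Q0 : {ae P, forall w, 0 <= Q w}.
apply: filterS2 QE (dp_ge0 dp) => w -> LT;rewrite lee_fin qT'/=.
rewrite /z;case: ltP => [lq|_];last by rewrite mul0r.
by rewrite mul1r subr_ge0 (le_trans (ltW lq)).
have : {ae P, forall w, Q w = 0}.
have : (\int[P]_w `|(Q w)%:E| = 0)%E.
rewrite -EQ;apply: ae_eq_nm;apply: filterS Q0 => w Qw.
by rewrite gee0_abs// lee_fin.
move=> /(ae_eq_integral_abs P measurableT (measurable_int _ iQ)).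
by apply: filterS => w /(_ Logic.I) [].
apply: filterS3 QE (dp_ge0 dp) => w -> LT;rewrite lee_fin qT'/= /z => h _.
rewrite leNgt;apply/negP => lq;move: h;rewrite lq mul1r => /eqP.
rewrite subr_eq0 => /eqP LE;move: lq;rewrite -LE ltNge LT//.
have all_ae : {ae P, forall w, forall q : rat, 0 <= (ratr q : R) <= T -> 0 <= L w (ratr q)}.
have : {ae P, forall w, forall n, if @unpickle rat n is Some q then
0 <= (ratr q : R) <= T -> 0 <= L w (ratr q) else True}.
by apply/ae_foralln => n;case: unpickle => [q|];[exact: rat_ae|exact: aeW].
by apply: filterS => w h q;have := h (pickle q);rewrite pickleK.
apply: filterS3 all_ae path_ae (dp_ge0 dp) => w qw [_ _ _ _ [[lr _] _ _]] LT t /andP[t0 tT].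
move: tT;rewrite le_eqVlt => /orP[/eqP->//|tT].
rewrite leNgt;apply/negP => lt0.
have : \forall r \near t^'+, L w r < 0.
by apply: (cvgr_lt (L w t)) => //;apply: lr;rewrite t0.
move=> /near_right_ex[e e0 he].
have tm : t < Num.min (t + e) T by rewrite lt_min tT andbT ltrDl.
have [q] := rat_in_itvoo tm.
rewrite in_itv/= lt_min => /andP[tq /andP[qe qT]].
have := he (ratr q) (ltac:(by apply/andP;split)).
by rewrite ltNge qw// (ltW qT) andbT (le_trans t0)// ltW.
Qed.

Lemma density_left_ge0 : {ae P, forall w, forall t, 0 < t <= T -> 0 <= pm w t}.
apply: filterS2 density_path_ge0 path_ae => w Lw [_ _ _ _ [cl pl _]] t tT.
rewrite pl//;have h := cadlag_left_lim cl tT;have /andP[t0 tT'] := tT.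
apply: (cvgr_to_ge h);near=> r;apply: Lw;apply/andP;split.
by near: r;exact: nbhs_left_ge.
by apply: (@le_trans _ _ t).
Unshelve. all: by end_near. Qed.

Local Notation pp w t := (Num.max (pm w t) 0).
Local Notation LT w := (Num.max (L w T) 0).

Lemma predictable_left_pos : pprocess Gl (fun w t => pp w t).
Proof. by apply: measurable_maxr => //;exact: dp_left dp. Qed.
Let measurable_LTr : mfun setT (fun w => LT w).
Proof. by apply: measurable_maxr => //;exact: terminal_measurable dp. Qed.
Let measurable_LT : mfun setT (fun w => (LT w)%:E).
Proof. exact/mEFinP. Qed.
Let LT0' w : 0 <= LT w. Proof. by rewrite le_max lexx orbT. Qed.
Let LT0 w : (0 <= (LT w)%:E)%E. Proof. by rewrite lee_fin le_max lexx orbT. Qed.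
Let pp0 w t : 0 <= pp w t. Proof. by rewrite le_max lexx orbT. Qed.

Section bounded_field.
Variables (W : Omega -> R -> V -> R) (B : R).
Hypotheses (mW : pfield Gl W)
 (B0 : 0 <= B)
 (WB : forall w t x, 0 <= W w t x <= B).
Let W0 w t x : (0 <= (W w t x)%:E)%E.
Proof. by rewrite lee_fin;case/andP: (WB w t x). Qed.
Let mWE : pfield Gl (fun w t x => (W w t x)%:E).
Proof. exact/mEFinP. Qed.

Lemma predictable_projection_bounded :
 (\int[P]_w ((LT w)%:E * \int[nu w]_q (W w q.1 q.2)%:E) =
 \int[P]_w \int[nu w]_q ((pp w q.1)%:E * (W w q.1 q.2)%:E))%E.
pose A w t := fine (\int[nu w]_(q in `]0%R, t] `*` setT) (W w q.1 q.2)%:E)%E.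
have mA : pprocess Gl A.
by apply: (@mcomp _ _ _ _ _ _ fine) => //;exact: cp_predictable cp _ mWE W0.
pose H w t x := a w (t, x) * A w t.
have mH : pfield Gl H.
apply: measurable_funM;first exact: field_integrand.
exact: field_process mA.
have Wpath w : mfun setT (fun q : R * V => W w q.1 q.2).
exact: field_path w mW.
have WBn w q : `|W w q.1 q.2| <= B.
by have /andP[h0 h1] := WB w q.1 q.2;rewrite ger0_norm.
have HB : {ae P, forall w, forall t x, `|H w t x| <= `|a w (t, x)| * (B * (1 + Ct w))}.
apply: filterS path_ae => w [fin _ _ _ _] t x;rewrite /H normrM ler_wpM2l//.
have mX : measurable (`]0, t] `*` setT : set (R * V)).
exact: measurableX.
have := Rintegral_bounded fin mX (mfunTS (Wpath w)) B0 (fun q _ => WBn w q).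
move=> /le_trans;apply;rewrite ler_wpM2l//.
have : fine (nu w (`]0, t] `*` setT)) <= Ct w;last by lra.
rewrite fine_le ?ge0_fin_numE//;last by apply: le_measure;rewrite ?inE.
by apply: le_lt_trans fin;apply: le_measure;rewrite ?inE.
have [iQ EQ] := compensated_integral_centred cp mH (dominated_field_integrable B0 mH HB).
set Q := (fun w => _) in iQ;pose X1 w : R := LT w * \int[nu w]_q W w q.1 q.2.
have fE w (f : R * V -> R) C : (nu w setT < +oo)%E -> mfun setT f -> (forall q, `|f q| <= C) ->
(\int[nu w]_q (f q)%:E = (\int[nu w]_q f q)%:E)%E.
move=> fin mf fC;rewrite /Rintegral fineK//;apply: integrable_fin_num => //.
exact: (bounded_integrable (B := C)).
have X1E : {ae P, forall w, ((LT w)%:E * \int[nu w]_q (W w q.1 q.2)%:E = (X1 w)%:E)%E}.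
by apply: filterS path_ae => w [fin _ _ _ _];rewrite (fE _ _ B).
have X2E : {ae P, forall w, (\int[nu w]_q ((pp w q.1)%:E * (W w q.1 q.2)%:E) =
(X1 w)%:E - Q w)%E}.
apply: filterS3 path_ae (dp_ge0 dp) density_left_ge0 => w [fin inj atl rw lw] Lw pw.
have [N hN] := cp_finite cp w;have T0 : 0 <= T := ltW T_gt0.
have mb := Wpath w;have [cl pl _] := lw.
have off f1 f2 : (forall q : R * V, 0 < q.1 <= T -> f1 q = f2 q) ->
(\int[nu w]_q f1 q = \int[nu w]_q f2 q)%E.
move=> f12;apply: ae_eq_nm.
exists (~` (`]0, T] `*` setT));split;[|exact: cp_off cp w|].
by apply: measurableC;apply: measurableX => //;exact: measurable_itv.
by apply: subsetC => q [/=];rewrite in_itv/= => qT _;exact: f12.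
have bp := linear_path_by_parts (cp_gt0 cp ^~ w) hN fin (cp_off cp w) T0
(mrw w) rw (mpw w) lw mb (WBn w).
have AE t : \int[nu w]_(r in [set r | r.1 <= t]) W w r.1 r.2 = A w t.
rewrite /A /Rintegral;congr fine;rewrite integral_mkcond [RHS]integral_mkcond.
apply: off => q /andP[q0 _];rewrite !patchE;congr (if _ then _ else _).
apply/idP/idP;rewrite !inE/=;rewrite in_itv/= q0/=;tauto.
have HE (k : jump_measure R V) :
\int[k]_q (a w q * \int[nu w]_(r in [set r | r.1 <= q.1]) W w r.1 r.2) =
\int[k]_q H w q.1 q.2.
by apply: eq_Rintegral => -[t x] _;rewrite AE.
rewrite !HE in bp;have [Bp hBp] := cadlag_bounded T0 cl.
have pB := cadlag_left_lim_bounded cl hBp.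
pose g (q : R * V) := if 0 < q.1 <= T then pm w q.1 * W w q.1 q.2 else 0.
have gE : (\int[nu w]_q ((pp w q.1)%:E * (W w q.1 q.2)%:E) = \int[nu w]_q (g q)%:E)%E.
by apply: off => q qT;rewrite -EFinM /g qT max_l// pw.
have mg : mfun setT g.
have mX : measurable (`]0, T] `*` setT : set (R * V)).
exact: measurableX.
have mpW : mfun setT (fun q : R * V => pm w q.1 * W w q.1 q.2).
by apply: measurable_funM => //;exact: (mcomp (mpw w) measurable_fst).
have := measurable_fun_cond (0 : R) mX (mfunTS mpW).
congr mfun;apply/funext => q;rewrite /g.
have -> // : `[< (`]0, T] `*` setT) q >] = (0 < q.1 <= T).
by apply/asboolP/idP => [[/=]|h];[rewrite in_itv|split => //=;rewrite in_itv].
rewrite gE (fE _ _ (Bp * B))//;last first.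
move=> q;rewrite /g;case: ifPn => [qT|_].
by rewrite normrM ler_pM// pl// pB.
by rewrite normr0 mulr_ge0// (le_trans _ (hBp 0 _))// lexx.
rewrite -EFinB;congr (_%:E);rewrite /Q -bp /X1 max_l// opprB addrC subrK.
by congr fine;apply: off => q qT;rewrite /g qT.
have [D [mD D0 Dfin hD]] := density_moments dp.
have iX1 : P.-integrable setT (EFin \o X1).
apply/integrableP;split.
apply/mEFinP;apply: measurable_funM;first exact/mEFinP.
by have := measurable_Rintegral_compensator cp mW.
apply: (@le_lt_trans _ _ (\int[P]_w (B%:E * (D w + D w)))%E);last first.
rewrite ge0_integralZl_EFin//;[|by move=> w _;rewrite adde_ge0|exact: emeasurable_funD].
by rewrite lte_mul_pinfty// ge0_integralD// lte_add_pinfty.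
apply: ge0_ae_le_nm => //;first by move=> w;rewrite mule_ge0// adde_ge0.
apply: filterS2 path_ae hD => w [fin _ _ _ _] [LD _ CD].
apply: (@le_trans _ _ (B%:E * ((L w T ^+ 2)%:E + ((1 + Ct w) ^+ 3)%:E))%E);last first.
by apply: lee_wpmul2l => //;rewrite leeD.
rewrite -EFinD -EFinM lee_fin /X1 normrM.
have C0 : 0 <= Ct w by rewrite fine_ge0.
have h := Rintegral_bounded fin measurableT (Wpath w) B0 (fun q _ => WBn w q).
apply: (@le_trans _ _ (`|L w T| * (B * Ct w))).
apply: ler_pM => //;rewrite ger0_norm ?le_max ?lexx ?orbT//.
by rewrite ge_max ler_norm normr_ge0.
rewrite mulrCA ler_wpM2l// -(real_normK (num_real (L w T))).
move: (`|L w T|) (normr_ge0 (L w T)) (Ct w) C0 => x x0 y y0.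
have h1 := sqr_ge0 (x - y);have h2 := sqr_ge0 x;have h3 : 0 <= y ^+ 3 by rewrite exprn_ge0.
rewrite (_ : (1 + y) ^+ 3 = 1 + 3 * y + 3 * y ^+ 2 + y ^+ 3);last by ring.
by have h4 := sqr_ge0 y;nra.
rewrite (ae_eq_nm X1E) (ae_eq_nm X2E).
have -> : (\int[P]_w ((X1 w)%:E - (Q w)) = \int[P]_w (X1 w)%:E - \int[P]_w Q w)%E.
exact: (@integralB _ _ _ P setT measurableT (fun w => (X1 w)%:E) Q iX1 iQ).
by rewrite [X in (_ - X)%E]EQ sube0.
Qed.

Local Notation rp w t x := (Num.max (rho w t x) 0).
Let at_jump n w (f : R -> V -> R) : R :=
 if (sg n w < +oo)%E then f (fine (sg n w)) (ze n w) else 0.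
Let at_jumpE n w (f : R -> V -> R) :
 at_atom (sg n w) (ze n w) (fun q => (f q.1 q.2)%:E) = (at_jump n w f)%:E.
by rewrite (at_atom_stopped cp (fun=> fun t x => (f t x)%:E)) /at_jump;case: ifP.
Qed.
Let mK : pfield Gl (fun w t x => pp w t * (rp w t x * W w t x)).
apply: measurable_funM;first exact: field_process predictable_left_pos.
by apply: measurable_funM => //;apply: measurable_maxr => //;exact: dp_factor dp.
Qed.
Let mjump (f : Omega -> R -> V -> R) n : pfield Gl f ->
 forall A, measurable A -> stopped_sigma_algebra Gl (sg n) [set w | A (at_jump n w (f w))].
move=> mf A mA.
exact: (stopped_value_measurable fG (cp_stop cp n) (cp_mark cp n) (0 : R) mf mA).
Qed.
Let mjumpE (f : Omega -> R -> V -> R) n : pfield Gl f ->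
 mfun setT (fun w => (at_jump n w (f w))%:E).
move=> mf;apply/mEFinP => _ A mA;rewrite setTI.
by have [] := mjump n mf mA.
Qed.

(** Optional stopping at each jump time, where the density has just been
  multiplied by the factor of the mark. *)
Let one_jump n : (\int[P]_w ((LT w)%:E * (at_jump n w (W w))%:E) =
 \int[P]_w (at_jump n w (fun t x => pp w t * (rp w t x * W w t x)))%:E)%E.
have JB w : `|at_jump n w (W w)| <= B.
rewrite /at_jump;case: ifP => _;last by rewrite normr0.
by have /andP[h0 h1] := WB w (fine (sg n w)) (ze n w);rewrite ger0_norm.
have [Q [iQ EQ QE]] := density_optional_stopping (cp_stop cp n) (mjump n mW) JB.
have iJ : P.-integrable setT (fun w => (LT w)%:E * (at_jump n w (W w))%:E)%E.
have iB := integrableZl measurableT B density_terminal_integrable.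
apply: (le_integrable _ _ _ iB) => //.
by apply: emeasurable_funM => //;exact: mjumpE mW.
move=> w _;rewrite -!EFinM lee_fin !normrM mulrC ler_pM//.
by rewrite (ger0_norm B0).
rewrite ger0_norm;last by rewrite le_max lexx orbT.
by rewrite ge_max ler_norm normr_ge0.
transitivity (\int[P]_w ((LT w)%:E * (at_jump n w (W w))%:E - (Q w)%:E))%E.
rewrite (@integralB _ _ _ P setT measurableT
(fun w => (LT w)%:E * (at_jump n w (W w))%:E)%E (EFin \o Q) iJ iQ).
by rewrite [X in (_ = _ - X)%E]EQ sube0.
apply: ae_eq_nm.
apply: filterS3 (filterI QE path_ae) (dp_ge0 dp) density_left_ge0.
move=> w [Qw [fin inj atl rw lw]] Lw pw;have [N hN] := cp_finite cp w.
rewrite -EFinM -EFinB Qw /at_jump;congr (_%:E).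
case: (boolP (sg n w < +oo)%E) => sn;last by rewrite mulr0 mul0r if_same subr0.
have st := cp_le cp sn;rewrite st max_l//.
have snE : sg n w = (fine (sg n w))%:E by rewrite fineK// gt0_fin_numE// (cp_gt0 cp).
have tT : 0 < fine (sg n w) <= T.
by rewrite -lte_fin -lee_fin -snE (cp_gt0 cp) st.
have /andP[t0 tT'] := tT.
rewrite (linear_path_jump (cp_gt0 cp ^~ w) hN inj fin (cp_V0 cp) atl (ltW T_gt0)
(mrw w) rw (dp_off dp w) (mpw w) lw sn tT').
rewrite !max_l ?pw//;first by ring.
by have /andP[] := rw _ (ze n w) tT.
Qed.

Lemma jump_projection_bounded :
 (\int[P]_w ((LT w)%:E * \int[mu w]_q (W w q.1 q.2)%:E) =
 \int[P]_w \int[nu w]_q (pp w q.1 * (rp w q.1 q.2 * W w q.1 q.2))%:E)%E.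
have K0 w t x : (0 <= (pp w t * (rp w t x * W w t x))%:E)%E.
by rewrite lee_fin !mulr_ge0// ?le_max ?lexx ?orbT//;case/andP: (WB w t x).
have aj0 n w (f : R -> V -> R) : (forall t x, (0 <= (f t x)%:E)%E) -> (0 <= (at_jump n w f)%:E)%E.
by move=> f0;rewrite /at_jump;case: ifP.
have mKE : pfield Gl (fun w t x => (pp w t * (rp w t x * W w t x))%:E).
exact/mEFinP.
rewrite -[RHS](cp_comp cp mKE K0).
transitivity (\int[P]_w \sum_(0 <= n <oo) ((LT w)%:E * (at_jump n w (W w))%:E))%E.
apply: eq_integral => w _;rewrite ge0_integral_points//;last exact: (field_path w mWE).
rewrite nneseriesZl//;last by move=> n _;exact: aj0.
by congr (_ * _)%E;apply: eq_eseriesr => n _;rewrite at_jumpE.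
rewrite integral_nneseries//;last 2 first.
- by move=> n;apply: emeasurable_funM => //;exact: mjumpE mW.
- by move=> n w _;rewrite mule_ge0// aj0.
under eq_eseriesr do rewrite one_jump.
rewrite -integral_nneseries//;last 2 first.
- by move=> n;exact: mjumpE mK.
- by move=> n w _;rewrite aj0.
apply: eq_integral => w _;rewrite ge0_integral_points//.
by apply: eq_eseriesr => n _;rewrite (at_jumpE n w (fun t x => pp w t * (rp w t x * W w t x))).
by apply/mEFinP;exact: (field_path w mK).
Qed.

End bounded_field.

Section monotone_limit.
Variables (n : Omega -> jump_measure R V) (e : Omega -> R).
Variables (Wk : nat -> Omega -> R -> V -> \bar R) (W : Omega -> R -> V -> \bar R).
Hypotheses (mn : forall K, pfield Gl K -> (forall w t x, 0 <= K w t x)%E ->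
 mfun setT (fun w => \int[n w]_q K w q.1 q.2)%E)
 (me : mfun setT e)
 (e0 : forall w, 0 <= e w)
 (mWk : forall k, pfield Gl (Wk k))
 (Wk0 : forall k w t x, (0 <= Wk k w t x)%E)
 (Wknd : forall w t x, nondecreasing_seq (fun k => Wk k w t x))
 (WkW : forall w t x, Wk k w t x @[k --> \oo] --> W w t x).

Lemma cvg_iterated_integral :
 (\int[P]_w ((e w)%:E * \int[n w]_q Wk k w q.1 q.2))%E @[k --> \oo] -->
 (\int[P]_w ((e w)%:E * \int[n w]_q W w q.1 q.2))%E.
have ind w : nondecreasing_seq (fun k => \int[n w]_q Wk k w q.1 q.2)%E.
move=> i j ij;apply: ge0_ae_le_nm => //.
by apply: aeW => q;exact: Wknd.
have ilim w : (\int[n w]_q Wk k w q.1 q.2)%E @[k --> \oo] --> (\int[n w]_q W w q.1 q.2)%E.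
have h := @cvg_monotone_convergence _ _ _ (n w) setT measurableT
(fun k q => Wk k w q.1 q.2) (fun k => field_path w (mWk k))
(fun k q _ => Wk0 k w q.1 q.2) (fun q _ => @Wknd w q.1 q.2).
rewrite (eq_integral (fun q => limn (fun k => Wk k w q.1 q.2)))//.
by move=> q _;apply/esym/cvg_lim => //;exact: WkW.
have h := @cvg_monotone_convergence _ _ _ P setT measurableT
(fun k w => (e w)%:E * \int[n w]_q Wk k w q.1 q.2)%E.
rewrite (eq_integral (fun w => limn (fun k => (e w)%:E * \int[n w]_q Wk k w q.1 q.2)%E)).
apply: h.
- by move=> k;apply: emeasurable_funM;[exact/mEFinP|exact: mn].
- by move=> k w _;rewrite mule_ge0 ?lee_fin//;exact: integral_ge0.
- by move=> w _ i j ij;apply: lee_wpmul2l;[rewrite lee_fin|exact: ind].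
move=> w _;apply/esym;apply: cvg_lim => //.
by apply: cvgeZl => //;exact: ilim.
Qed.

End monotone_limit.

Variable W : Omega -> R -> V -> \bar R.
Hypotheses (mW : pfield Gl W)
 (W0 : forall w t x, (0 <= W w t x)%E).
Let cut (k : nat) w t x : \bar R := mine (W w t x) k%:R%:E.
Let mcut k : pfield Gl (cut k).
Proof. by apply: measurable_mine => //;exact: mW. Qed.
Let cut0 k w t x : (0 <= cut k w t x)%E.
Proof. by rewrite /cut le_min W0 lee_fin ler0n. Qed.
Let cut_fin k w t x : cut k w t x = (fine (cut k w t x))%:E.
by rewrite fineK// ge0_fin_numE// /cut gt_min ltry orbT.
Qed.
Let cut_nd w t x : nondecreasing_seq (fun k => cut k w t x).
by move=> i j ij;rewrite /cut le_min !ge_min lexx/= lee_fin ler_nat ij orbT.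
Qed.
Let cut_lim w t x : cut k w t x @[k --> \oo] --> W w t x.
move: (W0 w t x);rewrite /cut;case: (W w t x) => [r r0| |//].
apply: cvg_near_cst;near=> k;apply: min_l;rewrite lee_fin.
by near: k;exact: nbhs_infty_ger.
move=> _;rewrite (_ : (fun k => _) = (fun k => (k%:R : R)%:E)).
by apply/cvgeryP;exact: cvgr_idn.
by apply/funext => k;rewrite min_r// leey.
Unshelve. all: by end_near. Qed.
Let cut_real k : pfield Gl (fun w t x => fine (cut k w t x)).
Proof. by apply: (@mcomp _ _ _ _ _ _ fine) => //;exact: mcut. Qed.
Let cut_bounded k w t x : 0 <= fine (cut k w t x) <= k%:R.
Proof. by rewrite fine_ge0//= -lee_fin -cut_fin /cut ge_min lexx orbT. Qed.

(** [nu] is predictable: by optional stopping at rational times the terminal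
density may be replaced by its left limits. *)
Lemma density_projection :
 (\int[P]_w ((LT w)%:E * \int[nu w]_q W w q.1 q.2) =
 \int[P]_w \int[nu w]_q ((pp w q.1)%:E * W w q.1 q.2))%E.
have h1 := cvg_iterated_integral (nu_measurable cp) measurable_LTr LT0'
mcut cut0 cut_nd cut_lim.
have mpp k : pfield Gl (fun w t x => (pp w t)%:E * cut k w t x)%E.
apply: emeasurable_funM;last exact: mcut.
apply/mEFinP;exact: field_process predictable_left_pos.
have h2 := @cvg_iterated_integral nu (cst 1) (fun k w t x => (pp w t)%:E * cut k w t x)%E
(fun w t x => (pp w t)%:E * W w t x)%E (nu_measurable cp)
(measurable_cst _) (fun=> ler01) mpp.
rewrite -(cvg_lim _ h1)//.
transitivity (\int[P]_w (1%:E * \int[nu w]_q ((pp w q.1)%:E * W w q.1 q.2)))%E;last first.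
by apply: eq_integral => w _;rewrite mul1e.
apply: cvg_lim => //;apply: cvg_trans (h2 _ _ _).
- apply: near_eq_cvg;near=> k.
under [LHS]eq_integral do rewrite mul1e.
rewrite (_ : (fun w => _) = (fun w => \int[nu w]_q ((pp w q.1)%:E * (fine (cut k w q.1 q.2))%:E))%E).
rewrite -(predictable_projection_bounded (cut_real k) (ler0n _ k) (cut_bounded k)).
by apply: eq_integral => w _;congr (_ * _)%E;apply: eq_integral => q _;rewrite -cut_fin.
by apply/funext => w;apply: eq_integral => q _;rewrite -cut_fin.
- by move=> k w t x;rewrite mule_ge0// lee_fin.
- by move=> w t x i j ij;apply: lee_wpmul2l;[rewrite lee_fin|exact: cut_nd].
- by move=> w t x;apply: cvgeZl => //;exact: cut_lim.
Unshelve. all: by end_near. Qed.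

Local Notation rp w t x := (Num.max (rho w t x) 0).

(** At a jump the density has just been multiplied by the factor of the mark,
whence the additional factor. *)
Lemma density_jump_projection :
 (\int[P]_w ((LT w)%:E * \int[mu w]_q W w q.1 q.2) =
 \int[P]_w \int[nu w]_q ((pp w q.1 * rp w q.1 q.2)%:E * W w q.1 q.2))%E.
have h1 := cvg_iterated_integral (mu_measurable cp) measurable_LTr LT0'
mcut cut0 cut_nd cut_lim.
have pr0 w t x : 0 <= pp w t * rp w t x by rewrite mulr_ge0// le_max lexx orbT.
have mpp k : pfield Gl (fun w t x => (pp w t * rp w t x)%:E * cut k w t x)%E.
apply: emeasurable_funM;last exact: mcut.
apply/mEFinP;apply: measurable_funM.
exact: field_process predictable_left_pos.
by apply: measurable_maxr => //;exact: dp_factor dp.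
have h2 := @cvg_iterated_integral nu (cst 1) (fun k w t x => (pp w t * rp w t x)%:E * cut k w t x)%E
(fun w t x => (pp w t * rp w t x)%:E * W w t x)%E (nu_measurable cp)
(measurable_cst _) (fun=> ler01) mpp.
rewrite -(cvg_lim _ h1)//.
transitivity (\int[P]_w (1%:E * \int[nu w]_q ((pp w q.1 * rp w q.1 q.2)%:E * W w q.1 q.2)))%E;last first.
by apply: eq_integral => w _;rewrite mul1e.
apply: cvg_lim => //;apply: cvg_trans (h2 _ _ _).
- apply: near_eq_cvg;near=> k.
under [LHS]eq_integral do rewrite mul1e.
rewrite (_ : (fun w => _) = (fun w => \int[nu w]_q
(pp w q.1 * (rp w q.1 q.2 * fine (cut k w q.1 q.2)))%:E)%E).
rewrite -(jump_projection_bounded (cut_real k) (ler0n _ k) (cut_bounded k)).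
by apply: eq_integral => w _;congr (_ * _)%E;apply: eq_integral => q _;rewrite -cut_fin.
by apply/funext => w;apply: eq_integral => q _;rewrite (cut_fin k w q.1) -EFinM mulrA.
- by move=> k w t x;rewrite mule_ge0// lee_fin.
- by move=> w t x i j ij;apply: lee_wpmul2l;[rewrite lee_fin|exact: cut_nd].
- by move=> w t x;apply: cvgeZl => //;exact: cut_lim.
Unshelve. all: by end_near. Qed.

Lemma mean_density : (\int[P]_w (LT w)%:E = 1)%E.
have s0 := stopping_time_cst fG (lexx (0 : R)).
have [||Q [iQ EQ QE]] := density_optional_stopping s0 (z := fun=> 1) (B := 1).
- move=> A _;have := stopped_sigma_algebraT fG s0.
have [A1|A1] := pselect (A 1);first by congr stopped_sigma_algebra;apply/seteqP;split.
move=> _;rewrite (_ : _ @^-1` _ = set0);last by apply/seteqP;split.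
have [h _ _] := stopped_sigma_algebra_sigma fG s0;exact: h.
- by move=> w;rewrite normr1.
rewrite -[RHS]adde0 -EQ -[X in (X + _)%E](mule1 1%E) -[X in (1 * X)%E](probability_setT P).
rewrite -integral_cst// -(integralD measurableT)//;last exact: finite_measure_integrable_cst.
apply: ae_eq_nm;apply: filterS2 QE (filterI (dp_linear dp) (dp_ge0 dp)).
move=> w -> [[_ _ lin] L0];rewrite lee_fin (ltW T_gt0) (max_l L0)/= mul1r.
have := lin 0;rewrite lexx (ltW T_gt0) => /(_ erefl) ->.
rewrite /compensated_integral set_itvoc0 set0X !Rintegral_set0 subrr addr0.
by rewrite -EFinD;congr EFin;lra.
Qed.

End change_of_measure.

Import HBNNSimple.

(** * Measures determined by predictable means *)

Section pointwise_finite_kernels.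
Context d1 d2 (X : mtype d1) (Y : mtype d2) (R : realType).
Variable n : X -> {measure set Y -> \bar R}.
Hypotheses (mn : forall U, measurable U -> mfun setT (n ^~ U))
 (n_fin : forall x, (n x setT < +oo)%E).

Lemma measurable_kernel_section (A : set (X * Y)) : measurable A ->
 mfun setT (fun x => n x (xsection A x)).
move=> mA;pose k : R.-ker X ~> Y := HB.pack n (isKernel.Build _ _ _ _ _ n mn).
have h := @measurable_prod_subset_xsection_kernel _ _ X Y R k setT measurableT.
have [|_] := h _ A mA.
move=> x;exists (fine (n x setT) + 1) => B mB.
rewrite /mrestr setIT (@le_lt_trans _ _ (n x setT))//;first by apply: le_measure;rewrite ?inE.
by rewrite -[ltLHS]fineK ?ge0_fin_numE// lte_fin ltrDl.
by congr mfun;apply/funext => x;rewrite /= /mrestr setIT.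
Qed.

Lemma measurable_kernel_integral (f : X * Y -> \bar R) :
 (forall z, 0 <= f z)%E -> mfun setT f ->
 mfun setT (fun x => \int[n x]_y f (x, y))%E.
move=> f0 mf;pose f_ := nnsfun_approx measurableT mf.
apply: (@measurable_fun_xsection_integral _ _ X Y R f n f_).
- by move=> a b ab;exact/nd_nnsfun_approx.
- by move=> z;exact/cvg_nnsfun_approx.
- move=> k r;apply: measurable_kernel_section.
exact: (@measurable_sfunP _ _ _ _ (f_ k) _ (@measurable_set1 _ r)).
Qed.

End pointwise_finite_kernels.

(** Two functionals on nonnegative measurable functions that are additive,
  homogeneous and continuous along nondecreasing sequences agree as soon as
  they agree on indicators. *)
Section positive_functionals.
Context d (X : mtype d) (R : realType).
Implicit Types (f g : X -> \bar R).
Local Open Scope ereal_scope.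

Definition nonneg_measurable f := mfun setT f /\ forall x, 0 <= f x.

Record functional (Phi : (X -> \bar R) -> \bar R) := PositiveFunctional {
 pf_ge0 : forall f, nonneg_measurable f -> 0 <= Phi f ;
 pf_le : forall f g, nonneg_measurable f -> nonneg_measurable g ->
 (forall x, f x <= g x) -> Phi f <= Phi g ;
 pf_add : forall f g, nonneg_measurable f -> nonneg_measurable g ->
 Phi (fun x => f x + g x) = Phi f + Phi g ;
 pf_scale : forall (r : R) f, (0 <= r)%R -> nonneg_measurable f ->
 Phi (fun x => r%:E * f x) = r%:E * Phi f ;
 pf_lim : forall (f_ : nat -> X -> \bar R) f, (forall k, nonneg_measurable (f_ k)) ->
 (forall x, nondecreasing_seq (f_ ^~ x)) ->
 (forall x, f_ k x @[k --> \oo] --> f x) ->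
 Phi (f_ k) @[k --> \oo] --> Phi f
}.

Lemma positive_functional_eq Phi Psi :
 functional Phi -> functional Psi ->
 (forall A, measurable A -> Phi (fun x => (\1_A x)%:E) = Psi (fun x => (\1_A x)%:E)) ->
 forall f, nonneg_measurable f -> Phi f = Psi f.
move=> pfP pfS PS f [mf f0];pose f_ := nnsfun_approx measurableT mf.
have nmind A : measurable A -> nonneg_measurable (fun x => (\1_A x)%:E).
by move=> mA;split;[exact/mEFinP/measurable_indic|move=> x;rewrite lee_fin].
have simple (k : nat) : Phi (fun x => (f_ k x)%:E) = Psi (fun x => (f_ k x)%:E).
have sum (s : seq R) : (forall r, r \in s -> (0 <= r)%R) ->
Phi (fun x => \sum_(r <- s) (r%:E * (\1_(f_ k @^-1` [set r]) x)%:E)) =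
Psi (fun x => \sum_(r <- s) (r%:E * (\1_(f_ k @^-1` [set r]) x)%:E)).
have nmterm r : (0 <= r)%R -> nonneg_measurable
(fun x => r%:E * (\1_(f_ k @^-1` [set r]) x)%:E).
move=> r0;have [m1 p1] := nmind _ (@measurable_sfunP _ _ _ _ (f_ k) _ (@measurable_set1 _ r)).
by split;[exact: measurable_funeM|move=> x;rewrite mule_ge0// lee_fin].
have nmsum (u : seq R) : (forall r, r \in u -> (0 <= r)%R) -> nonneg_measurable
(fun x => \sum_(r <- u) (r%:E * (\1_(f_ k @^-1` [set r]) x)%:E)).
move=> u0;split.
apply: emeasurable_sum => r;apply: measurable_funeM.
have mr := @measurable_sfunP _ _ _ _ (f_ k) _ (@measurable_set1 _ r).
exact: (nmind _ mr).1.
by move=> x;rewrite big_seq;apply: sume_ge0 => r ru;apply: (nmterm r (u0 r ru)).2.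
elim: s => [|r s ih] s0.
by under eq_fun do rewrite big_nil;have := PS set0 measurable0;rewrite indic0.
have r0 : (0 <= r)%R by apply: s0;rewrite mem_head.
have s0' r' : r' \in s -> (0 <= r')%R by move=> rs;apply: s0;rewrite in_cons rs orbT.
under eq_fun do rewrite big_cons.
rewrite (pf_add pfP (nmterm r r0) (nmsum s s0')) (pf_add pfS (nmterm r r0) (nmsum s s0')) ih//.
have mr : measurable (f_ k @^-1` [set r]).
exact: (@measurable_sfunP _ _ _ _ (f_ k) _ (@measurable_set1 _ r)).
by rewrite (pf_scale pfP r0 (nmind _ mr)) (pf_scale pfS r0 (nmind _ mr)) PS.
have fE : (fun x => (f_ k x)%:E) = (fun x =>
\sum_(r <- finmap.enum_fset (fset_set (range (f_ k)))) (r%:E * (\1_(f_ k @^-1` [set r]) x)%:E)).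
apply/funext => x;rewrite fimfunE fsbig_finite//= -sumEFin.
by apply: eq_bigr => r _;rewrite EFinM.
rewrite fE;apply: sum => r;rewrite in_fset_set// inE => -[x _ <-];exact: fun_ge0.
have nmf k : nonneg_measurable (fun x => (f_ k x)%:E).
by split;[exact/mEFinP|move=> x;rewrite lee_fin].
have nd x : nondecreasing_seq (fun k => (f_ k x)%:E).
by move=> a b ab;rewrite lee_fin;exact/lefP/nd_nnsfun_approx.
have lim x : (f_ k x)%:E @[k --> \oo] --> f x by exact: cvg_nnsfun_approx.
have h1 := pf_lim pfP nmf nd lim;have h2 := pf_lim pfS nmf nd lim.
rewrite -(cvg_lim _ h1)// -(cvg_lim _ h2)//;congr (limn _).
by apply/funext => k;exact: simple.
Qed.

Lemma functional_integral (m : {measure set X -> \bar R}) D : measurable D ->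
 functional (fun f => \int[m]_(x in D) f x).
move=> mD;split.
- by move=> f [mf f0];exact: integral_ge0.
- move=> f g [mf f0] [mg g0] fg;apply: ge0_le_integral => //.
+ exact: mfunTS.
+ exact: mfunTS.
- by move=> f g [mf f0] [mg g0];apply: ge0_integralD => //;exact: mfunTS.
- by move=> r f r0 [mf f0];apply: ge0_integralZl_EFin => //;exact: mfunTS.
- move=> f_ f nmf nd lim.
have h := @cvg_monotone_convergence _ _ _ m D mD f_ (fun k => mfunTS (nmf k).1)
(fun k x _ => (nmf k).2 x) (fun x _ => @nd x).
rewrite (eq_integral (fun x => limn (f_ ^~ x)))//.
by move=> x _;apply/esym/cvg_lim => //;exact: lim.
Qed.

End positive_functionals.

Section iterated_functionals.
Context d (X : mtype d) d' (Y : mtype d') (R : realType).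
Local Open Scope ereal_scope.

Lemma positive_functional_iterated (m : {measure set Y -> \bar R}) D
 (Phi : Y -> (X -> \bar R) -> \bar R) : measurable D ->
 (forall y, functional (Phi y)) ->
 (forall f, nonneg_measurable f -> mfun D (Phi ^~ f)) ->
 functional (fun f => \int[m]_(y in D) Phi y f).
move=> mD pf mPhi;split.
- by move=> f nf;apply: integral_ge0 => y _;exact: pf_ge0.
- move=> f g nf ng fg;apply: ge0_le_integral => //.
+ by move=> y _;exact: pf_ge0.
+ exact: mPhi.
+ exact: mPhi.
+ by move=> y _;exact: pf_le.
- move=> f g nf ng;rewrite -ge0_integralD//.
+ by apply: eq_integral => y _;exact: pf_add.
+ by move=> y _;exact: pf_ge0.
+ exact: mPhi.
+ by move=> y _;exact: pf_ge0.
+ exact: mPhi.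
- move=> r f r0 nf;rewrite -ge0_integralZl_EFin//.
+ by apply: eq_integral => y _;exact: pf_scale.
+ by move=> y _;exact: pf_ge0.
+ exact: mPhi.
- move=> f_ f nmf nd lim.
have Pnd y : nondecreasing_seq (fun k => Phi y (f_ k)).
by move=> a b ab;apply: (pf_le (pf y)) => // x;exact: nd.
have h := @cvg_monotone_convergence _ _ _ m D mD (fun k y => Phi y (f_ k))
(fun k => mPhi _ (nmf k)) (fun k y _ => pf_ge0 (pf y) (nmf k)) (fun y _ => @Pnd y).
rewrite (eq_integral (fun y => limn (fun k => Phi y (f_ k))))//.
by move=> y _;apply/esym/cvg_lim => //;exact: (pf_lim (pf y) nmf nd lim).
Qed.

Lemma positive_functional_comp (h : X -> Y) (Phi : (X -> \bar R) -> \bar R) :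
 mfun setT h -> functional Phi ->
 functional (fun f => Phi (f \o h)).
move=> mh pf;have nm (f : Y -> \bar R) : nonneg_measurable f -> nonneg_measurable (f \o h).
by move=> [mf f0];split;[exact: mcomp mf mh|move=> x;exact: f0].
split.
- by move=> f nf;apply: (pf_ge0 pf);exact: nm.
- by move=> f g nf ng fg;apply: (pf_le pf);[exact: nm|exact: nm|move=> x;exact: fg].
- by move=> f g nf ng;apply: (pf_add pf);exact: nm.
- by move=> r f r0 nf;apply: (pf_scale pf) => //;exact: nm.
- by move=> f_ f nf nd lim;exact: (pf_lim pf (fun k => nm _ (nf k)) (fun x => nd (h x))
(fun x => lim (h x))).
Qed.

End iterated_functionals.

Section mean_uniqueness.
Context {R : realType} {dO} {Omega : mtype dO} (P : probability Omega R).
Context {dV} {V : mtype dV}.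
Variables (Fl : R -> set (set Omega)) (T : R).
Hypotheses (fF : is_filtration Fl)
 (T_ge0 : 0 <= T).
Local Notation PS := (pspace Fl).
Local Open Scope ereal_scope.

Lemma measurable_field_embed :
 mfun [set: Omega * (R * V)] (fun z => ((z.1, z.2.1) : PS, z.2.2)).
apply: measurable_fun_pair;last exact: (mcomp measurable_snd measurable_snd).
have h : mfun [set: Omega * (R * V)] (fun z => (z.1, z.2.1)).
apply: measurable_fun_pair => //.
exact: (mcomp measurable_fst measurable_snd).
exact: (mcomp (measurable_predictable_id fF) h).
Qed.

Record time_kernel (n : Omega -> jump_measure R V) := TimeKernel {
 tk_measurable : forall U, measurable U -> mfun setT (n ^~ U) ;
 tk_finite : forall w, n w setT < +oo ;
 tk_off : forall w, n w (~` (`]0%R, T] `*` setT)) = 0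
}.

Lemma time_kernel_measurable_integral n (f : PS * V -> \bar R) : time_kernel n ->
 nonneg_measurable f ->
 mfun setT (fun w => \int[n w]_q f ((w, q.1), q.2)).
move=> nk [mf f0].
apply: (measurable_kernel_integral (tk_measurable nk) (tk_finite nk)
(f := fun z : Omega * (R * V) => f ((z.1, z.2.1), z.2.2))) => //.
exact: mcomp mf measurable_field_embed.
Qed.

Lemma time_kernel_functional n : time_kernel n ->
 functional (fun f : PS * V -> \bar R => \int[P]_w \int[n w]_q f ((w, q.1), q.2)).
move=> nk;apply: positive_functional_iterated => //.
- move=> w;apply: (positive_functional_comp (h := fun q : R * V => ((w, q.1) : PS, q.2)))
(functional_integral (n w) measurableT).
exact: measurable_field_slice.
- by move=> f nf;exact: time_kernel_measurable_integral.
Qed.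

Variables n1 n2 : Omega -> jump_measure R V.
Hypotheses (nk1 : time_kernel n1)
 (nk2 : time_kernel n2)
 (fin1 : \int[P]_w n1 w setT < +oo)
 (fin2 : \int[P]_w n2 w setT < +oo)
 (rect : forall A s t B, (0 <= s)%R -> (s <= t)%R -> Fl s A -> measurable B ->
 \int[P]_(w in A) n1 w (`]s, t] `*` B) = \int[P]_(w in A) n2 w (`]s, t] `*` B)).
Let Phi (n : Omega -> jump_measure R V) (D : set (PS * V)) :=
 \int[P]_w n w [set q | D ((w, q.1), q.2)].
Let slice_measurable w (D : set (PS * V)) : measurable D ->
 measurable [set q : R * V | D ((w, q.1), q.2)].
move=> mD;rewrite -[X in measurable X]setTI.
exact: (@measurable_field_slice _ _ _ Fl _ V w measurableT D mD).
Qed.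
Let Phi_measurable n (D : set (PS * V)) : time_kernel n -> measurable D ->
 mfun setT (fun w => n w [set q | D ((w, q.1), q.2)]).
move=> nk mD;have nm : nonneg_measurable (fun z : PS * V => (\1_D z : R)%:E).
by split;[exact/mEFinP/measurable_indic|move=> z;rewrite lee_fin].
have := time_kernel_measurable_integral nk nm.
congr mfun;apply/funext => w.
rewrite -[in RHS](setIT [set q | _]) -integral_indic//;last exact: slice_measurable.
Qed.
Let Phi_setD n (D D' : set (PS * V)) : time_kernel n -> \int[P]_w n w setT < +oo -> measurable D ->
 measurable D' -> D' `<=` D -> Phi n (D `\` D') = Phi n D - Phi n D'.
move=> nk nfin mD mD' DD'.
have le w (E : set (PS * V)) : measurable E -> n w [set q | E ((w, q.1), q.2)] <= n w setT.
by move=> mE;apply: le_measure;rewrite ?inE//;exact: slice_measurable.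
have i (E : set (PS * V)) : measurable E ->
P.-integrable setT (fun w => n w [set q | E ((w, q.1), q.2)]).
move=> mE;apply: ge0_integrable;[exact: Phi_measurable|by move=> w;exact: measure_ge0|].
apply: le_lt_trans nfin;apply: ge0_ae_le_nm => //.
by apply: aeW => w;exact: le.
rewrite /Phi -(integralB measurableT (i D mD) (i D' mD'));apply: eq_integral => w _.
have -> : [set q | (D `\` D') ((w, q.1), q.2)] =
[set q | D ((w, q.1), q.2)] `\` [set q | D' ((w, q.1), q.2)] by [].
rewrite measureD.
- by congr (_ - n w _);rewrite setIidr// => q /DD'.
- exact: slice_measurable.
- exact: slice_measurable.
- by apply: le_lt_trans (tk_finite nk w);exact: le.
Qed.
Let Phi_bigcup n (F : nat -> set (PS * V)) : time_kernel n ->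
 (forall i, measurable (F i)) -> nondecreasing_seq F ->
 Phi n (F i) @[i --> \oo] --> Phi n (\bigcup_i F i).
move=> nk mF ndF.
have nd w : nondecreasing_seq (fun i => n w [set q | F i ((w, q.1), q.2)]).
move=> i j ij;apply: le_measure;rewrite ?inE;[exact: slice_measurable..|].
by have /subsetPset FF := ndF i j ij;move=> q /FF.
have h := @cvg_monotone_convergence _ _ _ P setT measurableT
(fun i w => n w [set q | F i ((w, q.1), q.2)]) (fun i => Phi_measurable nk (mF i))
(fun i w _ => measure_ge0 _ _) (fun w _ => @nd w).
rewrite /Phi (eq_integral (fun w => limn (fun i => n w [set q | F i ((w, q.1), q.2)])))//.
move=> w _;apply/esym/cvg_lim => //.
have -> : [set q | (\bigcup_i F i) ((w, q.1), q.2)] =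
\bigcup_i [set q | F i ((w, q.1), q.2)] by [].
apply: nondecreasing_cvg_mu.
- by move=> i;exact: slice_measurable.
- by apply: bigcupT_measurable => i;exact: slice_measurable.
- by move=> i j ij;apply/subsetPset;have /subsetPset FF := ndF i j ij;move=> q /FF.
Qed.
Let predictable_rectangles_setI : setI_closed (predictable_rectangles Fl).
move=> D D' [[A FA ->]|[A [s [t [s0 st FA ->]]]]] [[A' FA' ->]|[A' [s' [t' [s0' st' FA' ->]]]]].
- left;exists (A `&` A');first exact: filtrationI.
by rewrite -setXI setIid.
- left;exists set0;first exact: filtration0.
rewrite set0X;apply/seteqP;split => // -[w u] [[/= _ ->] [/= _]].
by rewrite in_itv/= ltNge s0'.
- left;exists set0;first exact: filtration0.
rewrite set0X;apply/seteqP;split => // -[w u] [[/= _ +] [/= _ u0]].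
by rewrite u0 in_itv/= ltNge s0.
- have [le|gt] := leP (Num.max s s') (Num.min t t');last first.
left;exists set0;first exact: filtration0.
rewrite set0X;apply/seteqP;split => // -[w u] [[/= _ +] [/= _]].
rewrite !in_itv/= => /andP[su ut] /andP[su' ut'].
have h1 : (Num.max s s' < u)%R by rewrite gt_max su.
have h2 : (u <= Num.min t t')%R by rewrite le_min ut.
by have := lt_le_trans h1 h2;rewrite ltNge (ltW gt).
right;exists (A `&` A'), (Num.max s s'), (Num.min t t');split => //.
+ by rewrite le_max s0.
+ by apply: filtrationI;rewrite ?le_max ?s0//;[apply: filtrationS FA|apply: filtrationS FA'];
rewrite // le_max lexx ?orbT.
+ rewrite -setXI;congr (_ `*` _);apply/seteqP;split => u /=;
rewrite !in_itv/= gt_max le_min.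
by move=> [/andP[-> ->] /andP[-> ->]].
by move=> /andP[/andP[-> ->] /andP[-> ->]].
Qed.

Lemma mean_uniqueness_sets (D : set (PS * V)) : measurable D -> Phi n1 D = Phi n2 D.
move: D.
pose GT : set (set PS) := predictable_rectangles Fl `|` [set setT].
pose G : set (set (PS * V)) := [set A `*` B | A in GT & B in measurable].
pose H : set (set (PS * V)) := [set D | measurable D /\ Phi n1 D = Phi n2 D].
have GI : setI_closed G.
move=> _ _ [A GA [B mB <-]] [A' GA' [B' mB' <-]];rewrite -setXI.
exists (A `&` A');last by exists (B `&` B') => //;exact: measurableI.
case: GA GA' => [rA|->] [rA'|->];rewrite ?setIT ?setTI;[left|left|left|right] => //.
exact: predictable_rectangles_setI.
have mG D : G D -> measurable D.
move=> [A GA [B mB <-]];apply: measurableX => //.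
by case: GA => [rA|-> //];exact: sub_gen_smallest.
have offB n w B : time_kernel n -> measurable B ->
n w (setT `*` B) = n w (`]0%R, T] `*` B).
move=> nk mB;have mX : measurable (`]0%R, T] `*` setT : set (R * V)).
exact: measurableX.
have mTB : measurable (setT `*` B : set (R * V)) by exact: measurableX.
rewrite (_ : setT `*` B = (`]0%R, T] `*` B) `|` (~` (`]0%R, T] `*` setT) `&` (setT `*` B))).
rewrite measureU//=.
- rewrite [X in _ + X](_ : _ = 0) ?adde0//;apply/eqP;rewrite eq_le measure_ge0 andbT.
rewrite -(tk_off nk w);apply: le_measure;rewrite ?inE//.
by apply: measurableI => //;exact: measurableC.
exact: measurableC.
- exact: measurableX.
- by apply: measurableI => //;exact: measurableC.
- by apply/seteqP;split => // -[u x] [[/= uT _] [h _]];apply: h.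
apply/seteqP;split => -[u x] /=.
by move=> [_ Bx];have [uT|uT] := pselect (`]0%R, T]%classic u);[left|right;split => // -[]].
by move=> [[_ Bx]|[_ [_ Bx]]].
have PhiT n B : time_kernel n -> measurable B ->
Phi n (setT `*` B) = \int[P]_(w in setT) n w (`]0%R, T] `*` B).
move=> nk mB;apply: eq_integral => w _;rewrite -offB//;congr (n w _).
have PhiR n A s t B : time_kernel n -> measurable B -> measurable A ->
Phi n ((A `*` `]s, t]) `*` B) = \int[P]_(w in A) n w (`]s, t] `*` B).
move=> nk mB mA;rewrite [RHS]integral_mkcond;apply: eq_integral => w _;rewrite patchE.
case: ifPn => [/set_mem wA|wA].
by congr (n w _);apply/seteqP;split => -[u x] /=;[move=> [[]]|move=> []].
rewrite (_ : [set _ | _] = set0) ?measure0//.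
by apply/seteqP;split => // -[u x] [[/= wA' _] _];rewrite mem_set in wA.
have Phi0 n A B : time_kernel n -> measurable B -> Phi n ((A `*` [set 0%R]) `*` B) = 0.
move=> nk mB;apply: integral0_eq => w _;apply/eqP;rewrite eq_le measure_ge0 andbT.
rewrite -(tk_off nk w);apply: le_measure;rewrite ?inE.
- have [wA|wA] := pselect (A w).
rewrite (_ : [set _ | _] = [set 0%R] `*` B);first exact: measurableX.
by apply/seteqP;split => -[u x] /=;[move=> [[]]|move=> []].
rewrite (_ : [set _ | _] = set0);first exact: measurable0.
by apply/seteqP;split => // -[u x] [[]].
- by apply: measurableC;apply: measurableX => //;exact: measurable_itv.
- by move=> [u x] [[/= _ ->] _] [/=];rewrite in_itv/= ltxx.
have GH : G `<=` H.
move=> D GD;split;first exact: mG.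
case: GD => A [[[A0 FA ->]|[A0 [s [t [s0 st FA ->]]]]]|->] [B mB <-].
- by rewrite !Phi0.
- by rewrite !PhiR ?rect//;exact: filtrationM FA.
- by rewrite !PhiT// rect//;exact: filtrationT.
have HL : lambda_system setT H.
split => //.
- by apply: GH;exists setT;[right|exists setT => //;rewrite setXTT].
- move=> D D' DD' [mD hD] [mD' hD'];split;first exact: measurableD.
by rewrite !Phi_setD// hD hD'.
- move=> F ndF hF;have mF i : measurable (F i) by case: (hF i).
split;first exact: bigcupT_measurable.
rewrite -(cvg_lim _ (Phi_bigcup nk1 mF ndF))// -(cvg_lim _ (Phi_bigcup nk2 mF ndF))//.
by congr (limn _);apply/funext => i;case: (hF i).
have : <<s G >> `<=` H by exact: lambda_system_subset.
suff gen : measurable `<=` <<s G >> by move=> h D mD;have [] := h _ (gen _ mD).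
rewrite measurable_prod_measurableType;apply: smallest_sub;first exact: smallest_sigma_algebra.
move=> _ [A mA [B mB <-]].
suff : measurable `<=` [set A : set PS | <<s G >> (A `*` B)] by apply.
have sG : sigma_algebra setT <<s G >> := smallest_sigma_algebra _ _.
have GT' : <<s G >> (setT `*` B).
by apply: sub_gen_smallest;exists setT;[right|exists B].
apply: smallest_sub;last first.
by move=> D rD;apply: sub_gen_smallest;exists D;[left|exists B].
have [s0 sC sU] := sG;split => /=.
- by rewrite set0X.
- move=> D hD;have : <<s G >> ((setT `*` B) `&` ~` (D `*` B)).
by rewrite -setDE;exact: (@measurableD _ (g_sigma_algebraType G) _ _ GT' hD).
congr (<<s G >> _);apply/seteqP;split => -[p x] /=.
by move=> [[_ Bx] h];split => //;split => // Dp;apply: h.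
by move=> [[_ Dp] Bx];split => // -[].
- move=> F hF;rewrite (_ : _ `*` B = \bigcup_i (F i `*` B));first exact: sU.
apply/seteqP;split => -[p x] /=;first by move=> [[i _ Fp] Bx];exists i.
by move=> [i _ [Fp Bx]];split => //;exists i.
Qed.

Lemma mean_uniqueness (W : Omega -> R -> V -> \bar R) : pfield Fl W ->
 (forall w t x, 0 <= W w t x) ->
 \int[P]_w \int[n1 w]_q W w q.1 q.2 = \int[P]_w \int[n2 w]_q W w q.1 q.2.
move=> mW W0.
apply: (positive_functional_eq (time_kernel_functional nk1) (time_kernel_functional nk2) _
(f := fun z => W z.1.1 z.1.2 z.2));last by split=> // z;exact: W0.
move=> D mD;have := mean_uniqueness_sets mD;rewrite /Phi => h.
have E (n : Omega -> jump_measure R V) : \int[P]_w \int[n w]_q (\1_D ((w, q.1), q.2))%:E =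
\int[P]_w n w [set q | D ((w, q.1), q.2)].
apply: eq_integral => w _.
by rewrite -[in RHS](setIT [set q | _]) -integral_indic//;exact: slice_measurable.
by rewrite !E.
Qed.

End mean_uniqueness.

Lemma points_measure_eq {R : realType} {dV} {V : mtype dV}
 (s : nat -> \bar R) (y y' : nat -> V) A :
 (forall n r, s n = r%:E -> y n = y' n) -> points s y A = points s y' A.
move=> yy';rewrite /points/= /mseries;apply: eq_eseriesr => n _.
by rewrite /atom;have := yy' n;case: (s n) => // r /(_ r erefl) ->.
Qed.

(** * The jumps of the pair *)

Section path_jumps.
Context {R : realType} {d : nat}.
Variables (s : nat -> \bar R) (xi : nat -> 'rV[R]_d) (x : R -> 'rV[R]_d).
Hypotheses (s_gt0 : forall n, (0 < s n)%E)
 (s_step : forall n, (s n <= s n.+1)%E /\ (s n < +oo -> s n < s n.+1)%E)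
 (s_cvg : s n @[n --> \oo] --> +oo%E)
 (xi_neq0 : forall n, xi n != 0 <-> (s n < +oo)%E)
 (xE : forall t, 0 <= t ->
 \sum_(n < N) indic_after (s n) t *: xi n @[N --> \oo] --> x t).

Lemma point_measure_step A : measurable A ->
 point_measure (jump_times x) (jump x) A = points s xi A.
move=> mA;have sN n : s n <> -oo%E by have := s_gt0 n;case: (s n).
have inj n m : (s n < +oo)%E -> s n = s m -> n = m.
exact: step_time_inj.
have Ds t : jump_times x t <-> exists n, s n = t%:E by exact: step_path_jump_times.
apply: etrans (point_measureE (jump x) sN Ds inj mA) _.
by apply: points_measure_eq => n r sr;rewrite sr;exact: step_path_jump.
Qed.

Variable tau : \bar R.
Hypotheses (tau_gt0 : (0 < tau)%E)
 (tau_neq : forall n, (s n < +oo)%E -> tau <> s n).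

(** The jump times and marks of the pair: the jump of the indicator is put in
  front of the jumps of [x]. *)
Definition pair_time (n : nat) : \bar R := if n is m.+1 then s m else tau.
Definition pair_mark (n : nat) : 'rV[R]_d * R :=
 if n is m.+1 then (xi m, 0) else (0, 1).

Lemma pair_time_inj n m : (pair_time n < +oo)%E -> pair_time n = pair_time m -> n = m.
case: n m => [|n] [|m] //= sn.
- by move=> tm;exfalso;apply: (tau_neq (n := m));rewrite -?tm.
- by move=> /esym tm;exfalso;apply: (tau_neq sn).
- by move=> h;congr S;exact: (step_time_inj s_step sn h).
Qed.
Let z t := (x t, indic_after tau t).
Let jump_pair t : 0 < t -> jump z t = (jump x t, (tau == t%:E)%:R).
move=> t0;rewrite -(indic_after_jump tau t0) /jump t0.
have h1 := step_path_left_lim s_gt0 s_step s_cvg xE t0.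
have h2 := indic_after_left tau t.
rewrite (left_lim_pair h1 h2) (left_lim_near_cst h2).
by [].
Qed.

Lemma point_measure_pair A : measurable A ->
 point_measure (jump_times z) (jump z) A = points pair_time pair_mark A.
move=> mA;have sN n : pair_time n <> -oo%E.
by case: n => [|n] /=;[move: tau_gt0;case: tau|have := s_gt0 n;case: (s n)].
have Ds t : jump_times z t <-> exists n, pair_time n = t%:E.
split=> [[t0]|].
rewrite jump_pair// => jz;have [tt|tt] := eqVneq tau t%:E;first by exists 0%N.
have : jump_times x t.
split => //;apply: contraNneq jz => ->;rewrite (negbTE tt).
by [].
by rewrite (step_path_jump_times s_gt0 s_step s_cvg xi_neq0 xE) => -[n sn];exists n.+1.
move=> [n sn];have t0 : 0 < t.
by rewrite -lte_fin -sn;case: n {sn} => [|n] //=.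
split => //;rewrite jump_pair//;case: n sn => [|n] /= sn.
by rewrite sn eqxx;apply/eqP => -[_ /eqP];rewrite oner_eq0.
have := (xi_neq0 n).2;rewrite sn ltry => /(_ isT).
rewrite (step_path_jump s_gt0 s_step xE sn);by apply: contraNneq => -[-> _].
apply: etrans (point_measureE (jump z) sN Ds pair_time_inj mA) _.
apply: points_measure_eq => n r sr;rewrite sr /= jump_pair;last first.
by rewrite -lte_fin -sr;case: n {sr} => [|n] //=.
case: n sr => [|n] /= sr.
rewrite sr eqxx (step_path_no_jump s_gt0 s_step s_cvg xE)//.
by rewrite -lte_fin -sr.
by move=> n sn;apply: (tau_neq (n := n));rewrite sn ?ltry.
rewrite (step_path_jump s_gt0 s_step xE sr);congr (_, _).
case: eqP => // tr;exfalso;apply: (tau_neq (n := n));rewrite ?sr ?ltry//.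
Qed.

End path_jumps.

(** Jump times that do not accumulate, with marks known at the jump. *)
Record marked_points {R : realType} {dO} {Omega : mtype dO}
 (Fl : R -> set (set Omega)) {dV} {V : mtype dV}
 (s : nat -> Omega -> \bar R) (y : nat -> Omega -> V) := MarkedPoints {
 mp_filtration : is_filtration Fl ;
 mp_stop : forall n, stopping_time Fl (s n) ;
 mp_gt0 : forall n w, (0 < s n w)%E ;
 mp_mark : forall n B t, measurable B -> 0 <= t ->
 Fl t (y n @^-1` B `&` [set w | s n w <= t%:E]%E) ;
 mp_discrete : forall w (t : R), exists N, forall n, (N <= n)%N -> (t%:E < s n w)%E
}.

Definition cut_time {R : realType} {Omega : Type} (T : R) (s : Omega -> \bar R) (w : Omega) : \bar R :=
 if (s w <= T%:E)%E then s w else +oo%E.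

Lemma measurable_field_time {R : realType} {dO} {Omega : mtype dO}
 {dV} {V : mtype dV} (Fl : R -> set (set Omega)) (U : set (R * V)) :
 is_filtration Fl -> measurable U ->
 mfun [set q : pspace Fl * V | 0 <= q.1.2]
 (fun q => \1_U (q.1.2, q.2) : R).
move=> fF mU;apply: (@measurable_comp _ _ _ _ _ _ setT (\1_U : R * V -> R)) => //.
apply: measurable_fun_pair_on;last exact: mfunTS.
have := @measurable_comp _ _ _ (pspace Fl * V)%type (pspace Fl) R
[set p | 0 <= p.2] snd [set q | 0 <= q.1.2] fst (predictable_ge0 fF) _
(measurable_predictable_time fF) (mfunTS measurable_fst).
by apply=> _ [q /= q0 <-].
Qed.

Section cut_points.
Context {R : realType} {dO} {Omega : mtype dO} (P : probability Omega R).
Context {dV} {V : mtype dV}.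
Variables (Fl : R -> set (set Omega)) (T : R).
Variables (s : nat -> Omega -> \bar R) (y : nat -> Omega -> V).
Hypotheses (mp : marked_points Fl s y)
 (T_ge0 : 0 <= T).
Let fF := mp_filtration mp.
Local Notation sg := (fun n => cut_time T (s n)).

Lemma cut_time_le n w : (sg n w < +oo)%E -> (sg n w <= T%:E)%E.
Proof. by rewrite /cut_time;case: ifP => //;rewrite ltxx. Qed.

Lemma cut_time_gt0 n w : (0 < sg n w)%E.
Proof. by rewrite /cut_time;case: ifP => _ //;exact: mp_gt0 mp n w. Qed.

Lemma cut_time_finite w : exists N, forall n, (N <= n)%N -> sg n w = +oo%E.
have [N hN] := mp_discrete mp w T;exists N => n /hN h.
by rewrite /cut_time leNgt h.
Qed.

Lemma cut_time_set n t : 0 <= t ->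
 [set w | sg n w <= t%:E]%E = [set w | s n w <= (Num.min t T)%:E]%E.
move=> t0;apply/seteqP;split => w /=;rewrite /cut_time.
by case: ifP => // sT st;rewrite EFin_min le_min st.
by rewrite EFin_min le_min => /andP[st sT];rewrite sT.
Qed.
Let min0 t : 0 <= t -> 0 <= Num.min t T.
Proof. by move=> t0;rewrite le_min t0. Qed.

Lemma cut_time_stop n : stopping_time Fl (sg n).
split=> [w|t t0];first exact/ltW/cut_time_gt0.
rewrite cut_time_set//;apply: (filtrationS fF (min0 t0));first by rewrite ge_min lexx.
by case: (mp_stop mp n) => _;apply;exact: min0.
Qed.

Lemma cut_time_mark n B t : measurable B -> 0 <= t ->
 Fl t (y n @^-1` B `&` [set w | sg n w <= t%:E]%E).
move=> mB t0;rewrite cut_time_set//.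
apply: (filtrationS fF (min0 t0));first by rewrite ge_min lexx.
by apply: (mp_mark mp) => //;exact: min0.
Qed.

Definition cut_points (w : Omega) : jump_measure R V :=
 points (sg^~ w) (y^~ w).

Lemma integral_cut_points (f : R * V -> \bar R) w : mfun setT f ->
 (forall q, 0 <= f q)%E ->
 (\int[cut_points w]_q f q =
 \int[points (s^~ w) (y^~ w)]_(q in `]0%R, T] `*` setT) f q)%E.
move=> mf f0;have mX : measurable (`]0, T] `*` setT : set (R * V)).
exact: measurableX.
rewrite [RHS]integral_mkcond !ge0_integral_points//.
- apply: eq_eseriesr => n _;rewrite /at_atom /cut_time.
move: (mp_gt0 mp n w);case: (s n w) => [r| |]//=.
rewrite lte_fin => r0;rewrite lee_fin patchE;case: ifPn => rT.
by rewrite mem_set//=;split => //;rewrite in_itv/= r0.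
by rewrite memNset//= => -[];rewrite in_itv/= (negbTE rT) andbF.
- by apply/(measurable_restrict _ mX) => //;exact: mfunTS.
- by move=> q;rewrite patchE;case: ifP.
Qed.

Lemma cut_points_measure t B w : measurable B ->
 cut_points w (`]0, t] `*` B) =
 (\sum_(0 <= n <oo) (\1_(y n @^-1` B `&` [set w | sg n w <= t%:E]%E) w)%:E)%E.
move=> mB;have mX : measurable (`]0, t] `*` B : set (R * V)).
exact: measurableX.
rewrite -[in LHS](setIT (`]0, t] `*` B)) -integral_indic//.
rewrite ge0_integral_points;last 2 first.
- by apply/mEFinP;exact: measurable_indic.
- by move=> q;rewrite lee_fin.
apply: eq_eseriesr => n _;rewrite /at_atom.
have := cut_time_gt0 n w;have : ((\1_(y n @^-1` B `&` [set w | sg n w <= t%:E]%E) w) =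
((y n w \in B) && (sg n w <= t%:E)%E)%:R :> R).
by rewrite indicE in_setI;congr (_ && _)%:R;rewrite ?mem_setE//;
apply/idP/idP;rewrite inE.
move=> ->;case: (sg n w) => [r| |]//=;last by rewrite leye_eq andbF.
rewrite lte_fin => r0;rewrite indicE in_setX lee_fin andbC;congr (_ && _)%:R%:E.
by apply/idP/idP;rewrite inE/= in_itv/= r0.
Qed.

Lemma cut_points_kernel : time_kernel T cut_points.
split.
- move=> U mU;rewrite (_ : (fun w => _) = (fun w => \sum_(0 <= n <oo)
if (sg n w < +oo)%E then (\1_U (fine (sg n w), y n w))%:E else 0)%E);last first.
apply/funext => w;rewrite -[in LHS](setIT U) -integral_indic// ge0_integral_points.
+ apply: eq_eseriesr => n _;rewrite /at_atom.
by move: (cut_time_gt0 n w);case: (sg n w) => [r| |]//= _;rewrite ltry.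
+ by apply/mEFinP;exact: measurable_indic.
+ by move=> q;rewrite lee_fin.
apply: ge0_emeasurable_sum => [n w _ _|n _];first by case: ifP;rewrite lee_fin.
move=> _ B mB;rewrite setTI.
have mW : pfield Fl
(fun w t x => if `[< 0 <= t >] then (\1_U (t, x) : R)%:E else 0%E).
apply: (field_cut (I := [set t | 0 <= t])) => //;first exact: predictable_ge0.
by apply/mEFinP;apply: measurable_field_time.
have [mV _] := stopped_value_measurable fF (cut_time_stop n) (@cut_time_mark n) 0%E mW mB.
apply: eq_ind mV _ _;apply/funext => w;congr B.
move: (cut_time_gt0 n w);case: (sg n w) => [r| |]//=;rewrite lte_fin => r0.
by rewrite ltry;case: asboolP => // /(_ (ltW r0)).
- move=> w;have [N hN] := cut_time_finite w.
exact: points_measure_fin (cut_time_gt0 ^~ w) hN.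
- move=> w;have mX : measurable (~` (`]0, T] `*` setT) : set (R * V)).
by apply: measurableC;apply: measurableX => //;exact: measurable_itv.
rewrite -[X in cut_points w X](setIT) -integral_indic// integral_cut_points.
+ by apply: integral0_eq => q h;rewrite indicE memNset//=.
+ by apply/mEFinP;exact: measurable_indic.
+ by move=> q;rewrite lee_fin.
Qed.

Lemma cut_points_mean (mu nu : Omega -> jump_measure R V)
 (W : Omega -> R -> V -> \bar R) :
 {ae P, forall w, forall A, measurable A -> mu w A = points (s^~ w) (y^~ w) A} ->
 is_compensator P Fl mu nu ->
 pfield Fl W -> (forall w t x, 0 <= W w t x)%E ->
 (\int[P]_w \int[cut_points w]_q W w q.1 q.2 =
 \int[P]_w \int[nu w]_(q in `]0%R, T] `*` setT) W w q.1 q.2)%E.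
move=> muE [_ comp] mW W0.
pose W' w t x : \bar R := if `[< t \in `]0, T] >] then W w t x else 0%E.
have mI : measurable ([set p | p.2 \in `]0, T]] : set (pspace Fl)).
rewrite (_ : [set p | _] = setT `*` `]0, T]);last first.
by apply/seteqP;split => p /= //;case.
by apply: predictable_rectangleW => //;exact: filtrationT.
have mW' : pfield Fl W'.
apply: (field_cut (I := [set t | t \in `]0, T]])) => //.
exact: predictable_field_on_total.
have W'0 w t x : (0 <= W' w t x)%E by rewrite /W';case: ifP.
have cut (m : jump_measure R V) w :
(\int[m]_(q in `]0%R, +oo[ `*` setT) W' w q.1 q.2 =
\int[m]_(q in `]0%R, T] `*` setT) W w q.1 q.2)%E.
rewrite integral_mkcond [RHS]integral_mkcond;apply: eq_integral => q _.
rewrite !patchE /W';case: (boolP (q.1 \in `]0, T])) => qT.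
rewrite !mem_set//=;last by split => //;move: qT;rewrite !in_itv/= => /andP[->].
by case: asboolP.
case: asboolP => // _;rewrite [in RHS]memNset;first by case: ifP.
by move=> [] /=;rewrite (negbTE qT).
rewrite -(eq_integral _ _ (fun w _ => cut (nu w) w)) comp//;last first.
exact: predictable_field_on_total.
apply: ae_eq_nm;apply: filterS muE => w muE.
rewrite cut integral_cut_points//;last exact: field_path mW.
apply/esym/eq_measure_integral => A mA _;exact: muE.
Qed.

End cut_points.

Section cut_kernel.
Context {R : realType} {dO} {Omega : mtype dO} (P : probability Omega R).
Context {dV} {V : mtype dV}.
Variables (Fl : R -> set (set Omega)) (T : R).
Hypotheses (fF : is_filtration Fl)
 (T_ge0 : 0 <= T).
Variable nu : Omega -> jump_measure R V.
Hypothesis nuP : predictable_random_measure Fl nu.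

Lemma measurable_upto_set : measurable (`]0, T] `*` setT : set (R * V)).
Proof. exact: measurableX. Qed.

Definition cut_kernel (w : Omega) : jump_measure R V :=
 if (nu w (`]0%R, T] `*` setT) < +oo)%E
 then [the (jump_measure R V) of mrestr (nu w) measurable_upto_set]
 else [the (jump_measure R V) of mzero].

Lemma predictable_mass U : measurable U ->
 predictable_on `[0, +oo[ Fl (fun w t => nu w (U `&` `]0, t] `*` setT)).
move=> mU.
have I0 (t : R) : [set` `[0, +oo[] t = (0 <= t) by rewrite /= in_itv/= andbT.
pose W (w : Omega) (t : R) (x : V) : \bar R := (\1_U (t, x))%:E.
have mW : predictable_field_on `[0%R, +oo[ Fl W.
rewrite /predictable_field_on;under eq_set do rewrite I0.
by apply/mEFinP;exact: measurable_field_time.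
rewrite (_ : (fun w t => _) =
(fun w t => \int[nu w]_(q in `]0%R, t] `*` setT) W w q.1 q.2)%E).
by apply: nuP => // w t x;rewrite lee_fin.
apply/funext => w;apply/funext => t;rewrite /W;under eq_integral do rewrite -surjective_pairing.
rewrite integral_indic//;apply: measurableX => //;exact: measurable_itv.
Qed.

Lemma adapted_mass U t : measurable U -> 0 <= t ->
 forall B, measurable B -> Fl t [set w | B (nu w (U `&` `]0, t] `*` setT))].
move=> mU t0 B mB;have I0 (r : R) : [set` `[0, +oo[] r -> 0 <= r.
by rewrite /= in_itv/= andbT.
have mI : measurable ([set p | [set` `[0, +oo[] p.2] : set (pspace Fl)).
rewrite (_ : [set p | _] = [set p | 0 <= p.2]);first exact: predictable_ge0.
by apply/seteqP;split => p /=;rewrite in_itv/= andbT.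
have := predictable_adapted fF I0 mI (predictable_mass mU).
by move/adapted_onP => h;apply: (h fF I0) => //;rewrite /= in_itv/= t0.
Qed.

Lemma cut_compensator_kernel : time_kernel T cut_kernel.
have mass U : measurable U -> mfun setT (fun w => nu w (U `&` `]0, T] `*` setT)).
move=> mU _ B mB;rewrite setTI.
exact: (filtrationM fF T_ge0 (adapted_mass mU T_ge0 mB)).
split.
- move=> U mU;rewrite (_ : (fun w => _) = (fun w =>
if (nu w (`]0%R, T] `*` setT) < +oo)%E then nu w (U `&` `]0, T] `*` setT) else 0%E)).
apply: measurable_fun_ifT => //;last exact: mass.
apply: measurable_fun_lte => //;have := mass setT measurableT.
by under eq_fun do rewrite setTI.
by apply/funext => w;rewrite /cut_kernel;case: ifP => _ //=;rewrite setIC.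
- move=> w;rewrite /cut_kernel;case: ifPn => h /=;last by rewrite /mzero ltry.
by rewrite /mrestr setTI.
- move=> w;rewrite /cut_kernel;case: ifPn => h //=.
by rewrite /mrestr setICl measure0.
Qed.

Lemma cut_compensatorE w : (nu w (`]0%R, T] `*` setT) < +oo)%E ->
 forall U, cut_kernel w U = nu w (U `&` `]0, T] `*` setT).
Proof. by move=> h U;rewrite /cut_kernel h. Qed.

Lemma integral_cut_compensator (f : R * V -> \bar R) w :
 (nu w (`]0%R, T] `*` setT) < +oo)%E ->
 mfun setT f -> (forall q, 0 <= f q)%E ->
 (\int[cut_kernel w]_q f q = \int[nu w]_(q in `]0%R, T] `*` setT) f q)%E.
move=> h mf f0;rewrite /cut_kernel h ge0_integral_mrestr ?setTI//.
Qed.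

End cut_kernel.

Section kernel_difference.
Context {R : realType} {dO} {Omega : mtype dO} (P : probability Omega R).
Context {dV} {V : mtype dV}.
Variable T : R.
Variables n1 n2 : Omega -> jump_measure R V.
Hypotheses (nk1 : time_kernel T n1)
 (nk2 : time_kernel T n2)
 (fin1 : (\int[P]_w n1 w setT < +oo)%E)
 (fin2 : (\int[P]_w n2 w setT < +oo)%E).
Implicit Types n : Omega -> jump_measure R V.

Lemma kernel_le n U w : measurable U -> (n w U <= n w setT)%E.
Proof. by move=> mU;apply: le_measure => //;rewrite inE. Qed.

Lemma kernel_mass_integrable n U : time_kernel T n -> (\int[P]_w n w setT < +oo)%E ->
 measurable U -> P.-integrable setT (fun w => n w U).
move=> nk fin mU;apply: ge0_integrable => //;first exact: tk_measurable nk _ mU.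
apply: le_lt_trans fin;apply: ge0_le_integral => //.
- exact: tk_measurable nk _ mU.
- exact: tk_measurable nk _ measurableT.
- by move=> w _;exact: kernel_le.
Qed.

Lemma kernel_mass_fin n U w : time_kernel T n -> measurable U ->
 n w U = (fine (n w U))%:E.
move=> nk mU;rewrite fineK// ge0_fin_numE//.
by apply: le_lt_trans (tk_finite nk w);exact: kernel_le.
Qed.
Let mX (a b : R) B : measurable B -> measurable (`]a, b] `*` B : set (R * V)).
Proof. by move=> mB;apply: measurableX => //;exact: measurable_itv. Qed.
Let kernel_split n A B s t : time_kernel T n -> (\int[P]_w n w setT < +oo)%E ->
 measurable A -> measurable B -> 0 <= s -> s <= t ->
 (\int[P]_(w in A) n w (`]0%R, t] `*` B) = \int[P]_(w in A) n w (`]0%R, s] `*` B) +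
 \int[P]_(w in A) n w (`]s, t] `*` B))%E.
move=> nk fin mA mB s0 st;rewrite -ge0_integralD//;last 2 first.
- by apply: mfunTS;exact: tk_measurable nk _ (mX _ _ mB).
- by apply: mfunTS;exact: tk_measurable nk _ (mX _ _ mB).
apply: eq_integral => w _;rewrite -measureU//;try exact: mX.
- congr (n w _);apply/seteqP;split => -[u x] /=;rewrite !in_itv/=.
by move=> [/andP[u0 ut] Bx];case: (leP u s) => us;[left|right];rewrite ?u0.
move=> [[/andP[u0 us] Bx]|[/andP[su ut] Bx]];split => //.
by rewrite u0 (le_trans us).
by rewrite (le_lt_trans s0 su).
- apply/seteqP;split => // -[u x] [[/= u1 _] [/= u2 _]].
by move: u1 u2;rewrite !in_itv/= => /andP[_ h] /andP[h' _];move: (lt_le_trans h' h);rewrite ltxx.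
Qed.

(** Being centred over `]s, t] is what the increment of a martingale is. *)
Lemma kernel_difference_martingaleP A B s t : measurable A -> measurable B ->
 0 <= s -> s <= t ->
 ((\int[P]_(w in A) (fine (n1 w (`]0%R, t] `*` B)) - fine (n2 w (`]0%R, t] `*` B)))%:E =
 \int[P]_(w in A) (fine (n1 w (`]0%R, s] `*` B)) - fine (n2 w (`]0%R, s] `*` B)))%:E) <->
 \int[P]_(w in A) n1 w (`]s, t] `*` B) = \int[P]_(w in A) n2 w (`]s, t] `*` B))%E.
move=> mA mB s0 st.
have int n a b : time_kernel T n -> (\int[P]_w n w setT < +oo)%E ->
P.-integrable A (fun w => n w (`]a, b] `*` B)).
move=> nk fin;apply: (integrableS measurableT) => //.
exact: kernel_mass_integrable nk fin (mX _ _ mB).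
have diff r : (\int[P]_(w in A) (fine (n1 w (`]0%R, r] `*` B)) - fine (n2 w (`]0%R, r] `*` B)))%:E =
\int[P]_(w in A) n1 w (`]0%R, r] `*` B) - \int[P]_(w in A) n2 w (`]0%R, r] `*` B))%E.
rewrite -integralB//;[|exact: int|exact: int].
apply: eq_integral => w _;rewrite EFinB.
by rewrite -(kernel_mass_fin _ nk1 (mX _ _ mB)) -(kernel_mass_fin _ nk2 (mX _ _ mB)).
rewrite !diff (kernel_split nk1 fin1 mA mB s0 st) (kernel_split nk2 fin2 mA mB s0 st).
have fin n a b : time_kernel T n -> (\int[P]_w n w setT < +oo)%E ->
exists r : R, (\int[P]_(w in A) n w (`]a, b] `*` B) = r%:E)%E.
move=> nk f;exists (fine (\int[P]_(w in A) n w (`]a, b] `*` B))%E).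
by rewrite fineK// integrable_fin_num//;exact: int.
have [a ->] := fin _ 0 s nk1 fin1;have [b ->] := fin _ s t nk1 fin1.
have [c ->] := fin _ 0 s nk2 fin2;have [e ->] := fin _ s t nk2 fin2.
by split => -[h];congr EFin;lra.
Qed.

End kernel_difference.

Lemma integral_rectangle {R : realType} {T : Type} {dV} {V : mtype dV}
 (m : jump_measure R V) (A : set T) (a b : R) (B : set V) w :
 measurable B ->
 (\int[m]_q (\1_((A `*` `]a, b]) `*` B) ((w, q.1), q.2))%:E =
 (\1_A w)%:E * m (`]a, b] `*` B))%E.
move=> mB;have mX : measurable (`]a, b] `*` B : set (R * V)).
exact: measurableX.
have -> : (fun q => (\1_((A `*` `]a, b]) `*` B) ((w, q.1), q.2) : R)%:E) =
(fun q => (\1_A w : R)%:E * (\1_(`]a, b] `*` B) q)%:E)%E.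
apply/funext => -[u x];rewrite -EFinM !indicE !in_setX/= -andbA.
by case: (w \in A);rewrite ?mul1r ?mul0r.
rewrite ge0_integralZl//;first by rewrite integral_indic// setIT.
by apply/mEFinP;exact: measurable_indic.
Qed.

(** * Immersion *)

Section immersion_mean.
Context {R : realType} {dO} {Omega : mtype dO} (P : probability Omega R).
Context {dV} {V : mtype dV}.
Variables (Fl Gl : R -> set (set Omega)) (T : R).
Variables (s : nat -> Omega -> \bar R) (y : nat -> Omega -> V).
Variables (mu nu : Omega -> jump_measure R V).
Hypotheses (mp : marked_points Fl s y)
 (fG : is_filtration Gl)
 (im : immersed P Fl Gl)
 (T_ge0 : 0 <= T)
 (muE : {ae P, forall w, forall A, measurable A ->
 mu w A = points (s^~ w) (y^~ w) A})
 (comp : is_compensator P Fl mu nu)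
 (fin : (\int[P]_w nu w (`]0%R, T] `*` setT) < +oo)%E).
Let fF := mp_filtration mp.
Let nuP := proj1 comp.
Local Notation n1 := (cut_points T s y).
Local Notation n2 := (cut_kernel T nu).
Let nk1 : time_kernel T n1 := cut_points_kernel mp T_ge0.
Let nk2 : time_kernel T n2 := cut_compensator_kernel fF T_ge0 nuP.
Let mmass : mfun setT (fun w => nu w (`]0, T] `*` setT)).
move=> _ B mB;rewrite setTI.
have := filtrationM fF T_ge0 (adapted_mass fF nuP measurableT T_ge0 mB).
by congr measurable;apply/seteqP;split => w /=;rewrite setTI.
Qed.

Lemma compensator_mass_ae : {ae P, forall w, (nu w (`]0%R, T] `*` setT) < +oo)%E}.
have /(integrable_ae measurableT) : P.-integrable setT (fun w => nu w (`]0, T] `*` setT)).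
by apply: ge0_integrable.
by apply: filterS => w /(_ I);rewrite ge0_fin_numE.
Qed.
Let fin1 : (\int[P]_w n1 w setT < +oo)%E.
rewrite (eq_integral (fun w => \int[n1 w]__ 1%E)%E);last first.
by move=> w _;rewrite integral_cst// mul1e.
rewrite (cut_points_mean T mp muE comp (W := fun _ _ _ => 1%E))//;last exact: measurable_cst.
apply: le_lt_trans fin;rewrite le_eqVlt;apply/orP;left;apply/eqP.
by apply: eq_integral => w _;rewrite integral_cst ?mul1e//;exact: measurable_upto_set.
Qed.
Let fin2 : (\int[P]_w n2 w setT < +oo)%E.
rewrite (ae_eq_nm (g := fun w => nu w (`]0, T] `*` setT)))//.
by apply: filterS compensator_mass_ae => w h;rewrite cut_compensatorE// setTI.
Qed.
Let M B w (t : R) : R := fine (n1 w (`]0, t] `*` B)) -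
 fine (nu w ((setT `*` B) `&` `]0, Num.min t T] `*` setT)).
Let mX (a b : R) B : measurable B -> measurable (`]a, b] `*` B : set (R * V)).
Proof. by move=> mB;apply: measurableX => //;exact: measurable_itv. Qed.
Let cutE B t w : (nu w (`]0%R, T] `*` setT) < +oo)%E ->
 nu w ((setT `*` B) `&` `]0, Num.min t T] `*` setT) = n2 w (`]0, t] `*` B).
move=> h;rewrite cut_compensatorE//;congr (nu w _);apply/seteqP;split => -[u x] /=;
rewrite !in_itv/= le_min.
by move=> [[_ Bx] [/and3P[-> -> ->] _]].
by move=> [[/andP[-> ->] Bx] [/andP[_ ->] _]].
Qed.
Let kernel_path_adapted B t : measurable B -> 0 <= t ->
 forall A, measurable A -> Fl t [set w | A (n1 w (`]0, t] `*` B))].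
move=> mB t0 A mA.
have mU : mfun [set: g_sigma_algebraType (Fl t)]
(fun w : g_sigma_algebraType (Fl t) => n1 w (`]0, t] `*` B)).
rewrite (_ : (fun w => _) = (fun w => \sum_(0 <= n <oo)
(\1_(y n @^-1` B `&` [set w | cut_time T (s n) w <= t%:E]%E) w)%:E)%E);last first.
by apply/funext => w;rewrite (cut_points_measure T mp).
apply: ge0_emeasurable_sum => [n w _ _|n _];first by rewrite lee_fin.
apply/mEFinP;apply: measurable_indic.
by rewrite (filtrationE fF t0);exact: (cut_time_mark mp T_ge0).
have := mU measurableT _ mA;rewrite setTI (filtrationE fF t0);exact.
Qed.
Let M_adapted B : measurable B -> adapted_on `[0, +oo[ Fl (M B).
move=> mB t;rewrite /= in_itv/= andbT => t0.
have m0 : 0 <= Num.min t T by rewrite le_min t0.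
apply: measurable_funB;apply: mcomp => //= _ A mA;rewrite setTI
(filtrationE fF t0).
exact: kernel_path_adapted.
apply: (filtrationS fF m0);first by rewrite ge_min lexx.
by apply: (adapted_mass fF nuP) => //;exact: measurableX.
Qed.
Let M_cut B t A : measurable A -> (\int[P]_(w in A) (M B w t)%:E =
 \int[P]_(w in A) (fine (n1 w (`]0, t] `*` B)) - fine (n2 w (`]0, t] `*` B)))%:E)%E.
move=> mA;have [N [mN N0 hN]] := compensator_mass_ae.
apply: (eq_negligible mN N0) => w _ Nw.
by rewrite /M cutE//;apply: contrapT => h;apply: Nw;exact: hN.
Qed.
Let M_martingale B : measurable B -> martingale P Fl (M B).
move=> mB;split;first exact: M_adapted.
- move=> t t0.
have i1 := kernel_mass_integrable nk1 fin1 (mX 0 t mB).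
have m2 : mfun setT
(fun w => nu w ((setT `*` B) `&` `]0, Num.min t T] `*` setT)).
move=> _ A mA;rewrite setTI;have m0 : 0 <= Num.min t T by rewrite le_min t0.
apply: (filtrationM fF m0);apply: (adapted_mass fF nuP) => //.
exact: measurableX.
have i2 : P.-integrable setT (fun w => nu w ((setT `*` B) `&` `]0, Num.min t T] `*` setT)).
apply: ge0_integrable => //;apply: le_lt_trans fin;apply: ge0_le_integral => //.
move=> w _;apply: le_measure;rewrite ?inE.
+ by apply: measurableI;[exact: measurableX|exact: mX].
+ exact: measurable_upto_set.
+ by move=> -[u x] /= [_ []];rewrite !in_itv/= le_min => /and3P[-> _ ->].
have -> : (fun w => (M B w t)%:E) = (fun w => (fine (n1 w (`]0, t] `*` B)))%:E -
(fine (nu w ((setT `*` B) `&` `]0, Num.min t T] `*` setT)))%:E)%E.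
by apply/funext => w;rewrite EFinB.
have fine_le (x : \bar R) : (`|(fine x)%:E| <= `|x|)%E.
by case: x => [r| |] //=;rewrite normr0 leey.
apply: integrableB => //;[apply: le_integrable i1|apply: le_integrable i2] => //.
+ apply/mEFinP;apply: mcomp => //.
exact: tk_measurable nk1 _ (mX _ _ mB).
+ by apply/mEFinP;apply: mcomp.
- move=> r t A r0 rt FA;have mA := filtrationM fF r0 FA.
rewrite !M_cut//;apply/(kernel_difference_martingaleP nk1 nk2 fin1 fin2) => //.
pose W w u x : \bar R := (\1_((A `*` `]r, t]) `*` B) ((w, u), x))%:E.
have mW : pfield Fl W.
apply/mEFinP;rewrite (_ : (fun q => _) =
(\1_((A `*` `]r, t]) `*` B) : pspace Fl * V -> R));last first.
by apply/funext => -[[w u] x].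
apply: measurable_indic;apply: measurableX => //.
exact: predictable_rectangleW.
have W0 w u x : (0 <= W w u x)%E by rewrite lee_fin.
rewrite 2!(integral_mkcond A).
transitivity (\int[P]_w \int[n1 w]_q W w q.1 q.2)%E.
apply: eq_integral => w _;rewrite integral_rectangle//.
by rewrite patchE indicE;case: ifP;rewrite ?mul1e ?mul0e.
rewrite (cut_points_mean T mp muE comp)//;apply: ae_eq_nm.
apply: filterS compensator_mass_ae => w h.
rewrite -integral_cut_compensator//;last exact: field_path mW.
rewrite integral_rectangle//.
by rewrite patchE indicE;case: ifP;rewrite ?mul1e ?mul0e.
Qed.

(** The difference of the two masses accumulated over a set of marks is a
martingale of the small filtration; immersion makes it one of the large
filtration, and this determines the mean of every predictable integral there. *)
Lemma immersion_mean (W : Omega -> R -> V -> \bar R) :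
 pfield Gl W -> (forall w t x, 0 <= W w t x)%E ->
 (\int[P]_w \int[n1 w]_q W w q.1 q.2 =
 \int[P]_w \int[nu w]_(q in `]0%R, T] `*` setT) W w q.1 q.2)%E.
move=> mW W0;transitivity (\int[P]_w \int[n2 w]_q W w q.1 q.2)%E;last first.
apply: ae_eq_nm;apply: filterS compensator_mass_ae => w h.
by rewrite integral_cut_compensator//;exact: field_path mW.
apply: (mean_uniqueness fG T_ge0 nk1 nk2) => // A r t B r0 rt GA mB.
have mA := filtrationM fG r0 GA.
apply/(kernel_difference_martingaleP nk1 nk2 fin1 fin2) => //.
by rewrite -!M_cut//;have [_ _] := im (M_martingale mB);exact.
Qed.

End immersion_mean.

Section generated_filtrations.
Context {R : realType} {dO} {Omega : mtype dO}.

Lemma constant_filtration :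
 is_filtration (fun _ : R => (measurable : set (set Omega))) /\
 right_continuous_filtration (fun _ : R => (measurable : set (set Omega))).
split;last by move=> t t0 A /(_ (t + 1));apply;rewrite /= in_itv/= andbT ltrDl.
have sg : sigma_algebra setT (measurable : set (set Omega)).
split;first exact: measurable0.
- by move=> A mA;rewrite setTD;exact: measurableC.
- by move=> A mA;apply: bigcup_measurable => n _;exact: mA.
by split => [t _|t _ A|s t _ _ A].
Qed.

Lemma natural_filtrationP {dE} {E : mtype dE} (X : Omega -> R -> E) :
 (forall t, 0 <= t -> mfun setT (X ^~ t)) ->
 is_filtration (natural_filtration X).
move=> mX;have [fM rM] := constant_filtration.
apply: proj1 (smallest_filtration_filtration _).
exists (fun=> measurable);split => //.
have h := adapted_onP fM (I := `[0, +oo[%classic) X;apply/h => [t|t B];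
rewrite /= in_itv/= andbT// => t0 mB.
by have := mX t t0 measurableT _ mB;rewrite setTI.
Qed.

Variables (Fl : R -> set (set Omega)) (tau : Omega -> \bar R).
Hypotheses (fF : is_filtration Fl)
 (mtau : mfun setT tau)
 (tau0 : forall w, (0 <= tau w)%E).
Local Notation G := (progressive_enlargement Fl tau).

Lemma progressive_enlargementP :
 [/\ is_filtration G, forall t, 0 <= t -> Fl t `<=` G t & stopping_time G tau].
have [fM rM] := constant_filtration;split.
- apply: proj1 (smallest_filtration_filtration _).
exists (fun=> measurable);split => //;split => [t t0 A|].
exact: filtrationM.
split => // t t0.
by rewrite -[X in measurable X]setTI;exact: emeasurable_fun_infty_c.
- by move=> t t0 A FA H fH rH [FH _];exact: FH.
- by split => // t t0 H fH rH [_ [_]];apply.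
Qed.

End generated_filtrations.

Section marked_points_theory.
Context {R : realType} {dO} {Omega : mtype dO}.

Lemma marked_points_sub (Fl Gl : R -> set (set Omega)) {dV} {V : mtype dV}
 (s : nat -> Omega -> \bar R) (y : nat -> Omega -> V) :
 is_filtration Gl -> (forall t, 0 <= t -> Fl t `<=` Gl t) ->
 marked_points Fl s y -> marked_points Gl s y.
move=> fG FG mp;split => //.
- by move=> n;exact: stopping_time_sub FG (mp_stop mp n).
- exact: mp_gt0 mp.
- by move=> n B t mB t0;apply: FG => //;exact: mp_mark mp n B t mB t0.
- exact: mp_discrete mp.
Qed.

Context {d : nat}.
Implicit Types (s : nat -> Omega -> \bar R) (xi : nat -> Omega -> 'rV[R]_d).

Lemma marked_points_step Fl s xi : is_filtration Fl ->
 (forall n, stopping_time Fl (s n) /\ forall w, 0 < s n w)%E ->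
 (forall n w, s n w <= s n.+1 w /\ (s n w < +oo -> s n w < s n.+1 w))%E ->
 (forall w, s n w @[n --> \oo] --> +oo%E) ->
 (forall n, mfun
 [set: g_sigma_algebraType (stopped_sigma_algebra Fl (s n))]
 (fun w : g_sigma_algebraType (stopped_sigma_algebra Fl (s n)) => xi n w)) ->
 marked_points Fl s xi.
move=> fF sP step cvg mxi;split => //.
- by move=> n;case: (sP n).
- by move=> n w;case: (sP n).
- move=> n B t mB t0;have := mxi n measurableT _ mB;rewrite setTI.
rewrite (stopped_measurableE fF (proj1 (sP n))) => -[_];exact.
- move=> w t;have [N tN] := step_time_exceeds (cvg w) t.
exists N => n Nn;apply: lt_le_trans tN _.
by apply: (step_time_le (s := s ^~ w)) => // k;exact: step.
Qed.

Lemma marked_points_pair Gl s xi tau : marked_points Gl s xi ->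
 stopping_time Gl tau -> (forall w, 0 < tau w)%E ->
 marked_points Gl (fun n w => pair_time (s^~ w) (tau w) n)
 (fun n w => pair_mark (xi^~ w) n).
move=> mp st tau0;have fG := mp_filtration mp;split => //.
- by case=> [|n] //=;exact: mp_stop mp n.
- by case=> [|n] w //=;exact: mp_gt0 mp n w.
- case=> [|n] B t mB t0 /=.
rewrite (_ : _ @^-1` B = if `[< B (0, 1) >] then setT else set0).
case: ifP => _;rewrite ?setTI ?set0I;last exact: filtration0.
by case: st => _;apply.
by apply/seteqP;split => w /=;case: asboolP.
have mB' : measurable [set x : 'rV[R]_d | B (x, 0)].
rewrite -[X in measurable X]setTI.
have mf : mfun [set: 'rV[R]_d] (fun x => (x, 0 : R)).
by apply: measurable_fun_pair;[exact: measurable_id|exact: measurable_cst].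
exact: mf measurableT _ mB.
exact: mp_mark mp n _ _ mB' t0.
- move=> w t;have [N hN] := mp_discrete mp w t;exists N.+1;case=> // n;exact: hN.
Qed.

End marked_points_theory.

Definition first_passage {R : realType} (T a : R) (f : R -> R) : R :=
 inf ([set t | 0 <= t <= T /\ a <= f t] `|` [set T]).

Lemma first_passage_le {R : realType} (T a : R) (f : R -> R) t : 0 <= t -> 0 <= T ->
 {homo f : x y / x <= y} -> f @ t^'+ --> f t ->
 first_passage T a f <= t <-> T <= t \/ a <= f t.
move=> t0 T0 fnd frc;rewrite /first_passage;set A := (X in inf X).
have lA : has_lbound A by exists 0 => r [[/andP[]]//|->].
split=> [At|[Tt|aft]];last 2 first.
- by apply: le_trans Tt;apply: ge_inf => //;right.
- have [tT|/ltW Tt] := leP t T;first by apply: ge_inf => //;left;rewrite /= t0.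
by apply: le_trans Tt;apply: ge_inf => //;right.
have [|tT] := leP T t;[by left|right];rewrite leNgt;apply/negP => fa.
have e0 : 0 < a - f t by rewrite subr_gt0.
have /cvgrPdist_lt/(_ _ e0) h := frc.
suff : exists2 r, t < r & r <= inf A.
by move=> [r tr /le_trans/(_ At)];rewrite leNgt tr.
near (t^'+)%R => r;exists r => //.
apply: lb_le_inf;first by exists T;right.
have far : f r < a.
have : `|f t - f r| < a - f t by near: r.
by have := ler_norm (f r - f t);rewrite distrC;lra.
move=> u [[/= _ au]|->];last by near: r;exact/nbhs_right_le.
by rewrite leNgt;apply/negP => /ltW/fnd fur;move: (le_trans au fur);rewrite leNgt far.
Unshelve. all: by end_near. Qed.

(** * Quasi-left continuity *)

Section predictable_atoms.
Context {R : realType} {dO} {Omega : mtype dO} (P : probability Omega R).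
Context {dV} {V : mtype dV}.
Variables (Fl : R -> set (set Omega)) (T : R) (B : set V).
Variable m : Omega -> jump_measure R V.
Hypotheses (fF : is_filtration Fl)
 (T_gt0 : 0 < T)
 (mB : measurable B)
 (mP : forall W : Omega -> R -> V -> \bar R,
 pfield Fl W -> (forall w t x, 0 <= W w t x)%E ->
 pprocess Fl
 (fun w t => \int[m w]_(q in `]0%R, t] `*` setT) W w q.1 q.2)%E)
 (m_fin : {ae P, forall w, (m w (`]0%R, T] `*` B) < +oo)%E})
 (m_null : forall S : Omega -> R,
 predictable_time Fl (fun w => (S w)%:E) -> (forall w, 0 < S w <= T) ->
 {ae P, forall w, m w ([set S w] `*` B) = 0%E}).
Local Notation PS := (pspace Fl).
Let mX (a b : R) : measurable (`]a, b] `*` B : set (R * V)).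
Proof. exact: measurableX. Qed.
Let mass w t := m w (`]0, t] `*` B).
Let mass_le w r t : r <= t -> (mass w r <= mass w t)%E.
move=> rt;apply: le_measure;rewrite ?inE// => -[u x] [/=];rewrite !in_itv/=.
by move=> /andP[-> ur] Bx;rewrite (le_trans ur rt).
Qed.
Let slice_measurable w (D : set PS) : measurable D ->
 measurable [set q : R * V | D (w, q.1)].
move=> mD;have h : mfun setT (fun q : R * V => (w, q.1) : PS).
apply: (@mcomp _ _ _ _ _ _ (fun t => (w, t) : PS)) => //.
exact: measurable_predictable_slice.
by have := h measurableT D mD;rewrite setTI.
Qed.
Let predictable_mass_of (D : set PS) : measurable D ->
 pprocess Fl (fun w t =>
 m w ([set q | D (w, q.1)] `&` (`]0, t] `*` B))).
move=> mD.
have mf : pfield Fl (fun w u x => (\1_(D `*` B) ((w, u), x) : R)%:E).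
apply/mEFinP;rewrite (_ : (fun q => _) =
(\1_(D `*` B) : PS * V -> R));last by apply/funext => -[[w u] x].
by apply: measurable_indic;exact: measurableX.
rewrite (_ : (fun w t => _) = (fun w t => \int[m w]_(q in `]0%R, t] `*` setT)
(\1_(D `*` B) ((w, q.1), q.2))%:E)%E).
by apply: (mP mf) => w t x;rewrite lee_fin.
apply/funext => w;apply/funext => t.
have mDw : measurable ([set q | D (w, q.1)] `&` (setT `*` B) : set (R * V)).
apply: measurableI;last exact: measurableX.
exact: slice_measurable.
transitivity (\int[m w]_(q in `]0%R, t] `*` setT)
(\1_([set q | D (w, q.1)] `&` (setT `*` B)) q)%:E)%E;last first.
apply: eq_integral => -[u x] _;congr (_%:E);rewrite !indicE;congr (_%:R).
by rewrite in_setI !in_setX/= in_setT;congr (_ && _);rewrite inE;apply/asboolP/idP;rewrite inE.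
rewrite integral_indic//;last exact: measurableX.
congr (m w _);apply/seteqP;split => -[u x] /=;first by move=> [? [? ?]].
by move=> [[? [_ ?]] [? _]].
Qed.
Let predictable_mass_process : pprocess Fl mass.
rewrite (_ : mass = fun w t => m w ([set q | setT (w, q.1)] `&` (`]0, t] `*` B))).
exact: predictable_mass_of.
by apply/funext => w;apply/funext => t;rewrite setTI.
Qed.

(** The part of the mass accumulated before it exceeds a level is finite on
every path, so that its first passage times are attained everywhere. *)
Let low (k : nat) : set PS := [set p | (mass p.1 p.2 <= k%:R%:E)%E].
Let mlow k : measurable (low k).
rewrite -[X in measurable X]setTI;exact: emeasurable_fun_infty_c.
Qed.
Let lowset k w : set (R * V) := [set q | low k (w, q.1)] `&` (`]0, T] `*` B).
Let mlowset k w : measurable (lowset k w).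
by apply: measurableI => //;apply: slice_measurable;exact: mlow.
Qed.
Let low_mass k w : (m w (lowset k w) <= k%:R%:E)%E.
pose I := [set t | 0 < t <= T /\ (mass w t <= k%:R%:E)%E].
have lowE q : lowset k w q <-> I q.1 /\ B q.2.
rewrite /lowset/I /= in_itv/=;split;first by move=> [? [? ?]].
by move=> [[? ?] ?].
have [[t0 It0]|/set0P/negP/negPn/eqP I0] := pselect (I !=set0);last first.
rewrite (_ : lowset k w = set0) ?measure0 ?lee_fin//.
by apply/seteqP;split => // q /lowE[];rewrite I0.
have uI : has_ubound I by exists T => t [/andP[_ ?] _].
have hI : has_sup I by split => //;exists t0.
pose sg := sup I.
have Isg t : I t -> t <= sg by move=> It;exact: ub_le_sup.
have [Is|nIs] := pselect (I sg).
case: Is => sT;apply: le_trans;apply: le_measure;rewrite ?inE//.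
by move=> q /lowE[Iq Bq];split => //=;rewrite in_itv/= Isg// andbT;case: Iq => /andP[].
have below t : t < sg -> (mass w t <= k%:R%:E)%E.
move=> ts;have e0 : 0 < sg - t by rewrite subr_gt0.
have [r Ir] := sup_adherent e0 hI;rewrite subKr => tr.
by apply: le_trans (mass_le w (ltW tr)) _;case: Ir.
pose F n : set (R * V) := `]0, sg - n.+1%:R^-1] `*` B.
apply: (@le_trans _ _ (m w (\bigcup_n F n))).
apply: le_measure;rewrite ?inE//;first by apply: bigcup_measurable => n _;exact: mX.
move=> q /lowE[Iq Bq].
have qs : q.1 < sg.
by rewrite lt_neqAle Isg// andbT;apply/eqP => qs;apply: nIs;rewrite -qs.
have e0 : 0 < sg - q.1 by rewrite subr_gt0.
have /cvgrPdist_lt/(_ _ e0)[n _ hn] : (n.+1%:R : R)^-1 @[n --> \oo] --> 0.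
exact: cvg_harmonic.
exists n => //;split => //=;rewrite in_itv/=;apply/andP;split.
by case: Iq => /andP[].
have := hn n (leqnn n);rewrite /= sub0r normrN ger0_norm//.
by move: (n.+1%:R^-1) => v hv;lra.
have cF : m w (F n) @[n --> \oo] --> m w (\bigcup_n F n).
apply: nondecreasing_cvg_mu => //;first by move=> n;exact: mX.
by apply: bigcup_measurable => n _;exact: mX.
move=> a b ab;apply/subsetPset => -[u x] [/=];rewrite in_itv/= => /andP[u0 ua] Bx.
split => //=;rewrite in_itv/= u0/=;apply: le_trans ua _;rewrite lerD2l lerN2 lef_pV2 ?posrE//.
by rewrite ler_nat.
rewrite -(cvg_lim _ cF)//;apply: lime_le;first by apply/cvg_ex;eexists;exact: cF.
by apply: nearW => n;apply: below;rewrite ltrBlDr ltrDl.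
Qed.
Let lowm k w : jump_measure R V := mrestr (m w) (mlowset k w).
Let lowm_fin k w : (lowm k w setT < +oo)%E.
by rewrite /lowm /= /mrestr setTI;apply: le_lt_trans (low_mass k w) _;rewrite ltry.
Qed.

Local Notation F k w := (time_mass (lowm k w) B).
Let S k a w := first_passage T a (F k w).
Let S_le k a w t : 0 <= t -> S k a w <= t <-> T <= t \/ a <= F k w t.
move=> t0;apply: first_passage_le => //;first exact: ltW.
- by move=> x y;exact: time_mass_nd.
- exact: time_mass_right.
Qed.
Let S_interval k a w : 0 < a -> 0 < S k a w <= T.
move=> a0;apply/andP;split;last by apply/S_le;[exact: ltW|left].
by rewrite ltNge;apply/negP => /S_le[]//;rewrite ?time_mass0 leNgt ?T_gt0 ?a0.
Qed.
Let predictable_F k : pprocess Fl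
 (fun w t => fine (m w ([set q | low k (w, q.1)] `&` (`]0, t] `*` B)))).
Proof. by apply: mcomp => //;exact: predictable_mass_of. Qed.
Let FE k w t : t <= T -> F k w t = fine (m w ([set q | low k (w, q.1)] `&` (`]0, t] `*` B))).
move=> tT;rewrite /time_mass /lowm /= /mrestr /lowset;congr (fine (m w _)).
apply/seteqP;split => -[u x] /=;first by move=> [? [? _]].
move=> [? [ut ?]];split => //;split => //;split => //.
by move: ut;rewrite !in_itv/= => /andP[-> /le_trans ->].
Qed.
Let S_predictable k a : 0 < a -> predictable_time Fl (fun w => (S k a w)%:E).
move=> a0.
have mF : measurable ([set p | 0 <= p.2] `&` [set p | T <= p.2 \/
a <= fine (m p.1 ([set q | low k (p.1, q.1)] `&` (`]0, p.2] `*` B)))] : set PS).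
rewrite setIUr;apply: measurableU.
have mI : measurable (`[T, +oo[%classic : set R) by exact: measurable_itv.
have := measurable_predictable_time fF (predictable_ge0 fF) mI;congr measurable.
by apply/seteqP;split => p /=;rewrite in_itv/= andbT.
apply: measurableI;first exact: predictable_ge0.
have mI : measurable (`[a, +oo[%classic : set R) by exact: measurable_itv.
have := predictable_F k measurableT mI;rewrite setTI;congr measurable.
by apply/seteqP;split => p /=;rewrite in_itv/= andbT.
have SE : [set p : PS | 0 <= p.2 /\ ((S k a p.1)%:E <= p.2%:E)%E] =
[set p | 0 <= p.2] `&` [set p | T <= p.2 \/
a <= fine (m p.1 ([set q | low k (p.1, q.1)] `&` (`]0, p.2] `*` B)))].
apply/seteqP;split => -[w t] /= [t0];rewrite lee_fin => h;split => //.
move/(S_le _ _ _ t0): h => [|h];[by left|].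
by have [tT|/ltW] := leP t T;[right;rewrite -FE|left].
apply/S_le => //;case: h => [|h];[by left|].
by have [tT|/ltW] := leP t T;[right;rewrite FE|left].
split;last by rewrite SE.
split=> [w|t t0];first by rewrite lee_fin ltW//;case/andP: (S_interval k w a0).
have h := measurable_predictable_section fF t0.
rewrite -SE in mF;have := h measurableT _ mF;rewrite setTI filtrationE//.
by congr (Fl t _);apply/seteqP;split => w /=;[case|].
Qed.

(** First passage times of the accumulated mass are predictable, and rational
levels reach every atom. *)
Lemma predictable_atomless :
 {ae P, forall w, forall t, 0 < t <= T -> m w ([set t] `*` B) = 0%E}.
have null : {ae P, forall w, forall (k n : nat),
if @unpickle rat n is Some q then
0 < ratr q :> R -> m w ([set S k (ratr q) w] `*` B) = 0%E else True}.
apply/ae_foralln => k;apply/ae_foralln => n;case: unpickle => [q|];last exact: aeW.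
have [q0|q0] := ltP (0 : R) (ratr q);last exact: aeW.
have := m_null (S_predictable k q0) (fun w => S_interval k w q0).
by apply: filterS => w h.
apply: filterS2 m_fin null => w fin null t /andP[t0 tT].
have mt : measurable ([set t] `*` B : set (R * V)) by apply: measurableX.
have mlt : (m w ([set t] `*` B) < +oo)%E.
apply: le_lt_trans fin;apply: le_measure;rewrite ?inE// => -[u x] [/= -> Bx].
by split => //=;rewrite in_itv/= t0.
apply/eqP;rewrite eq_le measure_ge0 andbT leNgt;apply/negP => pos.
have [k hk] : exists k : nat, (mass w T <= k%:R%:E)%E.
have : mass w T \is a fin_num by rewrite ge0_fin_numE.
move=> /fineK <-;exists (Num.bound (fine (mass w T)));rewrite lee_fin.
by rewrite ltW// unstable.ltr_bound.
have lowE r : r <= T -> [set q | low k (w, q.1)] `&` (`]0, r] `*` B) = `]0, r] `*` B.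
move=> rT;rewrite setIC;apply/setIidPl => -[u x] [/=];rewrite in_itv/= => /andP[_ ur] _.
by apply: le_trans hk;apply: mass_le;exact: le_trans rT.
have gap r : 0 <= r -> r < t -> F k w r + fine (m w ([set t] `*` B)) <= F k w t.
move=> r0 rt;rewrite !FE ?(le_trans (ltW rt))// !lowE ?(le_trans (ltW rt))//.
have fn U : measurable U -> U `<=` `]0, T] `*` B -> m w U \is a fin_num.
move=> mU UT;rewrite ge0_fin_numE//;apply: le_lt_trans fin.
by apply: le_measure;rewrite ?inE.
have sub u : u <= T -> `]0, u] `*` B `<=` `]0, T] `*` B.
move=> uT -[v x] [/=];rewrite !in_itv/= => /andP[v0 vu] Bx;split => //=.
by rewrite v0 (le_trans vu).
have tsub : [set t] `*` B `<=` `]0, T] `*` B.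
by move=> -[v x] [/= -> Bx];split => //=;rewrite in_itv/= t0.
rewrite -fineD;[|by apply: fn => //;apply: sub;exact: le_trans (ltW rt) tT|exact: fn].
apply: fine_le;[|by apply: fn => //;exact: sub|].
by rewrite fin_numD !fn//;apply: sub;exact: le_trans (ltW rt) tT.
rewrite -measureU//;last first.
apply/seteqP;split => // -[v x] [[/=]];rewrite in_itv/= => /andP[_ vr] _ [vt _].
by move: rt;rewrite -vt ltNge vr.
apply: le_measure;rewrite ?inE//;first exact: measurableU.
move=> -[v x] [[/=]|[/= -> Bx]];rewrite !in_itv/=;last by rewrite t0 lexx.
by move=> /andP[-> vr] Bx;rewrite (le_trans vr)// ltW.
have pos' : 0 < fine (m w ([set t] `*` B)) by apply: fine_gt0;rewrite pos.
have F0 r : 0 <= F k w r by apply: fine_ge0.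
pose r0 := F k w t - fine (m w ([set t] `*` B)).
have r00 : 0 <= r0 by have := gap 0 (lexx _) t0;rewrite /r0;have := F0 0;lra.
have : r0 < F k w t by rewrite /r0;lra.
move=> /rat_in_itvoo[q];rewrite in_itv/= => /andP[r0q qF].
have q0 : 0 < ratr q :> R by exact: le_lt_trans r0q.
have St : S k (ratr q) w = t.
apply/eqP;rewrite eq_le;apply/andP;split.
by apply/S_le;[exact: ltW|right;exact: ltW].
have /andP[S0 _] := S_interval k w q0.
rewrite leNgt;apply/negP => SW;have /S_le := lexx (S k (ratr q) w).
move=> /(_ (ltW S0)) [|];first by rewrite leNgt (lt_le_trans SW tT).
have := gap _ (ltW S0) SW;rewrite -/r0;move: r0q;rewrite /r0.
by move: (F k w (S k (ratr q) w)) (F k w t) (fine _) (ratr q) => a b c e;lra.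
have := null k (pickle q);rewrite pickleK => /(_ q0);rewrite St => h.
by move: pos;rewrite h ltxx.
Qed.

End predictable_atoms.

(** * Continuous martingales of finite variation *)

Section mass_by_parts.
Context {R : realType} {dV} {V : mtype dV}.
Variable T : R.
Implicit Types m n : jump_measure R V.

Local Notation F m := (time_mass m setT).

Lemma measurable_time_mass m : (m setT < +oo)%E -> mfun setT (F m).
by move=> fin;apply: nondecreasing_measurable => // x y;exact: time_mass_nd.
Qed.

Lemma time_mass_bounded m t : (m setT < +oo)%E -> 0 <= F m t <= fine (m setT).
move=> fin;have mX : measurable (`]0, t] `*` setT : set (R * V)).
exact: measurableX.
have le : (m (`]0%R, t] `*` setT) <= m setT)%E by apply: le_measure;rewrite ?inE.
rewrite /time_mass fine_ge0//= fine_le// ge0_fin_numE//.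
exact: le_lt_trans fin.
Qed.

Definition upto (t : R) (q : R * V) : R := (q.1 <= t)%R%:R.

Lemma upto_indic t q : upto t q = \1_[set q : R * V | q.1 <= t] q.
rewrite indicE /upto;congr (nat_of_bool _)%:R.
by apply/idP/idP;rewrite inE.
Qed.

Lemma measurable_upto_indicator t : mfun setT (upto t).
rewrite (_ : upto t = \1_[set q | q.1 <= t]);last by apply/funext => q;exact: upto_indic.
by apply: measurable_indic;exact: measurable_upto.
Qed.
Let upto1 t q : `|upto t q| <= 1.
Proof. by rewrite /upto;case: (q.1 <= t)%R;rewrite ?normr1 ?normr0 ?ler01. Qed.
Let upto_mass m t (D : set (R * V)) s : (m setT < +oo)%E -> measurable D ->
 m (~` (`]0, T] `*` setT)) = 0%E -> s <= t ->
 (forall q, 0 < q.1 -> (D q -> q.1 <= s) /\ (q.1 < s -> D q)) ->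
 m ([set s] `*` setT) = 0%E ->
 \int[m]_(q in D) upto t q = F m s.
move=> fin mD off st Ds at0.
have mX : measurable (`]0, s] `*` setT : set (R * V)).
exact: measurableX.
have mT : measurable (~` (`]0, T] `*` setT) : set (R * V)).
by apply: measurableC;apply: measurableX => //;exact: measurable_itv.
rewrite /Rintegral /time_mass;congr fine.
rewrite (_ : (fun q => _) = (fun q => (\1_[set q : R * V | q.1 <= t] q)%:E));last first.
by apply/funext => q;rewrite upto_indic.
have mS : measurable ([set s] `*` setT : set (R * V)) by apply: measurableX.
have mU := measurable_upto (V := V) t.
rewrite integral_indic//;apply/eqP;rewrite eq_le;apply/andP;split.
apply: (@le_trans _ _ (m ((`]0, s] `*` setT) `|` ~` (`]0, T] `*` setT)))).
apply: le_measure;rewrite ?inE;[exact: measurableI|exact: measurableU|].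
move=> -[u x] /= [_ Du];case: (leP u 0) => u0;[right|left].
by rewrite /= in_itv/= => -[/andP[]];rewrite ltNge u0.
by split => //=;rewrite in_itv/= u0;case: (Ds (u, x) u0) => ->.
by rewrite measureU0.
apply: (@le_trans _ _ (m (([set q : R * V | q.1 <= t] `&` D) `|` [set s] `*` setT))).
apply: le_measure;rewrite ?inE//;first by apply: measurableU => //;exact: measurableI.
move=> -[u x] /= [+ _];rewrite in_itv/= le_eqVlt => /andP[u0 /orP[/eqP->|us]].
by right.
left;split;first by rewrite /= (le_trans (ltW us)).
by case: (Ds (u, x) u0) => _;apply.
by rewrite measureU0//;exact: measurableI.
Qed.

Lemma time_mass_by_parts m n t : (m setT < +oo)%E -> (n setT < +oo)%E ->
 m (~` (`]0, T] `*` setT)) = 0%E -> n (~` (`]0, T] `*` setT)) = 0%E ->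
 (forall s, m ([set s] `*` setT) = 0%E) -> (forall s, n ([set s] `*` setT) = 0%E) ->
 F m t * F n t = \int[n]_p (upto t p * F m p.1) + \int[m]_q (upto t q * F n q.1).
move=> mfin nfin moff noff mat nat.
have whole (k : jump_measure R V) : (k setT < +oo)%E -> k (~` (`]0, T] `*` setT)) = 0%E ->
(forall s, k ([set s] `*` setT) = 0%E) -> F k t = \int[k]_q upto t q.
move=> kf ko ka;rewrite Rintegral_mkcond.
rewrite -(upto_mass kf (measurable_upto t) ko (lexx t) _ (ka t));last first.
by move=> q _;split => //= /ltW.
rewrite [LHS]Rintegral_mkcond;congr (fine _);apply: eq_integral => q _.
by rewrite !patchE in_setT upto_indic indicE;case: (q \in _).
rewrite (whole m)// (whole n)// (Rintegral_by_parts mfin nfin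
(measurable_upto_indicator t) (measurable_upto_indicator t) (upto1 t) (upto1 t)).
congr (_ + _);apply: eq_Rintegral => q _;rewrite /upto;case: leP => qt;
rewrite ?mul0r// !mul1r;apply: upto_mass => //.
- exact: measurable_before.
- by move=> p _;split => //= /ltW.
- exact: measurable_upto.
- by move=> p _;split => //= /ltW.
Qed.

End mass_by_parts.

Lemma max_oppr {R : realType} (x : R) : Num.max x 0 - Num.max (- x) 0 = x.
Proof. by case: (leP x 0) => h1;case: (leP (- x) 0) => h2;lra. Qed.

Lemma half_square {R : realType} (a b i11 i12 i21 i22 p1 p2 q1 q2 : R) :
 a * b = i21 + i12 -> b * b = i22 + i22 -> a * a = i11 + i11 ->
 p2 - q2 = i21 - i22 -> p1 - q1 = i11 - i12 ->
 (p1 - p2) - (q1 - q2) = (a - b) ^+ 2 / 2.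
Proof. by move=> ab bb aa h2 h1;rewrite sqrrB expr2 ab expr2 bb aa;lra. Qed.

Section equal_masses.
Context {R : realType} {dO} {Omega : mtype dO} (P : probability Omega R).
Context {dV} {V : mtype dV}.
Variables (Gl : R -> set (set Omega)) (T : R).
Hypothesis fG : is_filtration Gl.
Variables n1 n2 : Omega -> jump_measure R V.
Hypotheses (nk1 : time_kernel T n1)
 (nk2 : time_kernel T n2).
Variable M : Omega -> R -> R.
Hypotheses (mM : pprocess Gl M)
 (ME : {ae P, forall w, forall t, 0 <= t <= T ->
 M w t = time_mass (n1 w) setT t - time_mass (n2 w) setT t})
 (at1 : {ae P, forall w, forall s, n1 w ([set s] `*` setT) = 0%E})
 (at2 : {ae P, forall w, forall s, n2 w ([set s] `*` setT) = 0%E})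
 (mean : forall W : Omega -> R -> \bar R, pprocess Gl W ->
 (forall w t, 0 <= W w t)%E ->
 (\int[P]_w \int[n1 w]_q W w q.1 = \int[P]_w \int[n2 w]_q W w q.1)%E)
 (square : (\int[P]_w (((fine (n1 w setT) + fine (n2 w setT)) ^+ 2)%:E) < +oo)%E).

Section fixed_time.
Variable t : R.
Hypothesis tT : 0 <= t <= T.
Let part (b : bool) w s : R :=
 (0 < s <= t)%R%:R * Num.max ((-1) ^+ b * M w s) 0.
Let part0 b w s : 0 <= part b w s.
Proof. by rewrite /part mulr_ge0// le_max lexx orbT. Qed.
Let mpart b : pprocess Gl (part b).
apply: measurable_funM;first exact: process_interval.
by apply: measurable_maxr => //;exact: measurable_funM.
Qed.
Let mean_part (n : Omega -> jump_measure R V) b (w : Omega) : \bar R :=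
 (\int[n w]_q (part b w q.1)%:E)%E.
Let measurable_mean_part n b : time_kernel T n -> mfun setT (mean_part n b).
move=> nk.
have := time_kernel_measurable_integral fG
(f := fun z : pspace Gl * V => (part b z.1.1 z.1.2)%:E) nk.
apply;split;last by move=> z;rewrite lee_fin.
by apply/mEFinP;exact: (field_process (V := V) (mpart b)).
Qed.
Let total w := fine (n1 w setT) + fine (n2 w setT).
Let part_le : {ae P, forall w, forall b s, 0 <= part b w s <= total w}.
apply: filterS ME => w Mw b s;rewrite part0/= /part.
have F1 := time_mass_bounded s (tk_finite nk1 w).
have F2 := time_mass_bounded s (tk_finite nk2 w).
have tot : 0 <= total w by rewrite /total addr_ge0// fine_ge0.
case: (boolP (0 < s <= t)%R) => st;rewrite ?mul0r// mul1r ge_max tot andbT.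
rewrite Mw;last first.
by case/andP: st tT => /ltW -> st /andP[_ /(le_trans st) ->].
by rewrite /total;case: b;rewrite ?expr1 ?expr0;move: F1 F2 => /andP[? ?] /andP[? ?];lra.
Qed.
Let finite_path w (n : Omega -> jump_measure R V) b : time_kernel T n ->
 (forall b s, 0 <= part b w s <= total w) ->
 (n w).-integrable setT (fun q => (part b w q.1)%:E) /\
 mean_part n b w = (\int[n w]_q part b w q.1)%:E.
move=> nk pl;have i : (n w).-integrable setT (fun q => (part b w q.1)%:E).
apply: (bounded_integrable (B := total w) (tk_finite nk w)) => //.
by apply: mfunTS;apply: mcomp => //;
exact: process_path (mpart b).
by move=> q _;have /andP[p0 pt] := pl b q.1;rewrite ger0_norm.
by split => //;rewrite /Rintegral fineK//;exact: integrable_fin_num.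
Qed.
Let mean_part_integrable (n : Omega -> jump_measure R V) b :
 time_kernel T n -> (forall w, fine (n w setT) <= total w) ->
 P.-integrable setT (mean_part n b).
move=> nk nt;apply: ge0_integrable;first exact: measurable_mean_part.
by move=> w;apply: integral_ge0 => q _;rewrite lee_fin.
apply: le_lt_trans square;apply: ge0_ae_le_nm.
- by move=> w;apply: integral_ge0 => q _;rewrite lee_fin.
- by move=> w;rewrite lee_fin sqr_ge0.
apply: filterS part_le => w pl;rewrite -/(total w).
have [i ->] := finite_path b nk pl;rewrite lee_fin expr2.
have t0 : 0 <= total w by apply: le_trans (nt w);exact: fine_ge0.
apply: le_trans (ler_norm _) _.
apply: le_trans (Rintegral_bounded (B := total w) (tk_finite nk w) measurableT _ t0 _) _.
- by apply: mfunTS;apply: mcomp => //;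
exact: process_path (mpart b).
- by move=> q _;have /andP[p0 pt] := pl b q.1;rewrite ger0_norm.
- by rewrite ler_wpM2l.
Qed.
Let i1 b : P.-integrable setT (mean_part n1 b).
Proof. by apply: mean_part_integrable => // w;rewrite /total lerDl fine_ge0. Qed.
Let i2 b : P.-integrable setT (mean_part n2 b).
Proof. by apply: mean_part_integrable => // w;rewrite /total lerDr fine_ge0. Qed.

(** For continuous increasing functions of time the square of the difference
`M` is twice the integral of `M` against its own increments, and this integral
has mean zero because `M` is predictable. *)
Let square_formula : {ae P, forall w,
 ((mean_part n1 false w - mean_part n2 false w) -
 (mean_part n1 true w - mean_part n2 true w) =
 ((time_mass (n1 w) setT t - time_mass (n2 w) setT t) ^+ 2 / 2)%:E)%E}.
near=> w.
have Mw : forall t, 0 <= t <= T -> M w t = time_mass (n1 w) setT t - time_mass (n2 w) setT t.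
by near: w;exact: ME.
have pl : forall b s, 0 <= part b w s <= total w by near: w;exact: part_le.
have a1 : forall s, n1 w ([set s] `*` setT) = 0%E by near: w;exact: at1.
have a2 : forall s, n2 w ([set s] `*` setT) = 0%E by near: w;exact: at2.
have [j1 ->] := finite_path false nk1 pl;have [j2 ->] := finite_path true nk1 pl.
have [j3 ->] := finite_path false nk2 pl;have [j4 ->] := finite_path true nk2 pl.
rewrite -!EFinB;congr EFin.
have f1 := tk_finite nk1 w;have f2 := tk_finite nk2 w.
have o1 := tk_off nk1 w;have o2 := tk_off nk2 w.
have iF (m k : jump_measure R V) : (m setT < +oo)%E -> (k setT < +oo)%E ->
m.-integrable setT (fun q => (upto t q * time_mass k setT q.1)%:E).
move=> mf kf;apply: (bounded_integrable (B := fine (k setT)) mf) => //.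
apply: mfunTS;apply: measurable_funM;first exact: measurable_upto_indicator.
by apply: mcomp => //;exact: measurable_time_mass.
move=> q _;have /andP[k0 kt] := time_mass_bounded q.1 kf.
rewrite normrM (ger0_norm k0) /upto;case: (q.1 <= t)%R;rewrite ?normr1 ?mul1r//.
by rewrite normr0 mul0r fine_ge0.
have combine (m : jump_measure R V) : (m setT < +oo)%E ->
m (~` (`]0, T] `*` setT)) = 0%E ->
m.-integrable setT (fun q => (part false w q.1)%:E) ->
m.-integrable setT (fun q => (part true w q.1)%:E) ->
\int[m]_q part false w q.1 - \int[m]_q part true w q.1 =
\int[m]_q (upto t q * time_mass (n1 w) setT q.1) -
\int[m]_q (upto t q * time_mass (n2 w) setT q.1).
move=> mf mo k1 k2;rewrite -!RintegralB//;try exact: iF.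
rewrite /Rintegral;congr fine;apply: (eq_negligible (N := ~` (`]0, T] `*` setT))) => //.
by apply: measurableC;apply: measurableX => //;exact: measurable_itv.
move=> q _ /contrapT[/= + _];rewrite in_itv/= => /andP[q0 qT];congr EFin.
rewrite /part /upto q0/= expr0 expr1 mul1r -!mulrBr.
case: (q.1 <= t)%R;rewrite ?mul0r// !mul1r -Mw ?(ltW q0)//.
by rewrite mulN1r max_oppr.
exact: half_square (time_mass_by_parts t f1 f2 o1 o2 a1 a2)
(time_mass_by_parts t f2 f2 o2 o2 a2 a2) (time_mass_by_parts t f1 f1 o1 o1 a1 a1)
(combine _ f2 o2 j3 j4) (combine _ f1 o1 j1 j2).
Unshelve. all: by end_near. Qed.

Lemma equal_masses_at : {ae P, forall w,
 time_mass (n1 w) setT t = time_mass (n2 w) setT t}.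
pose Q w := ((mean_part n1 false w - mean_part n2 false w) -
(mean_part n1 true w - mean_part n2 true w))%E.
have E b : (\int[P]_w (mean_part n1 b w - mean_part n2 b w) = 0)%E.
rewrite integralB// (_ : \int[P]_w mean_part n1 b w = \int[P]_w mean_part n2 b w)%E.
by rewrite subee//;apply: integrable_fin_num => //;exact: i2.
apply: (mean (W := fun w s => (part b w s)%:E)) => [|w s];last by rewrite lee_fin.
by apply/mEFinP;exact: mpart.
have iQ : P.-integrable setT Q by apply: integrableB => //;apply: integrableB.
have EQ : (\int[P]_w Q w = 0)%E.
by rewrite integralB//;try exact: integrableB;rewrite !E sube0.
have : (\int[P]_w `|Q w| = 0)%E.
rewrite -EQ;apply: ae_eq_nm;apply: filterS square_formula => w h.
by rewrite /Q h gee0_abs// lee_fin divr_ge0// sqr_ge0.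
move=> /(ae_eq_integral_abs P measurableT (measurable_int _ iQ)).
apply: filterS2 square_formula => w sq /(_ Logic.I) /=;rewrite /Q sq => -[] /eqP.
by rewrite mulf_eq0 sqrf_eq0 invr_eq0 pnatr_eq0/= orbF subr_eq0 => /eqP.
Qed.

End fixed_time.

Lemma equal_masses : 0 < T -> {ae P, forall w, forall t, 0 <= t <= T ->
 time_mass (n1 w) setT t = time_mass (n2 w) setT t}.
move=> T0;have : {ae P, forall w, forall n, if @unpickle rat n is Some q then
0 <= (ratr q : R) <= T ->
time_mass (n1 w) setT (ratr q) = time_mass (n2 w) setT (ratr q) else True}.
apply/ae_foralln => n;case: unpickle => [q|];last exact: aeW.
case: (boolP (0 <= (ratr q : R) <= T)) => h;last exact: aeW.
by apply: filterS (equal_masses_at h) => w.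
have TT : {ae P, forall w, time_mass (n1 w) setT T = time_mass (n2 w) setT T}.
by apply: equal_masses_at;rewrite lexx ltW.
apply: filterS2 TT => w eT eq t /andP[t0 tT].
move: tT;rewrite le_eqVlt => /orP[/eqP->//|tT].
apply/eqP;rewrite -subr_eq0;apply/negPn/negP => d0.
pose dd r := time_mass (n1 w) setT r - time_mass (n2 w) setT r.
have cd : dd r @[r --> t^'+] --> dd t.
apply: cvgB;apply: time_mass_right => //;[exact: tk_finite nk1 w|exact: tk_finite nk2 w].
have n0 : 0 < `|dd t| by rewrite normr_gt0.
move/cvgrPdist_lt/(_ _ n0): cd => /near_right_ex[e e0 he].
have tm : t < Num.min (t + e) T by rewrite lt_min tT andbT ltrDl.
have [q] := rat_in_itvoo tm.
rewrite in_itv/= lt_min => /andP[tq /andP[qe qT]].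
have := he (ratr q) (ltac:(by apply/andP;split)).
have qeq := eq (pickle q);rewrite pickleK in qeq.
rewrite [dd (ratr q)]/dd qeq;last by rewrite (ltW qT) andbT (le_trans t0)// ltW.
by rewrite subrr subr0 ltxx.
Qed.

End equal_masses.

Lemma stieltjes_itv {R : realType} (A : cumulative R R) (a b : R) : a <= b ->
 stieltjes A `]a, b] = (A b - A a)%:E.
move=> ab;rewrite /=.
rewrite /lebesgue_stieltjes_measure /measure_extension/=.
by rewrite measurable_mu_extE/= ?wlength_itv_bnd//;exact: is_ocitv.
Qed.

(** * Disintegrations *)

Section disintegration.
Context {R : realType} {dO} {Omega : mtype dO}.
Context {dV} {V : mtype dV}.
Variables (Fl : R -> set (set Omega)) (T : R).
Hypothesis fF : is_filtration Fl.
Variables (phi : R.-pker (pspace Fl) ~> V) (A : cumulative R R) (w : Omega).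
Variable m : jump_measure R V.
Hypothesis mphi : (forall D : set (R * V), measurable D ->
 m (D `&` (`]0%R, T] `*` setT)) =
 \int[stieltjes A]_(t in `]0%R, T]) phi (w, t) (xsection D t))%E.
Let mslice U : measurable U -> mfun [set: R] (fun t => phi (w, t) U).
move=> mU;have mk : mfun [set: pspace Fl] (phi ^~ U).
exact: measurable_kernel.
apply: (@mcomp _ _ _ _ _ _ (fun p : pspace Fl => phi p U)) => //.
exact: measurable_predictable_slice.
Qed.
Let phi1 t : (phi (w, t) setT < +oo)%E.
Proof. by rewrite prob_kernel ltry. Qed.

Lemma measurable_disintegrated (f : R * V -> \bar R) : mfun setT f ->
 (forall q, 0 <= f q)%E ->
 mfun setT (fun t => \int[phi (w, t)]_x f (t, x))%E.
by move=> mf f0;apply: (measurable_kernel_integral (n := fun t => phi (w, t))).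
Qed.

Lemma ge0_integral_disintegrated (f : R * V -> \bar R) : mfun setT f ->
 (forall q, 0 <= f q)%E ->
 (\int[m]_(q in `]0%R, T] `*` setT) f q =
 \int[stieltjes A]_(t in `]0%R, T]) \int[phi (w, t)]_x f (t, x))%E.
move=> mf f0;have mD : measurable (`]0, T] `*` setT : set (R * V)).
exact: measurableX.
apply: (positive_functional_eq (Phi := (fun f => \int[m]_(q in `]0%R, T] `*` setT) f q)%E)
(Psi := (fun f => \int[stieltjes A]_(t in `]0%R, T]) \int[phi (w, t)]_x f (t, x))%E)) => //.
- exact: functional_integral.
- refine (@positive_functional_iterated _ (R * V)%type _ _ R (stieltjes A) _
(fun t f => (\int[phi (w, t)]_x f (t, x))%E) _ _ _).
+ exact: measurable_itv.
+ move=> t;refine (@positive_functional_comp _ V _ (R * V)%type R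
(fun x => (t : R, x)) (fun g => \int[phi (w, t)]_x g x)%E _ _).
exact: measurable_pair1.
exact: functional_integral.
+ by move=> g [mg g0];apply: mfunTS;exact: measurable_disintegrated.
- move=> D mD';rewrite integral_indic// mphi//;apply: eq_integral => t _.
rewrite (_ : (fun x => _) = (fun x => (\1_(xsection D t) x)%:E)).
by rewrite integral_indic ?setIT//;exact: measurable_xsection.
apply/funext => x;rewrite !indicE;congr (nat_of_bool _)%:R%:E.
by rewrite mem_xsection.
Qed.

Lemma disintegrated_mass t : A 0 = 0 -> 0 <= t <= T -> m (`]0, t] `*` setT) = (A t)%:E.
move=> A0 /andP[t0 tT].
have mD : measurable (`]0, t] `*` setT : set (R * V)).
exact: measurableX.
have -> : `]0, t] `*` [set: V] = (`]0, t] `*` setT) `&` (`]0, T] `*` setT).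
apply/esym/setIidPl => -[u x] [/=];rewrite !in_itv/= => /andP[-> ut] _.
by rewrite (le_trans ut).
rewrite mphi//;transitivity (\int[stieltjes A]_(u in `]0%R, T]) (\1_(`]0, t]%classic) u)%:E)%E.
apply: eq_integral => u _;rewrite indicE;case: (boolP (u \in `]0, t]%classic)) => h.
rewrite (_ : xsection _ _ = setT) ?prob_kernel//.
by apply/seteqP;split => // x _;rewrite /xsection /= in_setX h in_setT.
rewrite (_ : xsection _ _ = set0) ?measure0//.
by apply/seteqP;split => // x;rewrite /xsection /= in_setX (negbTE h).
rewrite integral_indic;[|exact: measurable_itv|exact: measurable_itv].
rewrite (_ : _ `&` _ = `]0, t]%classic).
by have := stieltjes_itv A t0;rewrite A0 subr0;exact.
apply/setIidPl => u /=;rewrite !in_itv/= => /andP[-> ut].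
by rewrite (le_trans ut).
Qed.

End disintegration.

Section predictable_measures.
Context {R : realType} {dO} {Omega : mtype dO}.
Context {dV} {V : mtype dV}.
Variables (Fl : R -> set (set Omega)).
Hypothesis fF : is_filtration Fl.
Variable nu : Omega -> jump_measure R V.
Hypothesis nuP : predictable_random_measure Fl nu.

Lemma random_measure_process (W : Omega -> R -> V -> \bar R) :
 pfield Fl W -> (forall w t x, 0 <= W w t x)%E ->
 pprocess Fl
 (fun w t => \int[nu w]_(q in `]0%R, t] `*` setT) W w q.1 q.2)%E.
move=> mW W0.
have mI : measurable ([set p | [set` `[0, +oo[] p.2] : set (pspace Fl)).
rewrite (_ : [set p | _] = [set p | 0 <= p.2]);first exact: predictable_ge0.
by apply/seteqP;split => p /=;rewrite in_itv/= andbT.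
have h := nuP (predictable_field_on_total (I := [set` `[0, +oo[]) mW) W0.
have := predictable_process_cut 0%E mI h;congr pprocess.
apply/funext => w;apply/funext => t;case: asboolP => //=.
rewrite in_itv/= andbT => /negP;rewrite -ltNge => t0.
rewrite (_ : _ `*` _ = set0) ?integral_set0//.
by apply/seteqP;split => // -[u x] [/=];rewrite in_itv/= => /andP[/lt_le_trans h' /h' /lt_trans/(_ t0)];rewrite ltxx.
Qed.

Variable T : R.

Definition upto_horizon (w : Omega) : jump_measure R V :=
 mrestr (nu w) (measurable_upto_set T).

Lemma predictable_upto_horizon (W : Omega -> R -> V -> \bar R) :
 pfield Fl W -> (forall w t x, 0 <= W w t x)%E ->
 pprocess Fl
 (fun w t => \int[upto_horizon w]_(q in `]0%R, t] `*` setT) W w q.1 q.2)%E.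
move=> mW W0;pose W' w t x := (((0 < t <= T)%R%:R : R)%:E * W w t x)%E.
have mW' : pfield Fl W'.
apply: emeasurable_funM => //;apply/mEFinP.
exact: (field_process (V := V) (process_interval fF T)).
have W'0 w t x : (0 <= W' w t x)%E by rewrite mule_ge0// lee_fin.
have := random_measure_process mW' W'0;congr pprocess.
apply/funext => w;apply/funext => t.
have mt : measurable (`]0, t] `*` setT : set (R * V)).
exact: measurableX.
rewrite ge0_integral_mrestr//;last first.
by apply: mfunTS;exact: field_path mW.
rewrite [LHS]integral_mkcond [RHS]integral_mkcond;apply: eq_integral => q _.
have e : (q \in `]0, t] `*` setT `&` `]0, T] `*` setT) =
(q \in `]0, t] `*` setT) && (0 < q.1 <= T).
rewrite in_setI;congr andb;apply/idP/idP;rewrite inE.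
by move=> [/=];rewrite in_itv.
by move=> h;split => //=;rewrite in_itv.
rewrite !patchE e /W';case: (q \in `]0, t] `*` setT) => //=.
by case: ifP;rewrite ?mul1e ?mul0e.
Qed.

End predictable_measures.

(** The marks of the jumps of the step process inside the marks of the pair. *)
Definition state_marks {R : realType} {d : nat} : set ('rV[R]_d * R) :=
 [set z | z.2 = 0].

Lemma state_marks_indic {R : realType} {d : nat} (z : 'rV[R]_d * R) :
 \1_state_marks z = (z.2 == 0)%:R :> R.
rewrite indicE;congr (nat_of_bool _)%:R.
by apply/idP/eqP;rewrite inE.
Qed.

Lemma mstate_marks {R : realType} {d : nat} :
 measurable (@state_marks R d).
rewrite -[X in measurable X]setTI.
exact: (@measurable_snd _ _ 'rV[R]_d R _ [set 0] (measurable_set1 0)).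
Qed.

Lemma measurable_state_weight {R : realType} {d : nat} :
 mfun setT (fun z : 'rV[R]_d * R => (z.2 == 0)%:R : R).
rewrite (_ : (fun z => _) = \1_state_marks);last by apply/funext => z;rewrite state_marks_indic.
by apply: measurable_indic;exact: mstate_marks.
Qed.

Lemma measurable_state_field {R : realType} {d1} {T : mtype d1} {n : nat}
 {dE} {E : mtype dE} (f : T * 'rV[R]_n -> E) : mfun setT f ->
 mfun setT (fun q : T * ('rV[R]_n * R) => f (q.1, q.2.1)).
move=> mf;apply: (mcomp mf);apply: measurable_fun_pair => //.
exact: mcomp.
Qed.

Lemma integral_pair_points {R : realType} {d : nat} (s : nat -> \bar R)
 (xi : nat -> 'rV[R]_d) (T : R) (tau : \bar R) (f : R * 'rV[R]_d -> \bar R) :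
 let cut n := if (pair_time s tau n <= T%:E)%E then pair_time s tau n else +oo%E in
 let cut' n := if (s n <= T%:E)%E then s n else +oo%E in
 mfun setT f -> (forall q, 0 <= f q)%E ->
 (\int[points cut (pair_mark xi)]_q
 ((q.2.2 == 0)%R%:R%:E * f (q.1, q.2.1)) =
 \int[points cut' xi]_q f q)%E.
move=> cut cut' mf f0.
have g0 (q : R * ('rV[R]_d * R)) : (0 <= (q.2.2 == 0)%R%:R%:E * f (q.1, q.2.1))%E.
by rewrite mule_ge0// lee_fin.
have mg : mfun setT
(fun q : R * ('rV[R]_d * R) => (q.2.2 == 0)%R%:R%:E * f (q.1, q.2.1))%E.
apply: emeasurable_funM;last exact: measurable_state_field.
by apply/mEFinP;apply: (mcomp measurable_state_weight).
rewrite !ge0_integral_points//.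
have a0 n : (0 <= at_atom (cut n) (pair_mark xi n)
(fun q => (q.2.2 == 0)%R%:R%:E * f (q.1, q.2.1)))%E.
by rewrite /at_atom;case: (cut n) => // r;exact: g0.
rewrite nneseries_recl//.
rewrite [X in (X + _)%E](_ : _ = 0%E) ?add0e;last first.
by rewrite /at_atom;case: (cut 0%N) => //= r;rewrite oner_eq0 mul0e.
have := @nneseries_addn R (fun n => at_atom (cut n) (pair_mark xi n)
(fun q => (q.2.2 == 0)%R%:R%:E * f (q.1, q.2.1)))%E 1.
move=> <-//;apply: eq_eseriesr => n _;rewrite addn1 /at_atom /cut /cut' /=.
by case: ifP => // _;case: (s n) => //= r;rewrite eqxx mul1e.
Qed.

Section image_measures.
Context d1 d2 (X : mtype d1) (Y : mtype d2) (R : realType).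

Definition image_measure (m : {measure set X -> \bar R}) (f : X -> Y)
 (mf : mfun setT f) : {measure set Y -> \bar R} :=
 measure_function_pushforward__canonical__measure_function_Measure m mf.

Lemma ge0_integral_image (m : {measure set X -> \bar R}) (f : X -> Y)
 (mf : mfun setT f) (g : Y -> \bar R) :
 mfun setT g -> (forall y, 0 <= g y)%E ->
 (\int[image_measure m mf]_y g y = \int[m]_x g (f x))%E.
by move=> mg g0;rewrite /image_measure ge0_integral_pushforward// preimage_setT.
Qed.

End image_measures.

Section time_marginals.
Context {R : realType} {dV} {V : mtype dV}.
Variable T : R.
Variables m n : jump_measure R V.
Hypotheses (T_ge0 : 0 <= T)
 (m_fin : (m setT < +oo)%E)
 (n_fin : (n setT < +oo)%E)
 (m_off : m (~` (`]0, T] `*` setT)) = 0%E)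
 (n_off : n (~` (`]0, T] `*` setT)) = 0%E)
 (mn : forall t, 0 <= t <= T -> time_mass m setT t = time_mass n setT t).
Let mX (a b : R) : measurable (`]a, b] `*` setT : set (R * V)).
Proof. exact: measurableX. Qed.
Let interval_mass (k : jump_measure R V) a b :
 (k setT < +oo)%E -> k (~` (`]0, T] `*` setT)) = 0%E ->
 k (`]a, b] `*` setT) = if Num.max a 0 <= Num.min b T then
 (time_mass k setT (Num.min b T) - time_mass k setT (Num.max a 0))%:E else 0%E.
move=> kf ko;have -> : k (`]a, b] `*` setT) = k (`]Num.max a 0, Num.min b T] `*` setT).
apply/eqP;rewrite eq_le;apply/andP;split;last first.
apply: le_measure;rewrite ?inE// => -[u x] [/=].
by rewrite !in_itv/= gt_max le_min => /andP[/andP[-> _] /andP[-> _]].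
apply: (@le_trans _ _ (k ((`]Num.max a 0, Num.min b T] `*` setT) `|`
~` (`]0, T] `*` setT)))).
apply: le_measure;rewrite ?inE//;first by apply: measurableU => //;exact: measurableC.
move=> -[u x] [/=];rewrite in_itv/= => /andP[au ub] _.
case: (boolP (0 < u <= T)) => [/andP[u0 uT]|h];[left|right].
by split => //=;rewrite in_itv/= gt_max le_min au ub u0 uT.
by move=> [/=];rewrite in_itv/= (negbTE h).
by rewrite measureU0//;exact: measurableC.
case: leP => h;last first.
rewrite (_ : _ `*` _ = set0) ?measure0//;apply/seteqP;split => // -[u x] [/=].
by rewrite in_itv/= => /andP[/lt_le_trans h' /h' /(lt_trans h)];rewrite ltxx.
by rewrite time_massB// le_max lexx orbT.
Qed.

Lemma ge0_integral_time (g : R -> \bar R) : mfun setT g ->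
 (forall t, 0 <= g t)%E ->
 (\int[m]_q g q.1 = \int[n]_q g q.1)%E.
move=> mg g0.
rewrite -(ge0_integral_image m measurable_fst mg g0) -(ge0_integral_image n measurable_fst mg g0).
have fstE (A : set R) : fst @^-1` A = A `*` setT :> set (R * V).
by apply/seteqP;split => -[u x] //= [].
apply: eq_measure_integral => A mA _.
apply: (measure_unique (@ocitv R) (fun k => `]- k%:R, k%:R]%classic)) => //.
- exact: ocitvI.
- by move=> k;exact: is_ocitv.
- by rewrite bigcup_itvT.
- move=> _ [[a b] _ <-] /=;rewrite /image_measure/= /pushforward fstE.
rewrite !interval_mass//;case: ifP => // h;rewrite !mn//.
by rewrite le_max lexx orbT (le_trans h)// ge_min lexx orbT.
rewrite ge_min lexx orbT andbT;apply: le_trans h.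
by rewrite le_max lexx orbT.
- move=> k;apply: le_lt_trans m_fin;rewrite /image_measure/= /pushforward fstE.
by apply: le_measure;rewrite ?inE.
Qed.

End time_marginals.

Lemma measurable_stopping_time {R : realType} {dO} {Omega : mtype dO}
 (Fl : R -> set (set Omega)) (s : Omega -> \bar R) : is_filtration Fl ->
 stopping_time Fl s -> mfun setT s.
move=> fF [s0 ss];apply: (measurability _ (ErealGenOInfty.measurableE R)) => //.
move=> _ [_ [x ->] <-];rewrite setTI -[X in measurable X]setCK;apply: measurableC.
rewrite (_ : ~` _ = [set w | (s w <= x%:E)%E]);last first.
by apply/seteqP;split => w /=;rewrite in_itv/= andbT;[move/negP;rewrite -leNgt|move=> h;apply/negP;rewrite -leNgt].
have [x0|x0] := leP 0 x;first exact: (filtrationM fF x0 (ss _ x0)).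
rewrite (_ : [set w | _] = set0)//;apply/seteqP;split => // w /= /(le_trans (s0 w)).
by rewrite lee_fin leNgt x0.
Qed.

Section predictable_graphs.
Context {R : realType} {dO} {Omega : mtype dO} (P : probability Omega R).
Context {dV} {V : mtype dV}.
Variables (Fl : R -> set (set Omega)) (T : R) (S : Omega -> R) (B : set V).
Hypotheses (fF : is_filtration Fl)
 (T_ge0 : 0 <= T)
 (pS : predictable_time Fl (fun w => (S w)%:E))
 (S_le : forall w, 0 < S w <= T)
 (mB : measurable B).

Lemma predictable_graph : pprocess Fl (fun w t => (t == S w)%R%:R : R).
have [ss mS] := pS;have mlt := predictable_stopping_lt fF ss.
rewrite /pprocess (_ : (fun p => _) =
\1_([set p : pspace Fl | 0 <= p.2 /\ ((S p.1)%:E <= p.2%:E)%E] `\`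
[set p | ((S p.1)%:E < p.2%:E)%E])).
by apply: measurable_indic;exact: measurableD.
apply/funext => -[w t];rewrite indicE;congr (nat_of_bool _)%:R.
apply/eqP/idP;rewrite inE/= !lee_fin lte_fin.
by move=> ->;rewrite lexx ltxx;have /andP[/ltW] := S_le w.
by move=> [[_ St] /negP];rewrite -leNgt => tS;apply/eqP;rewrite eq_le tS.
Qed.

Lemma graph_null (nu : Omega -> jump_measure R V) :
 predictable_random_measure Fl nu ->
 (\int[P]_w \int[nu w]_(q in `]0%R, T] `*` setT)
 ((q.1 == S w)%R%:R * \1_B q.2 : R)%:E = 0)%E ->
 {ae P, forall w, nu w ([set S w] `*` B) = 0%E}.
move=> nuP E0;pose W w t x : \bar R := ((t == S w)%R%:R * \1_B x : R)%:E.
have mW : pfield Fl W.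
apply/mEFinP;apply: measurable_funM.
exact: (field_process (V := V) predictable_graph).
by apply: (@mcomp _ _ _ _ _ _ (\1_B : V -> R)) => //;exact: measurable_indic.
have W0 w t x : (0 <= W w t x)%E by rewrite lee_fin mulr_ge0.
have mI := process_time_measurable fF T_ge0
(random_measure_process fF nuP mW W0).
have gE w : (\int[nu w]_(q in `]0%R, T] `*` setT) W w q.1 q.2 = nu w ([set S w] `*` B))%E.
have mG : measurable ([set S w] `*` B : set (R * V)) by apply: measurableX.
rewrite (_ : (fun q => _) = (fun q => (\1_([set S w] `*` B) q)%:E)).
rewrite integral_indic//;last exact: measurable_upto_set.
congr (nu w _);apply/setIidPl => -[u x] [/= -> _];split => //=.
by rewrite in_itv/= S_le.
apply/funext => -[u x];rewrite /W !indicE in_setX /= -natrM mulnb.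
congr (nat_of_bool (_ && _))%:R%:E.
by apply/eqP/idP;rewrite inE.
have : (\int[P]_w `|nu w ([set S w] `*` B)| = 0)%E.
by rewrite -E0;apply: eq_integral => w _;rewrite -gE gee0_abs// integral_ge0.
move=> /(ae_eq_integral_abs P measurableT) h.
have /h : mfun setT (fun w => nu w ([set S w] `*` B)).
by apply: eq_ind mI _ _;apply/funext => w;rewrite -gE.
by apply: filterS => w /(_ Logic.I).
Qed.

End predictable_graphs.

(** * The compensator of the pair *)

Section jump_model.
Context {R : realType} {dO} {Omega : mtype dO} (P : probability Omega R).
Context {d : nat}.
Variables (T : R) (X : Omega -> R -> 'rV[R]_d) (tau : Omega -> \bar R).
Variables (F G : R -> set (set Omega)).
Hypotheses (T_gt0 : 0 < T)
 (mtau : mfun setT tau)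
 (tau_gt0 : forall w, (0 < tau w)%E)
 (fF : is_filtration F)
 (fG : is_filtration G)
 (FG : forall t, 0 <= t -> F t `<=` G t)
 (tauG : stopping_time G tau).

Variables (s : nat -> Omega -> \bar R) (xi : nat -> Omega -> 'rV[R]_d).
Hypotheses (s_stop : forall n, (stopping_time F (s n) /\ forall w, 0 < s n w)%E)
 (s_step : forall n w,
 (s n w <= s n.+1 w /\ (s n w < +oo -> s n w < s n.+1 w))%E)
 (s_cvg : forall w, s n w @[n --> \oo] --> +oo%E)
 (mxi : forall n, mfun
 [set: g_sigma_algebraType (stopped_sigma_algebra F (s n))]
 (fun w : g_sigma_algebraType (stopped_sigma_algebra F (s n)) => xi n w))
 (xi_neq0 : forall n w, xi n w != 0 <-> (s n w < +oo)%E)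
 (XE : forall w t, 0 <= t ->
 \sum_(n < N) indic_after (s n w) t *: xi n w @[N --> \oo] --> X w t)
 (qlc : quasi_left_continuous P F X)
 (avoid : avoids_stopping_times P F tau)
 (im : immersed P F G).
Let H : Omega -> cumulative R R := fun w => indic_after (tau w).
Let Z : Omega -> R -> 'rV[R]_d * R := fun w t => (X w t, H w t).
Let muX : Omega -> jump_measure R 'rV[R]_d :=
 fun w => point_measure (jump_times (X w)) (jump (X w)).
Let muZ : Omega -> jump_measure R ('rV[R]_d * R) :=
 fun w => point_measure (jump_times (Z w)) (jump (Z w)).

Variable nuX : Omega -> jump_measure R 'rV[R]_d.
Variable phiF : R.-pker (pspace F) ~> 'rV[R]_d.
Variables CF Lambda : Omega -> cumulative R R.
Variable nuZ : Omega -> jump_measure R ('rV[R]_d * R).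
Variable phi : R.-pker (pspace G) ~> ('rV[R]_d * R)%type.
Hypotheses (compX : is_compensator P F muX nuX)
 (CF0 : forall w t, t <= 0 -> CF w t = 0)
 (disX : disintegrates P T nuX phiF CF)
 (Lam0 : forall w t, t <= 0 -> Lambda w t = 0).
Let C : Omega -> cumulative R R := fun w => cumulativeD (CF w) (Lambda w).
Hypotheses (compZ : is_compensator P G muZ nuZ)
 (disZ : disintegrates P T nuZ phi C).
Variable M : R.
Hypotheses (M_gt1 : 1 < M)
 (moment : (\int[P]_w (expR ((3 + M ^+ 4) * C w T))%:E < +oo)%E).
Let T_ge0 : 0 <= T. Proof. exact: ltW. Qed.
Local Notation pt := (fun n w => pair_time (s^~ w) (tau w) n).
Local Notation pk := (fun n w => pair_mark (xi^~ w) n).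

Lemma state_points : marked_points F s xi.
Proof. exact: marked_points_step. Qed.

Lemma pair_points : marked_points G pt pk.
Proof. by apply: marked_points_pair => //;exact: marked_points_sub FG state_points. Qed.
Let s_gt0 n w : (0 < s n w)%E. Proof. by case: (s_stop n) => _;apply. Qed.
Let stopping_measurable n : mfun setT (s n).
Proof. by case: (s_stop n) => + _;exact: measurable_stopping_time. Qed.

(** Avoidance of stopping times separates the jump of the indicator from the
jumps of the step process. *)
Lemma no_common_jump : {ae P, forall w, forall n, (s n w < +oo)%E -> tau w <> s n w}.
apply/ae_foralln => n;case: (s_stop n) => sn _.
exists [set w | tau w = s n w /\ (s n w < +oo)%E];split.
- have h := measurable_eqe measurableT mtau (stopping_measurable n).
have h' := measurable_lte measurableT (stopping_measurable n) (measurable_cst +oo%E).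
by have := measurableI _ _ h h';rewrite !setTI.
- exact: avoid.
- by move=> w /= h;apply: contrapT => h';apply: h => lt eq;apply: h'.
Qed.

Lemma state_measure_points : {ae P, forall w, forall A, measurable A ->
 muX w A = points (s^~ w) (xi^~ w) A}.
apply: aeW => w A mA;exact: (point_measure_step (s_gt0^~ w) (s_step^~ w) (s_cvg w)
(xi_neq0^~ w) (@XE w) mA).
Qed.

Lemma pair_measure_points : {ae P, forall w, forall A, measurable A ->
 muZ w A = points (pt^~ w) (pk^~ w) A}.
apply: filterS no_common_jump => w nw A mA.
exact: (point_measure_pair (s_gt0^~ w) (s_step^~ w) (s_cvg w)
(xi_neq0^~ w) (@XE w) (tau_gt0 w) (nw) mA).
Qed.
Let C0 w : C w 0 = 0.
Proof. by rewrite /C/= /cumulativeD/= CF0// Lam0// addr0. Qed.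

Lemma state_mass : {ae P, forall w, forall t, 0 <= t <= T ->
 nuX w (`]0, t] `*` setT) = (CF w t)%:E}.
apply: filterS disX => w h t tT;apply: (disintegrated_mass h) => //;exact: CF0.
Qed.

Lemma pair_mass : {ae P, forall w, nuZ w (`]0, T] `*` setT) = (C w T)%:E}.
by apply: filterS disZ => w h;apply: (disintegrated_mass h) => //;rewrite T_ge0 lexx.
Qed.

Lemma clock_ge0 w : 0 <= CF w T <= C w T.
have L0 : 0 <= Lambda w T by rewrite -(Lam0 w (lexx 0)) cumulative_is_nondecreasing.
by rewrite -{1}(CF0 w (lexx 0)) cumulative_is_nondecreasing//= lerDl.
Qed.
Let moment_le (f : Omega -> \bar R) (u : R -> R) :
 {ae P, forall w, (f w <= (u (C w T))%:E)%E} -> (forall w, 0 <= f w)%E ->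
 (forall x, 0 <= x -> 0 <= u x <= expR ((3 + M ^+ 4) * x)) ->
 (\int[P]_w f w < +oo)%E.
move=> fu f0 ux;apply: le_lt_trans moment;apply: ge0_ae_le_nm => //.
apply: filterS fu => w /le_trans;apply;rewrite lee_fin.
by case/andP: (clock_ge0 w) => /le_trans h /h/ux /andP[].
Qed.
Let linear_le x : 0 <= x -> 0 <= x <= expR ((3 + M ^+ 4) * x).
move=> x0;rewrite x0/=;have M4 : 0 <= M ^+ 4 by rewrite exprn_ge0// ltW// (lt_trans ltr01).
apply: le_trans (expR_ge1Dx _);rewrite -[leLHS]mul1r ler_wpDl// ler_wpM2r//.
by rewrite -addrA;move: M4;lra.
Qed.

Lemma mean_state_mass : (\int[P]_w nuX w (`]0%R, T] `*` setT) < +oo)%E.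
apply: (moment_le (u := id)) => //;apply: filterS state_mass => w ->.
by rewrite lee_fin;case/andP: (clock_ge0 w).
by rewrite T_ge0 lexx.
Qed.

Lemma state_immersion (W : Omega -> R -> 'rV[R]_d -> \bar R) :
 pfield G W -> (forall w t x, 0 <= W w t x)%E ->
 (\int[P]_w \int[cut_points T s xi w]_q W w q.1 q.2 =
 \int[P]_w \int[nuX w]_(q in `]0%R, T] `*` setT) W w q.1 q.2)%E.
exact: (immersion_mean state_points fG im T_ge0 state_measure_points compX
mean_state_mass).
Qed.

(** Read on the marks of the step process, the compensator of the pair in the
large filtration and that of the step process in the small filtration have the
same mean on predictable fields. *)
Lemma pair_state_mean (W : Omega -> R -> 'rV[R]_d -> \bar R) :
 pfield G W -> (forall w t x, 0 <= W w t x)%E ->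
 (\int[P]_w \int[nuZ w]_(q in `]0%R, T] `*` setT)
 ((q.2.2 == 0)%R%:R%:E * W w q.1 q.2.1) =
 \int[P]_w \int[nuX w]_(q in `]0%R, T] `*` setT) W w q.1 q.2)%E.
move=> mW W0;rewrite -state_immersion//.
pose W' w t (z : 'rV[R]_d * R) := ((z.2 == 0)%R%:R%:E * W w t z.1)%E.
have mW' : pfield G W'.
apply: emeasurable_funM;last exact: measurable_state_field mW.
by apply/mEFinP;apply: (mcomp measurable_state_weight).
have W'0 w t z : (0 <= W' w t z)%E by rewrite mule_ge0// lee_fin.
rewrite -(cut_points_mean T pair_points pair_measure_points compZ mW' W'0).
apply: eq_integral => w _;apply: integral_pair_points => //.
exact: field_path mW.
Qed.

Lemma state_atomless :
 {ae P, forall w, forall t, 0 < t <= T -> nuX w ([set t] `*` setT) = 0%E}.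
apply: (predictable_atomless fF T_gt0 measurableT
(random_measure_process fF (proj1 compX))).
by apply: filterS state_mass => w ->;rewrite ?ltry// T_ge0 lexx.
move=> S pS S_le;apply: (graph_null fF T_ge0 pS S_le measurableT (proj1 compX)).
pose W w t (x : 'rV[R]_d) : \bar R := ((t == S w)%R%:R * \1_setT x : R)%:E.
have mW : pfield F W.
apply/mEFinP;apply: measurable_funM.
exact: (field_process (V := 'rV[R]_d) (predictable_graph fF pS S_le)).
by rewrite indicT;exact: measurable_cst.
have W0 w t x : (0 <= W w t x)%E by rewrite lee_fin mulr_ge0.
rewrite -(cut_points_mean T state_points state_measure_points compX mW W0).
rewrite (ae_eq_nm (g := cst 0%E)) ?integral0//.
have := qlc pS (fun w => ltry _);apply: filterS => w JS.
rewrite ge0_integral_points//;last exact: field_path mW.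
apply: eseries0 => n _ _;rewrite /at_atom /cut_time.
have := step_path_jump (xi := xi^~ w) (s_gt0^~ w) (s_step^~ w)
(@XE w) (n := n).
have := proj2 (xi_neq0 n w);case: ifP => // _;case: (s n w) => //= r + h.
move=> /(_ (ltry r)) xi0;rewrite /W;case: eqP => [rS|];rewrite ?mul0r//.
by move: xi0;rewrite -(h r erefl) rS JS eqxx.
Qed.

Lemma pair_atomless :
 {ae P, forall w, forall t, 0 < t <= T -> nuZ w ([set t] `*` state_marks) = 0%E}.
apply: (predictable_atomless fG T_gt0 mstate_marks
(random_measure_process fG (proj1 compZ))).
apply: filterS pair_mass => w h;apply: le_lt_trans (ltry (C w T));rewrite -h.
apply: le_measure;rewrite ?inE//.
- by apply: measurableX;[exact: measurable_itv|exact: mstate_marks].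
- exact: measurable_upto_set.
- by move=> q [].
move=> S pS S_le.
apply: (graph_null fG T_ge0 pS S_le mstate_marks (proj1 compZ)).
pose W w t (x : 'rV[R]_d) : \bar R := ((t == S w)%R%:R : R)%:E.
have mW : pfield G W.
apply/mEFinP.
exact: (field_process (V := 'rV[R]_d) (predictable_graph fG pS S_le)).
have W0 w t x : (0 <= W w t x)%E by rewrite lee_fin.
transitivity (\int[P]_w \int[nuZ w]_(q in `]0%R, T] `*` setT)
((q.2.2 == 0)%R%:R%:E * W w q.1 q.2.1))%E.
apply: eq_integral => w _;apply: eq_integral => q _.
by rewrite state_marks_indic /W -EFinM mulrC.
rewrite pair_state_mean// (ae_eq_nm (g := cst 0%E)) ?integral0//.
apply: filterS state_atomless => w h;rewrite -(h _ (S_le w)).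
have mS : measurable ([set S w] `*` setT : set (R * 'rV[R]_d)) by apply: measurableX.
rewrite (_ : (fun q => _) = (fun q => (\1_([set S w] `*` setT) q)%:E));last first.
apply/funext => q;rewrite indicE in_setX in_setT andbT;congr (nat_of_bool _)%:R%:E.
by apply/eqP/idP;rewrite inE.
rewrite integral_indic//;last exact: measurable_upto_set.
congr (nuX w _);apply/setIidPl => -[u x] [/= -> _];split => //=.
by rewrite in_itv/= S_le.
Qed.
Let fixed_mark (q : R * 'rV[R]_d) : R * ('rV[R]_d * R) := (q.1, (q.2, 0)).
Let measurable_fixed_mark : mfun setT fixed_mark.
Proof. by apply: measurable_fun_pair => //;exact: measurable_fun_pair. Qed.
Let mV0T : measurable (setT `*` state_marks : set (R * ('rV[R]_d * R))).
Proof. by apply: measurableX => //;exact: mstate_marks. Qed.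

(* Both are finite on every path, so that kernels of finite measures apply. *)
Let n1 w : jump_measure R ('rV[R]_d * R) :=
 mrestr (cut_kernel T nuZ w) mV0T.
Let n2 w : jump_measure R ('rV[R]_d * R) :=
 image_measure (cut_kernel T nuX w) measurable_fixed_mark.
Let kZ : time_kernel T (cut_kernel T nuZ) :=
 cut_compensator_kernel fG T_ge0 (proj1 compZ).
Let kX : time_kernel T (cut_kernel T nuX) :=
 cut_compensator_kernel fF T_ge0 (proj1 compX).
Let pre U : measurable U -> measurable (fixed_mark @^-1` U).
Proof. by move=> mU;have := measurable_fixed_mark measurableT mU;rewrite setTI. Qed.
Let nk1 : time_kernel T n1.
split.
- by move=> U mU;apply: (tk_measurable kZ);exact: measurableI.
- move=> w;apply: le_lt_trans (tk_finite kZ w).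
by rewrite /n1/= /mrestr;apply: kernel_le;exact: measurableI.
- move=> w;apply: (subset_measure0 _ _ _ (tk_off kZ w)) => //.
+ by apply: measurableI => //;apply: measurableC;exact: measurable_upto_set.
+ by apply: measurableC;exact: measurable_upto_set.
Qed.
Let nk2 : time_kernel T n2.
split.
- by move=> U mU;apply: (tk_measurable kX);exact: pre.
- by move=> w;exact: (tk_finite kX w).
- move=> w;rewrite -[RHS](tk_off kX w) /n2 /image_measure/= /pushforward.
by congr (cut_kernel T nuX w _);apply/seteqP;split => -[u x].
Qed.
Let finite_ae : {ae P, forall w, [/\ (nuZ w (`]0%R, T] `*` setT) < +oo)%E,
 (nuX w (`]0%R, T] `*` setT) < +oo)%E & nuZ w (`]0%R, T] `*` setT) = (C w T)%:E]}.
apply: filterS2 state_mass pair_mass => w eX eZ;rewrite eZ ltry eX ?ltry//.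
by rewrite T_ge0 lexx.
Qed.
Let mass1 w t : (nuZ w (`]0%R, T] `*` setT) < +oo)%E -> 0 <= t <= T ->
 n1 w (`]0, t] `*` setT) = nuZ w (`]0, t] `*` state_marks).
move=> h /andP[t0 tT];rewrite /n1/= /mrestr cut_compensatorE//;congr (nuZ w _).
apply/seteqP;split => -[u x] /=;first by move=> [[[? _] [_ ?]] _].
rewrite !in_itv/= => -[/andP[-> ut] ?];rewrite ut;split => //;split => //.
exact: le_trans tT.
Qed.
Let mass2 w t : (nuX w (`]0%R, T] `*` setT) < +oo)%E -> 0 <= t <= T ->
 n2 w (`]0, t] `*` setT) = nuX w (`]0, t] `*` setT).
move=> h /andP[t0 tT];rewrite /n2 /image_measure/= /pushforward cut_compensatorE//.
congr (nuX w _);apply/seteqP;split => -[u x] /=;first by move=> [[? _] _].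
rewrite !in_itv/= => -[/andP[-> ut] ?];rewrite ut;split => //;split => //.
exact: le_trans tT.
Qed.
Let square_le x : 0 <= x -> 0 <= (2 * x) ^+ 2 <= expR ((3 + M ^+ 4) * x).
move=> x0;rewrite sqr_ge0/=;have M4 : 1 <= M ^+ 4 by rewrite exprn_ege1// ltW.
apply: (@le_trans _ _ (expR (2 * x) ^+ 2)).
rewrite lerXn2r ?nnegrE ?expR_ge0// ?mulr_ge0//.
by apply: le_trans (expR_ge1Dx _);rewrite lerDr.
rewrite expr2 -expRD ler_expR -mulrDl ler_wpM2r//.
by move: M4;lra.
Qed.
Let mean_square_clock :
 (\int[P]_w (((fine (n1 w setT) + fine (n2 w setT)) ^+ 2)%:E) < +oo)%E.
apply: (moment_le (u := fun x => (2 * x) ^+ 2)).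
- apply: filterS2 finite_ae state_mass => w [fZ fX eZ] CFE;rewrite lee_fin.
have h1 : fine (n1 w setT) <= C w T.
rewrite -[leRHS]/(fine (C w T)%:E) -eZ;apply: fine_le.
+ by rewrite ge0_fin_numE//;exact: tk_finite nk1 w.
+ by rewrite ge0_fin_numE.
rewrite /n1/= /mrestr cut_compensatorE//;apply: le_measure;rewrite ?inE.
+ by apply: measurableI;[exact: measurableI|exact: measurable_upto_set].
+ exact: measurable_upto_set.
+ by move=> q [].
have h2 : fine (n2 w setT) <= C w T.
rewrite /n2 /image_measure/= /pushforward preimage_setT cut_compensatorE// setTI CFE/=.
by case/andP: (clock_ge0 w).
by rewrite T_ge0 lexx.
rewrite lerXn2r ?nnegrE ?addr_ge0// ?fine_ge0//;last by rewrite mulrDl mul1r lerD.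
by rewrite mulr_ge0//;case/andP: (clock_ge0 w);exact: le_trans.
- by move=> w;rewrite lee_fin sqr_ge0.
- exact: square_le.
Qed.
Let clock_gap w t := fine (nuZ w (`]0, t] `*` state_marks)) - fine (nuX w (`]0, t] `*` setT)).
Let predictable_interval_mass {dV} {V : mtype dV} (Fl : R -> set (set Omega))
 (nu : Omega -> jump_measure R V) (B : set V) :
 is_filtration Fl -> predictable_random_measure Fl nu -> measurable B ->
 pprocess Fl (fun w t => fine (nu w (`]0, t] `*` B))).
move=> fl nuP mB.
suff h : pprocess Fl (fun w t => nu w (`]0, t] `*` B)).
exact: (mcomp (f := fine)).
have mW : pfield Fl (fun w t x => (\1_B x : R)%:E).
apply/mEFinP;apply: (@mcomp _ _ _ _ _ _ (\1_B : V -> R)) => //.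
have W0 (w : Omega) (t : R) (x : V) : (0 <= (\1_B x : R)%:E)%E by rewrite lee_fin.
have := random_measure_process fl nuP mW W0;congr pprocess.
apply/funext => w;apply/funext => t.
have mt : measurable (`]0, t] `*` setT : set (R * V)).
exact: measurableX.
rewrite (_ : (fun q => _) = (fun q => (\1_(setT `*` B) q : R)%:E)).
rewrite integral_indic//;last exact: measurableX.
congr (nu w _);apply/seteqP;split => -[u x] /=;first by move=> [[_ ?] [? _]].
by move=> [].
by apply/funext => q;rewrite !indicE in_setX in_setT.
Qed.
Let predictable_gap : pprocess G clock_gap.
apply: measurable_funB.
exact: predictable_interval_mass fG (proj1 compZ) mstate_marks.
have := predictable_interval_mass fF (proj1 compX) measurableT.
by move=> h;exact: mcomp h (mpred_sub FG).
Qed.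
Let gapE : {ae P, forall w, forall t, 0 <= t <= T ->
 clock_gap w t = time_mass (n1 w) setT t - time_mass (n2 w) setT t}.
by apply: filterS finite_ae => w [fZ fX _] t tT;rewrite /time_mass mass1// mass2.
Qed.
Let atomless1 : {ae P, forall w, forall t, n1 w ([set t] `*` setT) = 0%E}.
apply: filterS2 finite_ae pair_atomless => w [fZ fX _] h t.
have mt : measurable ([set t] `*` setT : set (R * ('rV[R]_d * R))) by apply: measurableX.
rewrite /n1/= /mrestr cut_compensatorE//.
have [/h h0|tT] := pselect (0 < t <= T).
apply: subset_measure0 h0.
- by apply: measurableI;[exact: measurableI|exact: measurable_upto_set].
- by apply: measurableX => //;exact: mstate_marks.
- by move=> -[u x] /= [[[-> _] [_ ?]] _].
rewrite (_ : _ `&` _ = set0) ?measure0//;apply/seteqP;split => // -[u x] /=.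
by move=> [[[-> _] _] [+ _]];rewrite in_itv.
Qed.
Let atomless2 : {ae P, forall w, forall t, n2 w ([set t] `*` setT) = 0%E}.
apply: filterS2 finite_ae state_atomless => w [fZ fX _] h t.
have mt : measurable ([set t] `*` setT : set (R * ('rV[R]_d * R))) by apply: measurableX.
rewrite /n2 /image_measure/= /pushforward cut_compensatorE//.
have [/h h0|tT] := pselect (0 < t <= T).
apply: subset_measure0 h0.
- by apply: measurableI;[exact: pre|exact: measurable_upto_set].
- exact: measurableX.
- by move=> -[u x] /= [[-> _] _].
rewrite (_ : _ `&` _ = set0) ?measure0//;apply/seteqP;split => // -[u x] /=.
by move=> [[-> _] [+ _]];rewrite in_itv.
Qed.
Let integral_n1 w (g : R -> \bar R) : (nuZ w (`]0%R, T] `*` setT) < +oo)%E ->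
 mfun setT g -> (forall t, 0 <= g t)%E ->
 (\int[n1 w]_q g q.1 = \int[nuZ w]_(q in `]0%R, T] `*` setT)
 ((q.2.2 == 0)%R%:R%:E * g q.1))%E.
move=> fin mg g0.
have mg1 : mfun setT (fun q : R * ('rV[R]_d * R) => g q.1).
exact: mcomp.
rewrite /n1 ge0_integral_mrestr// setTI -integral_cut_compensator//.
- rewrite integral_mkcond;apply: eq_integral => q _;rewrite patchE -state_marks_indic indicE.
by rewrite in_setX in_setT/=;case: ifP => h;rewrite ?h ?mul1e ?mul0e.
- apply: emeasurable_funM => //;apply/mEFinP.
exact: (mcomp measurable_state_weight).
- by move=> q;rewrite mule_ge0// lee_fin.
Qed.
Let integral_n2 w (g : R -> \bar R) : (nuX w (`]0%R, T] `*` setT) < +oo)%E ->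
 mfun setT g -> (forall t, 0 <= g t)%E ->
 (\int[n2 w]_q g q.1 = \int[nuX w]_(q in `]0%R, T] `*` setT) g q.1)%E.
move=> fin mg g0;rewrite /n2 ge0_integral_image//;last exact: mcomp.
have mg1 : mfun setT (fun q : R * 'rV[R]_d => g q.1).
exact: mcomp.
exact: (integral_cut_compensator fin mg1).
Qed.

(** On the marks of the step process the compensator of the pair runs on the
clock of the step process. *)
Lemma pair_clock : {ae P, forall w, forall g : R -> \bar R, mfun setT g ->
 (forall t, 0 <= g t)%E ->
 (\int[nuZ w]_(q in `]0%R, T] `*` setT) ((q.2.2 == 0)%R%:R%:E * g q.1) =
 \int[stieltjes (CF w)]_(t in `]0%R, T]) g t)%E}.
have mean (W : Omega -> R -> \bar R) : pprocess G W ->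
(forall w t, 0 <= W w t)%E ->
(\int[P]_w \int[n1 w]_q W w q.1 = \int[P]_w \int[n2 w]_q W w q.1)%E.
move=> mW W0.
transitivity (\int[P]_w \int[nuZ w]_(q in `]0%R, T] `*` setT)
((q.2.2 == 0)%R%:R%:E * W w q.1))%E.
apply: ae_eq_nm;apply: filterS finite_ae => w [fZ _ _].
by apply: integral_n1 => //;exact: process_path mW.
rewrite (pair_state_mean (W := fun w t _ => W w t))//;last first.
exact: field_process.
apply: ae_eq_nm;apply: filterS finite_ae => w [_ fX _].
by rewrite integral_n2//;exact: process_path mW.
have := equal_masses fG nk1 nk2 predictable_gap gapE atomless1 atomless2 mean
mean_square_clock T_gt0.
move=> em;apply: filterS3 em finite_ae disX => w em [fZ fX _] dw g mg g0.
rewrite -integral_n1// (ge0_integral_time (tk_finite nk1 w) (tk_finite nk2 w)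
(tk_off nk1 w) (tk_off nk2 w) em)// integral_n2//.
rewrite (ge0_integral_disintegrated dw (f := fun q => g q.1))//;last exact: mcomp.
by apply: eq_integral => t _;rewrite /= integral_cst// prob_kernel mule1.
Qed.
Let pair_inj : {ae P, forall w, forall n m, (cut_time T (pt n) w < +oo)%E ->
 cut_time T (pt n) w = cut_time T (pt m) w -> n = m}.
apply: filterS no_common_jump => w nw n m.
rewrite /cut_time;case: ifP => // nT nlt;case: ifP => [_|_];last by move=> e;rewrite e in nlt.
exact: (pair_time_inj (s_step^~ w) (nw) nlt).
Qed.

Lemma pair_compensated_points : compensated_points P G T state_marks
 (fun n => cut_time T (pt n)) pk (upto_horizon nuZ T).
split.
- exact: fG.
- exact: T_gt0.
- exact: cut_time_stop pair_points T_ge0.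
- exact: cut_time_gt0 pair_points.
- exact: cut_time_le.
- exact: cut_time_finite pair_points.
- exact: cut_time_mark pair_points T_ge0.
- exact: pair_inj.
- by move=> w;rewrite /upto_horizon/= /mrestr setICl measure0.
- by move=> W mW W0;exact: (predictable_upto_horizon fG (proj1 compZ) T mW W0).
- move=> W mW W0;have := cut_points_mean T pair_points pair_measure_points compZ mW W0.
move=> ->;apply: eq_integral => w _;rewrite /upto_horizon ge0_integral_mrestr ?setTI//.
exact: field_path mW.
- apply: filterS finite_ae => w [fZ _ _].
by rewrite /upto_horizon/= /mrestr setTI.
- exact: mstate_marks.
- apply: filterS pair_atomless => w h t;rewrite /upto_horizon/= /mrestr.
have mt : measurable ([set t] `*` state_marks : set (R * ('rV[R]_d * R))).
by apply: measurableX => //;exact: mstate_marks.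
have [/h h0|tT] := pselect (0 < t <= T).
apply: subset_measure0 h0 => //.
by apply: measurableI => //;exact: measurable_upto_set.
rewrite (_ : _ `&` _ = set0) ?measure0//;apply/seteqP;split => // -[u x] /=.
by move=> [[-> _] [+ _]];rewrite in_itv.
Qed.

End jump_model.
Lemma finite_balance {R : realType} (a b j k : \bar R) : a \is a fin_num ->
 b \is a fin_num -> j \is a fin_num -> k \is a fin_num ->
 (a + j = b + k -> a - b - (k - j) = 0)%E.
case: a b j k => [a||] [b||] [j||] [k||]// _ _ _ _.
move=> -[h];have -> : (a%:E - b%:E - (k%:E - j%:E) = (a - b - (k - j))%:E)%E by [].
by congr EFin;lra.
Qed.

(** * The drift of a compensated integral *)

Section signed_disintegration.
Context {R : realType}.
Context {dV} {V : mtype dV}.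
Context {dY} {Y : mtype dY} {dU} {U : mtype dU}.
Variables (a : {measure set Y -> \bar R}) (D : set Y) (iota : Y -> U).
Variables (m : {measure set (U * V) -> \bar R}) (E : set (U * V)).
Variable k : U -> {measure set V -> \bar R}.
Hypotheses (mD : measurable D)
 (mE : measurable E)
 (miota : mfun setT iota)
 (mk : forall B, measurable B -> mfun setT (k ^~ B))
 (k_fin : forall t, (k t setT < +oo)%E)
 (mphi : forall f : U * V -> \bar R, mfun setT f ->
 (forall q, 0 <= f q)%E ->
 (\int[m]_(q in E) f q = \int[a]_(t in D) \int[k (iota t)]_x f (iota t, x))%E).
Variable f : U * V -> R.
Hypotheses (mf : mfun setT f)
 (fin : (\int[m]_(q in E) `|f q|%:E < +oo)%E).

Local Notation inner t := (\int[k (iota t)]_x f (iota t, x)).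
Let measurable_inner (g : U * V -> \bar R) : (forall q, 0 <= g q)%E ->
 mfun setT g ->
 mfun setT (fun t => \int[k (iota t)]_x g (iota t, x))%E.
move=> g0 mg;have := mcomp (measurable_kernel_integral mk k_fin g0 mg) miota.
exact.
Qed.
Let part (b : bool) q := Num.max ((-1) ^+ b * f q) 0.
Let part0 b q : (0 <= (part b q)%:E)%E. Proof. by rewrite lee_fin le_max lexx orbT. Qed.
Let mpart b : mfun setT (fun q => (part b q)%:E).
by apply/mEFinP;apply: measurable_maxr => //;exact: measurable_funM.
Qed.
Let mslice (t : U) : mfun setT (fun x : V => f (t, x)).
Proof. exact: mcomp mf (measurable_pair1 _). Qed.

Lemma disintegrated_slice_ae : {ae a, forall t, D t ->
 (k (iota t)).-integrable setT (fun x => (f (iota t, x))%:E)}.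
have mabs : mfun setT (fun q => `|f q|%:E).
by apply/mEFinP;exact: mcomp.
have := fin;rewrite mphi// => h.
have mI : mfun setT (fun t => \int[k (iota t)]_x `|f (iota t, x)|%:E)%E.
by apply: (measurable_inner _ mabs) => q;rewrite lee_fin.
have /integrable_ae : (a).-integrable D
(fun t => \int[k (iota t)]_x `|f (iota t, x)|%:E)%E.
apply: ge0_integrable => //;first exact: mfunTS.
by move=> t;exact: integral_ge0.
move=> /(_ mD);apply: filterS => t /[apply];rewrite ge0_fin_numE ?integral_ge0// => ft.
apply/integrableP;split;first by apply/mEFinP;exact: mslice.
by under eq_integral do rewrite abse_EFin.
Qed.
Let outer b t := (\int[k (iota t)]_x (part b (iota t, x))%:E)%E.
Let mouter b : mfun setT (outer b).
Proof. exact: measurable_inner (part0 b) (mpart b). Qed.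
Let outer_finite b : (\int[a]_(t in D) outer b t < +oo)%E.
rewrite -(mphi (f := fun q => (part b q)%:E))//;apply: le_lt_trans fin.
apply: ge0_le_integral => //;try exact: mfunTS.
- by apply: mfunTS;apply/mEFinP;exact: mcomp.
- move=> q _;rewrite lee_fin /part ge_max normr_ge0 andbT.
by apply: le_trans (ler_norm _) _;rewrite normrM normrX normrN1 expr1n mul1r.
Qed.
Let outer_integrable b : (a).-integrable D (outer b).
apply: ge0_integrable => //;first exact: mfunTS.
by move=> t;exact: integral_ge0.
Qed.
Let fine_outer b : {ae a, forall t, D t ->
 outer b t = (fine (outer b t))%:E}.
have := integrable_ae mD (outer_integrable b).
by apply: filterS => t /[apply] h;rewrite fineK.
Qed.
Let partE q : (f q)%:E = ((part false q)%:E - (part true q)%:E)%E.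
Proof. by rewrite -EFinB /part expr0 expr1 mul1r mulN1r max_oppr. Qed.
Let slice_part b t : (k (iota t)).-integrable setT (fun x => (f (iota t, x))%:E) ->
 (k (iota t)).-integrable setT (fun x => (part b (iota t, x))%:E).
move=> i;apply: le_integrable i => //.
by exact: (mcomp (mpart b) (measurable_pair1 _)).
move=> x _;rewrite lee_fin ger0_norm ?le_max ?lexx ?orbT// /part ge_max normr_ge0 andbT.
by apply: le_trans (ler_norm _) _;rewrite normrM normrX normrN1 expr1n mul1r.
Qed.

Lemma Rintegral_disintegrated :
 (a).-integrable D (fun t => (inner t)%:E) /\
 \int[m]_(q in E) f q = \int[a]_(t in D) inner t.
have innerE : {ae a, forall t, D t ->
(inner t)%:E = (outer false t - outer true t)%E}.
apply: filterS disintegrated_slice_ae => t /[apply] i.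
rewrite /Rintegral fineK;last exact: integrable_fin_num.
rewrite -integralB//;[|exact: slice_part|exact: slice_part].
by apply: eq_integral => x _;rewrite partE.
have minner : mfun setT (fun t => (inner t)%:E).
rewrite (_ : (fun t => _) = (fun t => (fine (outer false t - outer true t))%:E)).
apply/mEFinP;apply: mcomp => //.
exact: emeasurable_funB.
apply/funext => t;congr (fine _)%:E;rewrite integralE;congr (_ - _)%E.
by apply: eq_integral => x _;rewrite funeposE /part expr0 mul1r EFin_max.
by apply: eq_integral => x _;rewrite funenegE /part expr1 mulN1r EFin_max.
have idiff : (a).-integrable D (fun t => outer false t - outer true t)%E.
exact: integrableB.
have ii : (a).-integrable D (fun t => (inner t)%:E).
apply/integrableP;split;first exact: mfunTS.
case/integrableP: idiff => md;apply: le_lt_trans;rewrite le_eqVlt;apply/orP;left.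
apply/eqP/ae_eq_integral => //;try exact: mcomp.
by apply: mcomp => //;exact: mfunTS.
by apply: filterS innerE => t h /h ->.
split => //;rewrite /Rintegral.
have -> : (\int[a]_(t in D) (inner t)%:E =
\int[a]_(t in D) (outer false t - outer true t))%E.
apply: ae_eq_integral => //;[exact: mfunTS|exact: measurable_int idiff].
rewrite integralB// -!(mphi (f := fun q => (part _ q)%:E))//.
congr fine;rewrite -integralB//.
- by apply: eq_integral => q _;rewrite partE.
- apply: ge0_integrable => //;first exact: mfunTS.
by rewrite mphi//;exact: outer_finite.
- apply: ge0_integrable => //;first exact: mfunTS.
by rewrite mphi//;exact: outer_finite.
Qed.

End signed_disintegration.

(** Indexed by the sign bit, so that both parts are treated at once. *)
Definition sign_part {R : realType} (b : bool) (x : R) : R := Num.max ((-1) ^+ b * x) 0.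

Lemma sign_part_ge0 {R : realType} b (x : R) : 0 <= sign_part b x.
Proof. by rewrite /sign_part le_max lexx orbT. Qed.

Lemma sign_part_le {R : realType} b (x : R) : sign_part b x <= `|x|.
rewrite /sign_part ge_max normr_ge0 andbT;apply: le_trans (ler_norm _) _.
by rewrite normrM normrX normrN1 expr1n mul1r.
Qed.

Lemma sign_partE {R : realType} (x : R) : sign_part false x - sign_part true x = x.
Proof. by rewrite /sign_part expr0 expr1 mul1r mulN1r max_oppr. Qed.

Lemma measurable_sign_part {R : realType} d (X : mtype d) (f : X -> R) D b :
 mfun D f -> mfun D (fun x => sign_part b (f x)).
Proof. by move=> mf;apply: measurable_maxr => //;exact: measurable_funM. Qed.

Section signed_drift.
Context d (X : mtype d) (R : realType).
Variables (m : {measure set X -> \bar R}) (D : set X) (th r : X -> R) (M : R).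
Hypotheses (mD : measurable D)
 (mth : mfun setT th)
 (mr : mfun setT r)
 (rM : forall x, D x -> 0 <= r x <= M)
 (ith : m.-integrable D (EFin \o th)).

Lemma integrable_sign_part b : m.-integrable D (fun x => (sign_part b (th x))%:E).
apply: le_integrable ith => //.
by apply/mEFinP;apply: mfunTS;exact: measurable_sign_part.
by move=> x _;rewrite lee_fin ger0_norm ?sign_part_ge0// sign_part_le.
Qed.
Let weighted b x := Num.max (r x) 0 * sign_part b (th x).
Let mweighted b : mfun setT (weighted b).
by apply: measurable_funM;[exact: measurable_maxr|exact: measurable_sign_part].
Qed.

Lemma integrable_weighted b : m.-integrable D (fun x => (weighted b x)%:E).
have : m.-integrable D (fun x => M%:E * (EFin \o th) x)%E by exact: integrableZl.
apply: le_integrable => //;first by apply/mEFinP;exact: mfunTS.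
move=> x /rM/andP[r0 rM'];rewrite /weighted max_l//= lee_fin !normrM.
rewrite (ger0_norm r0) (ger0_norm (sign_part_ge0 _ _)) (ger0_norm (le_trans r0 rM')).
by rewrite ler_pM// ?sign_part_ge0// sign_part_le.
Qed.

Lemma signed_drift_integrable : m.-integrable D (fun x => (th x * (r x - 1))%:E).
have : m.-integrable D (fun x => (M + 1)%:E * (EFin \o th) x)%E by exact: integrableZl.
apply: le_integrable => //.
apply/mEFinP;apply: mfunTS;apply: measurable_funM => //.
exact: measurable_funB.
move=> x /rM/andP[r0 rM'];rewrite /= lee_fin !normrM mulrC ler_wpM2r//.
rewrite ler_norml (ger0_norm (_ : 0 <= M + 1));last by have := le_trans r0 rM';lra.
by apply/andP;split;lra.
Qed.

Lemma signed_drift :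
 \int[m]_(x in D) (th x * (r x - 1)) =
 (\int[m]_(x in D) weighted false x - \int[m]_(x in D) sign_part false (th x)) -
 (\int[m]_(x in D) weighted true x - \int[m]_(x in D) sign_part true (th x)).
have i b := integrable_sign_part b;have j b := integrable_weighted b.
have ib b := integrableB mD (j b) (i b).
rewrite -(RintegralB mD (j false) (i false)) -(RintegralB mD (j true) (i true)).
rewrite -(RintegralB mD (ib false) (ib true)).
apply: eq_Rintegral => x;rewrite inE => /rM/andP[r0 _];rewrite /weighted max_l//.
by rewrite -[th x in LHS]sign_partE;ring.
Qed.

End signed_drift.

Lemma EFin_Rintegral d (X : mtype d) (R : realType) (m : {measure set X -> \bar R})
 D (f : X -> R) : measurable D -> m.-integrable D (EFin \o f) ->
 (\int[m]_(x in D) (f x)%:E = (\int[m]_(x in D) f x)%:E)%E.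
Proof. by move=> mD i;rewrite /Rintegral fineK// (integrable_fin_num mD i). Qed.

Lemma finite_summand {R : realType} (a b : \bar R) : (0 <= a)%E -> (a + b < +oo)%E ->
 (b < +oo)%E.
Proof. by move=> a0;apply: le_lt_trans;rewrite leeDr. Qed.

Lemma weighted_balance {R : realType} (e a b k j : R) :
 (e%:E * a%:E - e%:E * b%:E - (e%:E * k%:E - e%:E * j%:E) =
 (e * (a - b - (k - j)))%:E)%E.
transitivity ((e * a - e * b - (e * k - e * j))%:E);first by [].
by congr EFin;ring.
Qed.

Lemma balance_difference {R : realType} (e a b k j a' b' k' j' : R) :
 ((e * (a - b - (k - j)))%:E - (e * (a' - b' - (k' - j')))%:E =
 (e * (a - a' - (b - b') - (k - j - (k' - j'))))%:E)%E.
Proof. by rewrite -EFinB;congr EFin;ring. Qed.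

Section drift.
Context {R : realType} {dO} {Omega : mtype dO} {P : probability Omega R}.
Context {d : nat}.
Local Notation V := ('rV[R]_d * R)%type.
Context {F G : R -> set (set Omega)} {T : R}
 {sg : nat -> Omega -> \bar R} {ze : nat -> Omega -> V}
 {nu : Omega -> jump_measure R V}
 {M : R} {rho : Omega -> R -> V -> R} {pm L : Omega -> R -> R}.
Hypotheses (dp : density_process P G T state_marks sg ze nu M rho pm L)
 (FG : forall t, 0 <= t -> F t `<=` G t).
Variable phiF : R.-pker (pspace F) ~> 'rV[R]_d.
Variable CF : Omega -> cumulative R R.
Hypotheses (mean : forall W : Omega -> R -> 'rV[R]_d -> \bar R,
 pfield G W -> (forall w t x, 0 <= W w t x)%E ->
 (\int[P]_w \int[nu w]_q ((q.2.2 == 0)%R%:R%:E * W w q.1 q.2.1) =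
 \int[P]_w \int[stieltjes (CF w)]_(t in `]0%R, T]) \int[phiF (w, t)]_x W w t x)%E)
 (clock : {ae P, forall w, forall g : R -> \bar R, mfun setT g ->
 (forall t, 0 <= g t)%E ->
 (\int[nu w]_q ((q.2.2 == 0)%R%:R%:E * g q.1) =
 \int[stieltjes (CF w)]_(t in `]0%R, T]) g t)%E}).
Variable r : Omega -> R -> 'rV[R]_d -> R.
Hypotheses (mr : pfield G r)
 (rhoE : forall w t z, rho w t z = if z.2 == 0 then r w t z.1 else 1).
Let cp := dp_points dp.
Let fG := cp_filtration cp.
Local Notation mu w := (points (sg^~ w) (ze^~ w)).
Local Notation LT w := (Num.max (L w T) 0).
Local Notation pp w t := (Num.max (pm w t) 0).
Implicit Types Q : Omega -> R -> 'rV[R]_d -> \bar R.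

Lemma predictable_mark_mean Q : pfield G Q ->
 (forall w t x, 0 <= Q w t x)%E ->
 pprocess G (fun w t => \int[phiF (w, t)]_x Q w t x)%E.
move=> mQ Q0;pose n (p : pspace G) : {measure set 'rV[R]_d -> \bar R} :=
phiF (p : pspace F).
have mn U : measurable U -> mfun setT (n ^~ U).
move=> mU;apply: (@mcomp _ _ _ _ _ _ (fun p : pspace F => phiF p U)).
exact: measurable_kernel.
exact: mpred_sub.
have nf p : (n p setT < +oo)%E by rewrite /n prob_kernel ltry.
have := @measurable_kernel_integral _ _ (pspace G) 'rV[R]_d R n mn nf
(fun z => Q z.1.1 z.1.2 z.2).
move=> /(_ (fun z => Q0 z.1.1 z.1.2 z.2) mQ) h;rewrite /pprocess.
by apply: eq_ind h _ _;apply/funext => -[w t].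
Qed.

Lemma predictable_on_state (W : Omega -> R -> V -> \bar R) :
 pfield G W ->
 pfield G (fun w t (z : V) => (z.2 == 0)%R%:R%:E * W w t z)%E.
move=> mW;apply: emeasurable_funM => //;apply/mEFinP.
exact: (mcomp measurable_state_weight).
Qed.
Let iterated_integralD (A B : Omega -> R -> V -> \bar R) :
 pfield G A -> (forall w t z, 0 <= A w t z)%E ->
 pfield G B -> (forall w t z, 0 <= B w t z)%E ->
 (\int[P]_w \int[nu w]_q A w q.1 q.2 + \int[P]_w \int[nu w]_q B w q.1 q.2 =
 \int[P]_w \int[nu w]_q (A w q.1 q.2 + B w q.1 q.2))%E.
move=> mA A0 mB B0;rewrite -ge0_integralD//.
- apply: eq_integral => w _;rewrite -ge0_integralD//.
+ exact: field_path mA.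
+ exact: field_path mB.
- by move=> w _;exact: integral_ge0.
- exact: nu_measurable cp _ mA A0.
- by move=> w _;exact: integral_ge0.
- exact: nu_measurable cp _ mB B0.
Qed.
Let pp0 w t : (0 <= (pp w t)%:E)%E. Proof. by rewrite lee_fin le_max lexx orbT. Qed.

(** Under the density the drift of a predictable mark function may be averaged
over the marks first. *)
Lemma mark_projection Q : pfield G Q -> (forall w t x, 0 <= Q w t x)%E ->
 (\int[P]_w \int[nu w]_q ((pp w q.1)%:E * ((q.2.2 == 0)%R%:R%:E * Q w q.1 q.2.1)) =
 \int[P]_w ((LT w)%:E * \int[nu w]_q ((q.2.2 == 0)%R%:R%:E *
 \int[phiF (w, q.1)]_x Q w q.1 x)))%E.
move=> mQ Q0;have mK := predictable_mark_mean mQ Q0.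
have K0 w t : (0 <= \int[phiF (w, t)]_x Q w t x)%E by exact: integral_ge0.
have mpp : pprocess G (fun w t => (pp w t)%:E).
by apply/mEFinP;exact: predictable_left_pos dp.
have mKV := field_process (V := V) mK.
rewrite (density_projection dp (predictable_on_state mKV));last first.
by move=> w t z;rewrite mule_ge0// lee_fin.
have mpQ : pfield G (fun w t x => (pp w t)%:E * Q w t x)%E.
by apply: emeasurable_funM => //;exact: (field_process (V := 'rV[R]_d) mpp).
transitivity (\int[P]_w \int[nu w]_q ((q.2.2 == 0)%R%:R%:E *
((pp w q.1)%:E * Q w q.1 q.2.1)))%E.
by apply: eq_integral => w _;apply: eq_integral => q _;rewrite muleCA.
rewrite (mean mpQ);last by move=> w t x;rewrite mule_ge0.
apply: ae_eq_nm;apply: filterS clock => w ck.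
rewrite (_ : (fun q => _) = (fun q => ((q.2.2 == 0)%R%:R%:E *
((pp w q.1)%:E * \int[phiF (w, q.1)]_x Q w q.1 x))%E));last first.
by apply/funext => q;rewrite muleCA.
rewrite (ck (fun t => (pp w t)%:E * \int[phiF (w, t)]_x Q w t x)%E);last 2 first.
- apply: emeasurable_funM;first exact: process_path mpp.
exact: process_path mK.
- by move=> t;rewrite mule_ge0.
apply: eq_integral => t _;rewrite ge0_integralZl//.
exact: (mcomp (f := fun z : R * 'rV[R]_d => Q w z.1 z.2)
(field_path w mQ) (measurable_pair1 t)).
Qed.

Definition drift_mass (K : Omega -> R -> 'rV[R]_d -> \bar R) w : \bar R :=
 (\int[nu w]_q ((q.2.2 == 0)%R%:R%:E * \int[phiF (w, q.1)]_x K w q.1 x))%E.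

Section one_field.
Variable W : Omega -> R -> V -> \bar R.
Hypotheses (mW : pfield G W)
 (W0 : forall w t z, (0 <= W w t z)%E).
Let Q1 w t x := W w t (x, 0).
Let Qr w t x := ((Num.max (r w t x) 0)%:E * W w t (x, 0%R))%E.
Let mQ1 : pfield G Q1.
have h : mfun setT (fun q : pspace G * 'rV[R]_d => (q.1, (q.2, 0 : R))).
by apply: measurable_fun_pair => //;apply: measurable_fun_pair.
exact: mcomp mW h.
Qed.
Let mQr : pfield G Qr.
apply: emeasurable_funM => //;apply/mEFinP.
by apply: measurable_maxr => //;exact: mr.
Qed.
Let Q10 w t x : (0 <= Q1 w t x)%E. Proof. exact: W0. Qed.
Let Qr0 w t x : (0 <= Qr w t x)%E.
Proof. by rewrite mule_ge0// lee_fin le_max lexx orbT. Qed.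

Lemma drift_identity :
 (\int[P]_w ((LT w)%:E * \int[mu w]_q W w q.1 q.2) +
 \int[P]_w ((LT w)%:E * drift_mass Q1 w) =
 \int[P]_w ((LT w)%:E * \int[nu w]_q W w q.1 q.2) +
 \int[P]_w ((LT w)%:E * drift_mass Qr w))%E.
have mpp : pfield G (fun w t (z : V) => (pp w t)%:E).
apply: field_process;apply/mEFinP;exact: predictable_left_pos dp.
have mrp : pfield G (fun w t (z : V) => (Num.max (rho w t z) 0)%:E).
by apply/mEFinP;apply: measurable_maxr => //;exact: dp_factor dp.
rewrite /drift_mass -(mark_projection mQ1 Q10) -(mark_projection mQr Qr0).
rewrite (density_jump_projection dp mW W0) (density_projection dp mW W0).
have m1 : pfield G
(fun w t (z : V) => (pp w t)%:E * ((z.2 == 0)%R%:R%:E * Q1 w t z.1))%E.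
apply: emeasurable_funM => //.
exact: (predictable_on_state (W := fun w t z => Q1 w t z.1) (measurable_state_field mQ1)).
have mr' : pfield G
(fun w t (z : V) => (pp w t)%:E * ((z.2 == 0)%R%:R%:E * Qr w t z.1))%E.
apply: emeasurable_funM => //.
exact: (predictable_on_state (W := fun w t z => Qr w t z.1) (measurable_state_field mQr)).
have mj : pfield G
(fun w t (z : V) => (pp w t * Num.max (rho w t z) 0)%:E * W w t z)%E.
apply: emeasurable_funM => //;under eq_fun do rewrite EFinM.
exact: emeasurable_funM.
have mp : pfield G (fun w t (z : V) => (pp w t)%:E * W w t z)%E.
exact: emeasurable_funM.
have m0 w t : 0 <= pp w t by rewrite le_max lexx orbT.
have r0 w t z : 0 <= Num.max (rho w t z) 0 by rewrite le_max lexx orbT.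
have p1 w t (z : V) : (0 <= (pp w t)%:E * ((z.2 == 0)%R%:R%:E * Q1 w t z.1))%E.
by rewrite !mule_ge0// lee_fin.
have pr w t (z : V) : (0 <= (pp w t)%:E * ((z.2 == 0)%R%:R%:E * Qr w t z.1))%E.
by rewrite mule_ge0// mule_ge0// lee_fin.
have pj w t z : (0 <= (pp w t * Num.max (rho w t z) 0)%:E * W w t z)%E.
by rewrite mule_ge0// lee_fin mulr_ge0.
have pW w t z : (0 <= (pp w t)%:E * W w t z)%E by rewrite mule_ge0.
apply: etrans (iterated_integralD mj pj m1 p1) _.
apply/esym;apply: etrans (iterated_integralD mp pW mr' pr) _;apply/esym.
apply: eq_integral => w _.
apply: eq_integral => -[t [x b]] _ /=;rewrite rhoE /Q1 /Qr/=.
case: eqP => [->|_];rewrite ?mul1e ?mul0e ?mule0 ?adde0;last first.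
by rewrite [Num.max 1 0]max_l ?mulr1 ?ler01.
by rewrite EFinM muleA addeC.
Qed.
End one_field.

Local Notation DX := (`]0, T] `*` setT).
Variable nuX : Omega -> jump_measure R 'rV[R]_d.
Hypothesis disX : {ae P, forall w, forall f : R * 'rV[R]_d -> \bar R,
 mfun setT f -> (forall q, 0 <= f q)%E ->
 (\int[nuX w]_(q in `]0%R, T] `*` setT) f q =
 \int[stieltjes (CF w)]_(t in `]0%R, T]) \int[phiF (w, t)]_x f (t, x))%E}.

Lemma drift_mass_state : {ae P, forall w, forall K : Omega -> R -> 'rV[R]_d -> \bar R,
 pfield G K -> (forall w t x, 0 <= K w t x)%E ->
 drift_mass K w = (\int[nuX w]_(q in `]0%R, T] `*` setT) K w q.1 q.2)%E}.
apply: filterS2 clock disX => w ck dx K mK K0.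
rewrite (dx (fun q => K w q.1 q.2))//;last exact: field_path mK.
rewrite /drift_mass (ck (fun t => \int[phiF (w, t)]_x K w t x)%E)//.
- exact: process_path (predictable_mark_mean mK K0).
- by move=> t;exact: integral_ge0.
Qed.

Variable Theta : Omega -> R -> V -> R.
Hypotheses (mTh : pfield G Theta)
 (Theta2 : (\int[P]_w \int[nu w]_q (Theta w q.1 q.2 ^+ 2)%:E < +oo)%E)
 (clock2 : (\int[P]_w (((LT w) ^+ 2)%:E * nu w setT) < +oo)%E)
 (clock1 : (\int[P]_w nu w setT < +oo)%E).
Let W (b : bool) w t z : \bar R := (sign_part b (Theta w t z))%:E.
Let Q1 b w t x := W b w t (x, 0%R).
Let Qr b w t x := ((Num.max (r w t x) 0)%:E * W b w t (x, 0%R))%E.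
Let mW b : pfield G (W b).
Proof. by apply/mEFinP;exact: measurable_sign_part. Qed.
Let W0 b w t z : (0 <= W b w t z)%E. Proof. by rewrite lee_fin sign_part_ge0. Qed.
Let mmark : mfun setT (fun q : pspace G * 'rV[R]_d => (q.1, (q.2, 0 : R))).
Proof. by apply: measurable_fun_pair => //;apply: measurable_fun_pair. Qed.
Let mQ1 b : pfield G (Q1 b).
Proof. exact: mcomp (mW b) mmark. Qed.
Let mQr b : pfield G (Qr b).
apply: emeasurable_funM;last exact: mQ1.
by apply/mEFinP;apply: measurable_maxr => //;exact: mr.
Qed.
Let LT0 w : (0 <= (LT w)%:E)%E. Proof. by rewrite lee_fin le_max lexx orbT. Qed.
Let mLT : mfun setT (fun w => (LT w)%:E).
by apply/mEFinP;apply: measurable_maxr => //;exact: terminal_measurable dp.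
Qed.
Let Theta2_path w : mfun setT (fun q => (Theta w q.1 q.2 ^+ 2)%:E).
by apply/mEFinP;apply: measurable_funX;exact: field_path mTh.
Qed.
Let sq0 (x : R) : (0 <= (x ^+ 2)%:E)%E. Proof. by rewrite lee_fin sqr_ge0. Qed.
Let mean_square (c : Omega -> R) : (forall w, 0 <= c w) -> mfun setT c ->
 (\int[P]_w ((c w ^+ 2)%:E * nu w setT) < +oo)%E ->
 forall b, (\int[P]_w ((c w)%:E * \int[nu w]_q W b w q.1 q.2) < +oo)%E.
move=> c0 mc fc b.
have mT2 : pfield G (fun w t z => (Theta w t z ^+ 2)%:E).
by apply/mEFinP;exact: measurable_funX.
have m2 := nu_measurable cp mT2 (fun w t z => sq0 _).
apply: (@le_lt_trans _ _ (\int[P]_w ((c w ^+ 2)%:E * nu w setT) +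
\int[P]_w \int[nu w]_q (Theta w q.1 q.2 ^+ 2)%:E)%E);last by rewrite lte_add_pinfty.
have mc2 : mfun setT (fun w => ((c w ^+ 2)%:E * nu w setT)%E).
apply: emeasurable_funM;last exact: measurable_total_mass dp.
by apply/mEFinP;exact: measurable_funX.
rewrite -ge0_integralD//;last 2 first.
- by move=> w _;rewrite mule_ge0.
- by move=> w _;exact: integral_ge0.
apply: ge0_le_integral => //.
- by move=> w _;rewrite mule_ge0 ?lee_fin// integral_ge0.
- apply: emeasurable_funM;first exact/mEFinP.
exact: nu_measurable cp _ (mW b) (W0 b).
- exact: emeasurable_funD.
move=> w _;rewrite -integral_cst// -ge0_integralD//.
rewrite -ge0_integralZl//;[|exact: field_path (mW b)|by rewrite lee_fin].
apply: ge0_le_integral => //.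
- by move=> q _;apply: mule_ge0;[rewrite lee_fin|exact: W0].
- by apply: emeasurable_funM => //;exact: field_path (mW b).
- by apply: emeasurable_funD.
move=> q _;rewrite /W -EFinM -EFinD lee_fin /=.
have := sign_part_le b (Theta w q.1 q.2);have := sign_part_ge0 b (Theta w q.1 q.2).
rewrite -[X in _ <= _ + X]real_normK ?num_real//.
move: (sign_part _ _) `|_| (c w) (c0 w) => p th e e0 p0 pth.
by have := sqr_ge0 (e - th);nra.
by move=> q _;rewrite /= lee_fin sqr_ge0.
Qed.
Let mean_terminal b : (\int[P]_w ((LT w)%:E * \int[nu w]_q W b w q.1 q.2) < +oo)%E.
apply: mean_square clock2 b;first by move=> w;rewrite le_max lexx orbT.
by apply: measurable_maxr => //;exact: terminal_measurable dp.
Qed.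
Let mean_plain b : (\int[P]_w \int[nu w]_q W b w q.1 q.2 < +oo)%E.
have := mean_square (c := fun=> 1) (fun=> ler01) (measurable_cst _) _ b.
under eq_integral do rewrite expr1n mul1e.
by move=> /(_ clock1);under eq_integral do rewrite mul1e.
Qed.
Let mon (f : Omega -> R -> 'rV[R]_d -> \bar R) : pfield G f ->
 (forall w t x, 0 <= f w t x)%E -> mfun setT (drift_mass f).
move=> mf f0;have h := predictable_mark_mean mf f0.
apply: (nu_measurable cp
(predictable_on_state (field_process (V := V) h))).
by move=> w t z;rewrite mule_ge0 ?lee_fin// integral_ge0.
Qed.
Let A b w := ((LT w)%:E * \int[mu w]_q W b w q.1 q.2)%E.
Let B b w := ((LT w)%:E * \int[nu w]_q W b w q.1 q.2)%E.
Let J b w := ((LT w)%:E * drift_mass (Q1 b) w)%E.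
Let K b w := ((LT w)%:E * drift_mass (Qr b) w)%E.
Let Q10 b w t x : (0 <= Q1 b w t x)%E. Proof. exact: W0. Qed.
Let Qr0 b w t x : (0 <= Qr b w t x)%E.
Proof. by rewrite mule_ge0// lee_fin le_max lexx orbT. Qed.
Let drift0 f w : (forall w t x, 0 <= f w t x)%E -> (0 <= drift_mass f w)%E.
Proof. by move=> f0;apply: integral_ge0 => q _;rewrite mule_ge0 ?lee_fin// integral_ge0. Qed.
Let rp0 w t z : (0 <= (pp w t * Num.max (rho w t z) 0)%:E)%E.
Proof. by rewrite lee_fin mulr_ge0 ?le_max ?lexx ?orbT. Qed.
Let state0 (z : V) : (0 <= ((z.2 == 0)%R%:R : R)%:E)%E. Proof. by rewrite lee_fin. Qed.
Let finite_jumps b : (\int[P]_w A b w < +oo)%E.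
have M0 : 0 <= M := ltW (lt_trans ltr01 (dp_gt1 dp)).
have ppW0 w t z : (0 <= (pp w t)%:E * W b w t z)%E := mule_ge0 (pp0 w t) (W0 b w t z).
have mppW : pfield G (fun w t (z : V) => (pp w t)%:E * W b w t z)%E.
apply: emeasurable_funM;last exact: mW.
have h : pprocess G (fun w t => (pp w t)%:E).
by apply/mEFinP;exact: predictable_left_pos dp.
exact: (field_process (V := V) h).
apply: (@le_lt_trans _ _ (M%:E * \int[P]_w B b w)%E);last first.
by rewrite lte_mul_pinfty// mean_terminal.
rewrite /A (density_jump_projection dp (mW b) (W0 b)).
rewrite /B (density_projection dp (mW b) (W0 b)).
rewrite -ge0_integralZl//;last 2 first.
- exact: nu_measurable cp _ mppW ppW0.
- by move=> w _;exact: integral_ge0.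
apply: ge0_ae_le_nm.
- by move=> w;apply: integral_ge0 => q _;exact: mule_ge0 (rp0 _ _ _) (W0 _ _ _ _).
- move=> w;apply: mule_ge0;first by rewrite lee_fin.
by apply: integral_ge0 => q _;exact: ppW0.
apply: filterS (dp_factor_le dp) => w rM.
rewrite -ge0_integralZl//;last exact: field_path mppW.
apply: (ge0_le_negligible (N := ~` (`]0, T] `*` setT))).
- by apply: measurableC;exact: measurable_upto_set.
- exact: cp_off cp w.
- by move=> q _;exact: mule_ge0 (rp0 _ _ _) (W0 _ _ _ _).
- by move=> q _;apply: mule_ge0;[rewrite lee_fin|exact: ppW0].
move=> q _ /contrapT[/= + _];rewrite in_itv/= => /(rM _ q.2)/andP[r0 rM'].
have ppw0 : 0 <= pp w q.1 by rewrite le_max lexx orbT.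
rewrite /W -!EFinM lee_fin (max_l r0) mulrA ler_wpM2r ?sign_part_ge0//.
by rewrite mulrC ler_wpM2r.
Qed.
Let on_state b w t z : (((z.2 == 0)%R%:R : R)%:E * Q1 b w t z.1 <= W b w t z)%E.
by case: z => x e;rewrite /Q1/=;case: eqP => [->|_];rewrite ?mul1e ?mul0e//;exact: W0.
Qed.
Let finite_drift b : (\int[P]_w J b w < +oo)%E /\ (\int[P]_w K b w < +oo)%E.
have id := drift_identity (mW b) (W0 b).
have J_fin : (\int[P]_w J b w < +oo)%E.
apply: le_lt_trans (mean_terminal b).
rewrite /J /drift_mass -(mark_projection (mQ1 b) (Q10 b)).
rewrite (density_projection dp (mW b) (W0 b)).
have l0 w (q : R * V) : (0 <= (pp w q.1)%:E * ((q.2.2 == 0)%R%:R%:E * Q1 b w q.1 q.2.1))%E.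
by apply: mule_ge0;[exact: pp0|apply: mule_ge0;[exact: state0|exact: Q10]].
have r0 w (q : R * V) : (0 <= (pp w q.1)%:E * W b w q.1 q.2)%E.
exact: mule_ge0 (pp0 _ _) (W0 _ _ _ _).
apply: ge0_ae_le_nm.
- by move=> w;apply: integral_ge0 => q _;exact: l0.
- by move=> w;apply: integral_ge0 => q _;exact: r0.
apply: aeW => w;apply: (@ge0_le_negligible _ _ _ _ _ set0).
- exact: measurable0.
- exact: measure0.
- by move=> q _;exact: l0.
- by move=> q _;exact: r0.
- by move=> q _ _;apply: lee_wpmul2l;[exact: pp0|exact: on_state].
split;first exact: J_fin.
have h : (\int[P]_w B b w + \int[P]_w K b w < +oo)%E.
by rewrite /B /K -id;apply: lte_add_pinfty;[exact: finite_jumps|exact: J_fin].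
have B0 : (0 <= \int[P]_w B b w)%E.
apply: integral_ge0 => w _;apply: mule_ge0;first exact: LT0.
by apply: integral_ge0 => q _;exact: W0.
exact: (finite_summand B0 h).
Qed.

Let mA b : mfun setT (A b).
Proof. by apply: emeasurable_funM => //;exact: mu_measurable cp _ (mW b) (W0 b). Qed.
Let mB b : mfun setT (B b).
Proof. by apply: emeasurable_funM => //;exact: nu_measurable cp _ (mW b) (W0 b). Qed.
Let mJ b : mfun setT (J b).
Proof. by apply: emeasurable_funM => //;exact: mon. Qed.
Let mK b : mfun setT (K b).
Proof. by apply: emeasurable_funM => //;exact: mon. Qed.
Let iA b : P.-integrable setT (A b).
apply: (ge0_integrable (@mA b));last exact: finite_jumps.
by move=> w;apply: mule_ge0;[exact: LT0|apply: integral_ge0 => q _;exact: W0].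
Qed.
Let iB b : P.-integrable setT (B b).
apply: (ge0_integrable (@mB b));last exact: mean_terminal.
by move=> w;apply: mule_ge0;[exact: LT0|apply: integral_ge0 => q _;exact: W0].
Qed.
Let iJ b : P.-integrable setT (J b).
apply: (ge0_integrable (@mJ b));last exact: (finite_drift b).1.
by move=> w;apply: mule_ge0;[exact: LT0|apply: drift0;exact: Q10].
Qed.
Let iK b : P.-integrable setT (K b).
apply: (ge0_integrable (@mK b));last exact: (finite_drift b).2.
by move=> w;apply: mule_ge0;[exact: LT0|apply: drift0;exact: Qr0].
Qed.
Let S b w := ((A b w - B b w) - (K b w - J b w))%E.
Let iS b : P.-integrable setT (S b).
exact: (integrableB measurableT (integrableB measurableT (iA b) (iB b))
(integrableB measurableT (iK b) (iJ b))).
Qed.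
Let ES b : (\int[P]_w S b w = 0)%E.
rewrite (integralB measurableT (integrableB measurableT (iA b) (iB b))
(integrableB measurableT (iK b) (iJ b))).
rewrite (integralB measurableT (iA b) (iB b)) (integralB measurableT (iK b) (iJ b)).
exact: (finite_balance (integrable_fin_num measurableT (iA b))
(integrable_fin_num measurableT (iB b)) (integrable_fin_num measurableT (iJ b))
(integrable_fin_num measurableT (iK b)) (drift_identity (mW b) (W0 b))).
Qed.
Let finite_marks : {ae P, forall w, forall b,
 (\int[nu w]_q W b w q.1 q.2 < +oo)%E /\ (drift_mass (Q1 b) w < +oo)%E}.
have fin (f : Omega -> \bar R) : mfun setT f -> (forall w, 0 <= f w)%E ->
(\int[P]_w f w < +oo)%E -> {ae P, forall w, (f w < +oo)%E}.
move=> mf f0 ff;have := integrable_ae measurableT (ge0_integrable mf f0 ff).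
by apply: filterS => w /(_ Logic.I);rewrite ge0_fin_numE.
have h b : {ae P, forall w, (\int[nu w]_q W b w q.1 q.2 < +oo)%E}.
apply: fin (mean_plain b);first exact: nu_measurable cp _ (mW b) (W0 b).
by move=> w;exact: integral_ge0.
have k b : {ae P, forall w, (drift_mass (Q1 b) w < +oo)%E}.
apply: fin;[exact: mon|by move=> w;exact: drift0|].
rewrite (ae_eq_nm (g := fun w => \int[stieltjes (CF w)]_(t in `]0%R, T])
\int[phiF (w, t)]_x Q1 b w t x)%E).
rewrite -mean//;apply: le_lt_trans (mean_plain b);apply: ge0_ae_le_nm.
- by move=> w;apply: integral_ge0 => q _;apply: mule_ge0;[exact: state0|exact: Q10].
- by move=> w;exact: integral_ge0.
apply: aeW => w;apply: (@ge0_le_negligible _ _ _ _ _ set0).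
- exact: measurable0.
- exact: measure0.
- by move=> q _;apply: mule_ge0;[exact: state0|exact: Q10].
- by move=> q _;exact: W0.
- by move=> q _ _;exact: on_state.
apply: filterS clock => w ck.
rewrite /drift_mass (ck (fun t => \int[phiF (w, t)]_x Q1 b w t x)%E)//.
exact: process_path (predictable_mark_mean (mQ1 b) (Q10 b)).
by move=> t;exact: integral_ge0.
apply: filterS2 (filterI (h false) (h true)) (filterI (k false) (k true)) => w [h0 h1] [k0 k1].
by case.
Qed.

(** Under the density the compensated integral of `Theta` acquires the drift
`Theta (r - 1)`, integrated against the compensator of the step process. *)
Lemma drift_centred : exists S : Omega -> \bar R,
 [/\ P.-integrable setT S, (\int[P]_w S w = 0)%E &
 {ae P, forall w, [/\ S w = (LT w * (\int[mu w]_q Theta w q.1 q.2 -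
 \int[nu w]_q Theta w q.1 q.2 -
 \int[nuX w]_(q in DX) (Theta w q.1 (q.2, 0) * (r w q.1 q.2 - 1))))%:E &
 (nuX w).-integrable DX (fun q => (Theta w q.1 (q.2, 0))%:E)]}].
exists (fun w => S false w - S true w)%E;split.
- exact: (integrableB measurableT (iS false) (iS true)).
- apply: etrans (integralB measurableT (iS false) (iS true)) _.
by apply: etrans (congr2 (fun x y => x - y)%E (ES false) (ES true)) _;exact: subee.
have ms := drift_mass_state.
near=> w.
have fm : forall b, (\int[nu w]_q W b w q.1 q.2 < +oo)%E /\
(drift_mass (Q1 b) w < +oo)%E by near: w;exact: finite_marks.
have msw : forall K, pfield G K -> (forall w t x, 0 <= K w t x)%E ->
drift_mass K w = (\int[nuX w]_(q in DX) K w q.1 q.2)%E.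
by near: w;exact: ms.
have rM : forall t x, 0 < t <= T -> 0 <= rho w t x <= M by near: w;exact: dp_factor_le dp.
have [N sN] := cp_finite cp w.
have mThw := field_path w mTh.
have mrw := field_path w mr.
have mDX : measurable (DX : set (R * 'rV[R]_d)) by exact: measurableX.
have mth : mfun setT (fun q : R * 'rV[R]_d => Theta w q.1 (q.2, 0)).
have h : mfun setT (fun q : R * 'rV[R]_d => (q.1, (q.2, 0 : R))).
by apply: measurable_fun_pair => //;apply: measurable_fun_pair.
exact: mcomp mThw h.
have nuI b : (nu w).-integrable setT (fun q => (sign_part b (Theta w q.1 q.2))%:E).
apply: ge0_integrable;[exact: field_path (mW b)| |exact: (fm b).1].
by move=> q;exact: W0.
have nuTh : (nu w).-integrable setT (fun q => (Theta w q.1 q.2)%:E).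
have := integrableB measurableT (nuI false) (nuI true).
by apply: eq_integrable => // q _;rewrite -EFinB sign_partE.
have xI b : (nuX w).-integrable DX (fun q => (sign_part b (Theta w q.1 (q.2, 0)))%:E).
apply: ge0_integrable;first by apply: mfunTS;exact: field_path (mQ1 b).
by move=> q;exact: Q10.
have := (fm b).2;rewrite (msw _ (mQ1 b) (Q10 b));exact.
have xTh : (nuX w).-integrable DX (EFin \o (fun q => Theta w q.1 (q.2, 0))).
have := integrableB mDX (xI false) (xI true).
by apply: eq_integrable => // q _;rewrite -EFinB sign_partE.
have rX : forall q, DX q -> 0 <= r w q.1 q.2 <= M.
move=> q [/= + _];rewrite in_itv/= => /(rM _ (q.2, 0)).
by rewrite rhoE/= eqxx.
have muI (f : R * V -> R) : mfun setT f -> (mu w).-integrable setT (EFin \o f).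
exact: integrable_finite_points (fun n => cp_gt0 cp n w) sN _.
have msb b : mfun setT (fun q : R * V => sign_part b (Theta w q.1 q.2)).
exact: measurable_sign_part.
have SE b : S b w = (LT w * (\int[mu w]_q sign_part b (Theta w q.1 q.2) -
\int[nu w]_q sign_part b (Theta w q.1 q.2) -
(\int[nuX w]_(q in DX) (Num.max (r w q.1 q.2) 0 * sign_part b (Theta w q.1 (q.2, 0))) -
\int[nuX w]_(q in DX) sign_part b (Theta w q.1 (q.2, 0)))))%:E.
have e1 := EFin_Rintegral measurableT (muI _ (msb b)).
have e2 := EFin_Rintegral measurableT (nuI b).
have e3 := etrans (msw _ (mQr b) (Qr0 b))
(EFin_Rintegral mDX (integrable_weighted mDX mth mrw rX xTh b)).
have e4 := etrans (msw _ (mQ1 b) (Q10 b)) (EFin_Rintegral mDX (xI b)).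
by apply: etrans (weighted_balance _ _ _ _ _);rewrite -e1 -e2 -e3 -e4.
split=> //;rewrite (signed_drift mDX mth mrw rX xTh) !SE.
rewrite (_ : \int[mu w]_q Theta w q.1 q.2 = \int[mu w]_q sign_part false (Theta w q.1 q.2) -
\int[mu w]_q sign_part true (Theta w q.1 q.2));last first.
rewrite -(RintegralB measurableT (muI _ (msb false)) (muI _ (msb true))).
by apply: eq_Rintegral => q _;rewrite sign_partE.
rewrite (_ : \int[nu w]_q Theta w q.1 q.2 = \int[nu w]_q sign_part false (Theta w q.1 q.2) -
\int[nu w]_q sign_part true (Theta w q.1 q.2));last first.
rewrite -(RintegralB measurableT (nuI false) (nuI true)).
by apply: eq_Rintegral => q _;rewrite sign_partE.
exact: balance_difference.
Unshelve. all: by end_near.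
Qed.

End drift.

Section integral_comparison.
Context d (X : mtype d) (R : realType) (m : {measure set X -> \bar R}).
Local Open Scope ereal_scope.

Lemma integral_minorant (f g : X -> \bar R) : m.-integrable setT g ->
 {ae m, forall w, g w <= f w} -> \int[m]_w g w <= \int[m]_w f w.
move=> ig gf;rewrite [leLHS]integralE [leRHS]integralE;apply: leeB.
- apply: ge0_ae_le_nm => //;apply: filterS gf => w gfw.
by rewrite !funeposE ge_max le_max gfw/= le_max lexx orbT.
- apply: ge0_ae_le_nm => //;apply: filterS gf => w gfw.
by rewrite !funenegE ge_max le_max leeN2 gfw/= le_max lexx orbT.
Qed.

Lemma le_Rintegral_ae (D : set X) (f g : X -> R) : measurable D ->
 m.-integrable D (EFin \o f) -> m.-integrable D (EFin \o g) ->
 {ae m, forall x, D x -> (f x <= g x)%R} ->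
 (\int[m]_(x in D) f x <= \int[m]_(x in D) g x)%R.
move=> mD fi gi fg;apply: fine_le;[exact: integrable_fin_num|exact: integrable_fin_num|].
rewrite integral_mkcond [leRHS]integral_mkcond;apply: integral_minorant.
by move/(integrable_mkcond (EFin \o f) mD): fi.
apply: filterS fg => x h;rewrite !patchE;case: ifPn => // /set_mem /h.
by rewrite lee_fin.
Qed.

End integral_comparison.

(** * Nonnegative densities and the initial events *)

Section densities.
Context {R : realType} {dO} {Omega : mtype dO} (P : probability Omega R).
Local Open Scope ereal_scope.

(** A density of a measure is nonnegative: the measure of the set where it is
negative would be negative. *)
Lemma density_ge0_ae (Q : {measure set Omega -> \bar R}) (l : Omega -> R) :
 mfun setT l ->
 (forall A, measurable A -> Q A = \int[P]_(w in A) (l w)%:E) ->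
 {ae P, forall w, (0 <= l w)%R}.
move=> ml QE;pose A := l @^-1` `]-oo, 0%R[.
have mA : measurable A by rewrite -[A]setTI;apply: ml.
have neg w : A w -> (l w < 0)%R by rewrite /A/= in_itv.
have ge0 w : A w -> 0 <= (- l w)%:E by move=> /neg h;rewrite lee_fin oppr_ge0 ltW.
have I0 : \int[P]_(w in A) (- l w)%:E = 0.
apply/eqP;rewrite eq_le integral_ge0// andbT -oppe_ge0 -integral_ge0N//.
rewrite (_ : (fun _ => _) = (fun w => (l w)%:E));first by rewrite -QE.
by apply/funext => w;rewrite -EFinN opprK.
have /(ae_eq_integral_abs P mA) : \int[P]_(w in A) `|(- l w)%:E| = 0.
by rewrite -[RHS]I0;apply: eq_integral => w /set_mem Aw;rewrite gee0_abs ?ge0.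
have mN : mfun A (fun w => (- l w)%:E).
by apply/mEFinP;apply: mfunTS;exact: mcomp.
move=> /(_ mN);apply: filterS => w h;rewrite leNgt;apply/negP => lw.
have Aw : A w by rewrite /A/= in_itv/=.
by have [/eqP] := h Aw;rewrite oppr_eq0 => /eqP e;rewrite e ltxx in lw.
Qed.

Section density_integral.
Variables (Q : {measure set Omega -> \bar R}) (e : Omega -> R).
Hypotheses (me : mfun setT e)
 (e0 : forall w, (0 <= e w)%R)
 (QE : forall A, measurable A -> Q A = \int[P]_(w in A) (e w)%:E).
Let weighted_functional (w : Omega) :
 functional (fun f : Omega -> \bar R => (e w)%:E * f w).
split => [f [_ f0]|f g _ _ fg|f g [_ f0] [_ g0]|a f _ _|f_ f _ _ flim].
- by rewrite mule_ge0// lee_fin.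
- by rewrite lee_wpmul2l// lee_fin.
- by rewrite ge0_muleDr.
- by rewrite muleCA.
- by apply: cvgeZl => //;exact: flim.
Qed.

Lemma ge0_integral_density f : nonneg_measurable f ->
 \int[Q]_w f w = \int[P]_w ((e w)%:E * f w).
move: f;apply: (@positive_functional_eq _ _ R (fun f => \int[Q]_w f w)
(fun f => \int[P]_w ((e w)%:E * f w)));first exact: functional_integral.
apply: (@positive_functional_iterated _ _ _ _ R P setT
(fun w (g : Omega -> \bar R) => (e w)%:E * g w) measurableT weighted_functional) => g [mg _].
by apply: emeasurable_funM => //;exact/mEFinP.
move=> A mA;rewrite integral_indic// setIT QE// integral_mkcond.
by apply: eq_integral => w _;rewrite patchE indicE;case: ifP;rewrite ?mule1 ?mule0.
Qed.

Lemma integral_density (f : Omega -> R) : mfun setT f ->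
 \int[Q]_w (f w)%:E = \int[P]_w (e w * f w)%:E.
move=> mf;rewrite [LHS]integralE [RHS]integralE.
have mf' : mfun setT (fun w => (f w)%:E) by exact/mEFinP.
congr (_ - _).
- rewrite ge0_integral_density;last by split => //;exact: measurable_funepos.
apply: eq_integral => w _;rewrite !funeposE -!EFin_max -EFinM.
by rewrite maxr_pMr// mulr0.
- rewrite ge0_integral_density;last by split => //;exact: measurable_funeneg.
apply: eq_integral => w _;rewrite !funenegE -!EFinN -!EFin_max -EFinM.
by rewrite maxr_pMr// mulr0 mulrN.
Qed.

Lemma density_ae (A : Omega -> Prop) : {ae P, forall w, A w} -> {ae Q, forall w, A w}.
move=> [N [mN N0 AN]];exists N;split => //;rewrite QE//.
by apply: null_set_integral => //;apply/mEFinP;exact: mfunTS.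
Qed.

End density_integral.

Lemma equal_image_integral (Q1 Q2 : {measure set Omega -> \bar R}) (f : Omega -> R) :
 mfun setT f ->
 (forall B, measurable B -> Q1 (f @^-1` B) = Q2 (f @^-1` B)) ->
 \int[Q1]_w (f w)%:E = \int[Q2]_w (f w)%:E.
move=> mf Q12;have ge0E (g : R -> \bar R) : nonneg_measurable g ->
\int[Q1]_w g (f w) = \int[Q2]_w g (f w).
move=> [mg g0];rewrite -(ge0_integral_image Q1 mf mg g0) -(ge0_integral_image Q2 mf mg g0).
have := @positive_functional_eq _ _ R _ _
(functional_integral (image_measure Q1 mf) measurableT)
(functional_integral (image_measure Q2 mf) measurableT).
move=> h;apply: (h _ g (conj mg g0)) => B mB.
rewrite !integral_indic// !setIT;exact: Q12 mB.
rewrite [LHS]integralE [RHS]integralE.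
congr (_ - _).
- transitivity (\int[Q1]_w maxe (f w)%:E 0);first by apply: eq_integral => w _;rewrite funeposE.
rewrite (ge0E (fun x => maxe x%:E 0));first by apply: eq_integral => w _;rewrite funeposE.
split => [|x];last by rewrite le_max lexx orbT.
by apply: measurable_maxe => //;exact/mEFinP.
- transitivity (\int[Q1]_w maxe (- (f w)%:E) 0);first by apply: eq_integral => w _;rewrite funenegE.
rewrite (ge0E (fun x => maxe (- x%:E) 0));first by apply: eq_integral => w _;rewrite funenegE.
split => [|x];last by rewrite le_max lexx orbT.
by apply: measurable_maxe => //;apply: mcomp => //;exact/mEFinP.
Qed.

End densities.

Section trivial_start.
Context {R : realType} {dO} {Omega : mtype dO} {d : nat}.
Variables (X : Omega -> R -> 'rV[R]_d) (tau rho : Omega -> \bar R).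
Hypotheses (mX : forall t, 0 <= t -> mfun setT (X ^~ t))
 (mtau : mfun setT tau)
 (tau0 : forall w, (0 <= tau w)%E)
 (rho_gt0 : forall w, (0 < rho w)%E)
 (rho_tau : forall w, (rho w <= tau w)%E)
 (X0 : forall w t, 0 <= t -> (t%:E < rho w)%E -> X w t = 0).

(* Events at time t that do not distinguish paths before `rho`. *)
Let blind (t : R) : set (set Omega) := [set A | measurable A /\
 forall w w', (t%:E < rho w)%E -> (t%:E < rho w')%E -> A w -> A w'].
Let blind_filtration : is_filtration blind.
split.
- move=> t _;split.
+ by split => //;exact: measurable0.
+ move=> A [mA hA];split;first by rewrite setTD;exact: measurableC.
by move=> w w' tw tw' [_ nA];split => // Aw';apply: nA;exact: hA tw' tw Aw'.
+ move=> B hB;split;first by apply: bigcup_measurable => k _;case: (hB k).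
by move=> w w' tw tw' [k _ Bw];exists k => //;case: (hB k) => _;apply;first exact: tw.
- by move=> t _ A [].
- move=> a b a0 ab A [mA hA];split => // w w' bw bw';apply: hA.
by apply: le_lt_trans bw;rewrite lee_fin.
by apply: le_lt_trans bw';rewrite lee_fin.
Qed.
Let blind_right : right_continuous_filtration blind.
move=> t t0 A hA;split.
have : [set` `]t, +oo[] (t + 1) by rewrite /= in_itv/= andbT ltrDl.
by move=> /hA[].
move=> w w' tw tw' Aw.
have [b tb bw] : exists2 b, t < b & (b%:E < rho w)%E /\ (b%:E < rho w')%E.
have [c tc cw] : exists2 c, t < c & (c%:E < Order.min (rho w) (rho w'))%E.
have : (t%:E < Order.min (rho w) (rho w'))%E by rewrite lt_min tw.
case: (Order.min _ _) => [m| |]//.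
by rewrite lte_fin => tm;exists ((t + m) / 2);rewrite ?lte_fin;lra.
by move=> _;exists (t + 1);rewrite ?ltry// ltrDl.
by exists c => //;move: cw;rewrite lt_min => /andP.
have : [set` `]t, +oo[] b by rewrite /= in_itv/= andbT.
by move=> /hA[_];apply;first exact: bw.1;first exact: bw.2.
Qed.

(** Before the first jump and before `tau` nothing is observed, so that the
filtration starts from events that do not separate points. *)
Lemma initial_event_trivial A :
 progressive_enlargement (natural_filtration X) tau 0 A -> forall w w', A w -> A w'.
move=> GA w w'.
suff /(fun h => GA blind blind_filtration blind_right h)[_] :
(forall t, 0 <= t -> natural_filtration X t `<=` blind t) /\
stopping_time blind tau by apply;exact: rho_gt0.
split=> [t t0|].
apply: smallest_filtration_sub => //;apply/adapted_onP => //.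
by move=> u;rewrite /= in_itv/= andbT.
move=> u B /=;rewrite in_itv/= andbT => u0 mB;split.
by have := mX u0 measurableT mB;rewrite setTI.
by move=> v v' uv uv' /=;rewrite !X0.
split => // t t0;split.
have := measurable_lee measurableT mtau (measurable_cst t%:E).
by rewrite setTI.
move=> v v' tv _ /= vt;have := lt_le_trans tv (rho_tau v).
by rewrite ltNge vt.
Qed.

Lemma initial_value_constant (Y : Omega -> R -> R) (T : R) : 0 <= T ->
 is_filtration (progressive_enlargement (natural_filtration X) tau) ->
 progressive_on T (progressive_enlargement (natural_filtration X) tau) Y ->
 exists y, forall w, Y w 0 = y.
move=> T0 fG pY;have [[w0 _]|no] := pselect (exists w : Omega, True);last first.
by exists 0 => w;exfalso;apply: no;exists w.
exists (Y w0 0) => w.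
have /pY h : 0 <= (0 : R) <= T by rewrite lexx.
have mD : measurable [set p : g_sigma_algebraType
(progressive_enlargement (natural_filtration X) tau 0) * R | 0 <= p.2 <= 0].
rewrite (_ : [set _ | _] = setT `*` `[0, 0]);first exact: measurableX.
by apply/seteqP;split => -[a b] /=;rewrite in_itv/=;[move=> ->|case].
have h0 : mfun setT (fun w : g_sigma_algebraType
(progressive_enlargement (natural_filtration X) tau 0) => Y w 0).
apply: (measurable_comp mD _ h (measurable_fun_pair (@measurable_id _ _ _)
(measurable_cst (0 : R)))).
by move=> _ [v _ <-] /=;rewrite lexx.
have := h0 measurableT [set Y w0 0] (measurable_set1 _);rewrite setTI.
rewrite (filtrationE fG)// => /initial_event_trivial;apply;last by [].
Qed.

End trivial_start.

Lemma ae_eq_Rnm {R : realType} d (X : mtype d)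
 (m : {measure set X -> \bar R}) (D : set X) (f g : X -> R) :
 {ae m, forall x, D x -> f x = g x} -> \int[m]_(x in D) f x = \int[m]_(x in D) g x.
move=> [N [mN N0 fgN]];congr fine;apply: (eq_negligible mN N0) => x Dx Nx.
by congr EFin;apply: contrapT => h;apply: Nx;apply: fgN => /(_ Dx).
Qed.

(** * Almost all times of the clock *)

Section almost_everywhere_inference.
Context d (X : mtype d) (R : realType) (m : {measure set X -> \bar R}).
Implicit Types A B : X -> Prop.

Lemma ae_imp A B : (forall x, A x -> B x) -> {ae m, forall x, A x} -> {ae m, forall x, B x}.
Proof. by move=> AB;apply: filterS. Qed.

Lemma ae_conj A B : {ae m, forall x, A x} -> {ae m, forall x, B x} ->
 {ae m, forall x, A x /\ B x}.
Proof. by move=> hA hB;apply: filterI. Qed.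

Lemma ae_all (A : nat -> X -> Prop) : (forall n, {ae m, forall x, A n x}) ->
 {ae m, forall x, forall n, A n x}.
Proof. by move=> hA;apply/ae_foralln. Qed.

End almost_everywhere_inference.

Section clock_paths.
Context {R : realType} {dV} {V : mtype dV}.
Variables (A : cumulative R R) (T : R) (n : jump_measure R V).
Variable k : R -> {measure set V -> \bar R}.
Local Notation m := (stieltjes A).
Local Notation DX := (`]0, T] `*` setT).
Hypotheses (dis : forall f : R * V -> \bar R, mfun setT f -> (forall q, 0 <= f q)%E ->
 (\int[n]_(q in DX) f q = \int[m]_(t in `]0%R, T]) \int[k t]_x f (t, x))%E)
 (k1 : forall t, k t setT = 1%E)
 (mk : forall B, measurable B -> mfun setT (k ^~ B)).

Lemma clock_integral (g : R -> \bar R) : mfun setT g -> (forall t, 0 <= g t)%E ->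
 (\int[n]_(q in DX) g q.1 = \int[m]_(t in `]0%R, T]) g t)%E.
move=> mg g0;rewrite (dis (f := fun q => g q.1))//;last exact: mcomp.
apply: eq_integral => t _;transitivity (\int[k t]_x cst (g t) x)%E;first by [].
by rewrite integral_cst// k1 mule1.
Qed.

Lemma clock_null (N : set R) : measurable N -> (\int[m]_(t in `]0%R, T]) (\1_N t)%:E = 0)%E ->
 {ae m, forall t, 0 < t <= T -> ~ N t}.
move=> mN I0;exists (N `&` `]0, T]);split.
- exact: measurableI.
- by rewrite -[LHS]integral_indic.
move=> t /= h;apply: contrapT => h';apply: h => t0 Nt;by apply: h';split.
Qed.

Lemma clock_atom_null (c : \bar R) :
 (forall t, 0 < t <= T -> n ([set t] `*` setT) = 0%E) ->
 {ae m, forall t, 0 < t <= T -> c <> t%:E}.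
move=> atom0;have [[a aT ca]|no] := pselect (exists2 a, 0 < a <= T & c = a%:E);last first.
by apply: aeW => t tT ct;apply: no;exists t.
have : {ae m, forall t, 0 < t <= T -> ~ [set a] t}.
apply: clock_null => //;rewrite -clock_integral;last 2 first.
- by apply/mEFinP;exact: measurable_indic.
- by move=> t;rewrite lee_fin.
rewrite (_ : (fun _ => _) = (fun q => (\1_([set a] `*` setT) q)%:E));last first.
apply/funext => -[t x];rewrite !indicE;congr (nat_of_bool _)%:R%:E.
by apply/idP/idP => /set_mem /= h;apply/mem_set => //;case: h.
rewrite integral_indic//;[|exact: measurableX|exact: measurableX].
apply/eqP;rewrite eq_le measure_ge0 andbT -(atom0 _ aT);apply: le_measure.
- by rewrite inE;apply: measurableI;exact: measurableX.
- by rewrite inE;exact: measurableX.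
- by move=> q [].
apply: ae_imp => t /[apply] h ct;apply: h;by rewrite /= -[t]/(fine t%:E) -ct ca.
Qed.

Variable f : R * V -> R.
Hypotheses (mf : mfun setT f)
 (fin : n.-integrable DX (fun q => (f q)%:E)).
Let fin' : (\int[n]_(q in DX) `|f q|%:E < +oo)%E.
Proof. by case/integrableP: fin => _;under eq_integral do rewrite abse_EFin. Qed.
Let k_fin t : (k t setT < +oo)%E. Proof. by rewrite k1 ltry. Qed.
Let mDX : measurable (DX : set (R * V)). Proof. exact: measurableX. Qed.
Let miota : mfun setT
 (id : lebesgue_stieltjes_measure_ocitv_type__canonical__measurable_structure_SemiRingOfSets R -> R).
Proof. exact: measurable_id. Qed.

Lemma clock_slice_ae : {ae m, forall t, 0 < t <= T ->
 (k t).-integrable setT (fun x => (f (t, x))%:E)}.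
have := @disintegrated_slice_ae R _ V _ _ _ R m `]0, T] id n DX k (measurable_itv _)
miota mk k_fin dis f mf fin'.
by apply: ae_imp => t h tT;apply: h;rewrite /= in_itv.
Qed.

Lemma clock_Rintegral :
 m.-integrable `]0, T] (fun t => (\int[k t]_x f (t, x))%:E) /\
 \int[n]_(q in DX) f q = \int[m]_(t in `]0, T]) \int[k t]_x f (t, x).
exact: (@Rintegral_disintegrated R _ V _ _ _ R m `]0, T] id n DX k (measurable_itv _) mDX
miota mk k_fin dis f mf fin').
Qed.

End clock_paths.

(** * The infimum of the Hamiltonians *)

Section generator_bounds.
Context {R : realType} {dV} {V : mtype dV} {U : Type}.
Variables (k : {measure set V -> \bar R}) (th : V -> R) (r : V -> U -> R) (l : U -> R).
Variables (M Ml : R).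
Hypotheses (ith : k.-integrable setT (EFin \o th))
 (mr : forall v, mfun setT (r ^~ v))
 (rM : forall x v, 0 <= r x v <= M)
 (lM : forall v, `|l v| <= Ml).

(** The integrability of the slice keeps the Hamiltonians bounded below, so
that their infimum is a lower bound. *)
Lemma generator_le v : inf [set l w + \int[k]_x (th x * (r x w - 1)) | w in [set: U]] <=
 l v + \int[k]_x (th x * (r x v - 1)).
apply: ge_inf;last by exists v.
exists (- Ml - (M + 1) * \int[k]_x `|th x|) => _ [w _ <-].
have mth : mfun setT th by apply/mEFinP;exact: measurable_int ith.
have M0 : 0 <= M + 1 by have /andP[a b] := rM point w;have := le_trans a b;lra.
have i1 := signed_drift_integrable measurableT mth (mr w) (fun x _ => rM x w) ith.
apply: lerD;first by have := lM w;rewrite ler_norml => /andP[].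
have /andP[+ _] : - ((M + 1) * \int[k]_x `|th x|) <= \int[k]_x (th x * (r x w - 1)) <=
(M + 1) * \int[k]_x `|th x|;last by [].
rewrite -ler_norml;apply: le_trans (le_normr_Rintegral measurableT i1) _.
rewrite -RintegralZl//;last by have := integrable_abse ith;apply: eq_integrable.
apply: le_Rintegral => //.
- by have := integrable_abse i1;apply: eq_integrable.
- by have := integrableZl measurableT (M + 1) (integrable_abse ith);apply: eq_integrable.
move=> x _;rewrite normrM mulrC ler_wpM2r//.
by have /andP[a b] := rM x w;rewrite ler_norml;apply/andP;split;lra.
Qed.

End generator_bounds.

(** * Densities that agree up to a stopping time *)

Section equal_until.
Context {R : realType} {dO} {Omega : mtype dO} {P : probability Omega R}
 {Gl : R -> set (set Omega)} {T : R} {dV} {V : mtype dV} {V0 : set V}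
 {sg : nat -> Omega -> \bar R} {ze : nat -> Omega -> V}
 {nu : Omega -> jump_measure R V}
 {M : R} {rho1 rho2 : Omega -> R -> V -> R} {pm1 pm2 L1 L2 : Omega -> R -> R}.
Hypotheses (dp1 : density_process P Gl T V0 sg ze nu M rho1 pm1 L1)
 (dp2 : density_process P Gl T V0 sg ze nu M rho2 pm2 L2).
Variable S : Omega -> R.
Hypotheses (S_stop : stopping_time Gl (fun w => (S w)%:E))
 (S_le : forall w, 0 < S w <= T)
 (rho12 : forall w t z, 0 < t <= S w -> rho1 w t z = rho2 w t z).
Let cp := dp_points dp1.
Let fG := cp_filtration cp.
Let T_gt0 : 0 < T := cp_T cp.
Local Notation mu w := (points (sg^~ w) (ze^~ w)).
Let path_fin w : exists N, forall n, (N <= n)%N -> sg n w = +oo%E := cp_finite cp w.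

(** The difference of the two densities solves the homogeneous equation up to
time `S`, and the moment estimate with initial value 0 forces it to vanish. *)
Lemma densities_agree : {ae P, forall w, L1 w (S w) = L2 w (S w)}.
have S0T w : 0 <= S w <= T by case/andP: (S_le w) => /ltW -> ->.
have mS : pprocess Gl (fun w t => (0 < t <= S w)%R%:R : R).
have mD := measurableI _ _ (predictable_gt fG (lexx (0 : R))) (predictable_stopping_ge fG S_stop).
have h : mfun setT (\1_([set p | 0 < p.2] `&`
[set p | 0 <= p.2 /\ (p.2%:E <= (S p.1)%:E)%E]) : pspace Gl -> R).
exact: measurable_indic mD.
rewrite /pprocess;apply: eq_ind h _ _;apply/funext => p;rewrite indicE;congr (nat_of_bool _)%:R.
apply/idP/andP => [/set_mem[/= a []]|[a b]];first by rewrite lee_fin.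
by apply/mem_set;split => //=;rewrite lee_fin (ltW a).
have adL : adapted_on `[0, T] Gl (fun w t => L1 w t - L2 w t).
move=> t tT;apply: measurable_funB;first exact: dp_adapted dp1 _ tT.
exact: dp_adapted dp2 _ tT.
have lin : {ae P, forall w, solves_linear (mu w) (nu w) (fun t => pm1 w t - pm2 w t)
(rho1 w) 0 (S w) (fun t => L1 w t - L2 w t)}.
apply: filterS2 (filterI (dp_linear dp1) (dp_linear dp2))
(filterI (cp_bounded cp) (filterI (dp_factor_le dp1) (dp_factor_le dp2))).
move=> w [lin1 lin2] [fin [r1M r2M]];have [N sN] := path_fin w.
have mufin := points_measure_fin (ze^~ w) (fun n => cp_gt0 cp n w) sN.
have [A1 a1] := integrand_bounded (ltW T_gt0) r1M lin1.
have [A2 a2] := integrand_bounded (ltW T_gt0) r2M lin2.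
have m1 := measurable_integrand T (field_path w (dp_factor dp1))
(process_path w (dp_left dp1)).
have m2 := measurable_integrand T (field_path w (dp_factor dp2))
(process_path w (dp_left dp2)).
case: lin1 lin2 => [c1 p1 e1] [c2 p2 e2];case/andP: (S_le w) => s0 sT.
split.
- case: c1 c2 => [r1 l1] [r2 l2];split => t /andP[t0 tS].
by apply: cvgB;[apply: r1|apply: r2];rewrite t0 (lt_le_trans tS).
by apply: is_cvgB;[apply: l1|apply: l2];rewrite t0 (le_trans tS).
- move=> t /andP[t0 tS];have tT : 0 < t <= T by rewrite t0 (le_trans tS).
rewrite p1// p2//;apply/esym/cvg_lim => //.
by apply: cvgB;[exact: cadlag_left_lim c1 tT|exact: cadlag_left_lim c2 tT].
move=> t /andP[t0 tS];have tT : 0 <= t <= T by rewrite t0 (le_trans tS).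
rewrite e1// e2//.
have D_le q : (`]0, t] `*` setT : set (R * V)) q -> 0 < q.1 <= T /\ 0 < q.1 <= S w.
by move=> [/= + _];rewrite in_itv/= => /andP[a b];rewrite a (le_trans b tS) (le_trans (le_trans b tS)).
have diff (n : jump_measure R V) : (n setT < +oo)%E ->
\int[n]_(q in `]0, t] `*` setT) ((pm1 w q.1 - pm2 w q.1) * (rho1 w q.1 q.2 - 1)) =
\int[n]_(q in `]0, t] `*` setT) (pm1 w q.1 * (rho1 w q.1 q.2 - 1)) -
\int[n]_(q in `]0, t] `*` setT) (pm2 w q.1 * (rho2 w q.1 q.2 - 1)).
move=> nf;have mD : measurable (`]0, t] `*` setT : set (R * V)) by exact: measurableX.
have E1 : \int[n]_(q in `]0, t] `*` setT) (pm1 w q.1 * (rho1 w q.1 q.2 - 1)) =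
\int[n]_(q in `]0, t] `*` setT) integrand T (rho1 w) (pm1 w) q.
by apply: eq_Rintegral => q /set_mem /D_le[qT _];rewrite /integrand qT.
have E2 : \int[n]_(q in `]0, t] `*` setT) (pm2 w q.1 * (rho2 w q.1 q.2 - 1)) =
\int[n]_(q in `]0, t] `*` setT) integrand T (rho2 w) (pm2 w) q.
by apply: eq_Rintegral => q /set_mem /D_le[qT _];rewrite /integrand qT.
rewrite E1 E2 -RintegralB//;last 2 first.
- exact: bounded_integrable nf mD (mfunTS m1) (fun q _ => a1 q).
- exact: bounded_integrable nf mD (mfunTS m2) (fun q _ => a2 q).
apply: eq_Rintegral => q /set_mem /D_le[qT qS].
by rewrite /integrand qT (rho12 _ qS);ring.
by rewrite /compensated_integral !diff//;ring.
have mpm := measurable_funB (dp_left dp1) (dp_left dp2).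
have [Z [mZ Z0 EZ ZP]] := linear_fourth_moment cp (dp_gt1 dp1) (dp_factor dp1) (dp_off dp1)
(dp_factor_le dp1) S0T mS mpm adL lin (mean_mark_mass dp1).
have : (\int[P]_w `|Z w| = 0)%E.
apply/eqP;rewrite eq_le integral_ge0// andbT;apply: le_trans (_ : _ <= 0%:E)%E => //.
by rewrite expr0n/= in EZ;under eq_integral do rewrite gee0_abs//.
move=> /(ae_eq_integral_abs P measurableT mZ);apply: filterS2 ZP => w Zw /(_ Logic.I) Z00.
have M10 : 0 <= M - 1 by rewrite subr_ge0 ltW// (dp_gt1 dp1).
have : (((L1 w (S w) - L2 w (S w)) ^+ 4 * expR (- ((2 + M ^+ 4) * time_mass (nu w) V0 (S w))))%:E
<= 0%:E)%E.
rewrite -[leRHS]Z00;apply: le_trans Zw;rewrite leeDl//;apply: mule_ge0;first by rewrite lee_fin.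
by apply: integral_ge0 => q _;rewrite lee_fin fourth_expR_ge0.
rewrite lee_fin pmulr_lle0 ?expR_gt0// => h.
have : (L1 w (S w) - L2 w (S w)) ^+ 4 == 0.
by rewrite eq_le h -[_ ^+ 4]/(_ ^+ (2 * 2)) exprM sqr_ge0.
by rewrite expf_eq0/= subr_eq0 => /eqP.
Qed.

(** Optional stopping leaves only the values at `S`, so that the two densities
define the same measure on the events before `S`. *)
Lemma densities_equal_before A : stopped_sigma_algebra Gl (fun w => (S w)%:E) A ->
 (\int[P]_(w in A) (L1 w T)%:E = \int[P]_(w in A) (L2 w T)%:E)%E.
move=> GA;have mA : measurable A by case: GA.
have stop L rho pm (dp : density_process P Gl T V0 sg ze nu M rho pm L) : exists Q : Omega -> R,
[/\ P.-integrable setT (EFin \o Q), (\int[P]_w (Q w)%:E = 0)%E &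
{ae P, forall w, Q w = \1_A w * (L w T - L w (S w))}].
have [||Q [iQ EQ QE]] := density_optional_stopping dp S_stop (z := \1_A) (B := 1).
- move=> B mB;rewrite preimage_indic;have sA := stopped_sigma_algebra_sigma fG S_stop.
have s0 : stopped_sigma_algebra Gl (fun w => (S w)%:E) set0 by case: sA.
have sC : stopped_sigma_algebra Gl (fun w => (S w)%:E) (~` A).
by case: sA => _ h _;rewrite -setTD;exact: h.
have sT := stopped_sigma_algebraT fG S_stop.
by case: ifP => _;case: ifP => _.
- by move=> w;rewrite indicE;case: (_ \in _);rewrite ?normr1 ?normr0.
exists Q;split => //;apply: filterS QE => w ->.
by have /andP[_] := S_le w;rewrite lee_fin /= => ->.
have [Q1 [iQ1 E1 Q1E]] := stop _ _ _ dp1;have [Q2 [iQ2 E2 Q2E]] := stop _ _ _ dp2.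
have i1 := density_terminal_integrable dp1;have i2 := density_terminal_integrable dp2.
have iA (f : Omega -> R) : P.-integrable setT (fun w => (f w)%:E) ->
P.-integrable A (fun w => (f w)%:E) by apply: integrableS.
have diff : (\int[P]_(w in A) ((L1 w T)%:E - (L2 w T)%:E) = 0)%E.
have -> : (\int[P]_(w in A) ((L1 w T)%:E - (L2 w T)%:E) =
\int[P]_w ((Q1 w)%:E - (Q2 w)%:E))%E.
rewrite integral_mkcond;apply: ae_eq_nm.
apply: filterS2 densities_agree (filterI Q1E Q2E) => w agree [-> ->].
rewrite patchE indicE agree;case: (_ \in _);rewrite -!EFinB /= ?mul1r ?mul0r;
congr EFin;lra.
by rewrite integralB// E1 E2 subee.
have f1 := integrable_fin_num mA (iA _ i1);have f2 := integrable_fin_num mA (iA _ i2).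
move: diff;rewrite (integralB mA (iA _ i1) (iA _ i2)) => /eqP.
by rewrite sube_eq ?add0e ?fin_num_adde_defl// => /eqP.
Qed.

End equal_until.

(** * Controls, costs and verification *)

Section horizon_time.
Context {R : realType} {dO} {Omega : mtype dO}.
Variables (T : R) (tau : Omega -> \bar R) (G : R -> set (set Omega)).
Hypotheses (T_gt0 : 0 < T)
 (tau_gt0 : forall w, (0 < tau w)%E).
Local Notation sigma := (min_time T tau).

Lemma min_timeE w : (sigma w)%:E = Order.min T%:E (tau w).
rewrite /min_time;have := tau_gt0 w;case: (tau w) => [a||]//= _.
- by rewrite -EFin_min.
- by rewrite min_l// leey.
Qed.

Lemma min_time_itv w : 0 < sigma w <= T.
have h0 : (0 < (sigma w)%:E)%E by rewrite min_timeE lt_min lte_fin T_gt0 tau_gt0.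
have hT : ((sigma w)%:E <= T%:E)%E by rewrite min_timeE ge_min lexx.
by move: h0 hT;rewrite lte_fin lee_fin => -> ->.
Qed.

Lemma min_time_stopping : is_filtration G -> stopping_time G tau ->
 stopping_time G (fun w => (sigma w)%:E).
move=> fG tauG;rewrite (_ : (fun w => _) = (fun w => Order.min T%:E (tau w))).
by apply: stopping_time_min => //;apply: stopping_time_cst => //;exact: ltW.
by apply/funext => w;rewrite min_timeE.
Qed.

Context {d : nat} {dU} {U : mtype dU}.

(** After the stopping time the running cost vanishes, so that stopping the
integral or the control makes no difference. *)
Lemma stopped_cost_cost (X : Omega -> R -> 'rV[R]_d)
 (l : Omega -> R -> 'rV[R]_d -> U -> R)
 (CF : Omega -> cumulative R R) g (Q : {measure set Omega -> \bar R}) u :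
 stopped_cost T tau X l CF g Q u = cost T tau X l CF g Q u.
apply: eq_integral => w _;congr ((_ + _)%R%:E);congr fine.
rewrite [LHS]integral_mkcond [RHS]integral_mkcond;apply: eq_integral => t _.
have /andP[s0 sT] := min_time_itv w.
rewrite !patchE indicE !mem_setE !in_itv/=.
case: (ltP 0 t) => /= [t0|//];rewrite (ltW t0)/=.
by case: (leP t (sigma w)) => [ts|_];rewrite ?mulr1 ?mulr0 ?(le_trans ts sT)//;case: ifP.
Qed.

Lemma stop_control_stopped (u0 : U) u : is_filtration G -> stopping_time G tau ->
 control T G u -> stopped_control T G tau u0 (stop_control T tau u0 u).
move=> fG tauG cu;split;last first.
move=> w t /andP[st _];have /negPf ts : ~~ (t <= sigma w) by rewrite -ltNge.
by rewrite /stop_control ts andbF.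
have mD := predictable_stopping_ge fG (min_time_stopping fG tauG).
have h : mfun ([set p : pspace G | 0 <= p.2 /\ (p.2%:E <= (sigma p.1)%:E)%E])
(fun p => u p.1 p.2).
apply: measurable_funS cu;first exact: predictable_le.
move=> p /= [p0];rewrite lee_fin => ps;rewrite in_itv/= p0/=.
by apply: le_trans ps _;case/andP: (min_time_itv p.1).
have := measurable_fun_cond u0 mD h.
rewrite /control /predictable_on => h';apply: mfunTS.
apply: eq_ind h' _ _;apply/funext => p;rewrite /stop_control /= lee_fin.
by case: asboolP => [[-> ->]//|];case: (0 <= p.2) => //=;case: (p.2 <= _) => // h1;exfalso;apply: h1.
Qed.

End horizon_time.

Lemma bounded_integrable_on {R : realType} d (X : mtype d)
 (m : {measure set X -> \bar R}) (D : set X) (f : X -> R) B :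
 (m D < +oo)%E -> measurable D -> mfun D f ->
 (forall x, D x -> `|f x| <= B) -> m.-integrable D (EFin \o f).
move=> mD_fin mD mf fB;apply/integrableP;split;first exact/mEFinP.
apply: (@le_lt_trans _ _ (\int[m]_(x in D) (cst B%:E) x)%E).
apply: ge0_le_integral => //;
try (by move=> x Dx;rewrite lee_fin (le_trans _ (fB x Dx))).
by apply: mcomp => //;exact/mEFinP.
rewrite integral_cst//;have [->|/set0P[x Dx]] := eqVneq D set0;first by rewrite measure0 mule0 ltry.
by apply: lte_mul_pinfty => //;rewrite lee_fin (le_trans _ (fB x Dx)).
Qed.

Section controlled_density.
Context {R : realType} {dO} {Omega : mtype dO} {P : probability Omega R}.
Context {d : nat}.
Local Notation V := ('rV[R]_d * R)%type.
Context {F G : R -> set (set Omega)} {T : R}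
 {sg : nat -> Omega -> \bar R} {ze : nat -> Omega -> V}
 {nu : Omega -> jump_measure R V}.
Hypotheses (cp : compensated_points P G T state_marks sg ze nu)
 (fF : is_filtration F)
 (FG : forall t, 0 <= t -> F t `<=` G t).
Let fG := cp_filtration cp.
Let T_gt0 := cp_T cp.
Local Notation mu w := (points (sg^~ w) (ze^~ w)).
Local Notation DZ := (`]0, T] `*` setT).
Variables muZ nuZ : Omega -> jump_measure R V.
Hypotheses (muE : {ae P, forall w, forall A, measurable A -> A `<=` DZ -> muZ w A = mu w A})
 (nuE : {ae P, forall w, forall A, measurable A -> A `<=` DZ -> nuZ w A = nu w A}).
Context {dU} {U : mtype dU}.
Variables (r l : Omega -> R -> 'rV[R]_d -> U -> R) (M Ml : R).
Hypotheses (mr : mfun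
 [set q : pspace F * 'rV[R]_d * U | 0 <= q.1.1.2 <= T]
 (fun q => r q.1.1.1 q.1.1.2 q.1.2 q.2))
 (M_gt1 : 1 < M)
 (bounds : {ae P, forall w, forall t x v, 0 <= t <= T ->
 0 <= r w t x v <= M /\ `|l w t x v| <= Ml})
 (moment : (\int[P]_w (expR ((3 + M ^+ 4) * fine (nu w setT)))%:E < +oo)%E).

Let rM : {ae P, forall w, forall t x v, 0 <= t <= T -> 0 <= r w t x v <= M}.
Proof. by apply: filterS bounds => w h t x v tT;case: (h t x v tT). Qed.
Let measurable_horizon_field :
 measurable ([set q | 0 <= q.1.1.2 <= T] : set (pspace F * 'rV[R]_d * U)).
rewrite (_ : [set _ | _] = [set p : pspace F | 0 <= p.2 <= T] `*` setT `*` setT).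
by do 2 apply: measurableX => //;exact: predictable_le.
by apply/seteqP;split => q /= => [h|[[]]//];split.
Qed.

Lemma compensated_integral_pair : {ae P, forall w, forall t (W : R -> V -> R), t <= T ->
 compensated_integral (muZ w) (nuZ w) `]0, t] W =
 compensated_integral (mu w) (nu w) `]0, t] W}.
apply: filterS2 muE nuE => w mE nE t W tT.
congr (fine _ - fine _);apply: eq_measure_integral => A mA AD;[apply: mE|apply: nE] => //;
by move=> q /AD[/= + _];rewrite !in_itv/= => /andP[a b];rewrite a (le_trans b tT).
Qed.

Lemma predictable_horizon : measurable ([set p | 0 < p.2 <= T] : set (pspace G)).
rewrite (_ : [set _ | _] = [set p | 0 < p.2] `&` [set p | 0 <= p.2 <= T]).
by apply: measurableI;[exact: predictable_gt|exact: predictable_le].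
apply/seteqP;split => p /=;first by move=> /andP[a b];rewrite a b (ltW a).
by move=> [-> /andP[_ ->]].
Qed.

(** The factor by which a control changes the intensity of the jumps, as a
field on the whole half-line. *)
Definition factor (u : Omega -> R -> U) w t (x : 'rV[R]_d) : R :=
 if `[< 0 < t <= T >] then r w t x (u w t) else 1.

Definition pair_factor u w t (z : V) : R := if z.2 == 0 then factor u w t z.1 else 1.

Section one_control.
Variables (u : Omega -> R -> U) (L : Omega -> R -> R) (Q : {measure set Omega -> \bar R}).
Hypotheses (cu : control T G u)
 (expL : is_stochastic_exponential P T G r muZ nuZ u L)
 (QE : forall A, measurable A -> Q A = (\int[P]_(w in A) (L w T)%:E)%E).

Lemma predictable_factor : pfield G (factor u).
apply: (field_cut (V := 'rV[R]_d) (I := [set t | 0 < t <= T]) 1 predictable_horizon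
(W := fun w t x => r w t x (u w t))).
have mD : measurable ([set q | 0 < q.1.2 <= T] : set (pspace G * 'rV[R]_d)).
rewrite (_ : [set _ | _] = [set p : pspace G | 0 < p.2 <= T] `*` setT).
by apply: measurableX => //;exact: predictable_horizon.
by apply/seteqP;split => q /= => [h|[]//];split.
pose f (q : pspace G * 'rV[R]_d) := ((q.1 : pspace F, q.2), u q.1.1 q.1.2).
suff mf : mfun [set q : pspace G * 'rV[R]_d | 0 < q.1.2 <= T] f.
apply: (measurable_comp measurable_horizon_field _ mr mf).
by move=> _ [q /andP[a b] <-] /=;rewrite (ltW a) b.
apply: measurable_fun_pair_on.
apply: mfunTS;apply: measurable_fun_pair => //.
exact: mcomp (mpred_sub FG) measurable_fst.
have mu' : mfun ([set p | 0 < p.2 <= T] : set (pspace G)) (fun p => u p.1 p.2).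
apply: measurable_funS cu;first exact: predictable_le.
by move=> p /= /andP[a b];rewrite in_itv/= (ltW a) b.
apply: (measurable_comp predictable_horizon _ mu');first by move=> _ [q h <-].
exact: mfunTS.
Qed.

Lemma predictable_pair_factor : pfield G (pair_factor u).
have h : pfield G (fun w t (z : V) => (z.2 == 0)%:R * factor u w t z.1 + (1 - (z.2 == 0)%:R)).
have m0 : mfun setT (fun q : pspace G * V => (q.2.2 == 0)%:R : R).
exact: (mcomp measurable_state_weight).
apply: measurable_funD;last exact: measurable_funB.
by apply: measurable_funM => //;exact: (measurable_state_field predictable_factor).
rewrite /pfield;apply: eq_ind h _ _;apply/funext => w;apply/funext => t;apply/funext => z.
rewrite /pair_factor /=.
by case: eqP => _;rewrite ?mul1r ?mul0r ?subrr ?addr0 ?subr0 ?add0r.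
Qed.

Lemma controlled_density : density_process P G T state_marks sg ze nu M
 (pair_factor u) (left_version T L) L.
case: expL => aL sL.
have mLT : mfun setT (L ^~ T).
have TT : T \in `[0, T] by rewrite in_itv/= lexx ltW.
move=> mT B mB;rewrite setTI.
have /adapted_onP h := aL;apply: (filtrationM fG (ltW T_gt0)).
by apply: (h fG) => // t;rewrite /= in_itv/= => /andP[].
split => //.
- exact: predictable_pair_factor.
- by move=> w t z /eqP/negPf z0;rewrite /pair_factor z0.
- apply: filterS rM => w rMw t z tT;rewrite /pair_factor /factor asboolT//.
by case: ifP => _;[apply: rMw;case/andP: tT => /ltW -> ->|rewrite ler01 ltW].
- exact: predictable_left_version.
- apply: filterS2 sL compensated_integral_pair => w [cad Leq] ciE.
have leftE t : 0 < t <= T -> left_version T L w t = left_lim (L w) t.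
by move=> tT;apply: left_versionE => //;case: cad => _;apply.
split => // t tT;rewrite Leq//;case/andP: (tT) => t0 tT';rewrite (ciE t _ tT').
congr (_ + (fine _ - fine _));apply: eq_integral => q;rewrite inE => -[/= + _];
rewrite in_itv/= => /andP[a b];
by rewrite leftE ?a ?(le_trans b tT')// /pair_factor /factor /jump_factor
asboolT ?a ?(le_trans b tT')//;case: eqP => _;rewrite ?mulr1 ?addr0 ?mulr0 ?add0r.
- exact: density_ge0_ae mLT QE.
Qed.

End one_control.

Variables (X : Omega -> R -> 'rV[R]_d) (tau : Omega -> \bar R).
Hypotheses (tauG : stopping_time G tau)
 (tau_gt0 : forall w, (0 < tau w)%E).
Local Notation sigma := (min_time T tau).
Hypotheses (aX : adapted_on `[0, T] G X)
 (X_left : forall w t, 0 < t -> \forall a \near t^'-, X w a = left_lim (X w) t)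
 (X_sigma : {ae P, forall w, X w (sigma w) = left_lim (X w) (sigma w)}).
Variable phiF : R.-pker (pspace F) ~> 'rV[R]_d.
Variable CF : Omega -> cumulative R R.
Hypotheses (X_clock : {ae P, forall w, {ae stieltjes (CF w), forall t, 0 < t <= T ->
 X w t = left_lim (X w) t}})
 (mean : forall W : Omega -> R -> 'rV[R]_d -> \bar R,
 pfield G W -> (forall w t x, 0 <= W w t x)%E ->
 (\int[P]_w \int[nu w]_q ((q.2.2 == 0)%R%:R%:E * W w q.1 q.2.1) =
 \int[P]_w \int[stieltjes (CF w)]_(t in `]0%R, T]) \int[phiF (w, t)]_x W w t x)%E)
 (clock : {ae P, forall w, forall g : R -> \bar R, mfun setT g ->
 (forall t, 0 <= g t)%E ->
 (\int[nu w]_q ((q.2.2 == 0)%R%:R%:E * g q.1) =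
 \int[stieltjes (CF w)]_(t in `]0%R, T]) g t)%E}).
Variable nuX : Omega -> jump_measure R 'rV[R]_d.
Hypothesis disX : {ae P, forall w, forall f : R * 'rV[R]_d -> \bar R,
 mfun setT f -> (forall q, 0 <= f q)%E ->
 (\int[nuX w]_(q in `]0%R, T] `*` setT) f q =
 \int[stieltjes (CF w)]_(t in `]0%R, T]) \int[phiF (w, t)]_x f (t, x))%E}.
Variable u0 : U.
Hypothesis ml : mfun
 [set q : pspace F * 'rV[R]_d * U | 0 <= q.1.1.2 <= T]
 (fun q => l q.1.1.1 q.1.1.2 q.1.2 q.2).
Variable L : (Omega -> R -> U) -> Omega -> R -> R.
Variable Pu : (Omega -> R -> U) -> {measure set Omega -> \bar R}.
Hypotheses (expL : forall u, control T G u ->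
 is_stochastic_exponential P T G r muZ nuZ u (L u))
 (PuE : forall u, control T G u -> forall A, measurable A ->
 Pu u A = (\int[P]_(w in A) (L u w T)%:E)%E).
Variable g : Omega -> 'rV[R]_d -> R.
Local Notation Gsigma := (stopped_sigma_algebra G (fun w => (sigma w)%:E)).
Hypothesis mg : mfun [set: g_sigma_algebraType Gsigma * 'rV[R]_d]
 (fun q => g q.1 q.2).
Let sigma_stop := min_time_stopping T_gt0 tau_gt0 fG tauG.
Let sigma_itv := min_time_itv T_gt0 tau_gt0.
Let dp u (cu : control T G u) := controlled_density cu (expL cu) (PuE cu).

Local Notation LT u w := (Num.max (L u w T) 0).
Let mLT u : control T G u -> mfun setT (fun w => LT u w).
by move=> cu;apply: measurable_maxr => //;exact: terminal_measurable (dp cu).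
Qed.
Let LT0 u w : 0 <= LT u w. Proof. by rewrite le_max lexx orbT. Qed.
Let PuE' u (cu : control T G u) A : measurable A ->
 Pu u A = (\int[P]_(w in A) (LT u w)%:E)%E.
move=> mA;rewrite PuE// integral_mkcond [RHS]integral_mkcond.
apply: ae_eq_nm;apply: filterS (dp_ge0 (dp cu)) => w L0.
by rewrite !patchE max_l.
Qed.

(** The running cost, read at the left limits and cut off at the horizon, which
makes it predictable. *)
Definition left_cost (u : Omega -> R -> U) w t : R :=
 if `[< 0 < t <= sigma w >] then l w t (left_lim (X w) t) (u w t) else 0.

Definition left_state w t := if 0 < t <= T then left_lim (X w) t else 0.

Lemma predictable_left_state : pprocess G left_state.
Proof. by apply: (predictable_left_const fG aX) => w t t0;exact: X_left. Qed.

Lemma predictable_left_cost u : control T G u -> pprocess G (left_cost u).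
move=> cu.
have mD : measurable ([set p | 0 < p.2 <= sigma p.1] : set (pspace G)).
have := measurableI _ _ (predictable_gt fG (lexx (0 : R))) (predictable_stopping_ge fG sigma_stop).
rewrite (_ : _ `&` _ = [set p | 0 < p.2 <= sigma p.1])//;apply/seteqP;split => p /=.
by move=> [-> [_]];rewrite lee_fin.
by move=> /andP[a b];rewrite lee_fin b a (ltW a).
have le0T (p : Omega * R) : 0 < p.2 <= sigma p.1 -> 0 <= p.2 <= T.
by move=> /andP[a b];rewrite (ltW a) (le_trans b)//;case/andP: (sigma_itv p.1).
pose f (p : pspace G) := ((p : pspace F, left_state p.1 p.2), u p.1 p.2).
have mf : mfun [set p : pspace G | 0 < p.2 <= sigma p.1] f.
apply: measurable_fun_pair_on.
apply: mfunTS;apply: measurable_fun_pair;last exact: predictable_left_state.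
exact: mpred_sub FG.
by apply: measurable_funS cu;[exact: predictable_le|move=> p /= /le0T;rewrite in_itv].
have h : mfun [set p : pspace G | 0 < p.2 <= sigma p.1]
(fun p => l p.1 p.2 (left_state p.1 p.2) (u p.1 p.2)).
by apply: (measurable_comp measurable_horizon_field _ ml mf) => _ [p /le0T pT <-].
have := measurable_fun_cond (0 : R) mD h;rewrite /pprocess => h'.
apply: eq_ind h' _ _;apply/funext => p;rewrite /left_cost /left_state /=.
by case: asboolP => // h0;have /andP[_ ->] := le0T p h0;have /andP[-> _] := h0.
Qed.
Let state0 (z : V) : (0 <= ((z.2 == 0)%R%:R : R)%:E)%E. Proof. by rewrite lee_fin. Qed.
Let early_field u b w t (z : V) : \bar R :=
 ((z.2 == 0)%R%:R%:E * (sign_part b (left_cost u w t))%:E)%E.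
Let early_field0 u b w t z : (0 <= early_field u b w t z)%E.
Proof. by apply: mule_ge0;[exact: state0|rewrite lee_fin sign_part_ge0]. Qed.
Let early_fieldP u b : control T G u -> pfield G (early_field u b).
move=> cu;have h : pprocess G (fun w t => (sign_part b (left_cost u w t))%:E).
by apply/mEFinP;apply: measurable_sign_part;exact: predictable_left_cost.
exact: (predictable_on_state (field_process (V := V) h)).
Qed.
Let early_part u b w t : \bar R :=
 (\int[nu w]_(q in `]0%R, t] `*` setT) early_field u b w q.1 q.2)%E.

(** The cost up to the horizon as a variable that is known at that time. *)
Definition early_cost u w : R := fine (early_part u false w (sigma w)) -
 fine (early_part u true w (sigma w)) + g w (left_state w (sigma w)).
Let stopped_process dE (E : mtype dE) (W : Omega -> R -> E) :
 pprocess G W ->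
 mfun [set: g_sigma_algebraType Gsigma]
 (fun w : g_sigma_algebraType Gsigma => W w (sigma w)).
move=> mW _ B mB;rewrite setTI (stopped_measurableE fG sigma_stop).
have mz C t : measurable C -> 0 <= t ->
G t ((fun=> 0 : R) @^-1` C `&` [set w | (sigma w)%:E <= t%:E]%E).
move=> mC t0;rewrite (_ : _ @^-1` C = if `[< C 0 >] then setT else set0).
case: ifP => _;rewrite ?setTI ?set0I;last exact: filtration0.
by case: sigma_stop => _;apply.
by apply/seteqP;split => w /=;case: asboolP.
have := stopped_value_measurable fG sigma_stop mz (W point 0)
(field_process (V := R) mW) mB.
by congr Gsigma;apply/seteqP;split => w /=;rewrite ltry.
Qed.

Lemma early_cost_stopped u : control T G u -> forall B, measurable B ->
 Gsigma (early_cost u @^-1` B).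
move=> cu B mB;rewrite -(stopped_measurableE fG sigma_stop) -[_ @^-1` _]setTI.
suff h : mfun [set: g_sigma_algebraType Gsigma]
(fun w : g_sigma_algebraType Gsigma => early_cost u w) by exact: h.
have part b : mfun [set: g_sigma_algebraType Gsigma]
(fun w : g_sigma_algebraType Gsigma => fine (early_part u b w (sigma w))).
apply: (@mcomp _ _ _ _ _ _ fine) => //;apply: stopped_process.
exact: cp_predictable cp _ (early_fieldP b cu) (early_field0 u b).
apply: measurable_funD;first exact: measurable_funB.
apply: (mcomp mg (_ : mfun setT
(fun w : g_sigma_algebraType Gsigma => (w, left_state w (sigma w))))).
by apply: measurable_fun_pair => //;apply: stopped_process;exact: predictable_left_state.
Qed.

Lemma measurable_early_cost u : control T G u -> mfun setT (early_cost u).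
move=> cu _ B mB;rewrite setTI;by case: (early_cost_stopped cu mB).
Qed.
Let left_cost_le w u t : (forall t x v, 0 <= t <= T -> 0 <= r w t x v <= M /\ `|l w t x v| <= Ml) ->
 `|left_cost u w t| <= Ml.
move=> b;rewrite /left_cost;case: asboolP => [/andP[a c]|_].
by case: (b t (left_lim (X w) t) (u w t)) => //;rewrite (ltW a) (le_trans c)//;case/andP: (sigma_itv w).
by rewrite normr0;apply: le_trans (proj2 (b 0 0 (u w 0) _));rewrite ?normr_ge0// lexx ltW.
Qed.
Let CF_fin w : (stieltjes (CF w) `]0%R, T] < +oo)%E.
Proof. by rewrite stieltjes_itv ?ltry// ltW. Qed.
Let left_cost_integrable w u : control T G u ->
 (forall t x v, 0 <= t <= T -> 0 <= r w t x v <= M /\ `|l w t x v| <= Ml) ->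
 (stieltjes (CF w)).-integrable `]0, T] (EFin \o left_cost u w).
move=> cu b;apply: (@bounded_integrable_on _ _ _ _ _ _ Ml (CF_fin w)).
- exact: measurable_itv.
- by apply: mfunTS;exact: process_path (predictable_left_cost cu).
- by move=> t _;exact: left_cost_le.
Qed.

Lemma early_costE u : control T G u -> {ae P, forall w,
 early_cost u w = \int[stieltjes (CF w)]_(t in `]0, T]) left_cost u w t + g w (X w (sigma w)) /\
 early_cost u w = \int[stieltjes (CF w)]_(t in `]0, T])
 (l w t (X w t) (u w t) * \1_(`[0, sigma w]) t) + g w (X w (sigma w))}.
move=> cu;apply: filterS2 (filterI bounds clock) (filterI X_clock X_sigma) => w [b ck] [Xc Xs].
have lci := left_cost_integrable cu b.
have mlc := process_path w (predictable_left_cost cu).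
have spi c : (stieltjes (CF w)).-integrable `]0, T] (fun t => (sign_part c (left_cost u w t))%:E).
by apply: integrable_sign_part;first [exact: mlc|exact: lci|exact: measurable_itv].
have partE c : early_part u c w (sigma w) =
(\int[stieltjes (CF w)]_(t in `]0, T]) sign_part c (left_cost u w t))%:E.
rewrite -(@EFin_Rintegral _ _ R (stieltjes (CF w)) `]0, T]
(fun t => sign_part c (left_cost u w t)) (measurable_itv _) (spi c)) -ck;last 2 first.
- by apply/mEFinP;exact: measurable_sign_part.
- by move=> t;rewrite lee_fin sign_part_ge0.
rewrite /early_part integral_mkcond;apply: eq_integral => q _;rewrite patchE.
case: ifPn => //;rewrite notin_setE /early_field => nq.
rewrite (_ : left_cost u w q.1 = 0).
by rewrite /sign_part mulr0 max_l// mule0.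
rewrite /left_cost;case: asboolP => // h;by exfalso;apply: nq;split.
have E1 : early_cost u w = \int[stieltjes (CF w)]_(t in `]0, T]) left_cost u w t +
g w (X w (sigma w)).
rewrite /early_cost !partE /=;congr (_ + g w _);last first.
by rewrite /left_state sigma_itv Xs.
rewrite -RintegralB;[|exact: measurable_itv|exact: (spi false)|exact: (spi true)].
by apply: eq_Rintegral => t _;rewrite sign_partE.
split=> //;rewrite E1;congr (_ + _);apply: ae_eq_Rnm.
apply: ae_imp Xc => t Xt;rewrite /= in_itv/= => tT;rewrite Xt// indicE mem_setE in_itv/= /left_cost.
case/andP: (tT) => t0 _;rewrite t0 (ltW t0)/=.
by case: (leP t (sigma w)) => ts;case: asboolP => //=;rewrite ?mulr1 ?mulr0//.
Qed.

Lemma cost_early u : control T G u ->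
 cost T tau X l CF g (Pu u) u = (\int[Pu u]_w (early_cost u w)%:E)%E /\
 cost T tau X l CF g (Pu u) u = (\int[P]_w (LT u w * early_cost u w)%:E)%E.
move=> cu.
have E1 : cost T tau X l CF g (Pu u) u = (\int[Pu u]_w (early_cost u w)%:E)%E.
apply: ae_eq_nm;apply: (density_ae (mLT cu) (PuE' cu)).
by apply: filterS (early_costE cu) => w [_ ->].
split=> //;rewrite E1;exact: (integral_density (mLT cu) (LT0 u) (PuE' cu) (measurable_early_cost cu)).
Qed.

(** Stopping a control does not change its density before `sigma`, and the
early cost is known at that time. *)
Lemma cost_stopped u : control T G u -> control T G (stop_control T tau u0 u) ->
 cost T tau X l CF g (Pu (stop_control T tau u0 u)) (stop_control T tau u0 u) =
 cost T tau X l CF g (Pu u) u.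
move=> cu cv;rewrite (cost_early cu).1 (cost_early cv).1.
have stopE w t : 0 < t <= sigma w -> stop_control T tau u0 u w t = u w t.
by move=> /andP[a b];rewrite /stop_control (ltW a) b.
have lcE : left_cost (stop_control T tau u0 u) = left_cost u.
apply/funext => w;apply/funext => t;rewrite /left_cost;case: asboolP => // h.
by rewrite stopE.
have -> : early_cost (stop_control T tau u0 u) = early_cost u.
by apply/funext => w;rewrite /early_cost /early_part /early_field lcE.
apply: equal_image_integral;first exact: measurable_early_cost.
move=> B mB;have GB := early_cost_stopped cu mB.
rewrite !PuE//;try by case: GB.
apply: (densities_equal_before (dp cv) (dp cu) sigma_stop sigma_itv _ GB).
move=> w t z tS;rewrite /pair_factor /factor;case: ifP => // _;case: asboolP => // _.
by rewrite stopE.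
Qed.

Section optimality.
Variables (Theta : Omega -> R -> V -> R) (y0 : R) (uT : Omega -> R -> U).
Hypotheses (mTh : pfield G Theta)
 (Theta2 : (\int[P]_w \int[nu w]_q (Theta w q.1 q.2 ^+ 2)%:E < +oo)%E)
 (bsde : {ae P, forall w,
 y0 + (\int[mu w]_q Theta w q.1 q.2 - \int[nu w]_q Theta w q.1 q.2) =
 g w (X w (sigma w)) + \int[stieltjes (CF w)]_(t in `]0, T])
 generator T tau phiF r l w t (X w t) (Theta w t)})
 (cT : control T G uT)
 (attained : {ae P, forall w, {ae stieltjes (CF w), forall t, 0 < t <= T ->
 generator T tau phiF r l w t (left_lim (X w) t) (Theta w t) =
 hamiltonian T tau phiF r l w t (left_lim (X w) t) (Theta w t) (uT w t)}}).
Let drift u w t : R := \int[phiF (w, t)]_x (Theta w t (x, 0) * (factor u w t x - 1)).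
Let ham u w t := left_cost u w t + drift u w t.
Let hamE u w t : 0 < t <= T ->
 hamiltonian T tau phiF r l w t (left_lim (X w) t) (Theta w t) (u w t) = ham u w t.
move=> tT;rewrite /hamiltonian /ham /drift /factor asboolT// /left_cost indicE mem_setE in_itv/=.
case/andP: (tT) => t0 _;rewrite (ltW t0)/=;congr (_ + _).
by case: asboolP => [/andP[_ ->]|];rewrite ?mulr1// t0/=;case: (t <= _) => //;rewrite mulr0.
Qed.
Let excess u w := \int[stieltjes (CF w)]_(t in `]0, T]) ham u w t -
 \int[stieltjes (CF w)]_(t in `]0, T]) ham uT w t.
Let ham_path u w : control T G u ->
 (forall t x v, 0 <= t <= T -> 0 <= r w t x v <= M /\ `|l w t x v| <= Ml) ->
 (forall f : R * 'rV[R]_d -> \bar R, mfun setT f -> (forall q, 0 <= f q)%E ->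
 (\int[nuX w]_(q in `]0%R, T] `*` setT) f q =
 \int[stieltjes (CF w)]_(t in `]0%R, T]) \int[phiF (w, t)]_x f (t, x))%E) ->
 (nuX w).-integrable (`]0, T] `*` setT) (fun q => (Theta w q.1 (q.2, 0))%:E) ->
 [/\ (stieltjes (CF w)).-integrable `]0, T] (EFin \o ham u w),
 \int[stieltjes (CF w)]_(t in `]0, T]) ham u w t =
 \int[stieltjes (CF w)]_(t in `]0, T]) left_cost u w t +
 \int[nuX w]_(q in `]0, T] `*` setT)
 (Theta w q.1 (q.2, 0) * (factor u w q.1 q.2 - 1)) &
 {ae stieltjes (CF w), forall t, 0 < t <= T ->
 (phiF (w, t)).-integrable setT (fun x => (Theta w t (x, 0))%:E)}].
move=> cu b dis xTh.
have mth : mfun setT (fun q : R * 'rV[R]_d => Theta w q.1 (q.2, 0)).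
have h : mfun setT (fun q : R * 'rV[R]_d => (q.1, (q.2, 0 : R))).
by apply: measurable_fun_pair => //;apply: measurable_fun_pair.
exact: mcomp (field_path w mTh) h.
have mfac := field_path w (predictable_factor cu).
have k1 t : phiF (w, t) setT = 1%E by exact: prob_kernel.
have mk B : measurable B -> mfun setT (fun t => phiF (w, t) B).
move=> mB;apply: (@mcomp _ _ _ _ _ _ (fun p : pspace F => phiF p B)).
exact: measurable_kernel.
exact: measurable_predictable_slice.
have mDX : measurable (`]0, T] `*` setT : set (R * 'rV[R]_d)) by exact: measurableX.
have rX : forall q : R * 'rV[R]_d, (`]0, T] `*` setT) q -> 0 <= factor u w q.1 q.2 <= M.
move=> q [/= + _];rewrite in_itv/= => qT;rewrite /factor asboolT//.
by case: (b q.1 q.2 (u w q.1)) => //;case/andP: qT => /ltW -> ->.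
have fi := signed_drift_integrable mDX mth mfac rX xTh.
have mf : mfun setT (fun q : R * 'rV[R]_d =>
Theta w q.1 (q.2, 0) * (factor u w q.1 q.2 - 1)).
by apply: measurable_funM => //;exact: measurable_funB.
have [di dE] := clock_Rintegral dis k1 mk mf fi.
have li := left_cost_integrable cu b.
split.
- have h : (stieltjes (CF w)).-integrable `]0, T]
((EFin \o left_cost u w) \+ (EFin \o drift u w))%E by apply: integrableD.
exact: h.
- by rewrite dE RintegralD.
- exact: (clock_slice_ae dis k1 mk mth xTh).
Qed.
Let slice_measurable w t v : 0 <= t <= T -> mfun setT (fun x => r w t x v).
move=> tT.
pose f (x : 'rV[R]_d) := (((w, t) : pspace F, x), v).
have mf : mfun setT f by do 2 apply: measurable_fun_pair => //.
by apply: (measurable_comp measurable_horizon_field _ mr mf) => _ [x _ <-].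
Qed.

(** The backward equation turns the cost of a control into the initial value,
a centred variable, and the excess of its Hamiltonian over the minimal one. *)
Lemma verification_identity u : control T G u -> exists S : Omega -> \bar R,
 [/\ P.-integrable setT S, (\int[P]_w S w = 0)%E &
 {ae P, forall w, ((LT u w * early_cost u w)%:E =
 (LT u w * y0)%:E + S w + (LT u w * excess u w)%:E)%E /\ 0 <= excess u w}].
move=> cu.
have [S [iS ES SP]] := drift_centred (dp cu) FG mean clock (predictable_factor cu)
(fun w t z => erefl) disX mTh Theta2 (mean_density_square_mass (dp cu))
(mean_total_mass (dp cu)).
exists S;split => //.
apply: filterS2 (filterI (filterI bounds disX) (filterI SP bsde))
(filterI (filterI X_clock attained) (early_costE cu)).
move=> w [[b dis] [[SE xTh] bw]] [[Xc att] [ecE _]].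
have [hi hE slices] := ham_path cu b dis xTh;have [hiT _ _] := ham_path cT b dis xTh.
have genE : {ae stieltjes (CF w), forall t, 0 < t <= T ->
generator T tau phiF r l w t (left_lim (X w) t) (Theta w t) = ham uT w t}.
by apply: ae_imp att => t h tT;rewrite h// hamE.
have genI : \int[stieltjes (CF w)]_(t in `]0, T])
generator T tau phiF r l w t (X w t) (Theta w t) =
\int[stieltjes (CF w)]_(t in `]0, T]) ham uT w t.
apply: ae_eq_Rnm;apply: ae_imp (ae_conj Xc genE) => t [Xt gt].
by rewrite /= in_itv/= => tT;rewrite Xt// gt.
have le : \int[stieltjes (CF w)]_(t in `]0, T]) ham uT w t <=
\int[stieltjes (CF w)]_(t in `]0, T]) ham u w t.
apply: le_Rintegral_ae => //;apply: ae_imp (ae_conj slices genE) => t [sl gt].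
rewrite /= in_itv/= => tT;rewrite -gt// -hamE//.
have tT' : 0 <= t <= T by case/andP: tT => /ltW -> ->.
apply: (@generator_le _ _ _ _ (phiF (w, t)) (fun x => Theta w t (x, 0)) (r w t)
(fun v => l w t (left_lim (X w) t) v * \1_(`[0, sigma w]) t) M Ml) => //.
- exact: sl.
- by move=> v;exact: slice_measurable.
- by move=> x v;case: (b t x v tT').
- move=> v;rewrite normrM;case: (b t (left_lim (X w) t) v tT') => _ lb.
by rewrite indicE;case: (_ \in _);rewrite ?normr1 ?normr0 ?mulr1 ?mulr0// (le_trans _ lb).
split;last by rewrite /excess subr_ge0.
have yE : g w (X w (sigma w)) = y0 + (\int[mu w]_q Theta w q.1 q.2 -
\int[nu w]_q Theta w q.1 q.2) - \int[stieltjes (CF w)]_(t in `]0, T]) ham uT w t.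
by rewrite bw genI addrK.
by rewrite SE -!EFinD ecE yE /excess hE;congr EFin;ring.
Qed.
Let LTi u : control T G u -> P.-integrable setT (fun w => (LT u w * y0)%:E) /\
 (\int[P]_w (LT u w * y0)%:E = y0%:E)%E.
move=> cu;have i : P.-integrable setT (fun w => (LT u w)%:E).
apply: ge0_integrable;first by apply/mEFinP;exact: mLT.
by move=> w;rewrite lee_fin.
by rewrite (mean_density (dp cu)) ltry.
split;first by have := integrableZr measurableT y0 i;apply: eq_integrable.
under eq_integral do rewrite EFinM.
by rewrite integralZr// (mean_density (dp cu)) mul1e.
Qed.

Lemma cost_ge u : control T G u -> (y0%:E <= cost T tau X l CF g (Pu u) u)%E.
move=> cu;rewrite (cost_early cu).2;have [S [iS ES SP]] := verification_identity cu.
have [i E] := LTi cu.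
rewrite (_ : y0%:E = \int[P]_w ((LT u w * y0)%:E + S w))%E;last first.
by rewrite integralD// E ES adde0.
apply: integral_minorant;first exact: integrableD.
apply: filterS SP => w [-> ex];rewrite leeDl// lee_fin mulr_ge0//.
Qed.

Lemma cost_attained : (cost T tau X l CF g (Pu uT) uT = y0%:E)%E.
rewrite (cost_early cT).2;have [S [iS ES SP]] := verification_identity cT.
have [i E] := LTi cT.
transitivity (\int[P]_w ((LT uT w * y0)%:E + S w))%E;last by rewrite integralD// E ES adde0.
apply: ae_eq_nm;apply: filterS SP => w [-> _].
by rewrite /excess subrr mulr0 adde0.
Qed.

End optimality.

End controlled_density.

Lemma Rintegral_full {R : realType} d (X : mtype d) (m : {measure set X -> \bar R})
 (D : set X) (f f' : X -> R) : measurable D -> m (~` D) = 0%E ->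
 (forall x, D x -> f x = f' x) -> \int[m]_(x in D) f x = \int[m]_x f' x.
move=> mD m0 ff';congr fine;rewrite integral_mkcond.
apply: (eq_negligible (measurableC mD) m0) => x _ /contrapT Dx.
by rewrite patchE mem_set//= ff'.
Qed.

(** The data are cut at [T] and read on the marks of the pair, so that the
verification applies to them; `Theta` is weighted by the exponential of the
clock, which is at least 1 because [beta] is nonnegative. *)
Theorem theorem5p26 :
  forall (R : realType) (dO : measure_display) (Omega : measurableType dO)
    (P : probability Omega R) (T : R) (d : nat)
    (X : Omega -> R -> 'rV[R]_d) (tau : Omega -> \bar R),
  0 < T -> (0 < d)%N ->
  (forall t, 0 <= t -> measurable_fun setT (X ^~ t)) ->
  measurable_fun setT tau -> (forall w, 0 < tau w)%E ->
  let F := natural_filtration X in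
  let G := progressive_enlargement F tau in
  let H : Omega -> cumulative R R := fun w => indic_after (tau w) in
  let Z : Omega -> R -> 'rV[R]_d * R := fun w t => (X w t, H w t) in
  let muX : Omega -> jump_measure R 'rV[R]_d :=
    fun w => point_measure (jump_times (X w)) (jump (X w)) in
  let muZ : Omega -> jump_measure R ('rV[R]_d * R) :=
    fun w => point_measure (jump_times (Z w)) (jump (Z w)) in
  step_process F X ->
  quasi_left_continuous P F X ->
  avoids_stopping_times P F tau ->
  immersed P F G ->
  forall (nuX : Omega -> jump_measure R 'rV[R]_d)
    (phiF : R.-pker (predictable_space F) ~> 'rV[R]_d)
    (CF : Omega -> cumulative R R)
    (Lambda : Omega -> cumulative R R)
    (nuZ : Omega -> jump_measure R ('rV[R]_d * R))
    (phi : R.-pker (predictable_space G) ~> ('rV[R]_d * R)%type),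
  is_compensator P F muX nuX ->
  increasing_process F CF ->
  disintegrates P T nuX phiF CF ->
  is_dual_predictable_projection P T G H Lambda ->
  let C : Omega -> cumulative R R := fun w => cumulativeD (CF w) (Lambda w) in
  is_compensator P G muZ nuZ ->
  disintegrates P T nuZ phi C ->
  forall (dU : measure_display) (U : measurableType dU) (u0 : U)
    (r l : Omega -> R -> 'rV[R]_d -> U -> R) (Mr Ml : R),
  measurable_fun
    [set q : predictable_space F * 'rV[R]_d * U | 0 <= q.1.1.2 <= T]
    (fun q => r q.1.1.1 q.1.1.2 q.1.2 q.2) ->
  measurable_fun
    [set q : predictable_space F * 'rV[R]_d * U | 0 <= q.1.1.2 <= T]
    (fun q => l q.1.1.1 q.1.1.2 q.1.2 q.2) ->
  1 < Mr -> 0 < Ml ->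
  {ae P, forall w, forall t x v, 0 <= t <= T ->
    0 <= r w t x v <= Mr /\ `|l w t x v| <= Ml} ->
  (\int[P]_w (expR ((3 + Mr ^+ 4) * C w T))%:E < +oo)%E ->
  forall (L : (Omega -> R -> U) -> Omega -> R -> R)
    (Pu : (Omega -> R -> U) -> {measure set Omega -> \bar R}),
  (forall u, control T G u ->
     is_stochastic_exponential P T G r muZ nuZ u (L u)) ->
  (forall u, control T G u -> forall A, measurable A ->
     Pu u A = (\int[P]_(w in A) (L u w T)%:E)%E) ->
  let Lbar : \bar R := ess_sup P (fun w => ereal_sup
    [set y | exists t x v, 0 <= t <= T /\ y = (`|r w t x v - 1|)%:E]) in
  forall (g : Omega -> 'rV[R]_d -> R) (beta : R),
  measurable_fun
    [set: g_sigma_algebraType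
            (stopped_sigma_algebra G (fun w => (min_time T tau w)%:E)) *
          'rV[R]_d]
    (fun q => g q.1 q.2) ->
  (Lbar ^+ 2 < beta%:E)%E ->
  (\int[P]_w (expR (beta * C w T))%:E < +oo)%E ->
  (\int[P]_w (`|g w (X w (min_time T tau w))| ^+ 2 *
              expR (beta * C w T))%:E < +oo)%E ->
  (forall Theta : Omega -> R -> 'rV[R]_d * R -> R,
     L1mu P T C phi Theta ->
     exists2 u : Omega -> R -> U, control T G u &
       attains_generator P T tau X phiF r l C phi Theta u) ->
  forall (Y : Omega -> R -> R) (Theta : Omega -> R -> 'rV[R]_d * R -> R)
    (uTheta : Omega -> R -> U),
  L2Prog P T G C beta Y ->
  L2mu P T C phi beta Theta ->
  solves_bsde P T tau X phiF r l muZ nuZ CF g Y Theta ->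
  control T G uTheta ->
  attains_generator P T tau X phiF r l C phi Theta uTheta ->
  let uhat := stop_control T tau u0 uTheta in
  let J u := cost T tau X l CF g (Pu u) u in
  let Jhat u := stopped_cost T tau X l CF g (Pu u) u in
  [/\ stopped_control T G tau u0 uhat,
      forall v, stopped_control T G tau u0 v -> (Jhat uhat <= Jhat v)%E,
      {ae P, forall w, (Y w 0)%:E = Jhat uhat},
      Jhat uhat = ereal_inf [set Jhat v | v in stopped_control T G tau u0] &
      Jhat uhat = ereal_inf [set J u | u in control T G]].
Proof.
move=> R dO Omega P T d X tau T0 d0 mX mtau tau0 F G H Z muX muZ stepX qlc avoid im.
move=> nuX phiF CF Lambda nuZ phi compX [aCF CF0] disX [pL Lam0 dualL] C compZ disZ.
move=> dU U u0 r l Mr Ml mr ml Mr1 Ml0 bounds moment L Pu expL PuE Lbar g beta mg betaL.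
move=> ebeta gb attain Y Theta uTheta [pY Y2] [pTh Th2] bsde cT att uhat J Jhat.
case: stepX => s [xi [s_stop [s_step [s_cvg [mxi [xi0 XE]]]]]].
have fF : is_filtration F := natural_filtrationP mX.
have [fG FG tauG] := progressive_enlargementP fF mtau (fun w => ltW (tau0 w)).
have T_ge0 := ltW T0.
have s_gt0 n w : (0 < s n w)%E := (s_stop n).2 w.
have cp := pair_compensated_points T0 mtau tau0 fF fG FG tauG s_stop s_step s_cvg mxi xi0 XE
qlc avoid im compX CF0 disX Lam0 compZ disZ Mr1 moment.
have mp := pair_points tau0 fF fG FG tauG s_stop s_step s_cvg mxi.
pose nu := upto_horizon nuZ T.
pose sg := fun n => cut_time T ((fun n w => pair_time (s^~ w) (tau w) n) n).
pose ze := fun n w => pair_mark (xi^~ w) n.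
have mDZ : measurable (`]0, T] `*` setT : set (R * ('rV[R]_d * R))) by exact: measurableX.
have aX : adapted_on `[0, T] G X.
move=> t;rewrite /= in_itv/= => /andP[t0 _].
have /adapted_onP h : adapted_on `[0, +oo[ F X.
apply/(adapted_onP fF) => [u|u B uI mB];first by rewrite /= in_itv/= andbT.
move=> Fl fFl _ aFl;have /(adapted_onP fFl) : adapted_on `[0, +oo[ Fl X by [].
by apply => // v;rewrite /= in_itv/= andbT.
have : adapted_on [set t] G X;last by apply.
apply/(adapted_onP fG) => [u -> //|u B -> mB];apply: FG => //.
by apply: (h fF _ t) => [v|//|//];rewrite /= in_itv/= ?andbT.
have X_left w t : 0 < t -> \forall a \near t^'-, X w a = left_lim (X w) t.
exact: (step_path_left_lim (xi := xi^~ w) (s_gt0^~ w) (s_step^~ w) (s_cvg w) (@XE w)).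
have no_jump w t : 0 < t -> (forall n, s n w <> t%:E) -> X w t = left_lim (X w) t.
move=> t0 st;have := step_path_no_jump (xi := xi^~ w) (s_gt0^~ w) (s_step^~ w) (s_cvg w) (@XE w) t0 st.
by rewrite /jump t0 => /eqP;rewrite subr_eq0 => /eqP.
have X_sigma : {ae P, forall w, X w (min_time T tau w) = left_lim (X w) (min_time T tau w)}.
have pT : predictable_time F (fun=> T%:E).
split;first exact: stopping_time_cst.
have := measurable_predictable_time fF (predictable_ge0 fF) (measurable_itv `[T, +oo[).
congr measurable;apply/seteqP;split => p /=;rewrite in_itv/= andbT lee_fin//.
apply: filterS2 (no_common_jump mtau fF s_stop avoid) (qlc _ pT (fun=> ltry _)) => w nj.
rewrite /jump /= T0 => /eqP;rewrite subr_eq0 => /eqP jT.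
have := min_timeE T tau0 w;have [tT|Tt] := leP (tau w) T%:E;last first.
by move=> [->].
move=> sE;apply: no_jump;first by have /andP[] := min_time_itv T0 tau0 w.
by move=> n sn;apply: (nj n);rewrite sn ?ltry.
have nu_full w (f : R * ('rV[R]_d * R) -> \bar R) : mfun setT f ->
(forall q, 0 <= f q)%E -> (\int[nu w]_q f q =
\int[nuZ w]_(q in `]0%R, T] `*` setT) f q)%E.
by move=> mf f0;rewrite /nu /upto_horizon ge0_integral_mrestr ?setTI.
have disXf : {ae P, forall w, forall f : R * 'rV[R]_d -> \bar R,
mfun setT f -> (forall q, 0 <= f q)%E ->
(\int[nuX w]_(q in `]0%R, T] `*` setT) f q =
\int[stieltjes (CF w)]_(t in `]0%R, T]) \int[phiF (w, t)]_x f (t, x))%E}.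
by apply: filterS disX => w h f mf f0;exact: ge0_integral_disintegrated.
have disZf : {ae P, forall w, forall f : R * ('rV[R]_d * R) -> \bar R,
mfun setT f -> (forall q, 0 <= f q)%E ->
(\int[nuZ w]_(q in `]0%R, T] `*` setT) f q =
\int[stieltjes (C w)]_(t in `]0%R, T]) \int[phi (w, t)]_x f (t, x))%E}.
by apply: filterS disZ => w h f mf f0;exact: ge0_integral_disintegrated.
have mstate (W : R * 'rV[R]_d -> \bar R) : mfun setT W ->
mfun setT (fun q : R * ('rV[R]_d * R) => (q.2.2 == 0)%R%:R%:E * W (q.1, q.2.1))%E.
move=> mW;apply: emeasurable_funM;last exact: measurable_state_field mW.
by apply/mEFinP;exact: (mcomp measurable_state_weight).
have mean (W : Omega -> R -> 'rV[R]_d -> \bar R) :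
pfield G W -> (forall w t x, 0 <= W w t x)%E ->
(\int[P]_w \int[nu w]_q ((q.2.2 == 0)%R%:R%:E * W w q.1 q.2.1) =
\int[P]_w \int[stieltjes (CF w)]_(t in `]0%R, T]) \int[phiF (w, t)]_x W w t x)%E.
move=> mW W0;transitivity (\int[P]_w \int[nuX w]_(q in `]0%R, T] `*` setT) W w q.1 q.2)%E.
rewrite -(pair_state_mean T0 mtau tau0 fF fG FG tauG s_stop s_step s_cvg mxi xi0 XE
avoid im compX CF0 disX Lam0 compZ Mr1 moment mW W0).
apply: eq_integral => w _;rewrite nu_full// => [|q];last by rewrite mule_ge0// lee_fin.
exact: (mstate (fun q => W w q.1 q.2) (field_path w mW)).
apply: ae_eq_nm;apply: filterS disXf => w h.
by rewrite (h (fun q => W w q.1 q.2))//;exact: field_path mW.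
have clockZ := pair_clock T0 mtau tau0 fF fG FG tauG s_stop s_step s_cvg mxi xi0 XE
qlc avoid im compX CF0 disX Lam0 compZ disZ Mr1 moment.
have clock : {ae P, forall w, forall h : R -> \bar R, mfun setT h ->
(forall t, 0 <= h t)%E -> (\int[nu w]_q ((q.2.2 == 0)%R%:R%:E * h q.1) =
\int[stieltjes (CF w)]_(t in `]0%R, T]) h t)%E}.
apply: filterS clockZ => w ck h mh h0;rewrite nu_full ?ck// => [|q].
by apply: (mstate (fun q => h q.1));exact: mcomp.
by rewrite mule_ge0// lee_fin.
have muE : {ae P, forall w, forall A, measurable A -> A `<=` `]0, T] `*` setT ->
muZ w A = points (sg^~ w) (ze^~ w) A}.
apply: filterS (pair_measure_points mtau tau0 fF s_stop s_step s_cvg xi0 XE avoid) => w h A mA AD.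
have := integral_cut_points T mp w (f := fun q => (\1_A q)%:E).
move=> /(_ _ (fun q => _)) h1;rewrite h// -[A in LHS](setIidl AD) -(integral_indic _ mDZ)//.
rewrite -h1//;first by rewrite integral_indic// setIT.
by apply/mEFinP;exact: measurable_indic.
have nuE : {ae P, forall w, forall A, measurable A -> A `<=` `]0, T] `*` setT ->
nuZ w A = nu w A}.
by apply: aeW => w A mA AD;rewrite /nu /upto_horizon /= /mrestr setIidl.
have k1 w t : phiF (w, t) setT = 1%E by exact: prob_kernel.
have X_clock : {ae P, forall w, {ae stieltjes (CF w), forall t, 0 < t <= T ->
X w t = left_lim (X w) t}}.
apply: filterS2 disXf (state_atomless T0 fF s_stop s_step s_cvg mxi xi0 XE qlc compX CF0 disX).
move=> w dis at0.
have : {ae stieltjes (CF w), forall t, forall n, 0 < t <= T -> s n w <> t%:E}.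
apply: ae_all => n;exact: (clock_atom_null dis (k1 w) _ at0).
by apply: ae_imp => t h tT;apply: no_jump => [|n];[case/andP: tT|exact: h].
have moment' : (\int[P]_w (expR ((3 + Mr ^+ 4) * fine (nu w setT)))%:E < +oo)%E.
apply: le_lt_trans moment;apply: ge0_ae_le_nm => [w|w|];rewrite ?lee_fin ?expR_ge0//.
apply: filterS (pair_mass T0 CF0 Lam0 disZ) => w h.
by rewrite /nu /upto_horizon /= /mrestr setTI h.
pose Th w t z := if `[< `[0, T]%classic t >] then Theta w t z else 0.
have mTh : pfield G Th.
by apply: (field_cut (0 : R) _ pTh);exact: predictable_le.
have ThE w t : 0 < t <= T -> Th w t = Theta w t.
move=> /andP[a b];apply/funext => z;rewrite /Th asboolT//= in_itv/= b (ltW a)//.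
have C0 w t : 0 <= t -> 0 <= C w t.
move=> t0;rewrite /C /= /cumulativeD /= addr_ge0//.
by rewrite -(CF0 w 0)// cumulative_is_nondecreasing.
by rewrite -(Lam0 w 0)// cumulative_is_nondecreasing.
have beta0 : 0 <= beta by rewrite -lee_fin (le_trans _ (ltW betaL))// sqre_ge0.
have Th22 : (\int[P]_w \int[nu w]_q (Th w q.1 q.2 ^+ 2)%:E < +oo)%E.
apply: le_lt_trans Th2;apply: ge0_ae_le_nm.
- by move=> w;apply: integral_ge0 => q _;rewrite lee_fin sqr_ge0.
- move=> w;apply: integral_ge0 => t _;apply: integral_ge0 => z _.
by rewrite lee_fin mulr_ge0 ?expR_ge0 ?sqr_ge0.
have sq0 w (q : R * ('rV[R]_d * R)) : (0 <= (Th w q.1 q.2 ^+ 2)%:E)%E by rewrite lee_fin sqr_ge0.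
have msq w : mfun setT (fun q => (Th w q.1 q.2 ^+ 2)%:E).
by apply/mEFinP;apply: measurable_funX;exact: field_path mTh.
apply: filterS disZf => w h;rewrite nu_full// h//.
apply: (@ge0_le_negligible _ _ _ _ _ set0) => //.
- by move=> t _;apply: integral_ge0 => z _;exact: (sq0 w (t, z)).
- by move=> t _;apply: integral_ge0 => z _;rewrite lee_fin mulr_ge0 ?expR_ge0 ?sqr_ge0.
move=> t /=;rewrite in_itv/= => tT _;apply: (@ge0_le_negligible _ _ _ _ _ set0) => //.
by move=> z _;exact: (sq0 w (t, z)).
move=> z _ _;rewrite ThE// lee_fin real_normK ?num_real// ler_peMl ?sqr_ge0//.
by rewrite -expR0 ler_expR mulr_ge0 ?C0//;case/andP: tT => /ltW.
have [y0 Y0] : exists y, forall w, Y w 0 = y.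
apply: (@initial_value_constant _ _ _ _ X tau (fun w => Order.min (s 0%N w) (tau w)) mX mtau
(fun w => ltW (tau0 w)) _ _ _ Y T T_ge0 fG pY).
- by move=> w;rewrite lt_min s_gt0 tau0.
- by move=> w;rewrite ge_min lexx orbT.
- move=> w t t0;rewrite lt_min => /andP[ts _].
by rewrite (step_pathE (xi := xi^~ w) (s_step^~ w) (@XE w) (k := 0))// big_ord0.
have bsde' : {ae P, forall w,
y0 + (\int[points (sg^~ w) (ze^~ w)]_q Th w q.1 q.2 - \int[nu w]_q Th w q.1 q.2) =
g w (X w (min_time T tau w)) + \int[stieltjes (CF w)]_(t in `]0, T])
generator T tau phiF r l w t (X w t) (Th w t)}.
apply: filterS2 bsde (compensated_integral_pair muE nuE) => w h /(_ T (Theta w) (lexx T)) cE.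
have := h 0;rewrite lexx T_ge0 => /(_ erefl);rewrite Y0 cE /compensated_integral.
have DE (q : R * ('rV[R]_d * R)) : (`]0, T] `*` setT) q -> Theta w q.1 q.2 = Th w q.1 q.2.
by move=> [/= + _];rewrite in_itv/= => /ThE ->.
have e1 : \int[points (sg^~ w) (ze^~ w)]_(q in `]0, T] `*` setT) Theta w q.1 q.2 =
\int[points (sg^~ w) (ze^~ w)]_q Th w q.1 q.2.
exact: Rintegral_full mDZ (tk_off (cut_points_kernel mp T_ge0) w) DE.
have e2 : \int[nu w]_(q in `]0, T] `*` setT) Theta w q.1 q.2 = \int[nu w]_q Th w q.1 q.2.
exact: Rintegral_full mDZ (cp_off cp w) DE.
rewrite e1 e2 => h0;apply: etrans h0 _.
apply: (congr1 (fun a => g w (X w (min_time T tau w)) + a)).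
by apply: eq_Rintegral => t /set_mem;rewrite /= in_itv/= => /ThE ->.
have att' : {ae P, forall w, {ae stieltjes (CF w), forall t, 0 < t <= T ->
generator T tau phiF r l w t (left_lim (X w) t) (Th w t) =
hamiltonian T tau phiF r l w t (left_lim (X w) t) (Th w t) (uTheta w t)}}.
case: att => N [mN N0 NE].
pose f (p : Omega * (R * ('rV[R]_d * R))) : \bar R :=
((p.2.2.2 == 0)%R%:R * \1_N (p.1, p.2.1) : R)%:E.
have f0 p : (0 <= f p)%E by rewrite lee_fin mulr_ge0.
have mf : mfun setT f.
apply/mEFinP;apply: measurable_funM.
exact: (mcomp measurable_state_weight (mcomp measurable_snd measurable_snd)).
apply: (mcomp (measurable_indic mN));apply: measurable_fun_pair => //.
exact: (mcomp measurable_fst measurable_snd).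
have mfw w : mfun setT (fun q => f (w, q)) by exact: mcomp mf (measurable_pair1 w).
have kZ := cut_compensator_kernel fG T_ge0 compZ.1.
have mh := measurable_kernel_integral (tk_measurable kZ) (tk_finite kZ) f0 mf.
have hE : {ae P, forall w, (\int[cut_kernel T nuZ w]_q f (w, q) =
\int[nuZ w]_(q in `]0%R, T] `*` setT) f (w, q))%E}.
apply: filterS (pair_mass T0 CF0 Lam0 disZ) => w Cw.
by rewrite integral_cut_compensator// Cw ltry.
have : (\int[P]_w `|\int[cut_kernel T nuZ w]_q f (w, q)| = 0)%E.
rewrite -N0;apply: ae_eq_nm;apply: filterS2 hE disZf => w hw dis.
rewrite gee0_abs ?integral_ge0// hw (dis (fun q => f (w, q)))//.
apply: eq_integral => t _;rewrite -ge0_integralZr//.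
+ by apply: eq_integral => z _;rewrite /f EFinM -state_marks_indic.
+ by apply/mEFinP;exact: measurable_indic mstate_marks.
move=> /(ae_eq_integral_abs P measurableT mh) h0.
apply: filterS2 (filterI h0 hE) (filterI clockZ disXf) => w [/(_ Logic.I) hw0 hw] [ck dis].
have mNw : measurable [set t | N (w, t)].
by have := measurable_xsection w mN;congr measurable;apply/seteqP;split => t;rewrite /xsection/= inE.
have nN : {ae stieltjes (CF w), forall t, 0 < t <= T -> ~ N (w, t)}.
apply: (clock_null mNw);rewrite -ck;last 2 first.
- by apply/mEFinP;exact: measurable_indic.
- by move=> t;rewrite lee_fin.
rewrite -[RHS]hw0 hw;apply: eq_integral => q _;rewrite /f -EFinM;congr (_ * _)%:E.
apply: ae_imp nN => t h tT;rewrite ThE//;apply: NE (h tT).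
by case/andP: tT => /ltW -> ->.
have stopJ u : control T G u -> Jhat u = J u.
by move=> cu;exact: stopped_cost_cost.
have ge_y0 u : control T G u -> (y0%:E <= J u)%E.
exact: (cost_ge cp fF FG muE nuE mr Mr1 bounds moment' tauG tau0 aX X_left X_sigma X_clock mean clock disXf
ml expL PuE mg mTh Th22 bsde' cT att').
have cuhat : stopped_control T G tau u0 uhat := stop_control_stopped T0 tau0 u0 fG tauG cT.
have Juhat : J uhat = y0%:E.
rewrite -(cost_attained cp fF FG muE nuE mr Mr1 bounds moment' tauG tau0 aX X_left X_sigma X_clock mean clock disXf
ml expL PuE mg mTh Th22 bsde' cT att').
exact: (cost_stopped cp fF FG muE nuE mr Mr1 bounds moment' tauG tau0 aX X_left X_sigma X_clock clock
ml expL PuE mg cT cuhat.1).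
split.
- exact: cuhat.
- by move=> v [cv _];rewrite stopJ ?Juhat ?stopJ ?ge_y0//;exact: cuhat.1.
- by apply: aeW => w;rewrite Y0 stopJ ?Juhat//;exact: cuhat.1.
- rewrite stopJ;last exact: cuhat.1.
apply/eqP;rewrite eq_le;apply/andP;split.
by apply: le_ereal_inf_tmp => _ [v [cv _] <-];rewrite Juhat stopJ ?ge_y0.
by apply: ereal_inf_lbound;exists uhat;[exact: cuhat|rewrite stopJ //;exact: cuhat.1].
- rewrite stopJ;last exact: cuhat.1.
apply/eqP;rewrite eq_le;apply/andP;split.
by apply: le_ereal_inf_tmp => _ [v cv <-];rewrite Juhat ge_y0.
by apply: ereal_inf_lbound;exists uhat;[exact: cuhat.1|].
Qed.
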